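(* Let $\Lambda=\{1,\ldots,n\}$ for some $n\ge 1$, or $\Lambda=\mathbb N$. Let $0<\delta<1$, and let $f_j\in H^\infty(\mathbb B)$, $j\in\Lambda$, satisfy $$\delta^2\le\sum_{j\in\Lambda}|f_j(q)|^2\le 1,\qquad q\in\mathbb B.$$ Then there exist $g_j\in H^\infty(\mathbb B)$, $j\in\Lambda$, such that $$\sum_{j\in\Lambda}f_j\star g_j=1\qquad\text{on }\mathbb B.$$ If $\Lambda=\mathbb N$, this series converges absolutely and uniformly on compact subsets of $\mathbb B$. Moreover, $$\sup_{q\in\mathbb B}\Bigl(\sum_{j\in\Lambda}|g_j(q)|^2\Bigr)^{1/2}\le\mathcal C(\delta).$$ Consequently, $$\sup_{j\in\Lambda}\|g_j\|_{H^\infty(\mathbb B)}\le\mathcal C(\delta)\le K\,\delta^{-3}\log\frac{\mathrm e}{\delta},$$ where $K$ is an absolute constant, independent in particular of the cardinality of $\Lambda$.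
   Context: $\mathbb H$ denotes the quaternions with the usual conjugation and modulus $|\cdot|$; $\mathbb B=\{q\in\mathbb H:|q|<1\}$; $\mathbb S=\{I\in\mathbb H:I^2=-1\}$. For $I\in\mathbb S$, $\mathbb C_I=\mathbb R+\mathbb R I$ and $\mathbb D_I=\mathbb B\cap\mathbb C_I$. A real-differentiable function $f:\mathbb B\to\mathbb H$ is (left) slice regular if for every $I\in\mathbb S$ one has $\frac12\bigl(\frac{\partial}{\partial x}+I\frac{\partial}{\partial y}\bigr)f(x+Iy)=0$ on $\mathbb D_I$; equivalently $f(q)=\sum_{m\ge0}q^m a_m$ with $a_m\in\mathbb H$, converging uniformly on compact subsets of $\mathbb B$. For $f(q)=\sum_m q^m a_m$ and $g(q)=\sum_m q^m b_m$, the slice regular product is $(f\star g)(q)=\sum_m q^m\bigl(\sum_{k=0}^m a_k b_{m-k}\bigr)$. $H^\infty(\mathbb B)$ is the space of bounded slice regular functions on $\mathbb B$, with $\|f\|_{H^\infty(\mathbb B)}=\sup_{q\in\mathbb B}|f(q)|$. Constants: for $0<\delta<1$ put $\delta_0=\min\{\delta,\mathrm e^{-1/2}\}$, $\kappa=\sqrt{1+\mathrm e^2}+\sqrt{\mathrm e}+\sqrt2\,\mathrm e$, $\mathcal C_0(\delta)=\frac{\kappa}{\delta_0^3}\log\frac1{\delta_0^4}+\frac1{\delta_0}$, and $\mathcal C(\delta)=\sqrt2\,\mathcal C_0(\delta)$. *)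

(* Defs.v *)
From HB Require Import structures.
From mathcomp Require Import all_boot all_order all_algebra.
From mathcomp Require Import all_classical all_reals all_analysis.
From mathcomp Require Import ring lra.

Set Implicit Arguments.
Unset Strict Implicit.
Unset Printing Implicit Defensive.

Import Order.TTheory GRing.Theory Num.Theory.
Import numFieldNormedType.Exports.

Local Open Scope classical_set_scope.
Local Open Scope ring_scope.

Record quaternion (R : realType) :=
  Quat { qre : R ; qim1 : R ; qim2 : R ; qim3 : R }.

Section QuaternionStructure.
Variable R : realType.
Local Notation H := (quaternion R).
Implicit Types (x y z : H) (a b : R).

Definition quat_tuple x := (qre x, qim1 x, qim2 x, qim3 x).
Definition tuple_quat (t : R * R * R * R) : H :=
  Quat t.1.1.1 t.1.1.2 t.1.2 t.2.

Lemma quat_tupleK : cancel quat_tuple tuple_quat. Proof. by case. Qed.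

HB.instance Definition _ := Choice.copy H (can_type quat_tupleK).

Definition quat_add x y : H :=
  Quat (qre x + qre y) (qim1 x + qim1 y) (qim2 x + qim2 y) (qim3 x + qim3 y).

Definition quat_opp x : H :=
  Quat (- qre x) (- qim1 x) (- qim2 x) (- qim3 x).

Lemma quat_addA : associative quat_add.
Proof. by move=> x y z; congr Quat; rewrite /= addrA. Qed.

Lemma quat_addC : commutative quat_add.
Proof. by move=> x y; congr Quat; rewrite /= addrC. Qed.

Lemma quat_add0 : left_id (Quat 0 0 0 0) quat_add.
Proof. by case=> *; congr Quat; rewrite /= add0r. Qed.

Lemma quat_addN : left_inverse (Quat 0 0 0 0) quat_opp quat_add.
Proof. by case=> *; congr Quat; rewrite /= addNr. Qed.

HB.instance Definition _ :=
  GRing.isZmodule.Build H quat_addA quat_addC quat_add0 quat_addN.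

Definition quat_mul x y : H := Quat
  (qre x * qre y - qim1 x * qim1 y - qim2 x * qim2 y - qim3 x * qim3 y)
  (qre x * qim1 y + qim1 x * qre y + qim2 x * qim3 y - qim3 x * qim2 y)
  (qre x * qim2 y - qim1 x * qim3 y + qim2 x * qre y + qim3 x * qim1 y)
  (qre x * qim3 y + qim1 x * qim2 y - qim2 x * qim1 y + qim3 x * qre y).

Lemma quat_mulA : associative quat_mul.
Proof. by move=> x y z; congr Quat => /=; ring. Qed.

Lemma quat_mul1q : left_id (Quat 1 0 0 0) quat_mul.
Proof. by case=> *; congr Quat => /=; ring. Qed.

Lemma quat_mulq1 : right_id (Quat 1 0 0 0) quat_mul.
Proof. by case=> *; congr Quat => /=; ring. Qed.

Lemma quat_mulDl : left_distributive quat_mul quat_add.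
Proof. by move=> x y z; congr Quat => /=; ring. Qed.

Lemma quat_mulDr : right_distributive quat_mul quat_add.
Proof. by move=> x y z; congr Quat => /=; ring. Qed.

Lemma quat_1neq0 : Quat 1 0 0 0 != 0 :> H.
Proof. by apply/eqP => -[] /eqP; rewrite oner_eq0. Qed.

HB.instance Definition _ := GRing.Zmodule_isNzRing.Build H
  quat_mulA quat_mul1q quat_mulq1 quat_mulDl quat_mulDr quat_1neq0.

Definition quat_scale a x : H :=
  Quat (a * qre x) (a * qim1 x) (a * qim2 x) (a * qim3 x).

Lemma quat_scaleA a b x : quat_scale a (quat_scale b x) = quat_scale (a * b) x.
Proof. by congr Quat; rewrite /= mulrA. Qed.

Lemma quat_scale1 : left_id 1 quat_scale.
Proof. by case=> *; congr Quat; rewrite /= mul1r. Qed.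

Lemma quat_scaleDr : right_distributive quat_scale +%R.
Proof. by move=> a x y; congr Quat; rewrite /= mulrDr. Qed.

Lemma quat_scaleDl x : {morph quat_scale^~ x : a b / a + b}.
Proof. by move=> a b; congr Quat; rewrite /= mulrDl. Qed.

HB.instance Definition _ := GRing.Zmodule_isLmodule.Build R H
  quat_scaleA quat_scale1 quat_scaleDr quat_scaleDl.

Lemma quat_scaleAl a x y : a *: (x * y) = a *: x * y.
Proof. by congr Quat => /=; ring. Qed.

Lemma quat_scaleAr a x y : a *: (x * y) = x * (a *: y).
Proof. by congr Quat => /=; ring. Qed.

HB.instance Definition _ := GRing.Lmodule_isLalgebra.Build R H quat_scaleAl.
HB.instance Definition _ := GRing.Lalgebra_isAlgebra.Build R H quat_scaleAr.

Definition quat_sqnorm x : R :=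
  qre x ^+ 2 + qim1 x ^+ 2 + qim2 x ^+ 2 + qim3 x ^+ 2.

Definition quat_norm x : R := Num.sqrt (quat_sqnorm x).

Lemma quat_sqnorm_ge0 x : 0 <= quat_sqnorm x.
Proof. by rewrite !addr_ge0 // sqr_ge0. Qed.

Lemma quat_normD x y : quat_norm (x + y) <= quat_norm x + quat_norm y.
Proof.
have [X0 Y0] := (sqrtr_ge0 (quat_sqnorm x), sqrtr_ge0 (quat_sqnorm y)).
rewrite -(ler_pXn2r (n := 2)) ?nnegrE ?sqrtr_ge0 ?addr_ge0 //.
rewrite sqrrD !sqr_sqrtr ?quat_sqnorm_ge0 //.
set d : R := qre x * qre y + qim1 x * qim1 y + qim2 x * qim2 y + qim3 x * qim3 y.
have -> : quat_sqnorm (x + y) = quat_sqnorm x + d *+ 2 + quat_sqnorm y.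
  by rewrite /quat_sqnorm /d /=; ring.
rewrite lerD2r lerD2l lerMn2r /= -sqrtrM ?quat_sqnorm_ge0 //.
rewrite (le_trans (ler_norm d)) // -sqrtr_sqr ler_wsqrtr // -subr_ge0.
have -> : quat_sqnorm x * quat_sqnorm y - d ^+ 2 =
  (qre x * qim1 y - qim1 x * qre y) ^+ 2 +
  (qre x * qim2 y - qim2 x * qre y) ^+ 2 +
  (qre x * qim3 y - qim3 x * qre y) ^+ 2 +
  (qim1 x * qim2 y - qim2 x * qim1 y) ^+ 2 +
  (qim1 x * qim3 y - qim3 x * qim1 y) ^+ 2 +
  (qim2 x * qim3 y - qim3 x * qim2 y) ^+ 2.
  by rewrite /quat_sqnorm /d; ring.
by rewrite !addr_ge0 // sqr_ge0.
Qed.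

Lemma quat_normZ a x : quat_norm (a *: x) = `|a| * quat_norm x.
Proof.
rewrite /quat_norm.
have -> : quat_sqnorm (a *: x) = a ^+ 2 * quat_sqnorm x.
  by rewrite /quat_sqnorm /=; ring.
by rewrite sqrtrM ?sqr_ge0 // sqrtr_sqr.
Qed.

Lemma quat_norm0_eq0 x : quat_norm x = 0 -> x = 0.
Proof.
move/eqP; rewrite sqrtr_eq0 => x0.
have /eqP : quat_sqnorm x = 0.
  by apply/eqP; rewrite eq_le x0 quat_sqnorm_ge0.
rewrite /quat_sqnorm !paddr_eq0 ?addr_ge0 ?sqr_ge0 // !sqrf_eq0.
by case: x {x0} => a b c d /= /andP[/andP[/andP[]]] /eqP-> /eqP-> /eqP-> /eqP->.
Qed.

(* The norm [`|q|] is the Euclidean modulus, and the topology is the metric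
   topology it induces. *)
HB.instance Definition _ :=
  Lmodule_isNormed.Build R H quat_normD quat_normZ quat_norm0_eq0.

End QuaternionStructure.

Section SliceRegular.
Variable R : realType.
Local Notation H := (quaternion R).
Implicit Types (f g : H -> H) (a b : nat -> H) (q I : H).

Definition qball : set H := [set q | `|q| < 1].

Definition imag_units : set H := [set I | I * I = -1].

Definition slice_point I (x y : R) : H := x%:A + y *: I.

(* Functions on the ball are represented by total functions on the quaternions;
   the values outside [qball] are irrelevant: [qball] is open, so all the
   derivatives below only depend on the restriction of [f] to it. *)
Definition slice_regular f : Prop :=
  (forall q, qball q -> differentiable f q) /\
  (forall I, imag_units I -> forall x y : R, qball (slice_point I x y) ->
    2^-1 *: (derive1 (fun t : R => f (slice_point I t y)) x
             + I * derive1 (fun t : R => f (slice_point I x t)) y) = 0).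

Definition Hinfty f : Prop :=
  slice_regular f /\ exists M : R, forall q, qball q -> `|f q| <= M.

Definition Hinfty_norm f : \bar R := ereal_sup [set (`|f q|)%:E | q in qball].

Definition qpseries a q : nat -> H := series (fun m => q ^+ m * a m).

Definition has_qcoef f a : Prop :=
  forall q, qball q -> qpseries a q @ \oo --> f q.

(* The coefficient sequence is unique; the zero sequence is only the default
   for functions without a power series expansion on [qball]. *)
Definition qcoef f : nat -> H := xget (fun=> 0) (has_qcoef f).

Definition star f g : H -> H := fun q =>
  limn (qpseries
    (fun m => \sum_(k < m.+1) qcoef f k * qcoef g (m - k)%N) q).

End SliceRegular.

Arguments qball R : clear implicits.
Arguments imag_units R : clear implicits.

Definition index_set (L : set nat) : Prop :=
  (exists2 n : nat, (1 <= n)%N & L = [set j | (1 <= j <= n)%N]) \/ L = setT.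

(* For finite [L] these are eventually equal to the full sum over [L]. *)
Definition partial_sums (V : nmodType) (L : set nat) (u : nat -> V) : nat -> V :=
  fun N => \sum_(0 <= j < N | j \in L) u j.

Section Constants.
Variable R : realType.
Implicit Types delta : R.

Definition euler_e : R := expR 1.

Definition delta0 delta : R := Num.min delta (expR (- 2^-1)).

Definition kappa : R :=
  Num.sqrt (1 + euler_e ^+ 2) + Num.sqrt euler_e + Num.sqrt 2 * euler_e.

Definition C0 delta : R :=
  kappa / delta0 delta ^+ 3 * ln (1 / delta0 delta ^+ 4) + 1 / delta0 delta.

Definition Ccorona delta : R := Num.sqrt 2 * C0 delta.

End Constants.

(* Main.v *)
Require Import Defs.
From HB Require Import structures.
From mathcomp Require Import all_boot all_order all_algebra.
From mathcomp Require Import all_classical all_reals all_analysis.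
From mathcomp Require Import complex ring lra.

Import Order.TTheory GRing.Theory Num.Theory.
Import numFieldNormedType.Exports.

Set Implicit Arguments.
Unset Strict Implicit.
Unset Printing Implicit Defensive.

Local Open Scope classical_set_scope.
Local Open Scope ring_scope.
Local Open Scope complex_scope.
Local Notation "x ^*" := (conjc x) : ring_scope.

(** The solution comes from a lower bound for the adjoint of the Toeplitz
    operator of the row (f_j) acting on quaternionic coefficient sequences: if
    |la|^2 <= C1^2 |T^* la|^2 for all finitely supported la, then an explicit
    recursion of lurking-isometry type (Leech's theorem) produces, degree by
    degree, coefficients b_j with sum_j f_j * g_j = 1 and a column Toeplitz
    operator of norm at most C > C1.  Evaluating g_j at a point q of a slice
    C_I splits it into two orthogonal pieces, controlled by the sums of
    b_j q^m and b_j conj(q)^m; this is the factor sqrt 2.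

    The lower bound is complex analytic.  Identifying H with C^2 turns the row
    (f_j) into a two-row symbol Phi with delta^2 <= G := Phi Phi^* <= 1 on the
    disc, and on the circle Phi^* k = w + conj psi with w, psi polynomials and
    psi(0) = 0.  With h := lambda k, u0 := Phi^* G^-1 h, xi the component of
    psi orthogonal to the rows of Phi, d := det G and eps := 1 / ln(delta^-4),
    the function
      al1 d^eps |h|^2 + |u0|^2 / 2 + al3 d^(1+eps) |xi|^2 + |xi|^2 / 2 - Re(psi u0)
    is subharmonic for al1 = X / delta^2, al3 = X / delta^4, X = e ln(delta^-4);
    the maximum principle and optimization in lambda give the bound, with a
    constant strictly smaller than the one of the paper.  This slack absorbs
    the reduction to finitely many polynomials on a slightly smaller ball. *)

(** * Jets and the maximum principle *)

(** The star product convolves coefficients and is not a pointwise product, so a solution chosen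
    value by value is of no use: the unknowns are the coefficients. The hypothesis on values can
    still be used, because the symbol at a point of the disc is governed by the f_j at a quaternion
    of the same modulus. The obstacle in the lower bound is psi, since the adjoint only sees w. On
    the circle psi + conj w lies in the span of the rows of Phi, so xi is a projection of -conj w
    and is controlled there; inside the disc the curvature of ker Phi must be paid for, which the
    weights d^eps and d^(1+eps) do at the price 1 / eps. As delta^4 <= d <= 1, the choice of eps
    keeps d^eps >= 1 / e: hence the logarithm and the e in X. As psi(0) = 0, the function is
    nonnegative at the centre, where the comparison is read. The bound is independent of the numbers
    of coefficients and of functions, so the finite solutions have a limit along an ultrafilter.
    Slice regularity only provides differentiability, without continuity of the derivatives; the
    power series therefore rests on a Goursat argument. *)

Section ComplexModulus.
Variable R : realType.
Local Notation C := R[i].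
Implicit Types z w : C.

Definition cmod z : R := Normc.normc z.

Lemma cmodE z : cmod z = Num.sqrt (complex.Re z ^+ 2 + complex.Im z ^+ 2).
Proof. by case: z. Qed.

Lemma cmod_ge0 z : 0 <= cmod z. Proof. by rewrite cmodE sqrtr_ge0. Qed.

Lemma sqr_cmod z : cmod z ^+ 2 = complex.Re z ^+ 2 + complex.Im z ^+ 2.
Proof. by rewrite cmodE sqr_sqrtr // addr_ge0 // sqr_ge0. Qed.

Lemma cmodD z w : cmod (z + w) <= cmod z + cmod w.
Proof. exact: (@le_normcD R z w). Qed.

Lemma cmodM z w : cmod (z * w) = cmod z * cmod w.
Proof. exact: Normc.normcM. Qed.

Lemma cmodN z : cmod (- z) = cmod z.
Proof. exact: (@normcN R z). Qed.

Lemma cmod0 : cmod 0 = 0. Proof. exact: Normc.normc0. Qed.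

Lemma cmod1 : cmod 1 = 1. Proof. exact: Normc.normc1. Qed.

Lemma cmod_eq0 z : cmod z = 0 -> z = 0.
Proof. exact: Normc.eq0_normc. Qed.

Lemma cmodJ z : cmod z^* = cmod z.
Proof. by rewrite !cmodE; case: z => a b /=; rewrite sqrrN. Qed.

Lemma cmodX z n : cmod (z ^+ n) = cmod z ^+ n.
Proof. by elim: n => [|n IH]; rewrite ?expr0 ?cmod1 // !exprS cmodM IH. Qed.

Lemma cmodV z : cmod z^-1 = (cmod z)^-1.
Proof. exact: Normc.normcV. Qed.

Lemma cmod_real (x : R) : cmod x%:C = `|x|.
Proof. by rewrite cmodE /= expr0n addr0 sqrtr_sqr. Qed.

Lemma Re_le_cmod z : `|complex.Re z| <= cmod z.
Proof.
by rewrite cmodE -sqrtr_sqr ler_wsqrtr // lerDl sqr_ge0.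
Qed.

Lemma mulJ_sqr_cmod z : z * z^* = (cmod z ^+ 2)%:C.
Proof. by rewrite sqr_cmod; case: z => a b; apply/eqP; rewrite eq_complex /=; apply/andP; split; apply/eqP; ring. Qed.

Lemma ReD z w : complex.Re (z + w) = complex.Re z + complex.Re w.
Proof. by case: z w => ? ? []. Qed.

Lemma ReN z : complex.Re (- z) = - complex.Re z.
Proof. by case: z. Qed.

Lemma ReJ z : complex.Re z^* = complex.Re z. Proof. by case: z. Qed.

Lemma ReM_real (x : R) z : complex.Re (x%:C * z) = x * complex.Re z.
Proof. by case: z => a b /=; rewrite mul0r subr0. Qed.

Lemma Re_sum (I : Type) (r : seq I) (P : pred I) (F : I -> C) :
  complex.Re (\sum_(i <- r | P i) F i) = \sum_(i <- r | P i) complex.Re (F i).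
Proof. by elim/big_rec2: _ => // i x y _ <-; rewrite ReD. Qed.

Lemma conjcM z w : (z * w)^* = z^* * w^*.
Proof. exact: rmorphM. Qed.
Lemma conjcD z w : (z + w)^* = z^* + w^*.
Proof. exact: rmorphD. Qed.
Lemma conjcN z : (- z)^* = - z^*.
Proof. exact: rmorphN. Qed.
Lemma conjc_sum (I : Type) (r : seq I) (P : pred I) (F : I -> C) :
  (\sum_(i <- r | P i) F i)^* = \sum_(i <- r | P i) (F i)^*.
Proof. exact: rmorph_sum. Qed.
Lemma realcM (x y : R) : (x * y)%:C = x%:C * y%:C.
Proof. exact: rmorphM. Qed.
Lemma realcD (x y : R) : (x + y)%:C = x%:C + y%:C.
Proof. exact: rmorphD. Qed.
Lemma realcN (x : R) : (- x)%:C = - x%:C.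
Proof. exact: rmorphN. Qed.

End ComplexModulus.

Arguments cmod {R} z : simpl never.

(** * Second-order Wirtinger jets and their calculus *)

Section Jets.
Variable R : realType.
Local Notation C := R[i].
Implicit Types (F G : C -> C).

(** The bound includes t = 0, so for k > 0 it forces F 0 = 0; [jet_val] reads the value of a jet off
    this. *)
Definition bigOh (k : nat) F := exists K r : R,
  [/\ 0 <= K, 0 < r & forall t, cmod t <= r -> cmod (F t) <= K * cmod t ^+ k].

Lemma bigOh_ext k F G r0 : 0 < r0 -> (forall t, cmod t <= r0 -> F t = G t) ->
  bigOh k F -> bigOh k G.
Proof.
move=> r00 FG [K [r [K0 r0' H]]]; exists K, (Num.min r0 r); split => //.
  by rewrite lt_min r00.
by move=> t; rewrite le_min => /andP[h1 h2]; rewrite -FG // H.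
Qed.

Lemma bigOh_eq k F G : F =1 G -> bigOh k F -> bigOh k G.
Proof. by move=> FG; apply: (@bigOh_ext _ _ _ 1). Qed.

Lemma bigOhD k F G : bigOh k F -> bigOh k G -> bigOh k (fun t => F t + G t).
Proof.
move=> [K [r [K0 r0 H]]] [K' [r' [K0' r0' H']]].
exists (K + K'), (Num.min r r'); split; [exact: addr_ge0|by rewrite lt_min r0|].
move=> t; rewrite le_min => /andP[h1 h2].
by rewrite mulrDl (le_trans (cmodD _ _)) // lerD // ?H ?H'.
Qed.

Lemma bigOhN k F : bigOh k F -> bigOh k (fun t => - F t).
Proof.
by move=> [K [r [K0 r0 H]]]; exists K, r; split => // t /H; rewrite cmodN.
Qed.

Lemma bigOhM i j F G : bigOh i F -> bigOh j G -> bigOh (i + j) (fun t => F t * G t).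
Proof.
move=> [K [r [K0 r0 H]]] [K' [r' [K0' r0' H']]].
exists (K * K'), (Num.min r r'); split; [exact: mulr_ge0|by rewrite lt_min r0|].
move=> t; rewrite le_min => /andP[h1 h2].
rewrite cmodM exprD mulrACA ler_pM ?cmod_ge0 ?H ?H' //.
Qed.

Lemma bigOhW i j F : (j <= i)%N -> bigOh i F -> bigOh j F.
Proof.
move=> ji [K [r [K0 r0 H]]]; exists K, (Num.min 1 r); split => //.
  by rewrite lt_min ltr01.
move=> t; rewrite le_min => /andP[h1 h2].
apply: le_trans (H _ h2) _; rewrite ler_wpM2l //.
by rewrite ler_wiXn2l // cmod_ge0.
Qed.

Lemma bigOh_const (a : C) : bigOh 0 (fun=> a).
Proof. by exists (cmod a), 1; split; rewrite ?cmod_ge0 // => t _; rewrite mulr1. Qed.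

Lemma bigOh_id : bigOh 1 (fun t => t).
Proof. by exists 1, 1; split; rewrite // => t _; rewrite mul1r. Qed.

Lemma bigOh_conj : bigOh 1 (fun t => t^*).
Proof. by exists 1, 1; split; rewrite // => t _; rewrite mul1r cmodJ. Qed.

Lemma bigOh_lin (b c : C) : bigOh 1 (fun t => b * t + c * t^*).
Proof.
apply: bigOhD; [exact: (bigOhM (bigOh_const b) bigOh_id)|].
exact: (bigOhM (bigOh_const c) bigOh_conj).
Qed.

Lemma bigOh_quad (e p q : C) :
  bigOh 2 (fun t => e * (t * t^*) + p * (t * t) + q * (t^* * t^*)).
Proof.
have h := bigOhM bigOh_id bigOh_id; have h' := bigOhM bigOh_conj bigOh_conj.
have h'' := bigOhM bigOh_id bigOh_conj.
apply: bigOhD; [apply: bigOhD|].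
- exact: (bigOhM (bigOh_const e) h'').
- exact: (bigOhM (bigOh_const p) h).
- exact: (bigOhM (bigOh_const q) h').
Qed.

(* The Wirtinger 2-jet at 0: [b], [c], [e] stand for the values of dF, dbar F
   and of d dbar F; the pure second derivatives [p], [q] never enter. *)
Definition jet F (a b c e : C) := exists p q : C,
  bigOh 3 (fun t => F t - (a + (b * t + c * t^*) +
           (e * (t * t^*) + p * (t * t) + q * (t^* * t^*)))).

Lemma jet_ext F G a b c e r0 : 0 < r0 ->
  (forall t, cmod t <= r0 -> F t = G t) -> jet F a b c e -> jet G a b c e.
Proof.
move=> r00 FG [p [q H]]; exists p, q; move: H; apply: (bigOh_ext r00).
by move=> t /FG ->.
Qed.

Lemma jet_eq F G a b c e a' b' c' e' : F =1 G -> jet F a b c e ->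
  a = a' -> b = b' -> c = c' -> e = e' -> jet G a' b' c' e'.
Proof. by move=> FG J <- <- <- <-; apply: (@jet_ext F _ _ _ _ _ 1). Qed.

Lemma jet_affine (a b : C) : jet (fun t => a + b * t) a b 0 0.
Proof.
exists 0, 0; apply: (@bigOh_eq _ (fun=> 0)); first by move=> t; ring.
by exists 0, 1; split => // t _; rewrite cmod0 mul0r.
Qed.

Lemma jet_const (a : C) : jet (fun=> a) a 0 0 0.
Proof. by apply: jet_eq (jet_affine a 0) _ _ _ _ => // t; ring. Qed.

Lemma jetD F G a b c e a' b' c' e' : jet F a b c e -> jet G a' b' c' e' ->
  jet (fun t => F t + G t) (a + a') (b + b') (c + c') (e + e').
Proof.
move=> [p [q H]] [p' [q' H']]; exists (p + p'), (q + q').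
by apply: bigOh_eq (bigOhD H H') => t; ring.
Qed.

Lemma jetN F a b c e : jet F a b c e ->
  jet (fun t => - F t) (- a) (- b) (- c) (- e).
Proof.
move=> [p [q H]]; exists (- p), (- q).
by apply: bigOh_eq (bigOhN H) => t; ring.
Qed.

Lemma jetB F G a b c e a' b' c' e' : jet F a b c e -> jet G a' b' c' e' ->
  jet (fun t => F t - G t) (a - a') (b - b') (c - c') (e - e').
Proof. by move=> H /jetN; apply: jetD. Qed.

Lemma jet_sub0 F a b c e : jet F a b c e -> bigOh 1 (fun t => F t - a).
Proof.
move=> [p [q /(bigOhW (isT : 1 <= 3)%N) H]].
have H1 := bigOhD H (bigOh_lin b c).
have H2 := bigOhD H1 (bigOhW (isT : 1 <= 2)%N (bigOh_quad e p q)).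
by apply: bigOh_eq H2 => t; ring.
Qed.

Lemma jet_sub1 F a b c e : jet F a b c e ->
  bigOh 2 (fun t => F t - (a + (b * t + c * t^*))).
Proof.
move=> [p [q /(bigOhW (isT : 2 <= 3)%N) H]].
have H2 := bigOhD H (bigOh_quad e p q).
by apply: bigOh_eq H2 => t; ring.
Qed.

Lemma jet_bigOh0 F a b c e : jet F a b c e -> bigOh 0 F.
Proof.
move=> /jet_sub0/(bigOhW (isT : 0 <= 1)%N) H.
by apply: bigOh_eq (bigOhD H (bigOh_const a)) => t; ring.
Qed.

Lemma jetM F G a b c e a' b' c' e' : jet F a b c e -> jet G a' b' c' e' ->
  jet (fun t => F t * G t) (a * a') (a * b' + b * a') (a * c' + c * a')
    (a * e' + b * c' + c * b' + e * a').
Proof.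
move=> JF JG; have G0 := jet_bigOh0 JG; move: JF JG => [p [q H]] [p' [q' H']].
exists (a * p' + p * a' + b * b'), (a * q' + q * a' + c * c').
have L := bigOh_lin b c; have L' := bigOh_lin b' c'.
have Q := bigOh_quad e p q; have Q' := bigOh_quad e' p' q'.
(* F G - P P' is (F - P) G + P (G - P'), with P and P' the quadratic polynomials; of P P' only the
   products of degree at least 3 are left over, in T3 to T5. *)
have T1 := bigOhM H G0.
have P0 : bigOh 0 (fun t => a + (b * t + c * t^*) +
           (e * (t * t^*) + p * (t * t) + q * (t^* * t^*))).
  by apply: bigOhD (bigOhD (bigOh_const a) (bigOhW _ L)) (bigOhW _ Q).
have T2 := bigOhM P0 H'.
have T3 := bigOhM L Q'; have T4 := bigOhM Q L'.
have T5 := bigOhW (isT : 3 <= 4)%N (bigOhM Q Q').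
by apply: bigOh_eq (bigOhD T1 (bigOhD T2 (bigOhD T3 (bigOhD T4 T5)))) => t; ring.
Qed.

Lemma jetJ F a b c e : jet F a b c e -> jet (fun t => (F t)^*) a^* c^* b^* e^*.
Proof.
move=> [p [q [K [r [K0 r0 H]]]]]; exists q^*, p^*, K, r; split => // t tr.
rewrite -cmodJ; move: (H t tr); congr (cmod _ <= _).
by rewrite !(conjcD, conjcN, conjcM, conjcK); ring.
Qed.

Lemma jet_sum (I : Type) (s : seq I) (F : I -> C -> C) a b c e :
  (forall i, jet (F i) (a i) (b i) (c i) (e i)) ->
  jet (fun t => \sum_(i <- s) F i t) (\sum_(i <- s) a i) (\sum_(i <- s) b i)
    (\sum_(i <- s) c i) (\sum_(i <- s) e i).
Proof.
move=> H; elim: s => [|i s IH].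
  rewrite !big_nil; apply: jet_eq (jet_const 0) _ _ _ _ => // t.
  by rewrite big_nil.
rewrite !big_cons; apply: jet_eq (jetD (H i) IH) _ _ _ _ => // t.
by rewrite big_cons.
Qed.

Definition taylor2 (f : R -> R) s f0 f1 f2 := exists K r : R, 0 < r /\
  forall u, `|u| <= r ->
    `|f (s + u) - (f0 + f1 * u + f2 / 2 * u ^+ 2)| <= K * `|u| ^+ 3.

(** The second derivative of h meets the square of the linear part of g, of which only the mixed
    product contributes to d dbar; the rest goes into the pure second derivatives. *)
Lemma jet_comp (f g : C -> R) (h : R -> R) s b c e f0 f1 f2 :
  taylor2 h s f0 f1 f2 -> (forall t, f t = h (g t)) ->
  jet (fun t => (g t)%:C) s%:C b c e ->
  jet (fun t => (f t)%:C) f0%:C (f1%:C * b) (f1%:C * c)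
    (f1%:C * e + f2%:C * (b * c)).
Proof.
move=> [K [r [r0 T]]] fh J.
have O1 := jet_sub0 J; have O2 := jet_sub1 J; move: (J) => [p [q H]].
set u : C -> C := fun t => (g t)%:C - s%:C.
exists (f1%:C * p + (f2 / 2)%:C * b ^+ 2), (f1%:C * q + (f2 / 2)%:C * c ^+ 2).
have T1 : bigOh 3 (fun t => (f t)%:C - (f0%:C + f1%:C * u t + (f2 / 2)%:C * (u t * u t))).
  have [K' [r' [K0 r0' O]]] := O1.
  (* The radius r / (K' + 1) keeps the increment of g inside the range of the Taylor expansion of
     h. *)
  exists (`|K| * K' ^+ 3), (Num.min r' (r / (K' + 1))); split.
  - by rewrite mulr_ge0 // exprn_ge0.
  - by rewrite lt_min r0' divr_gt0 // ltr_wpDl.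
  move=> t; rewrite le_min => /andP[h1 h2].
  have ut := O _ h1; rewrite expr1 in ut.
  have E : u t = (g t - s)%:C by rewrite /u realcD realcN.
  have cu : cmod (u t) = `|g t - s| by rewrite E cmod_real.
  have -> : (f t)%:C - (f0%:C + f1%:C * u t + (f2 / 2)%:C * (u t * u t)) =
     (h (s + (g t - s)) - (f0 + f1 * (g t - s) + f2 / 2 * (g t - s) ^+ 2))%:C.
    rewrite fh (addrC s) subrK E expr2 !(realcD, realcN, realcM); ring.
  rewrite cmod_real (le_trans (T _ _)) //.
    rewrite -cu (le_trans ut) // (le_trans (y := K' * (r / (K' + 1)))) //.
      by rewrite ler_wpM2l.
    rewrite mulrCA ger_pMr // ler_pdivrMr ?mul1r ?lerDl //.
    by rewrite ltr_wpDl.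
  apply: (@le_trans _ _ (`|K| * `|g t - s| ^+ 3)).
    by rewrite ler_wpM2r ?exprn_ge0 // ler_norm.
  rewrite -mulrA -exprMn ler_wpM2l // lerXn2r ?nnegrE // ?mulr_ge0 ?cmod_ge0 //.
  by rewrite -cu.
have T2 := bigOhM (bigOh_const f1%:C) H.
have O1' := bigOhD O1 (bigOh_lin b c).
have T3 := bigOhM (bigOh_const (f2 / 2)%:C) (bigOhM O2 O1').
have E2 : f2%:C = (f2 / 2)%:C + (f2 / 2)%:C.
  by rewrite -realcD; congr (_%:C); lra.
apply: bigOh_eq (bigOhD T1 (bigOhD T2 T3)) => t.
by rewrite E2 /u; ring.
Qed.

End Jets.

(** * The maximum principle *)

Section MaximumPrinciple.
Variable R : realType.
Local Notation C := R[i].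
Implicit Types F : C -> R.

Lemma compact_unit_disc : compact [set p : R * R | cmod (p.1 +i* p.2) <= 1].
Proof.
have seg : compact `[(-1)%R : R, 1]%classic by exact: segment_compact.
apply: (subclosed_compact _ (compact_setX seg seg)) => /=.
  have -> : [set p : R * R | cmod (p.1 +i* p.2) <= 1] =
      (fun p : R * R => p.1 * p.1 + p.2 * p.2) @^-1` [set x | x <= 1].
    apply/seteqP; split => p /=; rewrite -(@expr_le1 _ 2 (cmod _)) ?cmod_ge0 // sqr_cmod /= !expr2 //.
  apply: closed_comp; last exact: closed_le.
  move=> p _; apply: cvgD; apply: cvgM; first [exact: cvg_fst | exact: cvg_snd].
move=> p /= h; have {h} : cmod (p.1 +i* p.2) ^+ 2 <= 1 by rewrite exprn_ile1 // cmod_ge0.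
rewrite sqr_cmod /= => h; have [h1 h2] := (sqr_ge0 p.1, sqr_ge0 p.2).
by split; rewrite /= in_itv /= -ler_norml -(@expr_le1 _ 2) // real_normK ?num_real //; lra.
Qed.

Lemma jet_continuous (F : C -> R) z b c e :
  jet (fun t => (F (z + t))%:C) (F z)%:C b c e ->
  exists K r : R, [/\ 0 <= K, 0 < r &
    forall t, cmod t <= r -> `|F (z + t) - F z| <= K * cmod t].
Proof.
move=> /jet_sub0 [K [r [K0 r0 H]]]; exists K, r; split => // t /H.
by rewrite expr1 -realcN -realcD cmod_real.
Qed.

(** Over the four points d, -d, id, -id the linear and the pure second-order terms sum to zero, and
    4 Re(e) d^2 survives; it beats the cubic remainder once d (K + 1) < Re e. *)
Lemma jet_no_local_max (F : C -> R) z b c e :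
  jet (fun t => (F (z + t))%:C) (F z)%:C b c e -> 0 < complex.Re e ->
  forall r0 : R, 0 < r0 -> exists2 t, cmod t <= r0 & F z < F (z + t).
Proof.
move=> [p [q [K [r [K0 r0 H]]]]] e0 s0 s00.
apply: contrapT => N.
have {}N t : cmod t <= s0 -> F (z + t) <= F z.
  by move=> ts; rewrite leNgt; apply/negP => lt; apply: N; exists t.
set d := Num.min (Num.min r s0) (complex.Re e / (2 * (K + 1))).
have K1 : 0 < 2 * (K + 1) by rewrite mulr_gt0 // ltr_wpDl.
have d0 : 0 < d by rewrite !lt_min r0 s00 divr_gt0.
have dr : d <= r by rewrite /d !ge_min lexx.
have ds : d <= s0 by rewrite /d !ge_min lexx orbT.
have dK : d * (K + 1) < complex.Re e.
  apply: (@le_lt_trans _ _ (complex.Re e / 2)); last lra.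
  have : d <= complex.Re e / (2 * (K + 1)) by rewrite /d ge_min lexx orbT.
  by rewrite ler_pdivlMr //; lra.
pose D t := complex.Re ((F (z + t))%:C - ((F z)%:C + (b * t + c * t^*) +
           (e * (t * t^*) + p * (t * t) + q * (t^* * t^*)))).
have DK t : cmod t = d -> - (K * d ^+ 3) <= D t.
  move=> td; have := H t; rewrite td => /(_ dr) h.
  by have := le_trans (Re_le_cmod _) h; rewrite ler_norml => /andP[].
have c1 : cmod (d%:C) = d by rewrite cmod_real gtr0_norm.
have c2 : cmod (- d%:C) = d by rewrite cmodN.
have c3 : cmod (0 +i* d) = d.
  by rewrite cmodE /= expr0n add0r sqrtr_sqr gtr0_norm.
have c4 : cmod (- (0 +i* d)) = d by rewrite cmodN.
have := (N _ (eq_ind_r (fun x => x <= s0) ds c1), N _ (eq_ind_r (fun x => x <= s0) ds c2),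
  (N _ (eq_ind_r (fun x => x <= s0) ds c3), N _ (eq_ind_r (fun x => x <= s0) ds c4))).
have := (DK _ c1, DK _ c2, (DK _ c3, DK _ c4)).
rewrite /D; move: (F _) (F (z + _)) (F (z + _)) (F (z + _)) (F (z + _)) => f0 f1 f2 f3 f4.
move=> [[h1 h2] [h3 h4]] [[n1 n2] [n3 n4]].
have : 4 * (complex.Re e * d ^+ 2 - K * d ^+ 3) <= 0.
  move: h1 h2 h3 h4; case: (b) (c) (e) (p) (q) => b1 b2 [c1' c2'] [e1 e2] [p1 p2] [q1 q2] /=.
  lra.
have : 0 < d ^+ 2 * (complex.Re e - K * d).
  by rewrite mulr_gt0 ?exprn_gt0 // subr_gt0 (le_lt_trans _ dK) // mulrC; nra.
nra.
Qed.

Lemma jet_sqr_cmod (z : C) : jet (fun t : C => (cmod (z + t) ^+ 2)%:C)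
  (cmod z ^+ 2)%:C z^* z 1.
Proof.
have J := jet_affine z 1.
apply: jet_eq (jetM J (jetJ J)) _ _ _ _.
- by move=> t; rewrite -mulJ_sqr_cmod !(mul1r, conjcD, conjcM).
- by rewrite mulJ_sqr_cmod.
- by rewrite rmorph0 mulr0 mul1r add0r.
- by rewrite rmorph1 mulr1 mul0r addr0.
- by rewrite rmorph0 rmorph1 !(mul0r,mulr0,mulr1,mul1r) !(add0r, addr0).
Qed.

(** If F 0 > 0, adding (F 0 / 2) |z|^2 makes the Laplacian positive, while the boundary values stay
    at most F 0 / 2 and thus below the value at 0. The maximum is then interior, against
    [jet_no_local_max]. The jets at all points of the closed disc also supply continuity. *)
Lemma max_principle F :
  (forall z, cmod z <= 1 -> exists b c e,
     jet (fun t => (F (z + t))%:C) (F z)%:C b c e /\ 0 <= complex.Re e) ->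
  (forall z, cmod z = 1 -> F z <= 0) -> F 0 <= 0.
Proof.
move=> J bd; rewrite leNgt; apply/negP => F0.
pose eta := F 0 / 2; have eta0 : 0 < eta by rewrite divr_gt0.
pose G (z : C) := F z + eta * cmod z ^+ 2.
have JG z : cmod z <= 1 -> exists b c e,
     jet (fun t => (G (z + t))%:C) (G z)%:C b c e /\ 0 < complex.Re e.
  move=> /J [b [c [e [Je e0]]]].
  have := jetD Je (jetM (jet_const eta%:C) (jet_sqr_cmod z)) => Jt.
  do 3 eexists; split.
    apply: jet_eq Jt _ erefl erefl erefl => [t|]; by rewrite /G realcD realcM.
  by rewrite !(mul0r, addr0, mulr1) ReD /=; lra.
pose A := [set p : R * R | cmod (p.1 +i* p.2) <= 1].
have A0 : A !=set0 by exists (0, 0); rewrite /A /= cmod0.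
have GC : {within A, continuous (fun p : R * R => G (p.1 +i* p.2))}.
  apply: continuous_in_subspaceT => p; rewrite inE => Ap.
  have [b [c [e [/jet_continuous [K [r [K0 r0 H]]] _]]]] := JG _ Ap.
  apply/cvgrPdist_le => eps eps0.
  pose s := Num.min (r / 2) (eps / (2 * (K + 1))).
  have K1 : 0 < 2 * (K + 1) by rewrite mulr_gt0 // ltr_wpDl.
  have s0 : 0 < s by rewrite lt_min !divr_gt0.
  near=> p'.
  set t : C := (p'.1 - p.1) +i* (p'.2 - p.2).
  have ts : cmod t <= 2 * s.
    have -> : t = (p'.1 - p.1)%:C + 'i * (p'.2 - p.2)%:C.
      by apply/eqP; rewrite eq_complex /=; apply/andP; split; apply/eqP; ring.
    rewrite (le_trans (cmodD _ _)) // cmodM !cmod_real.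
    rewrite [cmod _]cmodE /= expr0n expr1n add0r sqrtr1 mul1r.
    rewrite mulrDl mul1r lerD // distrC; near: p'.
      have h : (fun p' : R * R => p'.1) @ nbhs p --> p.1 by exact: cvg_fst.
      by move/cvgrPdist_le : h; apply.
    have h : (fun p' : R * R => p'.2) @ nbhs p --> p.2 by exact: cvg_snd.
    by move/cvgrPdist_le : h; apply.
  have -> : p'.1 +i* p'.2 = p.1 +i* p.2 + t.
    by rewrite /t; simpc; rewrite !(addrC _ (_ - _)) !subrK.
  rewrite distrC (le_trans (H _ _)) //.
    rewrite (le_trans ts) // (le_trans (y := 2 * (r / 2))) //; last by lra.
    by rewrite ler_wpM2l // /s ge_min lexx.
  rewrite (le_trans (y := K * (2 * (eps / (2 * (K + 1)))))) //.
    by rewrite ler_wpM2l // (le_trans ts) // ler_wpM2l // /s ge_min lexx orbT.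
  have -> : K * (2 * (eps / (2 * (K + 1)))) = eps * (K / (K + 1)).
    by field; rewrite lt0r_neq0 // ltr_wpDl.
  by rewrite ger_pMr // ler_pdivrMr ?mul1r ?lerDl // ltr_wpDl.
have [[x y] /[!inE] Axy Gmax] := compact_EVT_max A0 compact_unit_disc GC.
set z := x +i* y; rewrite /= in Axy Gmax.
have Gz z' : cmod z' <= 1 -> G z' <= G z.
  by case: z' => x' y' h; apply: (Gmax (x', y')); rewrite inE.
have z1 : cmod z < 1.
  rewrite lt_neqAle Axy andbT; apply/eqP => /[dup] z1 /bd Fz.
  have := Gz 0; rewrite cmod0 /G cmod0 z1 expr1n expr0n /= mulr0 addr0 mulr1.
  by move=> /(_ ler01); rewrite /eta; lra.
have [b [c [e [Je e0]]]] := JG _ Axy.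
have [|t t1] := jet_no_local_max Je e0 (r0 := 1 - cmod z); first by rewrite subr_gt0.
rewrite ltNge Gz //; rewrite (le_trans (cmodD _ _)) //; lra.
Unshelve. all: by end_near.
Qed.

End MaximumPrinciple.

(** * Taylor expansions of real functions *)

Section Taylor.
Variable R : realType.
Implicit Types (f g : R -> R) (s u r K : R).

Lemma is_derive_expand f s l : is_derive s 1 f l -> forall eps : R, 0 < eps ->
  exists2 r : R, 0 < r & forall u, `|u| <= r -> `|f (s + u) - f s - l * u| <= eps * `|u|.
Proof.
move=> [df dfE] eps eps0; have := df; rewrite /derivable.
move/cvg_ex => [l' lim]; have El : l' = l.
  by rewrite -dfE /derive; apply/esym/cvg_lim.
move: lim; rewrite El => /cvgrPdist_le /(_ eps eps0) [r /= r0 H].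
exists (r / 2); first by rewrite divr_gt0.
move=> u ur; have [->|u0] := eqVneq u 0.
  by rewrite addr0 subrr mulr0 subr0 normr0 mulr0.
have /= := H u; rewrite sub0r normrN => /(_ _ u0) h.
have {h} : `|l - u^-1 *: (f (u *: 1 + s) - f s)| <= eps by apply: h; lra.
rewrite /= [u *: 1]mulr1 [u + s]addrC => h.
have -> : f (s + u) - f s - l * u = - u * (l - u^-1 *: (f (s + u) - f s)).
  by rewrite /GRing.scale /=; field.
by rewrite normrM normrN mulrC ler_wpM2r.
Qed.

(** The mean value theorem between 0 and u gains one power of |u|; the factor 1 / (n + 1) is given
    up. *)
Lemma primitive_bound f f' r K n : 0 <= K ->
  (forall u, `|u| <= r -> is_derive u 1 f (f' u)) -> f 0 = 0 ->
  (forall u, `|u| <= r -> `|f' u| <= K * `|u| ^+ n) ->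
  forall u, `|u| <= r -> `|f u| <= K * `|u| ^+ n.+1.
Proof.
move=> K0 df f0 bd u ur.
have cf a b : `|a| <= r -> `|b| <= r -> {within `[a, b], continuous f}.
  move=> ar br; apply: continuous_in_subspaceT => x /set_mem /=.
  rewrite in_itv /= => /andP[xa xb].
  apply: differentiable_continuous; apply/derivable1_diffP.
  have [] := df x _ => //; rewrite ler_norml; move: ar br; rewrite !ler_norml.
  by move=> /andP[a1 a2] /andP[b1 b2]; apply/andP; split; lra.
have r0 : `|0 : R| <= r by rewrite normr0 (le_trans _ ur).
have dd a b x : `|a| <= r -> `|b| <= r -> x \in `]a, b[ -> is_derive x 1 f (f' x).
  move=> ar br; rewrite in_itv /= => /andP[xa xb]; apply: df; rewrite ler_norml; move: ar br; rewrite !ler_norml.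
  by move=> /andP[a1 a2] /andP[b1 b2]; apply/andP; split; lra.
rewrite exprSr mulrA.
have [u0|u0] := leP 0 u.
  have [c /itvP cu] := MVT_segment u0 (fun x => dd _ _ x r0 ur) (cf _ _ r0 ur).
  rewrite f0 !subr0 => ->; rewrite normrM ler_wpM2r //.
  have cu' : `|c| <= `|u| by rewrite !ger0_norm ?cu.
  rewrite (le_trans (bd _ (le_trans cu' ur))) // ler_wpM2l // lerXn2r ?nnegrE //.
have [c /itvP cu] := MVT_segment (ltW u0) (fun x => dd _ _ x ur r0) (cf _ _ ur r0).
rewrite f0 !sub0r => /(congr1 (@GRing.opp _)); rewrite opprK mulrN opprK => ->.
rewrite normrM ler_wpM2r //.
have cu' : `|c| <= `|u| by rewrite !ler0_norm ?cu ?(ltW u0) // lerN2 cu.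
rewrite (le_trans (bd _ (le_trans cu' ur))) // ler_wpM2l // lerXn2r ?nnegrE //.
Qed.

(** Differentiability of f'' at s gives |f''(s + u) - f''(s)| <= K |u|, which [primitive_bound]
    integrates twice. *)
Lemma taylor2_of_derive f f' (f'' : R -> R) (f3 : R) s r : 0 < r ->
  (forall u, `|u| <= r -> is_derive (s + u) 1 f (f' (s + u))) ->
  (forall u, `|u| <= r -> is_derive (s + u) 1 f' (f'' (s + u))) ->
  is_derive s 1 f'' f3 ->
  taylor2 f s (f s) (f' s) (f'' s).
Proof.
move=> r0 df df' /is_derive_expand /(_ 1 ltr01) [r' r'0 H].
pose K := `|f3| + 1; have K0 : 0 <= K by rewrite addr_ge0.
pose m := Num.min r r'.
have mr u : `|u| <= m -> `|u| <= r by move/le_trans; apply; rewrite ge_min lexx.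
have B0 u : `|u| <= m -> `|f'' (s + u) - f'' s| <= K * `|u| ^+ 1.
  move=> um; rewrite expr1.
  have -> : f'' (s + u) - f'' s = f'' (s + u) - f'' s - f3 * u + f3 * u by rewrite subrK.
  rewrite (le_trans (ler_normD _ _)) // /K mulrDl addrC normrM lerD // H //.
  by rewrite (le_trans um) // ge_min lexx orbT.
have sh (g g' : R -> R) u : is_derive (s + u) 1 g (g' (s + u)) ->
    is_derive u 1 (fun v => g (s + v)) (g' (s + u)).
  move=> dg; have := @is_derive1_comp _ g (fun v => s + v) u _ 1 dg.
  rewrite mulr1; apply; apply: is_derive_eq (is_deriveD _ _) _ => //.
  by rewrite add0r.
have B1 : forall u, `|u| <= m -> `|f' (s + u) - f' s - f'' s * u| <= K * `|u| ^+ 2.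
  apply: (@primitive_bound (fun u => f' (s + u) - f' s - f'' s * u)
     (fun u => f'' (s + u) - f'' s)) => //.
    move=> u um; have := sh _ _ _ (df' u (mr _ um)) => D.
    by apply: is_derive_eq; rewrite subr0 scaler1.
  by rewrite addr0 subrr mulr0 subr0.
have B2 : forall u, `|u| <= m ->
    `|f (s + u) - f s - f' s * u - f'' s / 2 * u ^+ 2| <= K * `|u| ^+ 3.
  apply: (@primitive_bound (fun u => f (s + u) - f s - f' s * u - f'' s / 2 * u ^+ 2)
     (fun u => f' (s + u) - f' s - f'' s * u)) => //.
    move=> u um; have := sh _ _ _ (df u (mr _ um)) => D.
    by apply: is_derive_eq; rewrite ?subr0 ?scaler1 ?expr1 /GRing.scale /=; field.
  by rewrite addr0 subrr mulr0 expr0n /= mulr0 !subr0.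
exists K, m; split; first by rewrite lt_min r0.
move=> u /B2; rewrite !opprD !addrA //.
Qed.

Lemma taylor2_powR (eps s : R) : 0 < s ->
  taylor2 (fun x => x `^ eps) s (s `^ eps) (eps * s `^ (eps - 1))
    (eps * (eps - 1) * s `^ (eps - 2)).
Proof.
move=> s0.
have pos u : `|u| <= s / 2 -> 0 < s + u.
  by rewrite ler_norml => /andP[h1 h2]; lra.
have D2 (x : R) (c a : R) : 0 < x ->
    is_derive x 1 (fun x => c * x `^ a) (c * a * x `^ (a - 1)).
  move=> x0; have D := @is_derive1_powR _ a x x0.
  apply: is_derive_eq; rewrite /GRing.scale /=; ring.
have -> : eps * (eps - 1) * s `^ (eps - 2) = eps * (eps - 1) * s `^ (eps - 1 - 1).
  by congr (_ * _ `^ _); ring.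
have H := @taylor2_of_derive (fun x => x `^ eps) (fun x => eps * x `^ (eps - 1))
  (fun x => eps * (eps - 1) * x `^ (eps - 1 - 1))
  (eps * (eps - 1) * (eps - 1 - 1) * s `^ (eps - 1 - 1 - 1)) s (s / 2).
apply: H.
- by rewrite divr_gt0.
- move=> u /pos su; exact: is_derive1_powR.
- by move=> u /pos; exact: D2.
- exact: D2.
Qed.

End Taylor.

(** * The subharmonic function and the estimate on the disc *)

Section GramAlgebra.
Variable R : realType.
Local Notation C := R[i].

(* [gramU], [gramX], [gramT] are |u0|^2, |xi|^2 and psi u0, where
   u0 = Phi^* G^-1 h is the least-norm solution of Phi u0 = h, and xi is the
   part of psi orthogonal to the rows of Phi; G = [A B; B' D] is the Gram
   matrix of the rows of Phi, and primes stand for complex conjugates. *)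
Definition gramU (A B B' D h1 h1' h2 h2' : C) : C :=
  (D * (h1 * h1') + A * (h2 * h2') - h1' * B * h2 - h2' * B' * h1) / (A * D - B * B').

Definition gramX (A B B' D S m1 m1' m2 m2' : C) : C :=
  S - gramU A B B' D m1' m1 m2' m2.

Definition gramT (A B B' D m1 m2 h1 h2 : C) : C :=
  (m1 * (D * h1 - B * h2) + m2 * (A * h2 - B' * h1)) / (A * D - B * B').

Section LeftGauge.
Variables (A B B' D g11 g12 g21 g22 g11' g12' g21' g22' : C).
Let A1 := g11 * g11' * A + g11 * g12' * B + g12 * g11' * B' + g12 * g12' * D.
Let D1 := g21 * g21' * A + g21 * g22' * B + g22 * g21' * B' + g22 * g22' * D.
Let B1 := g11 * g21' * A + g11 * g22' * B + g12 * g21' * B' + g12 * g22' * D.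
Let B1' := g21 * g11' * A + g21 * g12' * B + g22 * g11' * B' + g22 * g12' * D.

Lemma gram_det_gauge : A1 * D1 - B1 * B1' =
  (g11 * g22 - g12 * g21) * (g11' * g22' - g12' * g21') * (A * D - B * B').
Proof. rewrite /A1 /D1 /B1 /B1'; ring. Qed.

Hypothesis g0 : g11 * g22 - g12 * g21 != 0.
Hypothesis g0' : g11' * g22' - g12' * g21' != 0.
Hypothesis d0 : A * D - B * B' != 0.

(** The least-norm solution of Phi u0 = h also solves (g Phi) u0 = g h for an invertible 2 x 2
    matrix g, and the row space is the same. With primed letters as independent variables this is a
    rational identity. *)
Lemma gramU_gauge h1 h1' h2 h2' :
  gramU A1 B1 B1' D1 (g11 * h1 + g12 * h2) (g11' * h1' + g12' * h2')
    (g21 * h1 + g22 * h2) (g21' * h1' + g22' * h2') =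
  gramU A B B' D h1 h1' h2 h2'.
Proof.
have d1 : A1 * D1 - B1 * B1' != 0 by rewrite gram_det_gauge !mulf_neq0.
apply/eqP; rewrite /gramU eqr_div //; apply/eqP; rewrite gram_det_gauge /A1 /D1 /B1 /B1'; ring.
Qed.

Lemma gramT_gauge m1 m2 h1 h2 :
  gramT A1 B1 B1' D1 (g11' * m1 + g12' * m2) (g21' * m1 + g22' * m2)
    (g11 * h1 + g12 * h2) (g21 * h1 + g22 * h2) =
  gramT A B B' D m1 m2 h1 h2.
Proof.
have d1 : A1 * D1 - B1 * B1' != 0 by rewrite gram_det_gauge !mulf_neq0.
apply/eqP; rewrite /gramT eqr_div //; apply/eqP; rewrite gram_det_gauge /A1 /D1 /B1 /B1'; ring.
Qed.

End LeftGauge.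

(** Subtracting a combination of the rows from psi does not change its component orthogonal to
    them. *)
Lemma gramX_shift A B B' D S m1 m1' m2 m2' c1 c1' c2 c2' :
  A * D - B * B' != 0 ->
  gramX A B B' D (S - c1 * m1' - c2 * m2' - c1' * m1 - c2' * m2 +
      c1 * c1' * A + c1 * c2' * B + c2 * c1' * B' + c2 * c2' * D)
    (m1 - c1 * A - c2 * B') (m1' - c1' * A - c2' * B)
    (m2 - c1 * B - c2 * D) (m2' - c1' * B' - c2' * D) =
  gramX A B B' D S m1 m1' m2 m2'.
Proof. by move=> d0; rewrite /gramX /gramU; field. Qed.

(** As Phi u0 = h, subtracting c times the rows from psi lowers psi u0 by c h. *)
Lemma gramT_shift A B B' D m1 m2 h1 h2 c1 c2 :
  A * D - B * B' != 0 ->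
  gramT A B B' D (m1 - c1 * A - c2 * B') (m2 - c1 * B - c2 * D) h1 h2 =
  gramT A B B' D m1 m2 h1 h2 - (c1 * h1 + c2 * h2).
Proof. by move=> d0; rewrite /gramT; field. Qed.

End GramAlgebra.

Section JetInverse.
Variable R : realType.
Local Notation C := R[i].
Implicit Types (F G : C -> C).

Lemma jet_neq0 F a b c e : jet F a b c e -> a != 0 ->
  exists2 r : R, 0 < r & forall t, cmod t <= r -> cmod a / 2 <= cmod (F t).
Proof.
move=> /jet_sub0 [K [r [K0 r0 H]]] a0.
have a1 : 0 < cmod a.
  by rewrite lt_neqAle cmod_ge0 andbT eq_sym; apply: contraNneq a0 => /cmod_eq0 ->.
exists (Num.min r (cmod a / (2 * (K + 1)))).
  by rewrite lt_min r0 divr_gt0 // mulr_gt0 // ltr_wpDl.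
move=> t; rewrite le_min => /andP[/H h1 h2].
have : cmod a <= cmod (F t) + cmod (F t - a).
  by rewrite -(cmodN (F t - a)); apply: le_trans (cmodD _ _); rewrite opprB addrC subrK.
have : K * cmod t ^+ 1 <= cmod a / 2.
  rewrite expr1 (le_trans (y := K * (cmod a / (2 * (K + 1))))) ?ler_wpM2l //.
  have -> : K * (cmod a / (2 * (K + 1))) = cmod a / 2 * (K / (K + 1)).
    by field; rewrite lt0r_neq0 // ltr_wpDl.
  rewrite ger_pMr ?divr_gt0 // ler_pdivrMr ?mul1r ?lerDl // ltr_wpDl //.
lra.
Qed.

(** The candidate jet P satisfies F P = 1 up to pure second-order terms and order 3; dividing by F
    gives the claim, and those pure terms become the free coefficients -p / a and -q / a. *)
Lemma jetV F a b c e : jet F a b c e -> a != 0 ->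
  jet (fun t => (F t)^-1) a^-1 (- b / a ^+ 2) (- c / a ^+ 2)
    (2 * b * c / a ^+ 3 - e / a ^+ 2).
Proof.
move=> JF a0; have [r0 r00 Fa] := jet_neq0 JF a0.
have a1 : 0 < cmod a.
  by rewrite lt_neqAle cmod_ge0 andbT eq_sym; apply: contraNneq a0 => /cmod_eq0 ->.
have F0 t : cmod t <= r0 -> F t != 0.
  move=> /Fa; apply: contraTneq => ->; rewrite cmod0 -ltNge divr_gt0 //.
set b' := - b / _; set c' := - c / _; set e' := (_ - _).
pose P t := a^-1 + (b' * t + c' * t^*) + (e' * (t * t^*) + 0 * (t * t) + 0 * (t^* * t^*)).
have JP : jet P a^-1 b' c' e'.
  exists 0, 0; apply: (@bigOh_eq _ _ (fun=> 0)).
    by move=> t; rewrite /P subrr.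
  by exists 0, 1; split => // t _; rewrite cmod0 mul0r.
have [p [q H]] := jetM JF JP.
have V0 : bigOh 0 (fun t => (F t)^-1).
  exists (cmod a / 2)^-1, r0; split => //; first by rewrite invr_ge0 divr_ge0 // ltW.
  by move=> t /Fa h; rewrite cmodV mulr1 lef_pV2 // posrE ?divr_gt0 // (lt_le_trans _ h) ?divr_gt0.
have V1 : bigOh 1 (fun t => (F t)^-1 - a^-1).
  have h := bigOhM (jet_sub0 JF) (bigOhM V0 (bigOh_const (- a^-1))).
  by apply: bigOh_ext r00 _ h => t /F0 Ft; field; rewrite a0 Ft.
have T1 := bigOhM H V0.
have T2 := bigOhM (bigOh_quad 0 p q) V1.
exists (- p / a), (- q / a).
apply: bigOh_ext r00 _ (bigOhN (bigOhD T1 T2)) => t /F0 Ft.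
by rewrite /P /b' /c' /e'; field; rewrite a0 Ft.
Qed.

End JetInverse.

(** * Jets of Hermitian products of holomorphic vectors *)

Section GramJets.
Variables (R : realType) (J : finType).
Local Notation C := R[i].
Implicit Types (p q : J -> C -> C).

Definition ip p q (t : C) : C := \sum_j p j t * (q j t)^*.

Lemma conj_ip p q t : (ip p q t)^* = ip q p t.
Proof.
by rewrite /ip conjc_sum; apply: eq_bigr => j _; rewrite conjcM conjcK mulrC.
Qed.

Lemma ip_linl p1 p2 q (a b : C -> C) t :
  ip (fun j t => a t * p1 j t + b t * p2 j t) q t = a t * ip p1 q t + b t * ip p2 q t.
Proof.
rewrite /ip !mulr_sumr -big_split /=; apply: eq_bigr => j _; ring.
Qed.

Lemma ip_linr p1 p2 q (a b : C -> C) t :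
  ip q (fun j t => a t * p1 j t + b t * p2 j t) t = (a t)^* * ip q p1 t + (b t)^* * ip q p2 t.
Proof. by rewrite -conj_ip ip_linl conjcD !conjcM !conj_ip. Qed.

Lemma ip_shiftl p1 p2 p q (a b : C -> C) t :
  ip (fun j t => p j t - a t * p1 j t - b t * p2 j t) q t =
  ip p q t - a t * ip p1 q t - b t * ip p2 q t.
Proof.
by rewrite /ip !mulr_sumr -!sumrB; apply: eq_bigr => j _; ring.
Qed.

Lemma ip_shiftr p1 p2 p q (a b : C -> C) t :
  ip q (fun j t => p j t - a t * p1 j t - b t * p2 j t) t =
  ip q p t - (a t)^* * ip q p1 t - (b t)^* * ip q p2 t.
Proof. by rewrite -conj_ip ip_shiftl !conjcD !conjcN !conjcM !conj_ip. Qed.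

Lemma jet_ip p q (a a' b b' : J -> C) :
  (forall j, jet (p j) (a j) (a' j) 0 0) -> (forall j, jet (q j) (b j) (b' j) 0 0) ->
  jet (ip p q) (\sum_j a j * (b j)^*) (\sum_j a' j * (b j)^*)
    (\sum_j a j * (b' j)^*) (\sum_j a' j * (b' j)^*).
Proof.
move=> Jp Jq; apply: (@jet_sum _ _ _ (fun j t => p j t * (q j t)^*)) => j.
apply: jet_eq (jetM (Jp j) (jetJ (Jq j))) _ _ _ _ => //; rewrite ?conjc0; ring.
Qed.

(** For a Gram matrix G = 1 + E |t|^2 up to pure second-order terms, the mixed coefficient of G^-1
    is -E; this is the subtracted term. *)
Lemma jet_gramU_normal (A B B' D h1 h1' h2 h2' : C -> C) (al be eta eta' : C)
    (k1 l1 n1 s1 k1' l1' n1' s1' k2 l2 n2 s2 k2' l2' n2' s2' : C) :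
  jet A 1 0 0 al -> jet D 1 0 0 be -> jet B 0 0 0 eta -> jet B' 0 0 0 eta' ->
  jet h1 k1 l1 n1 s1 -> jet h1' k1' l1' n1' s1' ->
  jet h2 k2 l2 n2 s2 -> jet h2' k2' l2' n2' s2' ->
  jet (fun t => gramU (A t) (B t) (B' t) (D t) (h1 t) (h1' t) (h2 t) (h2' t))
    (k1 * k1' + k2 * k2') (k1 * l1' + l1 * k1' + k2 * l2' + l2 * k2')
    (k1 * n1' + n1 * k1' + k2 * n2' + n2 * k2')
    (k1 * s1' + l1 * n1' + n1 * l1' + s1 * k1' +
     (k2 * s2' + l2 * n2' + n2 * l2' + s2 * k2') -
     (al * (k1 * k1') + be * (k2 * k2') + k1' * eta * k2 + k2' * eta' * k1)).
Proof.
move=> JA JD JB JB' J1 J1' J2 J2'.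
have JN := jetB (jetB (jetD (jetM JD (jetM J1 J1')) (jetM JA (jetM J2 J2')))
  (jetM (jetM J1' JB) J2)) (jetM (jetM J2' JB') J1).
have Jd := jetB (jetM JA JD) (jetM JB JB').
have d1 : (1 * 1 - 0 * 0 : C) != 0 by rewrite mulr1 mulr0 subr0 oner_neq0.
have e1 : (1 * 1 - 0 * 0 : C) = 1 by rewrite mulr1 mulr0 subr0.
apply: jet_eq (jetM JN (jetV Jd d1)) _ _ _ _ => //;
  rewrite ?e1 ?expr1n ?invr1 ?divr1; ring.
Qed.

Lemma jet_gramT_normal (A B B' D m1 m2 h1 h2 : C -> C) (al be eta eta' : C)
    (k1 l1 t1 s1 k2 l2 t2 s2 : C) :
  jet A 1 0 0 al -> jet D 1 0 0 be -> jet B 0 0 0 eta -> jet B' 0 0 0 eta' ->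
  jet m1 0 0 t1 s1 -> jet m2 0 0 t2 s2 ->
  jet h1 k1 l1 0 0 -> jet h2 k2 l2 0 0 ->
  jet (fun t => gramT (A t) (B t) (B' t) (D t) (m1 t) (m2 t) (h1 t) (h2 t))
    0 0 (t1 * k1 + t2 * k2) (s1 * k1 + s2 * k2 + (t1 * l1 + t2 * l2)).
Proof.
move=> JA JD JB JB' M1 M2 J1 J2.
have JN := jetD (jetM M1 (jetB (jetM JD J1) (jetM JB J2)))
  (jetM M2 (jetB (jetM JA J2) (jetM JB' J1))).
have Jd := jetB (jetM JA JD) (jetM JB JB').
have d1 : (1 * 1 - 0 * 0 : C) != 0 by rewrite mulr1 mulr0 subr0 oner_neq0.
have e1 : (1 * 1 - 0 * 0 : C) = 1 by rewrite mulr1 mulr0 subr0.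
apply: jet_eq (jetM JN (jetV Jd d1)) _ _ _ _ => //;
  rewrite ?e1 ?expr1n ?invr1 ?divr1; ring.
Qed.

(** [p], [p'] and [kap] are the derivatives d, dbar and d dbar of log d. In these terms a power acts
    simply: [ex] multiplies [kap] and ex^2 multiplies p p'. *)
Lemma jet_powR (d : C -> R) (s ex : R) (p p' kap : C) : 0 < s ->
  jet (fun t => (d t)%:C) s%:C (s%:C * p) (s%:C * p') (s%:C * (p * p' + kap)) ->
  jet (fun t => (d t `^ ex)%:C) (s `^ ex)%:C ((s `^ ex)%:C * (ex%:C * p))
   ((s `^ ex)%:C * (ex%:C * p'))
   ((s `^ ex)%:C * (ex%:C * kap + ex%:C ^+ 2 * (p * p'))).
Proof.
move=> s0 Jd; have := jet_comp (taylor2_powR ex s0) (fun t => erefl (d t `^ ex)) Jd.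
have E1 : s `^ ex = s `^ (ex - 1) * s.
  by rewrite -{3}(powRr1 (ltW s0)) -powRD ?subrK // (gt_eqF s0) implybT.
have E2 : s `^ (ex - 1) = s `^ (ex - 2) * s.
  rewrite -{3}(powRr1 (ltW s0)) -powRD ?(gt_eqF s0) ?implybT //.
  by congr (_ `^ _); ring.
move=> Jp; apply: jet_eq Jp _ _ _ _ => //; rewrite E1 ?E2 !realcM ?realcD ?realcN ?real_complexE; ring.
Qed.

Lemma Re_mulJ_le (z w : C) :
  complex.Re (z * w^*) <= 2^-1 * cmod z ^+ 2 + 2^-1 * cmod w ^+ 2.
Proof. by rewrite !sqr_cmod; case: z w => a b [c d] /=; have := sqr_ge0 (a - c); have := sqr_ge0 (b - d); rewrite !sqrrB; lra. Qed.

Lemma CauchySchwarz_ip (x v : J -> C) :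
  cmod (\sum_j x j * (v j)^*) ^+ 2 <= (\sum_j cmod (x j) ^+ 2) * (\sum_j cmod (v j) ^+ 2).
Proof.
have [S ES] : exists S, S = \sum_j x j * (v j)^* by eexists.
rewrite -ES; set X := \sum_j cmod (x j) ^+ 2; set V := \sum_j _.
have V0 : 0 <= V by apply: sumr_ge0 => j _; exact: sqr_ge0.
have X0 : 0 <= X by apply: sumr_ge0 => j _; exact: sqr_ge0.
(* The squared norm of x - l S v. The value l = 1 / V is optimal; for V = 0 a large l forces S =
   0. *)
have key (l : R) : 0 <= X - 2 * l * cmod S ^+ 2 + l ^+ 2 * cmod S ^+ 2 * V.
  have : 0 <= \sum_j cmod (x j - (l%:C * S) * v j) ^+ 2.
    by apply: sumr_ge0 => j _; exact: sqr_ge0.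
  congr (0 <= _); apply: (_ : injective (fun x : R => x%:C)); first by move=> ? ? [].
  rewrite rmorph_sum /=.
  under eq_bigr => j _ do rewrite -mulJ_sqr_cmod conjcD conjcN !conjcM conjc_real.
  have -> (c2 : R) : (X - 2 * l * c2 + l ^+ 2 * c2 * V)%:C =
      X%:C - (l%:C + l%:C) * c2%:C + l%:C * l%:C * c2%:C * V%:C.
    by rewrite -!(realcM, realcD, realcN); congr (_%:C); ring.
  rewrite -(mulJ_sqr_cmod S) /X /V !rmorph_sum /=.
  under [X in X - _ + _]eq_bigr => j _ do rewrite -mulJ_sqr_cmod.
  under [X in _ + _ * X]eq_bigr => j _ do rewrite -mulJ_sqr_cmod.
  have -> : \sum_j (x j - l%:C * S * v j) * ((x j)^* - l%:C * S^* * (v j)^*) =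
     \sum_j x j * (x j)^* - l%:C * S^* * (\sum_j x j * (v j)^*)
     - l%:C * S * (\sum_j x j * (v j)^*)^* + l%:C ^+ 2 * (S * S^*) * \sum_j v j * (v j)^*.
    rewrite conjc_sum !mulr_sumr -!sumrB -big_split /=; apply: eq_bigr => j _.
    rewrite conjcM conjcK; ring.
  rewrite -ES; ring.
have [V00|V1] := eqVneq V 0.
  have := key X; have := key (X + 1); rewrite V00 !mulr0 !addr0; have := sqr_ge0 (cmod S).
  have := sqr_ge0 (cmod S); have [->|S0] := eqVneq (cmod S) 0; first by rewrite expr0n.
  have S1 : 0 < cmod S by rewrite lt_neqAle eq_sym S0 cmod_ge0.
  have k := key ((X + 1) / cmod S ^+ 2); move: k; rewrite V00 mulr0 addr0.
  have -> : 2 * ((X + 1) / cmod S ^+ 2) * cmod S ^+ 2 = 2 * (X + 1).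
    by field; rewrite lt0r_neq0.
  lra.
have Vp : 0 < V by rewrite lt_neqAle eq_sym V1 V0.
have := key V^-1.
have -> : X - 2 * V^-1 * cmod S ^+ 2 + V^-1 ^+ 2 * cmod S ^+ 2 * V = (X * V - cmod S ^+ 2) / V.
  by field.
by rewrite pmulr_lge0 ?invr_gt0 // subr_ge0.
Qed.

End GramJets.

(** * Normal coordinates at a point *)

Section NormalForm.
Variables (R : realType) (J : finType).
Local Notation C := R[i].
Implicit Types (p q psi : J -> C -> C) (h : C -> C).

Definition ipdet p1 p2 (t : C) : C :=
  ip p1 p1 t * ip p2 p2 t - ip p1 p2 t * ip p2 p1 t.
Definition normU p1 p2 h1 h2 (t : C) : C :=
  gramU (ip p1 p1 t) (ip p1 p2 t) (ip p2 p1 t) (ip p2 p2 t)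
    (h1 t) (h1 t)^* (h2 t) (h2 t)^*.
Definition normX p1 p2 psi (t : C) : C :=
  gramX (ip p1 p1 t) (ip p1 p2 t) (ip p2 p1 t) (ip p2 p2 t) (ip psi psi t)
    (ip psi p1 t) (ip p1 psi t) (ip psi p2 t) (ip p2 psi t).
Definition pairT p1 p2 psi h1 h2 (t : C) : C :=
  gramT (ip p1 p1 t) (ip p1 p2 t) (ip p2 p1 t) (ip p2 p2 t)
    (ip psi p1 t) (ip psi p2 t) (h1 t) (h2 t).

Definition hol_jet h (a b : C) := jet h a b 0 0.

Lemma hol_jet_affine (a b : C) : hol_jet (fun t => a + b * t) a b.
Proof. exact: jet_affine. Qed.

Lemma hol_jetD h1 h2 a b a' b' : hol_jet h1 a b -> hol_jet h2 a' b' ->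
  hol_jet (fun t => h1 t + h2 t) (a + a') (b + b').
Proof. by move=> H H'; apply: jet_eq (jetD H H') _ _ _ _ => //; ring. Qed.

Lemma hol_jetN h a b : hol_jet h a b -> hol_jet (fun t => - h t) (- a) (- b).
Proof. by move=> H; apply: jet_eq (jetN H) _ _ _ _ => //; ring. Qed.

Lemma hol_jetM h1 h2 a b a' b' : hol_jet h1 a b -> hol_jet h2 a' b' ->
  hol_jet (fun t => h1 t * h2 t) (a * a') (a * b' + b * a').
Proof. by move=> H H'; apply: jet_eq (jetM H H') _ _ _ _ => //; ring. Qed.

Lemma jet_val (F : C -> C) a b c e : jet F a b c e -> F 0 = a.
Proof.
move=> /jet_sub0 [K [r [K0 r0 H]]]; have := H 0; rewrite cmod0 expr1 mulr0 (ltW r0).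
move=> /(_ isT) h; apply/eqP; rewrite -subr_eq0; apply/eqP/cmod_eq0/le_anti.
by rewrite h cmod_ge0.
Qed.

(** [q1], [q2] are a holomorphic change of basis of the rows, with determinant 1 / [de], and [chi]
    is psi minus a holomorphic combination of them. The determinant changes by |de|^2 and the
    pairing by the holomorphic [cc]; log |de|^2 and Re cc are harmonic, so no curvature is lost. The
    orthogonality relations cancel every first-order term of the Gram matrix. *)
Record normal_data p1 p2 psi h1 h2 (u1 v1 u2 v2 x y : J -> C) (k1 l1 k2 l2 : C)
    (de0 de1 : C) : Prop := NormalData {
  nd_u11 : \sum_j u1 j * (u1 j)^* = 1;
  nd_u22 : \sum_j u2 j * (u2 j)^* = 1;
  nd_u12 : \sum_j u1 j * (u2 j)^* = 0;
  nd_v11 : \sum_j v1 j * (u1 j)^* = 0;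
  nd_v12 : \sum_j v1 j * (u2 j)^* = 0;
  nd_v21 : \sum_j v2 j * (u1 j)^* = 0;
  nd_v22 : \sum_j v2 j * (u2 j)^* = 0;
  nd_x1 : \sum_j x j * (u1 j)^* = 0;
  nd_x2 : \sum_j x j * (u2 j)^* = 0;
  nd_y1 : \sum_j y j * (u1 j)^* = 0;
  nd_y2 : \sum_j y j * (u2 j)^* = 0;
  nd_de0 : de0 != 0;
  nd_fun : exists (q1 q2 chi : J -> C -> C) (f1 f2 de cc : C -> C) (r0 : R),
    [/\ (forall j, hol_jet (q1 j) (u1 j) (v1 j)),
        (forall j, hol_jet (q2 j) (u2 j) (v2 j)),
        (forall j, hol_jet (chi j) (x j) (y j)),
        hol_jet f1 k1 l1 /\ hol_jet f2 k2 l2 &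
        [/\ hol_jet de de0 de1, (exists a b, hol_jet cc a b), 0 < r0 &
         forall t, cmod t <= r0 ->
          [/\ ipdet p1 p2 t = de t * (de t)^* * ipdet q1 q2 t,
              normU p1 p2 h1 h2 t = normU q1 q2 f1 f2 t,
              normX p1 p2 psi t = normX q1 q2 chi t &
              pairT p1 p2 psi h1 h2 t = pairT q1 q2 chi f1 f2 t + cc t]]] }.

(** Gram-Schmidt at 0 makes the rows orthonormal; terms of degree one in t then remove the
    components of the derivatives along the rows, first for the rows and next for psi. All
    corrections are affine in t, hence holomorphic. *)
Lemma normal_form p1 p2 psi h1 h2 (a1 b1 a2 b2 x0 y0 : J -> C) (m1 n1 m2 n2 : C) :
  (forall j, hol_jet (p1 j) (a1 j) (b1 j)) -> (forall j, hol_jet (p2 j) (a2 j) (b2 j)) ->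
  (forall j, hol_jet (psi j) (x0 j) (y0 j)) -> hol_jet h1 m1 n1 -> hol_jet h2 m2 n2 ->
  0 < complex.Re (ip p1 p1 0) -> 0 < complex.Re (ipdet p1 p2 0) ->
  exists u1 v1 u2 v2 x y k1 l1 k2 l2 de0 de1,
    normal_data p1 p2 psi h1 h2 u1 v1 u2 v2 x y k1 l1 k2 l2 de0 de1.
Proof.
move=> Hp1 Hp2 Hpsi H1 H2 A0 d0.
pose A := ip p1 p1 0; pose B := ip p1 p2 0; pose D := ip p2 p2 0.
have JA := jet_ip Hp1 Hp1; have JB := jet_ip Hp1 Hp2; have JD := jet_ip Hp2 Hp2.
have JB' := jet_ip Hp2 Hp1.
have real_of (z : C) : z^* = z -> z = (complex.Re z)%:C.
  case: z => a b /= [] h; congr (_ +i* _); lra.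
have Ar : A = (complex.Re A)%:C by apply: real_of; rewrite conj_ip.
have dr : ipdet p1 p2 0 = (complex.Re (ipdet p1 p2 0))%:C.
  by apply: real_of; rewrite /ipdet conjcD conjcN !conjcM !conj_ip; ring.
have neq0 (s : R) : 0 < s -> s%:C != 0.
  by move=> s0; apply/eqP => -[] /eqP; rewrite (gt_eqF s0).
have A00 : A != 0 by rewrite Ar neq0.
have d00 : ipdet p1 p2 0 != 0 by rewrite dr neq0.
(* Gram-Schmidt factors: A^(-1/2) for the first row and (A / det G)^(1/2) for the second, whose
   squared distance to the first is det G / A. *)
pose e1 : C := ((Num.sqrt (complex.Re A))^-1)%:C.
pose e2 : C := (Num.sqrt (complex.Re A / complex.Re (ipdet p1 p2 0)))%:C.
have e1J : e1^* = e1 by rewrite /e1 conjc_real.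
have e2J : e2^* = e2 by rewrite /e2 conjc_real.
have e1E : e1 * e1 * A = 1.
  rewrite Ar /e1 -!realcM -expr2 exprVn sqr_sqrtr ?(ltW A0) // mulVf ?rmorph1 //.
  by rewrite lt0r_neq0.
have e2E : e2 * e2 * ipdet p1 p2 0 = A.
  rewrite dr [RHS]Ar /e2 -!realcM -expr2 sqr_sqrtr; last by rewrite divr_ge0 ?ltW.
  by rewrite divfK // lt0r_neq0.
have e10 : e1 != 0 by apply/eqP => h; move/eqP: e1E; rewrite h !mul0r eq_sym oner_eq0.
have e20 : e2 != 0 by apply/eqP => h; move/eqP: e2E; rewrite h !mul0r eq_sym (negPf A00).
clearbody e1 e2.
pose B' := ip p2 p1 0; pose e21 := - e2 * B' / A.
pose u1 j := e1 * a1 j; pose u2 j := e21 * a1 j + e2 * a2 j.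
have EA : A = \sum_j a1 j * (a1 j)^* by exact: jet_val JA.
have EB : B = \sum_j a1 j * (a2 j)^* by exact: jet_val JB.
have EB' : B' = \sum_j a2 j * (a1 j)^* by exact: jet_val JB'.
have ED : D = \sum_j a2 j * (a2 j)^* by exact: jet_val JD.
have sum_lin (a b c d : C) (f g r s : J -> C) :
   \sum_j (a * f j + b * g j) * (c * r j + d * s j)^* =
   a * c^* * (\sum_j f j * (r j)^*) + a * d^* * (\sum_j f j * (s j)^*) +
   b * c^* * (\sum_j g j * (r j)^*) + b * d^* * (\sum_j g j * (s j)^*).
  rewrite !mulr_sumr -!big_split /=; apply: eq_bigr => j _.
  by rewrite conjcD !conjcM; ring.
have AJ : A^* = A by rewrite conj_ip.
have BJ : B'^* = B by rewrite conj_ip.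
have e21J : e21^* = - e2 * B / A by rewrite /e21 !conjcM conjcN e2J BJ conjc_inv AJ.
have d0E : ipdet p1 p2 0 = A * D - B * B' by [].
have U11 : \sum_j u1 j * (u1 j)^* = 1.
  rewrite -e1E EA mulr_sumr; apply: eq_bigr => j _; rewrite /u1 conjcM e1J; ring.
have U12 : \sum_j u1 j * (u2 j)^* = 0.
  have -> : \sum_j u1 j * (u2 j)^* =
      \sum_j (e1 * a1 j + 0 * a2 j) * (e21 * a1 j + e2 * a2 j)^*.
    by apply: eq_bigr => j _; rewrite mul0r addr0.
  rewrite sum_lin -EA -EB -EB' -ED e2J e21J; field; exact: A00.
have U22 : \sum_j u2 j * (u2 j)^* = 1.
  rewrite (sum_lin e21 e2 e21 e2 a1 a2 a1 a2) -EA -EB -EB' -ED e21J e2J /e21.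
  apply: (mulIf A00); rewrite mul1r -[RHS]e2E d0E; field; exact: A00.
have U21 : \sum_j u2 j * (u1 j)^* = 0.
  rewrite (_ : \sum_j u2 j * (u1 j)^* = (\sum_j u1 j * (u2 j)^*)^*); last first.
    by rewrite conjc_sum; apply: eq_bigr => j _; rewrite [in RHS]conjcM conjcK mulrC.
  by rewrite U12 conjc0.
(* Derivatives of the rows after the constant change of basis; the N's are their components along
   [u1], [u2]. *)
pose w1 j := e1 * b1 j; pose w2 j := e21 * b1 j + e2 * b2 j.
pose N11 := \sum_j w1 j * (u1 j)^*; pose N12 := \sum_j w1 j * (u2 j)^*.
pose N21 := \sum_j w2 j * (u1 j)^*; pose N22 := \sum_j w2 j * (u2 j)^*.
pose v1 j := w1 j - N11 * u1 j - N12 * u2 j.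
pose v2 j := w2 j - N21 * u1 j - N22 * u2 j.
have sum_sub (f g1 g2 s : J -> C) (c1 c2 : C) :
    \sum_j (f j - c1 * g1 j - c2 * g2 j) * (s j)^* = \sum_j f j * (s j)^* -
      c1 * (\sum_j g1 j * (s j)^*) - c2 * \sum_j g2 j * (s j)^*.
  rewrite !mulr_sumr -!sumrB; apply: eq_bigr => j _; ring.
pose c01 := \sum_j x0 j * (u1 j)^*; pose c02 := \sum_j x0 j * (u2 j)^*.
pose x j := x0 j - c01 * u1 j - c02 * u2 j.
pose z j := y0 j - c01 * v1 j - c02 * v2 j.
pose c11 := \sum_j z j * (u1 j)^*; pose c12 := \sum_j z j * (u2 j)^*.
pose y j := z j - c11 * u1 j - c12 * u2 j.
(* The matrix g(t) is (1 - t N) E, with E the lower triangular Gram-Schmidt matrix of entries [e1],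
   [e21], [e2]. *)
pose g11 (t : C) := e1 + - (N11 * e1 + N12 * e21) * t.
pose g12 (t : C) := 0 + - (N12 * e2) * t.
pose g21 (t : C) := e21 + - (N21 * e1 + N22 * e21) * t.
pose g22 (t : C) := e2 + - (N22 * e2) * t.
pose q1 j t := g11 t * p1 j t + g12 t * p2 j t.
pose q2 j t := g21 t * p1 j t + g22 t * p2 j t.
pose f1 t := g11 t * h1 t + g12 t * h2 t.
pose f2 t := g21 t * h1 t + g22 t * h2 t.
pose cc1 (t : C) := c01 + c11 * t; pose cc2 (t : C) := c02 + c12 * t.
pose chi j t := psi j t - cc1 t * q1 j t - cc2 t * q2 j t.
pose ga t := g11 t * g22 t - g12 t * g21 t.
pose ga1 := - (N11 * e1 + N12 * e21) * e2 - e1 * (N22 * e2) + N12 * e2 * e21.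
have Jga : hol_jet ga (e1 * e2) ga1.
  have := hol_jetD (hol_jetM (hol_jet_affine e1 (- (N11 * e1 + N12 * e21))) (hol_jet_affine e2 (- (N22 * e2))))
   (hol_jetN (hol_jetM (hol_jet_affine 0 (- (N12 * e2))) (hol_jet_affine e21 (- (N21 * e1 + N22 * e21))))).
  by move=> h; apply: jet_eq h _ _ _ _ => //; rewrite /ga1; ring.
have ga0 : e1 * e2 != 0 by rewrite mulf_neq0.
have Jde := jetV Jga ga0.
have Hq1 j : hol_jet (q1 j) (u1 j) (v1 j).
  have := hol_jetD (hol_jetM (hol_jet_affine e1 (- (N11 * e1 + N12 * e21))) (Hp1 j))
   (hol_jetM (hol_jet_affine 0 (- (N12 * e2))) (Hp2 j)).
  by move=> h; apply: jet_eq h _ _ _ _ => //; rewrite /v1 /w1 /u1 /u2; ring.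
have Hq2 j : hol_jet (q2 j) (u2 j) (v2 j).
  have := hol_jetD (hol_jetM (hol_jet_affine e21 (- (N21 * e1 + N22 * e21))) (Hp1 j))
   (hol_jetM (hol_jet_affine e2 (- (N22 * e2))) (Hp2 j)).
  by move=> h; apply: jet_eq h _ _ _ _ => //; rewrite /v2 /w2 /u1 /u2; ring.
have Hf1 : hol_jet f1 (e1 * m1) (e1 * n1 - (N11 * e1 + N12 * e21) * m1 - N12 * e2 * m2).
  have := hol_jetD (hol_jetM (hol_jet_affine e1 (- (N11 * e1 + N12 * e21))) H1)
   (hol_jetM (hol_jet_affine 0 (- (N12 * e2))) H2).
  by move=> h; apply: jet_eq h _ _ _ _ => //; ring.
have Hf2 : hol_jet f2 (e21 * m1 + e2 * m2)
    (e21 * n1 + e2 * n2 - (N21 * e1 + N22 * e21) * m1 - N22 * e2 * m2).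
  have := hol_jetD (hol_jetM (hol_jet_affine e21 (- (N21 * e1 + N22 * e21))) H1)
   (hol_jetM (hol_jet_affine e2 (- (N22 * e2))) H2).
  by move=> h; apply: jet_eq h _ _ _ _ => //; ring.
have Hcc1 : hol_jet cc1 c01 c11 by exact: hol_jet_affine.
have Hcc2 : hol_jet cc2 c02 c12 by exact: hol_jet_affine.
have Hchi j : hol_jet (chi j) (x j) (y j).
  have := hol_jetD (hol_jetD (Hpsi j) (hol_jetN (hol_jetM Hcc1 (Hq1 j))))
    (hol_jetN (hol_jetM Hcc2 (Hq2 j))).
  by move=> h; apply: jet_eq h _ _ _ _ => //; rewrite /y /x /z; ring.
have [r1 r10 ga_n] := jet_neq0 Jga ga0.
have Jd : exists b c e, jet (ipdet p1 p2) (ipdet p1 p2 0) b c e.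
  have := jetB (jetM JA JD) (jetM JB JB') => Jd; have dv : ipdet p1 p2 0 = _ := jet_val Jd.
  by rewrite dv; do 3 eexists; exact: Jd.
have [db [dc [dee Jd']]] := Jd; have [r2 r20 d_n] := jet_neq0 Jd' d00.
have cmod_neq (a b : C) : a != 0 -> cmod a / 2 <= cmod b -> b != 0.
  move=> a0; apply: contraTneq => ->; rewrite cmod0 -ltNge divr_gt0 //.
  by rewrite lt_neqAle cmod_ge0 andbT eq_sym; apply: contraNneq a0 => /cmod_eq0 ->.
exists u1, v1, u2, v2, x, y, (e1 * m1), (e1 * n1 - (N11 * e1 + N12 * e21) * m1 - N12 * e2 * m2),
  (e21 * m1 + e2 * m2), (e21 * n1 + e2 * n2 - (N21 * e1 + N22 * e21) * m1 - N22 * e2 * m2),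
  (e1 * e2)^-1, (- ga1 / (e1 * e2) ^+ 2).
have V11 : \sum_j v1 j * (u1 j)^* = 0 by rewrite sum_sub U11 U21 -/N11; ring.
have V12 : \sum_j v1 j * (u2 j)^* = 0 by rewrite sum_sub U12 U22 -/N12; ring.
have V21 : \sum_j v2 j * (u1 j)^* = 0 by rewrite sum_sub U11 U21 -/N21; ring.
have V22 : \sum_j v2 j * (u2 j)^* = 0 by rewrite sum_sub U12 U22 -/N22; ring.
split=> //.
- by rewrite sum_sub U11 U21 -/c01; ring.
- by rewrite sum_sub U12 U22 -/c02; ring.
- by rewrite sum_sub U11 U21 -/c11; ring.
- by rewrite sum_sub U12 U22 -/c12; ring.
- by rewrite invr_eq0.
exists q1, q2, chi, f1, f2, (fun t => (ga t)^-1), (fun t => cc1 t * f1 t + cc2 t * f2 t),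
  (Num.min r1 r2); split => //; split.
- by apply: jet_eq Jde _ _ _ _ => //; ring.
- do 2 eexists; exact: (hol_jetD (hol_jetM Hcc1 Hf1) (hol_jetM Hcc2 Hf2)).
- by rewrite lt_min r10.
move=> t; rewrite le_min => /andP[/ga_n gat /d_n dt].
have {}gat := cmod_neq _ _ ga0 gat; have {}dt := cmod_neq _ _ d00 dt.
have gat' : (ga t)^* != 0 by rewrite conjc_eq0.
clearbody g11 g12 g21 g22 cc1 cc2.
have gE' : (g11 t)^* * (g22 t)^* - (g12 t)^* * (g21 t)^* = (ga t)^*.
  by rewrite /ga conjcD conjcN !conjcM.
have gat2 : (g11 t)^* * (g22 t)^* - (g12 t)^* * (g21 t)^* != 0 by rewrite gE'.
have Q11 : ip q1 q1 t = g11 t * (g11 t)^* * ip p1 p1 t + g11 t * (g12 t)^* * ip p1 p2 t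
    + g12 t * (g11 t)^* * ip p2 p1 t + g12 t * (g12 t)^* * ip p2 p2 t.
  by rewrite ip_linl !ip_linr; ring.
have Q12 : ip q1 q2 t = g11 t * (g21 t)^* * ip p1 p1 t + g11 t * (g22 t)^* * ip p1 p2 t
    + g12 t * (g21 t)^* * ip p2 p1 t + g12 t * (g22 t)^* * ip p2 p2 t.
  by rewrite ip_linl !ip_linr; ring.
have Q21 : ip q2 q1 t = g21 t * (g11 t)^* * ip p1 p1 t + g21 t * (g12 t)^* * ip p1 p2 t
    + g22 t * (g11 t)^* * ip p2 p1 t + g22 t * (g12 t)^* * ip p2 p2 t.
  by rewrite ip_linl !ip_linr; ring.
have Q22 : ip q2 q2 t = g21 t * (g21 t)^* * ip p1 p1 t + g21 t * (g22 t)^* * ip p1 p2 t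
    + g22 t * (g21 t)^* * ip p2 p1 t + g22 t * (g22 t)^* * ip p2 p2 t.
  by rewrite ip_linl !ip_linr; ring.
have detE : ipdet q1 q2 t = ga t * (ga t)^* * ipdet p1 p2 t.
  by rewrite /ipdet Q11 Q12 Q21 Q22 gram_det_gauge gE'.
have dq : ip q1 q1 t * ip q2 q2 t - ip q1 q2 t * ip q2 q1 t != 0.
  by rewrite -/(ipdet q1 q2 t) detE !mulf_neq0.
have conj_lin (a b : C) s s' : (a * s + b * s')^* = a^* * s^* + b^* * s'^*.
  by rewrite conjcD !conjcM.
split.
- rewrite detE conjc_inv; field; rewrite gat gat' //.
- by rewrite /normU Q11 Q12 Q21 Q22 /f1 /f2 !conj_lin gramU_gauge.
- transitivity (normX q1 q2 psi t).
    rewrite /normX /gramX Q11 Q12 Q21 Q22.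
    have -> : ip psi q1 t = (g11 t)^* * ip psi p1 t + (g12 t)^* * ip psi p2 t by rewrite ip_linr.
    have -> : ip psi q2 t = (g21 t)^* * ip psi p1 t + (g22 t)^* * ip psi p2 t by rewrite ip_linr.
    have -> : ip q1 psi t = g11 t * ip p1 psi t + g12 t * ip p2 psi t by rewrite ip_linl.
    have -> : ip q2 psi t = g21 t * ip p1 psi t + g22 t * ip p2 psi t by rewrite ip_linl.
    by rewrite gramU_gauge.
  rewrite /normX.
  have := gramX_shift (ip psi psi t) (ip psi q1 t) (ip q1 psi t) (ip psi q2 t)
    (ip q2 psi t) (cc1 t) (cc1 t)^* (cc2 t) (cc2 t)^* dq => <-.
  congr gramX; rewrite ?ip_shiftl ?ip_shiftr ?ip_shiftl; ring.
transitivity (pairT q1 q2 psi f1 f2 t).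
  rewrite /pairT Q11 Q12 Q21 Q22 /f1 /f2.
  have -> : ip psi q1 t = (g11 t)^* * ip psi p1 t + (g12 t)^* * ip psi p2 t by rewrite ip_linr.
  have -> : ip psi q2 t = (g21 t)^* * ip psi p1 t + (g22 t)^* * ip psi p2 t by rewrite ip_linr.
  by rewrite gramT_gauge.
rewrite /pairT.
have := gramT_shift (ip psi q1 t) (ip psi q2 t) (f1 t) (f2 t) (cc1 t) (cc2 t) dq => h.
rewrite !ip_shiftl h; ring.
Qed.

End NormalForm.

(** * Subharmonicity of the auxiliary function *)

Section Bellman.
Variables (R : realType) (J : finType).
Local Notation C := R[i].
Variables (eps al1 al3 : R).
Implicit Types (p q psi : J -> C -> C) (h : C -> C).

Definition Gdet p1 p2 t : R := complex.Re (ipdet p1 p2 t).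

(** Complex valued so that jets can be multiplied; subharmonicity concerns its real part. *)
Definition Bellman p1 p2 psi h1 h2 (t : C) : C :=
  (al1 * Gdet p1 p2 t `^ eps)%:C * (h1 t * (h1 t)^* + h2 t * (h2 t)^*) +
  (2^-1)%:C * normU p1 p2 h1 h2 t +
  (al3 * Gdet p1 p2 t `^ (1 + eps))%:C * normX p1 p2 psi t +
  (2^-1)%:C * normX p1 p2 psi t - pairT p1 p2 psi h1 h2 t.

Lemma jetZ (x : C) F a b c e : jet F a b c e ->
  jet (fun t => x * F t) (x * a) (x * b) (x * c) (x * e).
Proof. by move=> H; apply: jet_eq (jetM (jet_const x) H) _ _ _ _ => //; ring. Qed.

Lemma cmod_sum_mulJ (x : J -> C) :
  \sum_j x j * (x j)^* = (\sum_j cmod (x j) ^+ 2)%:C.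
Proof. by rewrite rmorph_sum; apply: eq_bigr => j _; rewrite mulJ_sqr_cmod. Qed.

(* The terms with [kap] come from the curvature of ker Phi and of its
   orthogonal, and are paid for by the two weighted terms. *)
Lemma Bellman_positive (u1 v1 u2 v2 x y : J -> C) (k1 l1 k2 l2 m1 n1 m2 n2 p : C) (D W V : R) :
  let kap := \sum_j v1 j * (v1 j)^* + \sum_j v2 j * (v2 j)^* in
  let t1 := \sum_j x j * (v1 j)^* in let t2 := \sum_j x j * (v2 j)^* in
  let s1 := \sum_j y j * (v1 j)^* in let s2 := \sum_j y j * (v2 j)^* in
  let Q := \sum_j (k1^* * v1 j + k2^* * v2 j) * (k1^* * v1 j + k2^* * v2 j)^* in
  let T := t1 * t1^* + t2 * t2^* in
  let xx := \sum_j x j * (x j)^* in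
  0 <= al1 * W -> 0 <= al3 * V ->
  complex.Re (k1 * k1^* + k2 * k2^*) <= al1 * W * eps * complex.Re (m1 * m1^* + m2 * m2^*) ->
  1 <= al3 * V * eps ->
  0 <= complex.Re (
   (al1 * W)%:C * (eps%:C * kap * (m1 * m1^* + m2 * m2^*) +
     ((n1 + eps%:C * p * m1) * (n1 + eps%:C * p * m1)^* +
      (n2 + eps%:C * p * m2) * (n2 + eps%:C * p * m2)^*)) +
   (2^-1)%:C * (l1 * l1^* + l2 * l2^* - Q) +
   (al3 * V)%:C * ((1 + eps)%:C * kap * xx - T +
     \sum_j (y j + (1 + eps)%:C * p * x j) * (y j + (1 + eps)%:C * p * x j)^*) +
   (2^-1)%:C * (\sum_j y j * (y j)^* - T) -
   (s1 * k1 + s2 * k2 + (t1 * l1 + t2 * l2))).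
Proof.
move=> kap t1 t2 s1 s2 Q T xx W0 V0 HW HV.
have nn (z : C) : 0 <= cmod z ^+ 2 by exact: sqr_ge0.
have S0 (f : J -> C) : 0 <= \sum_j cmod (f j) ^+ 2 by apply: sumr_ge0.
set K := \sum_j cmod (v1 j) ^+ 2 + \sum_j cmod (v2 j) ^+ 2.
have K0 : 0 <= K by rewrite addr_ge0.
have Ek : kap = K%:C by rewrite /kap !cmod_sum_mulJ -realcD.
set QR := \sum_j cmod (k1^* * v1 j + k2^* * v2 j) ^+ 2.
have EQ : Q = QR%:C by rewrite /Q cmod_sum_mulJ.
set XR := \sum_j cmod (x j) ^+ 2; have Ex : xx = XR%:C by rewrite /xx cmod_sum_mulJ.
set TR := cmod t1 ^+ 2 + cmod t2 ^+ 2.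
have ET : T = TR%:C by rewrite /T !mulJ_sqr_cmod -realcD.
have QK : QR <= K * (cmod k1 ^+ 2 + cmod k2 ^+ 2).
  rewrite /QR /K -big_split /= mulr_suml ler_sum // => j _.
  rewrite !sqr_cmod; case: (k1) (k2) (v1 j) (v2 j) => a b [c d] [e f] [g h] /=.
  rewrite -subr_ge0.
  have -> : (e ^+ 2 + f ^+ 2 + (g ^+ 2 + h ^+ 2)) * (a ^+ 2 + b ^+ 2 + (c ^+ 2 + d ^+ 2)) -
      ((a * e - - b * f + (c * g - - d * h)) ^+ 2 +
       (a * f + - b * e + (c * h + - d * g)) ^+ 2) =
     (a * g - c * e - b * h + d * f) ^+ 2 + (a * h + b * g - c * f - d * e) ^+ 2 by ring.
  by rewrite addr_ge0 // sqr_ge0.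
have TK : TR <= K * XR.
  by rewrite mulrC /K mulrDr lerD // CauchySchwarz_ip.
(* The cross terms are split by 2ab <= a^2 + b^2. Their halves of |y|^2 and |l|^2 cancel the
   positive ones, and -Q - T is what remains to be absorbed. *)
have B1 : complex.Re (s1 * k1 + s2 * k2) <=
    2^-1 * \sum_j cmod (y j) ^+ 2 + 2^-1 * QR.
  have -> : s1 * k1 + s2 * k2 = \sum_j y j * (k1^* * v1 j + k2^* * v2 j)^*.
    rewrite /s1 /s2 !mulr_suml -big_split /=; apply: eq_bigr => j _.
    by rewrite conjcD !conjcM !conjcK; ring.
  rewrite Re_sum /QR !mulr_sumr -big_split /= ler_sum // => j _; exact: Re_mulJ_le.
have B2 : complex.Re (t1 * l1 + t2 * l2) <=
    2^-1 * TR + 2^-1 * (cmod l1 ^+ 2 + cmod l2 ^+ 2).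
  have := Re_mulJ_le t1 l1^*; have := Re_mulJ_le t2 l2^*.
  by rewrite !conjcK !cmodJ ReD /TR; lra.
rewrite Ek EQ Ex ET !mulJ_sqr_cmod !cmod_sum_mulJ -!realcD.
rewrite (_ : eps%:C * K%:C * (cmod m1 ^+ 2 + cmod m2 ^+ 2)%:C =
  (eps * K * (cmod m1 ^+ 2 + cmod m2 ^+ 2))%:C); last by rewrite !realcM.
rewrite (_ : (1 + eps)%:C * K%:C * XR%:C = ((1 + eps) * K * XR)%:C); last by rewrite !realcM.
rewrite -!realcD -!realcN -!realcD.
rewrite !(ReD, ReN) !ReM_real /=.
move: HW; rewrite !mulJ_sqr_cmod -!realcD /= => HW.
set Z1 := cmod (n1 + _) ^+ 2 + cmod (n2 + _) ^+ 2; have Z10 : 0 <= Z1 by rewrite addr_ge0.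
set Z2 := \sum_j cmod _ ^+ 2; have Z20 : 0 <= Z2 by exact: S0.
(* The weighted terms absorb Q and T: Q is at most K |k|^2, and T at most K |x|^2, so that (1 + eps)
   K |x|^2 - T still keeps eps K |x|^2. *)
have A1 : QR <= al1 * W * (eps * K * (cmod m1 ^+ 2 + cmod m2 ^+ 2) + Z1).
  rewrite mulrDr (le_trans QK) // ler_wpDr ?(mulr_ge0 W0 Z10) //.
  apply: le_trans (ler_wpM2l K0 HW) _.
  by rewrite le_eqVlt; apply/orP; left; apply/eqP; ring.
have A2 : TR <= al3 * V * ((1 + eps) * K * XR - TR + Z2).
  rewrite mulrDr ler_wpDr ?(mulr_ge0 V0 Z20) //.
  have h : eps * (K * XR) <= (1 + eps) * K * XR - TR by have := TK; lra.
  apply: le_trans (ler_wpM2l V0 h).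
  have -> : al3 * V * (eps * (K * XR)) = (al3 * V * eps) * (K * XR) by ring.
  by apply: le_trans TK _; apply: ler_peMl => //; rewrite (mulr_ge0 K0) // S0.
move: B1 B2; rewrite ReD; lra.
Qed.

(** In normal coordinates the d dbar derivative of log d is kap = |v1|^2 + |v2|^2, and its first
    derivative p comes from the gauge alone. The last two hypotheses are the conditions of
    [Bellman_positive] at the base point. *)
Lemma jet_Bellman p1 p2 psi h1 h2 (a1 b1 a2 b2 x0 y0 : J -> C) (m1 n1 m2 n2 : C) :
  0 <= al1 -> 0 <= al3 ->
  (forall j, hol_jet (p1 j) (a1 j) (b1 j)) -> (forall j, hol_jet (p2 j) (a2 j) (b2 j)) ->
  (forall j, hol_jet (psi j) (x0 j) (y0 j)) -> hol_jet h1 m1 n1 -> hol_jet h2 m2 n2 ->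
  0 < complex.Re (ip p1 p1 0) -> 0 < Gdet p1 p2 0 ->
  complex.Re (normU p1 p2 h1 h2 0) <=
    al1 * Gdet p1 p2 0 `^ eps * eps * (cmod (h1 0) ^+ 2 + cmod (h2 0) ^+ 2) ->
  1 <= al3 * Gdet p1 p2 0 `^ (1 + eps) * eps ->
  exists b c e, jet (Bellman p1 p2 psi h1 h2) (Bellman p1 p2 psi h1 h2 0) b c e /\
    0 <= complex.Re e.
Proof.
move=> al10 al30 Hp1 Hp2 Hpsi H1 H2 A0 d0 HU HV.
have [u1 [v1 [u2 [v2 [x [y [k1 [l1 [k2 [l2 [de0 [de1 ND]]]]]]]]]]]] :=
  normal_form Hp1 Hp2 Hpsi H1 H2 A0 d0.
case: ND => u11 u22 u12 v11 v12 v21 v22 x1 x2 y1 y2 de00.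
move=> [q1 [q2 [chi [f1 [f2 [de [cc [r0 [Hq1 Hq2 Hchi [Hf1 Hf2]]]]]]]]]].
move=> [Hde [ca [cb Hcc]] r00 HF].
have u21 : \sum_j u2 j * (u1 j)^* = 0.
  rewrite (_ : \sum_j u2 j * (u1 j)^* = (\sum_j u1 j * (u2 j)^*)^*).
    by rewrite u12 conjc0.
  by rewrite conjc_sum; apply: eq_bigr => j _; rewrite [in RHS]conjcM conjcK mulrC.
have flip (f g : J -> C) : \sum_j f j * (g j)^* = 0 -> \sum_j g j * (f j)^* = 0.
  move=> h; rewrite (_ : \sum_j g j * (f j)^* = (\sum_j f j * (g j)^*)^*).
    by rewrite h conjc0.
  by rewrite conjc_sum; apply: eq_bigr => j _; rewrite [in RHS]conjcM conjcK mulrC.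
have J11 := jet_ip Hq1 Hq1; have J22 := jet_ip Hq2 Hq2.
have J12 := jet_ip Hq1 Hq2; have J21 := jet_ip Hq2 Hq1.
have Jc1 := jet_ip Hchi Hq1; have Jc2 := jet_ip Hchi Hq2.
have J1c := jet_ip Hq1 Hchi; have J2c := jet_ip Hq2 Hchi.
have Jcc := jet_ip Hchi Hchi.
rewrite u11 v11 (flip _ _ v11) in J11; rewrite u22 v22 (flip _ _ v22) in J22.
rewrite u12 v12 (flip _ _ v21) in J12; rewrite u21 v21 (flip _ _ v12) in J21.
rewrite x1 y1 in Jc1; rewrite x2 y2 in Jc2.
rewrite (flip _ _ x1) (flip _ _ y1) in J1c; rewrite (flip _ _ x2) (flip _ _ y2) in J2c.
set t1 := \sum_j x j * (v1 j)^* in Jc1; set t2 := \sum_j x j * (v2 j)^* in Jc2.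
set s1 := \sum_j y j * (v1 j)^* in Jc1; set s2 := \sum_j y j * (v2 j)^* in Jc2.
set t1' := \sum_j v1 j * (x j)^* in J1c; set t2' := \sum_j v2 j * (x j)^* in J2c.
have t1E : t1' = t1^*.
  by rewrite /t1 conjc_sum; apply: eq_bigr => j _; rewrite [in RHS]conjcM conjcK mulrC.
have t2E : t2' = t2^*.
  by rewrite /t2 conjc_sum; apply: eq_bigr => j _; rewrite [in RHS]conjcM conjcK mulrC.
set kap := \sum_j v1 j * (v1 j)^* + \sum_j v2 j * (v2 j)^*.
pose p := de1 / de0.
pose D := cmod de0 ^+ 2.
have D0 : 0 < D.
  rewrite exprn_gt0 // lt_neqAle cmod_ge0 andbT eq_sym.
  by apply: contraNneq de00 => /cmod_eq0 ->.
have realq t : (ipdet q1 q2 t)^* = ipdet q1 q2 t.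
  by rewrite /ipdet conjcD conjcN !conjcM !conj_ip; ring.
have realp t : ipdet p1 p2 t = (Gdet p1 p2 t)%:C.
  have : (ipdet p1 p2 t)^* = ipdet p1 p2 t.
    by rewrite /ipdet conjcD conjcN !conjcM !conj_ip; ring.
  by rewrite /Gdet; case: (ipdet _ _ _) => a b /= [] h; congr (_ +i* _); lra.
have JG : jet (fun t => (Gdet p1 p2 t)%:C) D%:C (D%:C * p) (D%:C * p^*)
    (D%:C * (p * p^* + kap)).
  have Jq := jetB (jetM J11 J22) (jetM J12 J21).
  have Jd := jetM (jetM Hde (jetJ Hde)) Jq.
  have DE : D%:C = de0 * de0^* by rewrite mulJ_sqr_cmod.
  have de0' : de0^* != 0 by rewrite conjc_eq0.
  have pE : p^* = de1^* / de0^* by rewrite conjcM conjc_inv.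
  apply: (jet_ext r00 (F := fun t => de t * (de t)^* * ipdet q1 q2 t)).
    by move=> t /HF [<- _ _ _].
  apply: jet_eq Jd _ _ _ _ => //; rewrite ?conjc0 ?DE ?pE /kap /p; field; rewrite ?de00 ?de0' //.
have GD : Gdet p1 p2 0 = D by have := jet_val JG => -[].
rewrite GD in HU HV.
have JW := jet_powR eps D0 JG; have JV := jet_powR (1 + eps) D0 JG.
set W := D `^ eps in JW HU; set V := D `^ (1 + eps) in JV HV.
have W0 : 0 <= W by exact: powR_ge0. have V0 : 0 <= V by exact: powR_ge0.
have JU : jet (normU p1 p2 h1 h2) (k1 * k1^* + k2 * k2^*) (l1 * k1^* + l2 * k2^*)
   (k1 * l1^* + k2 * l2^*) (l1 * l1^* + l2 * l2^* -
   \sum_j (k1^* * v1 j + k2^* * v2 j) * (k1^* * v1 j + k2^* * v2 j)^*).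
  apply: (jet_ext r00 (F := normU q1 q2 f1 f2)); first by move=> t /HF [_ <- _ _].
  apply: jet_eq (jet_gramU_normal J11 J22 J12 J21 Hf1 (jetJ Hf1) Hf2 (jetJ Hf2)) _ _ _ _ => //;
    rewrite ?conjc0; try ring.
  have -> : \sum_j (k1^* * v1 j + k2^* * v2 j) * (k1^* * v1 j + k2^* * v2 j)^* =
     k1^* * k1 * (\sum_j v1 j * (v1 j)^*) + k1^* * k2 * (\sum_j v1 j * (v2 j)^*) +
     k2^* * k1 * (\sum_j v2 j * (v1 j)^*) + k2^* * k2 * (\sum_j v2 j * (v2 j)^*).
    rewrite !mulr_sumr -!big_split /=; apply: eq_bigr => j _.
    by rewrite conjcD !conjcM !conjcK; ring.
  ring.
have JX : jet (normX p1 p2 psi) (\sum_j x j * (x j)^*) (\sum_j y j * (x j)^*)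
   (\sum_j x j * (y j)^*) (\sum_j y j * (y j)^* - (t1 * t1^* + t2 * t2^*)).
  apply: (jet_ext r00 (F := normX q1 q2 chi)); first by move=> t /HF [_ _ <- _].
  apply: jet_eq (jetB Jcc (jet_gramU_normal J11 J22 J12 J21 J1c Jc1 J2c Jc2)) _ _ _ _ => //;
    rewrite ?t1E ?t2E; ring.
have JT : exists b c, jet (pairT p1 p2 psi h1 h2) (0 + ca) b c
   (s1 * k1 + s2 * k2 + (t1 * l1 + t2 * l2)).
  exists (0 + cb), (t1 * k1 + t2 * k2 + 0).
  apply: (jet_ext r00 (F := fun t => pairT q1 q2 chi f1 f2 t + cc t)).
    by move=> t /HF [_ _ _ <-].
  by apply: jet_eq (jetD (jet_gramT_normal J11 J22 J12 J21 Jc1 Jc2 Hf1 Hf2) Hcc) _ _ _ _ => //; ring.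
have [tb [tc {}JT]] := JT.
have JH : jet (fun t => h1 t * (h1 t)^* + h2 t * (h2 t)^*) (m1 * m1^* + m2 * m2^*)
   (n1 * m1^* + n2 * m2^*) (m1 * n1^* + m2 * n2^*) (n1 * n1^* + n2 * n2^*).
  by apply: jet_eq (jetD (jetM H1 (jetJ H1)) (jetM H2 (jetJ H2))) _ _ _ _ => //;
    rewrite ?conjc0; ring.
have Jtot := jetB (jetD (jetD (jetD (jetM (jetZ al1%:C JW) JH) (jetZ (2^-1)%:C JU))
   (jetM (jetZ al3%:C JV) JX)) (jetZ (2^-1)%:C JX)) JT.
(* The d dbar coefficient, with [p] absorbed in completed squares as [Bellman_positive] expects. *)
have [F [a [b [c [e {Jtot}[Jtot FE eE]]]]]] : exists F a b c e,
    [/\ jet F a b c e, F =1 Bellman p1 p2 psi h1 h2 & e =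
   (al1 * W)%:C * (eps%:C * kap * (m1 * m1^* + m2 * m2^*) +
     ((n1 + eps%:C * p * m1) * (n1 + eps%:C * p * m1)^* +
      (n2 + eps%:C * p * m2) * (n2 + eps%:C * p * m2)^*)) +
   (2^-1)%:C * (l1 * l1^* + l2 * l2^* -
      \sum_j (k1^* * v1 j + k2^* * v2 j) * (k1^* * v1 j + k2^* * v2 j)^*) +
   (al3 * V)%:C * ((1 + eps)%:C * kap * (\sum_j x j * (x j)^*) - (t1 * t1^* + t2 * t2^*) +
     \sum_j (y j + (1 + eps)%:C * p * x j) * (y j + (1 + eps)%:C * p * x j)^*) +
   (2^-1)%:C * (\sum_j y j * (y j)^* - (t1 * t1^* + t2 * t2^*)) -
   (s1 * k1 + s2 * k2 + (t1 * l1 + t2 * l2))].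
  do 5 eexists; split; first exact: Jtot.
    by move=> t; rewrite /Bellman !realcM.
  have -> : \sum_j (y j + (1 + eps)%:C * p * x j) * (y j + (1 + eps)%:C * p * x j)^* =
     \sum_j y j * (y j)^* + (1 + eps)%:C * p^* * (\sum_j y j * (x j)^*) +
     (1 + eps)%:C * p * (\sum_j x j * (y j)^*) +
     (1 + eps)%:C ^+ 2 * p * p^* * (\sum_j x j * (x j)^*).
    rewrite !mulr_sumr -!big_split /=; apply: eq_bigr => j _.
    by rewrite conjcD !conjcM conjc_real; ring.
  rewrite !conjcD !conjcM conjc_real !realcM; ring.
exists b, c, e; split.
  have JB : jet (Bellman p1 p2 psi h1 h2) a b c e by apply: (jet_ext ltr01 _ Jtot) => t _.
  by rewrite (jet_val JB).
have h10 := jet_val H1; have h20 := jet_val H2.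
rewrite eE; apply: Bellman_positive => //; try exact: mulr_ge0.
by rewrite -(jet_val JU) !mulJ_sqr_cmod -realcD /= -h10 -h20.
Qed.

End Bellman.

(** * Polynomials and Parseval's identity on the circle *)

Section Entire.
Variable R : realType.
Local Notation C := R[i].
Implicit Types (f g : C -> C) (c : nat -> C).

Definition entire f := forall z, exists a b, hol_jet (fun t => f (z + t)) a b.

Lemma entire_const a : entire (fun=> a).
Proof. by move=> z; exists a, 0; exact: jet_const. Qed.

Lemma entire_id : entire (fun z => z).
Proof.
move=> z; exists z, 1; apply: jet_eq (hol_jet_affine z 1) _ _ _ _ => // t.
by rewrite mul1r.
Qed.

Lemma entireD f g : entire f -> entire g -> entire (fun z => f z + g z).
Proof.
move=> Hf Hg z; have [a [b H]] := Hf z; have [a' [b' H']] := Hg z.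
do 2 eexists; exact: (hol_jetD H H').
Qed.

Lemma entireM f g : entire f -> entire g -> entire (fun z => f z * g z).
Proof.
move=> Hf Hg z; have [a [b H]] := Hf z; have [a' [b' H']] := Hg z.
do 2 eexists; exact: (hol_jetM H H').
Qed.

Lemma entireX f n : entire f -> entire (fun z => f z ^+ n).
Proof.
move=> Hf; elim: n => [|n IH]; first exact: entire_const.
move=> z; have [a [b H]] := entireM Hf IH z; exists a, b.
by apply: jet_eq H _ _ _ _ => // t; rewrite exprS.
Qed.

Lemma entire_ext f g : f =1 g -> entire f -> entire g.
Proof.
move=> fg H z; have [a [b Hz]] := H z; exists a, b.
by apply: jet_eq Hz _ _ _ _ => // t; rewrite fg.
Qed.

Lemma entire_sum (I : Type) (r : seq I) (P : pred I) (F : I -> C -> C) :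
  (forall i, entire (F i)) -> entire (fun z => \sum_(i <- r | P i) F i z).
Proof.
move=> H; elim: r => [|i r IH].
  by apply: entire_ext (entire_const 0) => z; rewrite big_nil.
case Pi: (P i).
  by apply: entire_ext (entireD (H i) IH) => z; rewrite big_cons Pi.
by apply: entire_ext IH => z; rewrite big_cons Pi.
Qed.

Definition ev c n z : C := \sum_(i < n) c i * z ^+ i.

Lemma entire_ev c n : entire (ev c n).
Proof.
apply: entire_sum => i; apply: entireM (entire_const _) _.
exact: entireX entire_id.
Qed.

(** On the circle |c0 + z g|^2 = |c0|^2 + |g|^2 + 2 Re(conj c0 z g), and induction applies to g.
    This is Parseval without integrals: the mean over the circle is the value at 0 of a harmonic
    function. *)
Lemma boundary_sqr n c : exists P, [/\ entire P, P 0 = (\sum_(i < n) cmod (c i) ^+ 2)%:C &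
  forall z, cmod z = 1 -> complex.Re (P z) = cmod (ev c n z) ^+ 2].
Proof.
elim: n c => [|n IH] c.
  exists (fun=> 0); split; first exact: entire_const.
    by rewrite big_ord0.
  by move=> z _; rewrite /ev big_ord0 cmod0 expr0n.
have [P [EP P0 Pb]] := IH (fun i => c i.+1).
pose g := ev (fun i => c i.+1) n.
exists (fun z => P z + (cmod (c 0%N) ^+ 2)%:C + (2 * (c 0%N)^*) * (z * g z)); split.
- apply: entireD (entireD EP (entire_const _)) (entireM (entire_const _) _).
  exact: entireM entire_id (entire_ev _ _).
- by rewrite P0 big_ord_recl mul0r mulr0 addr0 addrC realcD.
move=> z z1.
have -> : ev c n.+1 z = c 0%N + z * g z.
  rewrite /ev big_ord_recl expr0 mulr1; congr (_ + _).
  rewrite /g /ev mulr_sumr; apply: eq_bigr => i _.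
  by rewrite /= /bump leq0n add1n exprS; ring.
rewrite !ReD Pb // -/g.
have -> : cmod (g z) ^+ 2 = cmod (z * g z) ^+ 2 by rewrite cmodM z1 mul1r.
rewrite !sqr_cmod; case: (c 0%N) (z * g z) => a b [d e] /=; ring.
Qed.

End Entire.

(** * Pointwise bounds on the Gram matrix and on the circle *)

Section GramBounds.
Variables (R : realType) (J : finType).
Local Notation C := R[i].
Variables (p1 p2 : J -> C -> C) (z : C) (del : R).
Hypothesis del0 : 0 < del.
Hypothesis Hb : forall v1 v2 : C,
  del ^+ 2 * (cmod v1 ^+ 2 + cmod v2 ^+ 2) <=
    \sum_j cmod ((p1 j z)^* * v1 + (p2 j z)^* * v2) ^+ 2 <=
  cmod v1 ^+ 2 + cmod v2 ^+ 2.

Let A := ip p1 p1 z. Let B := ip p1 p2 z. Let B' := ip p2 p1 z. Let D := ip p2 p2 z.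

Lemma gram_form v1 v2 :
  (\sum_j cmod ((p1 j z)^* * v1 + (p2 j z)^* * v2) ^+ 2)%:C =
  A * (v1 * v1^*) + B' * (v1 * v2^*) + B * (v2 * v1^*) + D * (v2 * v2^*).
Proof.
rewrite rmorph_sum /A /B /B' /D /ip !mulr_suml -!big_split /=; apply: eq_bigr => j _.
by rewrite -mulJ_sqr_cmod conjcD !conjcM !conjcK; ring.
Qed.

Lemma ipA : A = (\sum_j cmod (p1 j z) ^+ 2)%:C. Proof. exact: cmod_sum_mulJ. Qed.
Lemma ipD : D = (\sum_j cmod (p2 j z) ^+ 2)%:C. Proof. exact: cmod_sum_mulJ. Qed.

Lemma ipBB' : B * B' = (cmod B ^+ 2)%:C.
Proof. by rewrite -mulJ_sqr_cmod /B conj_ip. Qed.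

Lemma Gdet_eq : (Gdet p1 p2 z)%:C = A * D - B * B'.
Proof.
rewrite /Gdet /ipdet -/A -/D -/B -/B' ipBB' ipA ipD -realcM -realcN -realcD //.
Qed.

Lemma ReA_bounds : del ^+ 2 <= complex.Re A <= 1.
Proof.
have := Hb 1 0; rewrite cmod1 cmod0 expr1n expr0n /= addr0 !mulr1.
by under eq_bigr => j _ do rewrite mulr1 mulr0 addr0 cmodJ; rewrite ipA.
Qed.

Lemma ReD_bounds : del ^+ 2 <= complex.Re D <= 1.
Proof.
have := Hb 0 1; rewrite cmod1 cmod0 expr1n expr0n /= add0r !mulr1.
by under eq_bigr => j _ do rewrite mulr1 mulr0 add0r cmodJ; rewrite ipD.
Qed.

Lemma Gdet_bounds : del ^+ 4 <= Gdet p1 p2 z <= 1.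
Proof.
have /andP[A1 A2] := ReA_bounds; have /andP[D1 D2] := ReD_bounds.
have GE : Gdet p1 p2 z = complex.Re A * complex.Re D - cmod B ^+ 2.
  have := Gdet_eq; rewrite ipBB' ipA ipD -realcM -realcN -realcD => -[->] //.
have del2 : 0 < del ^+ 2 by rewrite exprn_gt0.
apply/andP; split; last first.
  rewrite GE; have := sqr_ge0 (cmod B).
  have : complex.Re A * complex.Re D <= 1.
    by rewrite mulr_ile1 //; apply: ltW; apply: lt_le_trans del2 _.
  lra.
(* A column of the adjugate of G: the quadratic form takes there the value det G times D. *)
have /andP[h _] := Hb D (- B').
have E : (\sum_j cmod ((p1 j z)^* * D + (p2 j z)^* * (- B')) ^+ 2) =
    Gdet p1 p2 z * complex.Re D.
  apply: (_ : injective (fun x : R => x%:C)); first by move=> ? ? [].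
  rewrite gram_form realcM Gdet_eq conjcN.
  have DJ : D^* = D by rewrite conj_ip.
  have BJ : B'^* = B by rewrite conj_ip.
  have -> : (complex.Re D)%:C = D by rewrite ipD.
  rewrite DJ BJ; ring.
rewrite E in h.
have D0 : 0 < complex.Re D by apply: lt_le_trans D1.
have cD : cmod D ^+ 2 = complex.Re D ^+ 2.
  by rewrite ipD cmod_real real_normK // num_real.
rewrite cD in h.
have : del ^+ 2 * complex.Re D ^+ 2 <= Gdet p1 p2 z * complex.Re D.
  by apply: le_trans h; rewrite ler_wpM2l ?(ltW del2) // lerDl sqr_ge0.
rewrite [complex.Re D ^+ 2]expr2 mulrA ler_pM2r // => h2; apply: le_trans h2.
by rewrite -[4%N]/(2 + 2)%N exprD ler_wpM2l // ltW.
Qed.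

Let d0 : A * D - B * B' != 0.
Proof.
rewrite -Gdet_eq; apply/eqP => -[] /eqP; rewrite gt_eqF //.
by have /andP[h _] := Gdet_bounds; apply: lt_le_trans h; rewrite exprn_gt0.
Qed.

(** [lns1] and [lns2] are the coordinates of G^-1 h, and [lns] is the least-norm solution u0. *)
Definition lns1 h1 h2 := (D * h1 - B * h2) / (A * D - B * B').
Definition lns2 h1 h2 := (A * h2 - B' * h1) / (A * D - B * B').
Definition lns h1 h2 j := (p1 j z)^* * lns1 h1 h2 + (p2 j z)^* * lns2 h1 h2.

Lemma gramU_lns h1 h2 : gramU A B B' D h1 h1^* h2 h2^* =
  (\sum_j cmod (lns h1 h2 j) ^+ 2)%:C.
Proof.
rewrite gram_form /gramU /lns1 /lns2 !conjcM !conjc_inv !conjcD !conjcN !conjcM.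
have -> : A^* = A by rewrite conj_ip. have -> : D^* = D by rewrite conj_ip.
have -> : B^* = B' by rewrite conj_ip. have -> : B'^* = B by rewrite conj_ip.
by field; rewrite [B' * B]mulrC; exact: d0.
Qed.

(** With y = G^-1 h, |u0|^2 equals Re <h, y> and is at least del^2 |y|^2; bounding the pairing by
    (del^-2 |h|^2 + del^2 |y|^2) / 2 and absorbing the second half gives the claim. *)
Lemma gramU_le h1 h2 : complex.Re (gramU A B B' D h1 h1^* h2 h2^*) <=
  del ^- 2 * (cmod h1 ^+ 2 + cmod h2 ^+ 2).
Proof.
set U := gramU _ _ _ _ _ _ _ _; have UE : U = (complex.Re U)%:C by rewrite /U gramU_lns.
set y1 := lns1 h1 h2; set y2 := lns2 h1 h2.
have /andP[h _] := Hb y1 y2.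
have {}h : del ^+ 2 * (cmod y1 ^+ 2 + cmod y2 ^+ 2) <= complex.Re U.
  by rewrite /U gramU_lns.
have Uy : complex.Re U = complex.Re (h1 * y1^* + h2 * y2^*).
  rewrite -(ReJ (h1 * _ + _)); congr complex.Re.
  rewrite conjcD !conjcM !conjcK /U /gramU /y1 /y2 /lns1 /lns2; field; exact: d0.
have del2 : 0 < del ^+ 2 by rewrite exprn_gt0.
clearbody y1 y2; have b1 := Re_mulJ_le (del^-1%:C * h1) (del%:C * y1).
have b2 := Re_mulJ_le (del^-1%:C * h2) (del%:C * y2).
have e (h' y : C) : complex.Re (del^-1%:C * h' * (del%:C * y)^*) = complex.Re (h' * y^*).
  rewrite conjcM conjc_real; congr complex.Re.
  rewrite mulrACA -realcM mulVf ?mul1r //; exact: lt0r_neq0.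
rewrite !e !cmodM !cmod_real !exprMn !real_normK ?num_real // exprVn in b1 b2.
move: h b1 b2; rewrite Uy ReD; set x1 := complex.Re _; set x2 := complex.Re (h2 * _).
lra.
Qed.

Lemma gramT_lns psi h1 h2 :
  gramT A B B' D (ip psi p1 z) (ip psi p2 z) h1 h2 = \sum_j psi j z * lns h1 h2 j.
Proof.
have -> : \sum_j psi j z * lns h1 h2 j =
    ip psi p1 z * lns1 h1 h2 + ip psi p2 z * lns2 h1 h2.
  rewrite /ip !mulr_suml -big_split /=; apply: eq_bigr => j _; rewrite /lns; ring.
by rewrite /gramT /lns1 /lns2; field; exact: d0.
Qed.

Variables (psi : J -> C -> C) (k1 k2 : C) (w : J -> C).
Hypothesis Hpsi : forall j, (p1 j z)^* * k1 + (p2 j z)^* * k2 = w j + (psi j z)^*.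

Let chi j (t : C) := psi j t - k1^* * p1 j t - k2^* * p2 j t.

Let chiE j : chi j z = - (w j)^*.
Proof.
have := congr1 (@conjc R) (Hpsi j); rewrite !conjcD !conjcM !conjcK /chi => h.
have -> : psi j z = (w j)^* + psi j z - (w j)^* by ring.
by rewrite -h; ring.
Qed.

(** Subtracting conj k times the rows turns psi into -conj w at z without changing xi, which is
    therefore a projection of -conj w. *)
Lemma normX_boundary : complex.Re (normX p1 p2 psi z) <= \sum_j cmod (w j) ^+ 2.
Proof.
have := gramX_shift (ip psi psi z) (ip psi p1 z) (ip p1 psi z) (ip psi p2 z)
    (ip p2 psi z) k1^* k1 k2^* k2 d0.
have -> : normX p1 p2 psi z = gramX A B B' D (ip psi psi z) (ip psi p1 z)
  (ip p1 psi z) (ip psi p2 z) (ip p2 psi z) by [].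
move=> <-.
have c1 : ip chi p1 z = ip psi p1 z - k1^* * A - k2^* * B'.
  exact: (ip_shiftl p1 p2 psi p1 (fun=> k1^*) (fun=> k2^*) z).
have c2 : ip chi p2 z = ip psi p2 z - k1^* * B - k2^* * D.
  exact: (ip_shiftl p1 p2 psi p2 (fun=> k1^*) (fun=> k2^*) z).
have c1' : ip p1 chi z = ip p1 psi z - k1 * A - k2 * B.
  by have := ip_shiftr p1 p2 psi p1 (fun=> k1^*) (fun=> k2^*) z; rewrite !conjcK.
have c2' : ip p2 chi z = ip p2 psi z - k1 * B' - k2 * D.
  by have := ip_shiftr p1 p2 psi p2 (fun=> k1^*) (fun=> k2^*) z; rewrite !conjcK.
have cc : ip chi chi z = ip psi psi z - k1^* * ip p1 psi z - k2^* * ip p2 psi z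
   - k1 * ip psi p1 z - k2 * ip psi p2 z + k1^* * k1 * A + k1^* * k2 * B + k2^* * k1 * B'
   + k2^* * k2 * D.
  have -> : ip chi chi z = ip psi chi z - k1^* * ip p1 chi z - k2^* * ip p2 chi z.
    exact: (ip_shiftl p1 p2 psi chi (fun=> k1^*) (fun=> k2^*) z).
  have -> : ip psi chi z = ip psi psi z - k1 * ip psi p1 z - k2 * ip psi p2 z.
    by have := ip_shiftr p1 p2 psi psi (fun=> k1^*) (fun=> k2^*) z; rewrite !conjcK.
  by rewrite c1' c2'; ring.
rewrite -cc -c1 -c2 -c1' -c2' /gramX ReD ReN.
have -> : ip chi p1 z = (ip p1 chi z)^* by rewrite conj_ip.
have -> : ip chi p2 z = (ip p2 chi z)^* by rewrite conj_ip.
rewrite gramU_lns (_ : ip chi chi z = (\sum_j cmod (chi j z) ^+ 2)%:C) /=; last exact: cmod_sum_mulJ.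
have -> : \sum_j cmod (chi j z) ^+ 2 = \sum_j cmod (w j) ^+ 2.
  by apply: eq_bigr => j _; rewrite chiE cmodN cmodJ.
by rewrite lerBlDr lerDl sumr_ge0 // => j _; exact: sqr_ge0.
Qed.

(** psi u0 is conj(k) h plus the product of -conj w with u0; the second term is bounded by half the
    sum of the squared norms. *)
Lemma pairT_boundary (h1 h2 : C -> C) :
  complex.Re (k1^* * h1 z + k2^* * h2 z) <=
  complex.Re (pairT p1 p2 psi h1 h2 z) + 2^-1 * (\sum_j cmod (w j) ^+ 2) +
    2^-1 * complex.Re (normU p1 p2 h1 h2 z).
Proof.
have := gramT_shift (ip psi p1 z) (ip psi p2 z) (h1 z) (h2 z) k1^* k2^* d0.
have <- : ip chi p1 z = ip psi p1 z - k1^* * A - k2^* * B'.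
  exact: (ip_shiftl p1 p2 psi p1 (fun=> k1^*) (fun=> k2^*) z).
have <- : ip chi p2 z = ip psi p2 z - k1^* * B - k2^* * D.
  exact: (ip_shiftl p1 p2 psi p2 (fun=> k1^*) (fun=> k2^*) z).
rewrite gramT_lns -[gramT _ _ _ _ _ _ _ _]/(pairT p1 p2 psi h1 h2 z) => E.
have -> : complex.Re (k1^* * h1 z + k2^* * h2 z) = complex.Re (pairT p1 p2 psi h1 h2 z) -
   complex.Re (\sum_j chi j z * lns (h1 z) (h2 z) j).
  by rewrite E -ReN -ReD; congr complex.Re; ring.
rewrite -addrA lerD2l /normU gramU_lns /= Re_sum -sumrN !mulr_sumr -big_split /=.
rewrite ler_sum // => j _; rewrite chiE.
have := Re_mulJ_le (w j)^* (lns (h1 z) (h2 z) j)^*.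
by rewrite conjcK !cmodJ; congr (_ <= _); rewrite mulNr ReN opprK.
Qed.

End GramBounds.

(** * The lower bound for the complex symbol *)

Section CoronaH2.
Variables (R : realType) (J : finType).
Local Notation C := R[i].

Lemma jet_Re (F : C -> C) a b c e : jet F a b c e ->
  exists b' c' e', jet (fun t => (complex.Re (F t))%:C) (complex.Re a)%:C b' c' e' /\
    complex.Re e' = complex.Re e.
Proof.
move=> H; have J1 := jetZ (2^-1)%:C (jetD H (jetJ H)).
have E (z : C) : (2^-1)%:C * (z + z^*) = (complex.Re z)%:C.
  by case: z => x y; apply/eqP; rewrite eq_complex /=; apply/andP; split; apply/eqP; field.
do 3 eexists; split.
  apply: jet_eq J1 _ erefl erefl erefl => [t|]; exact: E.
by rewrite E.
Qed.

Let Re_Bellman (a b c : R) (g1 g2 u x t : C) :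
  complex.Re (a%:C * (g1 * g1^* + g2 * g2^*) + c%:C * u + b%:C * x + c%:C * x - t) =
  a * (cmod g1 ^+ 2 + cmod g2 ^+ 2) + c * complex.Re u + b * complex.Re x +
    c * complex.Re x - complex.Re t.
Proof. by rewrite !mulJ_sqr_cmod -realcD !ReD ReN !ReM_real. Qed.

(** Re [Bell] minus the harmonic Re [q] is subharmonic and nonpositive on the circle, hence at 0.
    There [Bell] is nonnegative and [q] is a combination of the two coefficient sums. *)
Lemma corona_H2 (del : R) (p1 p2 psi : J -> C -> C) (k1 k2 : nat -> C)
    (w : J -> nat -> C) (n : nat) :
  0 < del -> del < 1 ->
  (forall j, entire (p1 j)) -> (forall j, entire (p2 j)) -> (forall j, entire (psi j)) ->
  (forall z, cmod z <= 1 -> forall v1 v2 : C,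
    del ^+ 2 * (cmod v1 ^+ 2 + cmod v2 ^+ 2) <=
      \sum_j cmod ((p1 j z)^* * v1 + (p2 j z)^* * v2) ^+ 2 <=
    cmod v1 ^+ 2 + cmod v2 ^+ 2) ->
  (forall j, psi j 0 = 0) ->
  (forall z j, cmod z = 1 -> (p1 j z)^* * ev k1 n z + (p2 j z)^* * ev k2 n z =
     ev (w j) n z + (psi j z)^*) ->
  forall X, X = expR 1 * ln (del ^- 4) ->
  \sum_(i < n) (cmod (k1 i) ^+ 2 + cmod (k2 i) ^+ 2) <=
    4 * (X / del ^+ 2 + del ^- 2) * (X / del ^+ 4 + 1) *
    \sum_j \sum_(i < n) cmod (w j i) ^+ 2.
Proof.
move=> del0 del1 E1 E2 Epsi Hb psi0 Hbd X XL.
pose L := ln (del ^- 4); pose eps := L^-1.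
have d4 : 1 < del ^- 4 by rewrite invf_gt1 ?exprn_gt0 // exprn_ilt1 // ltW.
have L0 : 0 < L by rewrite ln_gt0.
have eps0 : 0 < eps by rewrite invr_gt0.
have X0 : 0 < X by rewrite XL mulr_gt0 // expR_gt0.
have del2 : 0 < del ^+ 2 by rewrite exprn_gt0.
have del4 : 0 < del ^+ 4 by rewrite exprn_gt0.
pose al1 := X / del ^+ 2; pose al3 := X / del ^+ 4.
have al10 : 0 < al1 by rewrite divr_gt0. have al30 : 0 < al3 by rewrite divr_gt0.
pose s := al1 + del ^- 2.
have s0 : 0 < s by rewrite addr_gt0 // invr_gt0.
(* Minimizes s lam^2 - lam, with value -1 / (4 s). *)
pose lam : R := (2 * s)^-1.
have lam0 : 0 < lam by rewrite invr_gt0 mulr_gt0.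
pose h1 z := lam%:C * ev k1 n z; pose h2 z := lam%:C * ev k2 n z.
have Eh1 : entire h1 by apply: entireM (entire_const _) (entire_ev _ _).
have Eh2 : entire h2 by apply: entireM (entire_const _) (entire_ev _ _).
(* This fixes eps: (del^4)^eps is exactly 1 / e. *)
have Wlow (d : R) : del ^+ 4 <= d -> expR (- 1) <= d `^ eps.
  move=> dd; apply: (le_trans (y := (del ^+ 4) `^ eps)); last first.
    by rewrite ge0_ler_powR // ?nnegrE ?ltW // (lt_le_trans del4).
  rewrite /powR gt_eqF // ler_expR /eps -[del ^+ 4]invrK lnV ?posrE ?invr_gt0 //.
  by rewrite -/L mulrN mulVf // gt_eqF.
have XE : X * eps = expR 1 by rewrite XL /eps mulfK // gt_eqF.
have e1E : expR 1 * expR (-1) = 1 :> R by rewrite expRN mulfV // gt_eqF // expR_gt0.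
pose Bell := Bellman eps al1 al3 p1 p2 psi h1 h2.
have [P1 [EP1 P10 P1b]] := boundary_sqr n k1.
have [P2 [EP2 P20 P2b]] := boundary_sqr n k2.
have /choice [PW HPW] := fun j => boundary_sqr n (w j).
(* Coefficients of |k|^2 and |w|^2 in the boundary bound: |u0|^2 / 2 occurs twice and adds del^-2 to
   [al1], |w|^2 / 2 occurs twice and adds 1 to [al3], and -lam |k|^2 comes from the pairing. *)
pose ck := s * lam ^+ 2 - lam; pose cw := al3 + 1.
pose q z := ck%:C * (P1 z + P2 z) + cw%:C * \sum_j PW j z.
have Eq : entire q.
  apply: entireD (entireM (entire_const _) (entireD EP1 EP2)) (entireM (entire_const _) _).
  by apply: entire_sum => j; have [] := HPW j.
pose F z := complex.Re (Bell z) - complex.Re (q z).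
have FJ z : cmod z <= 1 -> exists b c e,
     jet (fun t => (F (z + t))%:C) (F z)%:C b c e /\ 0 <= complex.Re e.
  move=> z1.
  have sk (p : J -> C -> C) : (forall j, entire (p j)) ->
      exists a b : J -> C, forall j, hol_jet (fun t => p j (z + t)) (a j) (b j).
    move=> Ep; have /choice [ab Hab] : forall j, exists ab : C * C,
        hol_jet (fun t => p j (z + t)) ab.1 ab.2.
      by move=> j; have [a [b H]] := Ep j z; exists (a, b).
    by exists (fun j => (ab j).1), (fun j => (ab j).2).
  have [a1 [b1 H1]] := sk _ E1; have [a2 [b2 H2]] := sk _ E2.
  have [a0 [b0 H0]] := sk _ Epsi.
  have [m1 [n1 Hh1]] := Eh1 z; have [m2 [n2 Hh2]] := Eh2 z.
  have Hz := Hb z z1.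
  have /andP[A1 _] := ReA_bounds Hz; have /andP[G1 _] := Gdet_bounds del0 Hz.
  (* As X eps = e, this gives al1 d^eps eps >= del^-2 and al3 d^(1 + eps) eps >= 1, the two
     conditions of [jet_Bellman]. *)
  have key : 1 <= expR 1 * Gdet p1 p2 z `^ eps.
    by apply: le_trans (ler_wpM2l (expR_ge0 1) (Wlow _ G1)); rewrite e1E.
  have sh (p p' : J -> C -> C) : ip (fun j t => p j (z + t)) (fun j t => p' j (z + t)) 0 = ip p p' z.
    by rewrite /ip addr0.
  have GE : Gdet (fun j t => p1 j (z + t)) (fun j t => p2 j (z + t)) 0 = Gdet p1 p2 z.
    by rewrite /Gdet /ipdet !sh.
  have [] := @jet_Bellman R J eps al1 al3 (fun j t => p1 j (z + t)) (fun j t => p2 j (z + t))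
    (fun j t => psi j (z + t)) (fun t => h1 (z + t)) (fun t => h2 (z + t))
    a1 b1 a2 b2 a0 b0 m1 n1 m2 n2 (ltW al10) (ltW al30) H1 H2 H0 Hh1 Hh2.
  - by rewrite sh; apply: lt_le_trans A1.
  - by rewrite GE; apply: lt_le_trans G1.
  - rewrite GE /normU !sh addr0.
    apply: le_trans (gramU_le del0 Hz _ _) _.
    rewrite ler_wpM2r ?addr_ge0 ?sqr_ge0 //.
    have -> : al1 * Gdet p1 p2 z `^ eps * eps = X * eps * (Gdet p1 p2 z `^ eps) / del ^+ 2.
      by rewrite /al1; ring.
    by rewrite XE ler_peMl ?invr_ge0 ?(ltW del2).
  - rewrite GE; have G0 := lt_le_trans del4 G1.
    rewrite powRD; last by rewrite (gt_eqF G0) implybT.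
    rewrite powRr1 ?(ltW G0) //.
    have -> : al3 * (Gdet p1 p2 z * Gdet p1 p2 z `^ eps) * eps =
        (X * eps * Gdet p1 p2 z `^ eps) * (Gdet p1 p2 z / del ^+ 4).
      by rewrite /al3; ring.
    rewrite -[1]mulr1 XE ler_pM //.
    by rewrite ler_pdivlMr ?mul1r.
  move=> b [c [e [JB e0]]].
  have [b' [c' [e' [JRe e'E]]]] := jet_Re JB.
  have [qa [qb Hq]] := Eq z; have [qb' [qc' [qe' [JqRe qe'E]]]] := jet_Re Hq.
  exists (b' - qb'), (c' - qc'), (e' - qe'); split; last first.
    by rewrite ReD ReN e'E qe'E /= subr0.
  have BE t : Bellman eps al1 al3 (fun j t => p1 j (z + t)) (fun j t => p2 j (z + t))
      (fun j t => psi j (z + t)) (fun t => h1 (z + t)) (fun t => h2 (z + t)) t = Bell (z + t).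
    by [].
  apply: jet_eq (jetB JRe JqRe) _ erefl erefl erefl => [t|].
    by rewrite /F BE realcD realcN.
  by rewrite BE addr0 -(jet_val Hq) addr0 /F realcD realcN.
have Fb z : cmod z = 1 -> F z <= 0.
  move=> z1; have z1' : cmod z <= 1 by rewrite z1.
  have Hz := Hb z z1'; have Hw j := Hbd z j z1.
  have /andP[G0 G1] := Gdet_bounds del0 Hz.
  have {}G0 := lt_le_trans del4 G0.
  have Xb := normX_boundary del0 Hz Hw.
  have Tb := pairT_boundary del0 Hz Hw h1 h2.
  have Ub := gramU_le del0 Hz (h1 z) (h2 z).
  rewrite -[gramU _ _ _ _ _ _ _ _]/(normU p1 p2 h1 h2 z) in Ub.
  set d := Gdet p1 p2 z in G0 G1.
  have pow1 a : 0 <= a -> d `^ a <= 1.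
    move=> a0; apply: (@le_trans _ _ (1 `^ a)); last by rewrite powR1.
    by rewrite ge0_ler_powR // ?nnegrE // ltW.
  have W1 := pow1 _ (ltW eps0); have V1 := pow1 _ (addr_ge0 ler01 (ltW eps0)).
  set wz := \sum_j cmod (ev (w j) n z) ^+ 2 in Xb Tb.
  have w0 : 0 <= wz by apply: sumr_ge0 => j _; exact: sqr_ge0.
  set H := cmod (h1 z) ^+ 2 + cmod (h2 z) ^+ 2 in Ub.
  have H0 : 0 <= H by rewrite addr_ge0 ?sqr_ge0.
  pose K := cmod (ev k1 n z) ^+ 2 + cmod (ev k2 n z) ^+ 2.
  have HK : H = lam ^+ 2 * K.
    by rewrite /H /h1 /h2 !cmodM !cmod_real !exprMn real_normK ?num_real // -mulrDr.
  have kh : complex.Re ((ev k1 n z)^* * h1 z + (ev k2 n z)^* * h2 z) = lam * K.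
    rewrite /h1 /h2 ReD ![_^* * _]mulrC -!mulrA !ReM_real -mulrDr !mulJ_sqr_cmod //.
  rewrite kh in Tb.
  have T1 : al1 * d `^ eps * H <= al1 * H.
    by rewrite ler_wpM2r // ler_piMr // ltW.
  have T3 : al3 * d `^ (1 + eps) * complex.Re (normX p1 p2 psi z) <= al3 * wz.
    rewrite -mulrA ler_wpM2l ?(ltW al30) //.
    apply: (le_trans (ler_wpM2l (powR_ge0 _ _) Xb)).
    by rewrite ler_piMl.
  have BellE : complex.Re (Bell z) = al1 * d `^ eps * H +
     2^-1 * complex.Re (normU p1 p2 h1 h2 z) +
     al3 * d `^ (1 + eps) * complex.Re (normX p1 p2 psi z) +
     2^-1 * complex.Re (normX p1 p2 psi z) - complex.Re (pairT p1 p2 psi h1 h2 z).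
    exact: Re_Bellman.
  have qE : complex.Re (q z) = ck * K + cw * wz.
    rewrite /q ReD !ReM_real ReD P1b // P2b // Re_sum; congr (_ + cw * _).
    by apply: eq_bigr => j _; have [_ _ ->] := HPW j.
  rewrite /F BellE qE /ck /cw.
  have : al1 * H + del ^- 2 * H = s * lam ^+ 2 * K by rewrite HK /s; ring.
  move: T1 T3 Tb Xb Ub; set u := complex.Re _; set t := complex.Re _; set x := complex.Re _.
  lra.
have := max_principle FJ Fb.
rewrite /F => F0.
(* As psi vanishes at 0, so do the terms in xi and the pairing; the others are nonnegative. *)
have B0 : 0 <= complex.Re (Bell 0).
  have z1 : cmod (0 : C) <= 1 by rewrite cmod0.
  have Hz := Hb 0 z1.
  have ps0 p : ip psi p 0 = 0 by rewrite /ip big1 // => j _; rewrite psi0 mul0r.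
  have ps0' p : ip p psi 0 = 0 by rewrite -conj_ip ps0 conjc0.
  have T0 : pairT p1 p2 psi h1 h2 0 = 0 by rewrite /pairT !ps0 /gramT !mul0r addr0 mul0r.
  have X00 : normX p1 p2 psi 0 = 0.
    by rewrite /normX /gramX /gramU !ps0 !ps0' !(mul0r, mulr0, subr0, addr0).
  rewrite /Bell /Bellman T0 X00 !mulr0 subr0 !addr0 ReD !ReM_real /normU (gramU_lns del0 Hz).
  rewrite !mulJ_sqr_cmod -realcD /= addr_ge0 // mulr_ge0 ?addr_ge0 ?sqr_ge0 //.
    by rewrite mulr_ge0 ?powR_ge0 ?(ltW al10).
  by apply: sumr_ge0 => j _; exact: sqr_ge0.
have Q0 : complex.Re (q 0) = ck * (\sum_(i < n) (cmod (k1 i) ^+ 2 + cmod (k2 i) ^+ 2)) +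
   cw * \sum_j \sum_(i < n) cmod (w j i) ^+ 2.
  rewrite /q ReD !ReM_real P10 P20 -realcD Re_sum big_split /=; congr (_ + cw * _).
  by apply: eq_bigr => j _; have [_ -> _] := HPW j.
rewrite Q0 in F0.
set K := \sum_(i < n) _ in F0 *; set Wn := \sum_j _ in F0 *.
have ckE : ck = - (4 * s)^-1.
  by rewrite /ck /lam; field; rewrite gt_eqF.
have : (4 * s)^-1 * K <= cw * Wn by move: F0 B0; rewrite ckE; lra.
rewrite mulrC ler_pdivrMr ?mulr_gt0 // => h.
by rewrite -/al1 -/al3 -/s -/cw (le_trans h) // le_eqVlt; apply/orP; left; apply/eqP; ring.
Qed.

End CoronaH2.

(** * Quaternions and the Leech recursion *)

Section QuaternionAlgebra.
Variable R : realType.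
Local Notation H := (quaternion R).
Implicit Types (x y z : H) (a : R).

Definition qconj x : H := Quat (qre x) (- qim1 x) (- qim2 x) (- qim3 x).

Lemma quat_eqP x y : qre x = qre y -> qim1 x = qim1 y -> qim2 x = qim2 y ->
  qim3 x = qim3 y -> x = y.
Proof. by case: x y => ? ? ? ? [? ? ? ?] /= -> -> -> ->. Qed.

Lemma qconjD x y : qconj (x + y) = qconj x + qconj y.
Proof. by apply: quat_eqP => /=; ring. Qed.

Lemma qconjM x y : qconj (x * y) = qconj y * qconj x.
Proof. by apply: quat_eqP => /=; ring. Qed.

Lemma qconjK x : qconj (qconj x) = x.
Proof. by apply: quat_eqP => /=; ring. Qed.

Lemma qconjZ a x : qconj (a *: x) = a *: qconj x.
Proof. by apply: quat_eqP => /=; ring. Qed.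

Lemma qconj0 : qconj 0 = 0.
Proof. by apply: quat_eqP => /=; ring. Qed.

Lemma qconj_sum (I : Type) (r : seq I) (P : pred I) (F : I -> H) :
  qconj (\sum_(i <- r | P i) F i) = \sum_(i <- r | P i) qconj (F i).
Proof. exact: (big_morph qconj qconjD qconj0). Qed.

Lemma qre0 : qre (0 : H) = 0. Proof. by []. Qed.
Lemma qreD x y : qre (x + y) = qre x + qre y. Proof. by []. Qed.
Lemma qreN x : qre (- x) = - qre x. Proof. by []. Qed.
Lemma qreZ a x : qre (a *: x) = a * qre x. Proof. by []. Qed.
Lemma qre_sum (I : Type) (r : seq I) (P : pred I) (F : I -> H) :
  qre (\sum_(i <- r | P i) F i) = \sum_(i <- r | P i) qre (F i).
Proof. exact: (big_morph (@qre R) qreD erefl). Qed.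

Lemma qre_comm x y : qre (x * y) = qre (y * x).
Proof. by rewrite /=; ring. Qed.

Lemma sqr_qnorm x : `|x| ^+ 2 = quat_sqnorm x.
Proof. by rewrite sqr_sqrtr // quat_sqnorm_ge0. Qed.

Lemma qre_conjM_self x : qre (qconj x * x) = `|x| ^+ 2.
Proof. by rewrite sqr_qnorm /quat_sqnorm /=; ring. Qed.

Lemma qconjM_self x : qconj x * x = (`|x| ^+ 2)%:A.
Proof. by rewrite sqr_qnorm /quat_sqnorm; apply: quat_eqP => /=; ring. Qed.

Lemma qMconj_self x : x * qconj x = (`|x| ^+ 2)%:A.
Proof. by rewrite sqr_qnorm /quat_sqnorm; apply: quat_eqP => /=; ring. Qed.

Lemma qnormM x y : `|x * y| = `|x| * `|y|.
Proof.
apply: (@pexpIrn _ 2); rewrite ?nnegrE ?mulr_ge0 // exprMn !sqr_qnorm /quat_sqnorm /=; ring.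
Qed.

Lemma qnorm_conj x : `|qconj x| = `|x|.
Proof.
by apply: (@pexpIrn _ 2); rewrite ?nnegrE // !sqr_qnorm /quat_sqnorm /=; ring.
Qed.

Lemma qnorm1 : `|1 : H| = 1.
Proof. by apply: (@pexpIrn _ 2); rewrite ?nnegrE // sqr_qnorm /quat_sqnorm /=; ring. Qed.

Lemma qnormX x n : `|x ^+ n| = `|x| ^+ n.
Proof. by elim: n => [|n IH]; rewrite ?expr0 ?qnorm1 // !exprS qnormM IH. Qed.

Lemma qre_le_norm x : `|qre x| <= `|x|.
Proof.
rewrite -(@ler_pXn2r _ 2) ?nnegrE // sqr_qnorm real_normK ?num_real // /quat_sqnorm.
by rewrite -!addrA lerDl !addr_ge0 // sqr_ge0.
Qed.

Lemma qnorm_sum (I : Type) (r : seq I) (P : pred I) (F : I -> H) :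
  `|\sum_(i <- r | P i) F i| <= \sum_(i <- r | P i) `|F i|.
Proof. exact: ler_norm_sum. Qed.

(** Equips the quaternions with a finite-dimensional real structure, so that injectivity yields
    solvability in [Gam_solve]. *)
Definition quat_row (x : H) : 'rV[R]_4 :=
  \row_(i < 4) nth 0 [:: qre x; qim1 x; qim2 x; qim3 x] i.

Lemma quat_row_linear : linear quat_row.
Proof.
move=> a x y; apply/rowP => i; rewrite !mxE.
by case: i => -[|[|[|[|]]]] //= _.
Qed.

Lemma quat_row_bij : bijective quat_row.
Proof.
exists (fun r : 'rV[R]_4 => Quat (r 0 0) (r 0 1) (r 0 2%:R) (r 0 3%:R)) => [x|r].
  by apply: quat_eqP; rewrite /= !mxE.
apply/rowP => i; rewrite !mxE.
case: i => -[|[|[|[|]]]] //= lt; congr (r _ _); exact: val_inj.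
Qed.

HB.instance Definition _ := Lmodule_hasFinDim.Build R (quaternion R)
  (exist2 (fun f : quaternion R -> 'rV[R]_4 => linear f) (fun f => bijective f)
     quat_row quat_row_linear quat_row_bij).

Lemma qre_conjM x y : qre (qconj x * y) =
  qre x * qre y + qim1 x * qim1 y + qim2 x * qim2 y + qim3 x * qim3 y.
Proof. by rewrite /=; ring. Qed.

Lemma qre_conjM_comm x y : qre (qconj x * y) = qre (qconj y * x).
Proof. by rewrite !qre_conjM; ring. Qed.

Lemma qre_conjM_sqrB x y : qre (qconj (x - y) * (x - y)) =
  qre (qconj x * x) + qre (qconj y * y) - 2 * qre (qconj x * y).
Proof. by rewrite /=; ring. Qed.

Lemma qre_conjM_le (r : R) x y :
  2 * (r * qre (qconj x * y)) <= r ^+ 2 * `|x| ^+ 2 + `|y| ^+ 2.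
Proof.
rewrite -!qre_conjM_self -subr_ge0.
have -> : r ^+ 2 * qre (qconj x * x) + qre (qconj y * y) - 2 * (r * qre (qconj x * y)) =
  qre (qconj (r *: x - y) * (r *: x - y)) by rewrite /=; ring.
by rewrite qre_conjM_self exprn_ge0.
Qed.

End QuaternionAlgebra.

Arguments qre {R} q : simpl never.
Arguments qim1 {R} q : simpl never.
Arguments qim2 {R} q : simpl never.
Arguments qim3 {R} q : simpl never.

Lemma injective_endo_surj (K : fieldType) (V : vectType K) (f : V -> V) :
  linear f -> (forall u, f u = 0 -> u = 0) -> forall v, exists u, f u = v.
Proof.
move=> fl finj v.
pose fL := GRing.isLinear.Build K V V *:%R f fl.
pose g : {linear V -> V} := HB.pack f fL.
pose h := linfun g.
have k0 : lker h == 0%VS.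
  apply/lker0P => a b; rewrite !lfunE /= => ab.
  apply/eqP; rewrite -subr_eq0; apply/eqP/finj.
  by rewrite -[f _]/(g (a - b)) linearB /= ab subrr.
exists (h^-1%VF v); have := lker0_lfunVK k0 v.
by rewrite lfunE.
Qed.

(** Substitute m for m - l; the part of the square outside the triangle vanishes by hypothesis. *)
Lemma triangular_sum (V : nmodType) (N : nat) (g : nat -> nat -> V) :
  (forall m l, (N <= m + l)%N -> g m l = 0) ->
  \sum_(m < N) \sum_(l < m.+1) g (m - l)%N l = \sum_(l < N) \sum_(m < N) g m l.
Proof.
move=> g0.
transitivity (\sum_(m < N) \sum_(l < N | (l <= m)%N) g (m - l)%N l).
  apply: eq_bigr => m _.
  by rewrite (big_ord_widen N (fun l => g (m - l)%N l)) //.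
rewrite (exchange_big_dep xpredT) //=; apply: eq_bigr => l _.
rewrite -(big_geq_mkord l N xpredT (fun m => g (m - l)%N l)).
rewrite -(big_mkord xpredT (fun m => g m l)).
rewrite -{1}[nat_of_ord l]add0n big_addn.
rewrite [RHS](@big_cat_nat _ _ _ (N - l)) ?leq_subr //=.
rewrite [X in _ = _ + X]big_nat_cond [X in _ = _ + X]big1 ?addr0.
  by apply: eq_bigr => m _; rewrite addnK.
by move=> m; rewrite andbT => /andP[h _]; apply: g0; rewrite addnC -leq_subLR.
Qed.

(** * Leech's factorization by a finite recursion *)

Section Leech.
Variables (R : realType) (N J : nat).
Local Notation H := (quaternion R).
Variables (a : nat -> nat -> H) (c c1 : R).
Implicit Types (la mu : nat -> H).

Let supp la := forall m, (N <= m)%N -> la m = 0.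

(** Component j of T^* la in degree l; cutting the sum at N is exact when la is supported below
    N. *)
Definition adjA la l j : H := \sum_(m < N) qconj (a j m) * la (m + l)%N.

Hypothesis c0 : 0 < c.
Hypothesis cc1 : c < c1.
Hypothesis lower : forall la, supp la -> c1 ^+ 2 * (\sum_(m < N) `|la m| ^+ 2) <=
  \sum_(l < N) \sum_(j < J) `|adjA la l j| ^+ 2.

(* [Gam] is [A A^* - c^2 + c^2 e_0 e_0^*] and [KS la] is [A A^* - c^2] applied to
   the backward shift of [la]; [Gam = S K S^* + a a^*] on supported sequences. *)
Let AAs la m : H := \sum_(l < m.+1) \sum_(j < J) a j (m - l)%N * adjA la l j.
Let Gam la m : H := AAs la m - c ^+ 2 *: la m + (if m is 0%N then c ^+ 2 *: la 0%N else 0).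
Let KS la m : H := AAs (fun i => la i.+1) m - c ^+ 2 *: la m.+1.

Let B la mu : R := \sum_(l < N) \sum_(j < J) qre (qconj (adjA la l j) * adjA mu l j) -
  c ^+ 2 * \sum_(m < N) qre (qconj (la m) * mu m).

Lemma adjA_shift la l j : adjA (fun i => la i.+1) l j = adjA la l.+1 j.
Proof. by apply: eq_bigr => m _; rewrite addnS. Qed.

Lemma Gam_shift la m : Gam la m =
  (if m is m'.+1 then KS la m' else 0) + \sum_(j < J) a j m * adjA la 0%N j.
Proof.
case: m => [|m]; rewrite /Gam /KS /AAs.
  by rewrite big_ord1 add0r subrK.
rewrite big_ord_recl /= subn0 addr0 [RHS]addrC addrA; congr (_ + _ - _).
by apply: eq_bigr => l _; apply: eq_bigr => j _; rewrite adjA_shift.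
Qed.

Lemma adjA_lin (r : R) la mu l j :
  adjA (fun m => r *: la m + mu m) l j = r *: adjA la l j + adjA mu l j.
Proof.
rewrite /adjA scaler_sumr -big_split /=; apply: eq_bigr => m _.
by rewrite mulrDr scalerAr.
Qed.

Lemma AAs_lin (r : R) la mu m :
  AAs (fun m => r *: la m + mu m) m = r *: AAs la m + AAs mu m.
Proof.
rewrite /AAs scaler_sumr -big_split /=; apply: eq_bigr => l _.
rewrite scaler_sumr -big_split /=; apply: eq_bigr => j _.
by rewrite adjA_lin mulrDr scalerAr.
Qed.

Lemma Gam_lin (r : R) la mu m :
  Gam (fun m => r *: la m + mu m) m = r *: Gam la m + Gam mu m.
Proof.
rewrite /Gam AAs_lin; case: m => [|m].
  rewrite !scalerDr !scalerN !scalerA [r * _]mulrC !subrK //.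
by rewrite !addr0 !scalerDr scalerN !scalerA [r * _]mulrC opprD addrACA.
Qed.

Lemma adjA_sum k (F : nat -> nat -> H) (x : nat -> H) l j :
  adjA (fun m => \sum_(i < k) F i m * x i) l j = \sum_(i < k) adjA (F i) l j * x i.
Proof.
under [RHS]eq_bigr => i _ do rewrite /adjA mulr_suml.
rewrite exchange_big /=; apply: eq_bigr => m _; rewrite mulr_sumr.
by apply: eq_bigr => i _; rewrite mulrA.
Qed.

Lemma AAs_sum k (F : nat -> nat -> H) (x : nat -> H) m :
  AAs (fun m => \sum_(i < k) F i m * x i) m = \sum_(i < k) AAs (F i) m * x i.
Proof.
under [RHS]eq_bigr => i _ do rewrite /AAs mulr_suml.
rewrite exchange_big /=; apply: eq_bigr => l _.
under [RHS]eq_bigr => i _ do rewrite mulr_suml.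
rewrite exchange_big /=; apply: eq_bigr => j _.
by rewrite adjA_sum mulr_sumr; apply: eq_bigr => i _; rewrite mulrA.
Qed.

(** Coefficients multiply from the left, so the operators are linear for quaternions on the right;
    this carries the recursion through convolution with [x]. *)
Lemma Gam_sum k (F : nat -> nat -> H) (x : nat -> H) m :
  Gam (fun m => \sum_(i < k) F i m * x i) m = \sum_(i < k) Gam (F i) m * x i.
Proof.
rewrite /Gam AAs_sum; case: m => [|m].
  rewrite subrK; apply: eq_bigr => i _; rewrite subrK //.
rewrite addr0 scaler_sumr -sumrB; apply: eq_bigr => i _.
by rewrite addr0 mulrBl scalerAl.
Qed.

Lemma KS_sum k (F : nat -> nat -> H) (x : nat -> H) m :
  KS (fun m => \sum_(i < k) F i m * x i) m = \sum_(i < k) KS (F i) m * x i.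
Proof.
rewrite /KS (AAs_sum _ (fun i m => F i m.+1)) scaler_sumr -sumrB.
by apply: eq_bigr => i _; rewrite mulrBl scalerAl.
Qed.

Lemma AAs_adjoint la mu : supp la ->
  \sum_(m < N) qre (qconj (la m) * AAs mu m) =
  \sum_(l < N) \sum_(j < J) qre (qconj (adjA la l j) * adjA mu l j).
Proof.
move=> sla.
pose g m l := \sum_(j < J) qre (qconj (la (m + l)%N) * (a j m * adjA mu l j)).
transitivity (\sum_(m < N) \sum_(l < m.+1) g (m - l)%N l).
  apply: eq_bigr => m _; rewrite /AAs mulr_sumr qre_sum; apply: eq_bigr => l _.
  by rewrite /g subnK -1?ltnS // mulr_sumr qre_sum.
rewrite triangular_sum; last first.
  by move=> m l ml; rewrite /g big1 // => j _; rewrite sla // qconj0 mul0r.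
apply: eq_bigr => l _; rewrite /g exchange_big /=; apply: eq_bigr => j _.
have -> : qconj (adjA la l j) = \sum_(m < N) qconj (la (m + l)%N) * a j m.
  by rewrite /adjA qconj_sum; apply: eq_bigr => m _; rewrite qconjM qconjK.
by rewrite mulr_suml qre_sum; apply: eq_bigr => m _; rewrite mulrA.
Qed.

Lemma B_Gam la : supp la ->
  \sum_(m < N) qre (qconj (la m) * Gam la m) = B la la + c ^+ 2 * `|la 0%N| ^+ 2.
Proof.
move=> sla; rewrite /B -AAs_adjoint // mulr_sumr.
rewrite -qre_conjM_self -sumrB.
have -> : c ^+ 2 * qre (qconj (la 0%N) * la 0%N) = \sum_(m < N)
    (if nat_of_ord m is 0%N then c ^+ 2 * qre (qconj (la m) * la m) else 0).
  case: (N) (sla : forall m, (N <= m)%N -> la m = 0) => [s|n _]; first by rewrite big_ord0 s // mulr0 qre0 mulr0.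
  by rewrite big_ord_recl big1 ?addr0.
rewrite -big_split /=; apply: eq_bigr => m _; rewrite /Gam.
have E (u v w z : H) : qre (u * (v - c ^+ 2 *: w + z)) =
    qre (u * v) - c ^+ 2 * qre (u * w) + qre (u * z).
  have -> : u * (v - c ^+ 2 *: w + z) = u * v - c ^+ 2 *: (u * w) + u * z.
    by rewrite mulrDr mulrBr scalerAr.
  by [].
rewrite E; congr (_ + _); case: (nat_of_ord m) => [|m'].
  by rewrite -scalerAr qreZ.
by rewrite mulr0.
Qed.

Lemma KS_B la mu : supp la ->
  \sum_(m < N) qre (qconj (la m) * KS mu m) = B la (fun i => mu i.+1).
Proof.
move=> sla; rewrite /B -AAs_adjoint // mulr_sumr -sumrB; apply: eq_bigr => m _.
by rewrite /KS mulrBr -scalerAr qreD qreN qreZ.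
Qed.

Lemma B_ge la : supp la -> (c1 ^+ 2 - c ^+ 2) * \sum_(m < N) `|la m| ^+ 2 <= B la la.
Proof.
move=> sla; rewrite /B mulrBl; apply: lerB.
  apply: le_trans (lower sla) _; rewrite le_eqVlt; apply/orP; left; apply/eqP.
  by apply: eq_bigr => l _; apply: eq_bigr => j _; rewrite qre_conjM_self.
rewrite le_eqVlt; apply/orP; left; apply/eqP; congr (_ * _).
by apply: eq_bigr => l _; rewrite qre_conjM_self.
Qed.

Let gap : 0 < c1 ^+ 2 - c ^+ 2.
Proof. by rewrite subr_gt0 ltr_pXn2r // nnegrE ltW // (lt_trans c0). Qed.

Lemma B_ge0 la : supp la -> 0 <= B la la.
Proof.
move=> /B_ge; apply: le_trans; apply: mulr_ge0; first exact: ltW.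
by apply: sumr_ge0 => m _; rewrite exprn_ge0.
Qed.

(** Positivity of the form [B] at mu - la. *)
Lemma B_cauchy la mu : supp la -> supp mu -> 2 * B la mu <= B la la + B mu mu.
Proof.
move=> sla smu.
have sd : supp (fun m => (-1) *: la m + mu m).
  by move=> m Nm; rewrite sla // smu // scaler0 addr0.
have := B_ge0 sd.
have sq (u v : H) : qre (qconj ((-1) *: u + v) * ((-1) *: u + v)) =
    qre (qconj u * u) + qre (qconj v * v) - 2 * qre (qconj u * v).
  by rewrite scaleN1r addrC qre_conjM_sqrB (qre_conjM_comm v) [X in X - _]addrC.
rewrite /B.
under eq_bigr => l _ do under eq_bigr => j _ do rewrite adjA_lin sq.
under [X in _ * X]eq_bigr => l _ do rewrite sq.
under eq_bigr => l _ do rewrite sumrB big_split /= -mulr_sumr.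
rewrite sumrB big_split /= -mulr_sumr.
rewrite [X in _ - _ * X]sumrB [X in _ - _ * (X - _)]big_split /= -mulr_sumr.
move: (c ^+ 2) => C2; lra.
Qed.

(** Both sums in [B] are shifted by one index, so by telescoping exactly their terms of index 0 are
    lost. *)
Lemma B_shift la : supp la ->
  B (fun i => la i.+1) (fun i => la i.+1) + \sum_(j < J) `|adjA la 0%N j| ^+ 2 =
  B la la + c ^+ 2 * `|la 0%N| ^+ 2.
Proof.
move=> sla.
have tele (g : nat -> R) : \sum_(m < N) g m.+1 = \sum_(m < N) g m + g N - g 0%N.
  by elim: (N) => [|n IH]; rewrite ?big_ord0 ?big_ord_recr /= ?IH; ring.
rewrite /B.
under eq_bigr => l _ do under eq_bigr => j _ do rewrite adjA_shift.
rewrite (tele (fun l => \sum_(j < J) qre (qconj (adjA la l j) * adjA la l j))).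
rewrite (tele (fun l => qre (qconj (la l) * la l))).
have -> : \sum_(j < J) qre (qconj (adjA la N j) * adjA la N j) = 0.
  rewrite big1 // => j _; rewrite (_ : adjA la N j = 0) ?mulr0 //.
  by rewrite /adjA big1 // => m _; rewrite sla ?mulr0 // leq_addl.
rewrite (sla N) // mulr0.
under [X in _ + X = _]eq_bigr => j _ do rewrite -qre_conjM_self.
rewrite -qre_conjM_self; set S := \sum_(j < J) _; rewrite qre0; ring.
Qed.

(** [Gam] is positive definite on sequences supported below N, by [B_Gam] and the gap between c and
    c1; an injective endomorphism in finite dimension is onto. *)
Lemma Gam_solve (v : nat -> H) : exists la, supp la /\ forall m, (m < N)%N -> Gam la m = v m.
Proof.
pose ext (u : {ffun 'I_N -> H}) m : H := oapp u 0 (insub m).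
have ext_in u (i : 'I_N) : ext u i = u i by rewrite /ext valK.
have ext_supp u : supp (ext u).
  by move=> m Nm; rewrite /ext insubF // ltnNge Nm.
pose f (u : {ffun 'I_N -> H}) : {ffun 'I_N -> H} := [ffun i : 'I_N => Gam (ext u) i].
have ext_lin (r : R) u w m : ext (r *: u + w) m = r *: ext u m + ext w m.
  rewrite /ext; case: insubP => [i _ _|_] /=; rewrite ?ffunE //.
  by rewrite scaler0 addr0.
have fl : linear f.
  move=> r u w; apply/ffunP => i; rewrite !ffunE -Gam_lin; congr Gam.
  by apply/funext => m; rewrite ext_lin.
have f0 u : f u = 0 -> u = 0.
  move=> fu0.
  have G0 (i : 'I_N) : Gam (ext u) i = 0 by move/ffunP: fu0 => /(_ i); rewrite !ffunE.
  have := B_Gam (ext_supp u); rewrite big1 => [E|m _]; last by rewrite G0 mulr0.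
  have s0 : \sum_(m < N) `|ext u m| ^+ 2 = 0.
    apply/eqP; rewrite eq_le sumr_ge0 ?andbT; last by move=> m _; rewrite exprn_ge0.
    rewrite -(pmulr_rle0 _ gap) (le_trans (B_ge (ext_supp u))) //.
    have := mulr_ge0 (exprn_ge0 2 (ltW c0)) (exprn_ge0 2 (normr_ge0 (ext u 0%N))); lra.
  apply/ffunP => i; rewrite ffunE -ext_in; apply/normr0_eq0/eqP.
  move/eqP: s0; rewrite psumr_eq0; last by move=> m _; rewrite exprn_ge0.
  by move/allP => /(_ i (mem_index_enum _)); rewrite /= expf_eq0.
have [u fu] := injective_endo_surj fl f0 [ffun i : 'I_N => v i].
exists (ext u); split => // m mN.
by move/ffunP: fu => /(_ (Ordinal mN)); rewrite !ffunE.
Qed.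

(** A state-space realization of b, with states [Lam] and with [B] as energy of the shifted state.
    The factorization telescopes by [Gam_shift], and the energy balance makes convolution with b a
    contraction; rescaling by 1 / c is left to [leech_stage]. *)
Lemma leech_finite : exists b : nat -> nat -> H,
  (forall m, (m < N)%N -> \sum_(l < m.+1) \sum_(j < J) a j (m - l)%N * b j l =
     (if m is 0%N then c%:A else 0)) /\
  (forall M (x : nat -> H), \sum_(k < M) \sum_(j < J)
     `|\sum_(l < k.+1) b j (k - l)%N * x l| ^+ 2 <= \sum_(k < M) `|x k| ^+ 2).
Proof.
have /choice [sol Hsol] := Gam_solve.
pose ce m : H := if m is 0%N then c%:A else 0.
(* Iterates of Gam^-1 K S^* starting from Gam^-1 applied to the constant c; b_i is the degree 0 part
   of the adjoint at [Lam i]. *)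
pose Lam := fix Lam i := if i is i'.+1 then sol (KS (Lam i')) else sol ce.
have sL i : supp (Lam i) by case: i => [|i]; apply: (Hsol _).1.
have L0 m : (m < N)%N -> Gam (Lam 0%N) m = ce m by exact: (Hsol _).2.
have LS i m : (m < N)%N -> Gam (Lam i.+1) m = KS (Lam i) m by exact: (Hsol _).2.
clearbody Lam; exists (fun j i => adjA (Lam i) 0%N j); split.
  move=> m mN.
  (* By [Gam_shift] the product is [Gam] minus [KS] one degree lower, and that [KS] is [Gam] of the
     next state: a telescoping difference. *)
  have step l : (l < m.+1)%N -> \sum_(j < J) a j (m - l)%N * adjA (Lam l) 0%N j =
     Gam (Lam l) (m - l)%N - (if (l < m)%N then Gam (Lam l.+1) (m - l.+1)%N else 0).
    move=> lm; rewrite Gam_shift subnS.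
    case: ltnP => [lm'|ml]; last first.
      have -> : l = m by apply/eqP; rewrite eqn_leq ml -ltnS lm.
      by rewrite subnn add0r subr0.
    have [p pE] : exists p, (m - l)%N = p.+1 by exists (m - l).-1; rewrite prednK // subn_gt0.
    rewrite pE /= LS; last by rewrite (leq_trans _ mN) // ltnS -ltnS -pE (leq_trans (leq_subr _ _)).
    by rewrite addrC addKr.
  rewrite (eq_bigr (fun l : 'I_m.+1 => Gam (Lam l) (m - l)%N -
      (if (l < m)%N then Gam (Lam l.+1) (m - l.+1)%N else 0))); last first.
    by move=> l _; apply: step.
  rewrite sumrB [X in _ - X]big_ord_recr /= ltnn addr0 big_ord_recl subn0 L0 //.
  rewrite [X in _ - X](eq_bigr (fun i : 'I_m => Gam (Lam i.+1) (m - i.+1)%N)) ?addrK //.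
  by move=> i _; rewrite /= ltn_ord.
move=> M x.
pose Lk k m : H := \sum_(l < k.+1) Lam (k - l)%N m * x l.
have sLk k : supp (Lk k).
  by move=> m Nm; rewrite /Lk big1 // => l _; rewrite sL // mul0r.
pose prev k := if k is k'.+1 then (fun i => Lk k' i.+1) else (fun=> 0).
have sprev k : supp (prev k).
  by case: k => [|k] m Nm //=; apply: sLk; rewrite leqW.
have B0 : B (fun=> 0) (fun=> 0) = 0.
  rewrite /B !big1 ?mulr0 ?subr0 // => l _; rewrite ?mulr0 //.
  by rewrite big1 // => j _; rewrite (_ : adjA _ _ _ = 0) ?mulr0 // /adjA big1 // => m _; rewrite mulr0.
have rec k m : (m < N)%N -> Gam (Lk k) m =
    (if k is k'.+1 then KS (Lk k') m else 0) + ce m * x k.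
  move=> mN; rewrite (Gam_sum _ (fun l => Lam (k - l)%N)) big_ord_recr /= subnn L0 //.
  congr (_ + _); case: k => [|k]; first by rewrite big_ord0.
  rewrite (KS_sum _ (fun l => Lam (k - l)%N)); apply: eq_bigr => l _.
  by rewrite subSn -1?ltnS // LS.
(* The left side is the form of [Gam] at [Lk k]. Through the recursion it also equals B(Lk k, prev
   k) plus a pairing with x_k; [B_cauchy] and 2ab <= a^2 + b^2 return half of it, which is
   absorbed. *)
have energy k : B (prev k.+1) (prev k.+1) + \sum_(j < J) `|adjA (Lk k) 0%N j| ^+ 2 <=
    B (prev k) (prev k) + `|x k| ^+ 2.
  rewrite B_shift //; have E := B_Gam (sLk k).
  have E2 : \sum_(m < N) qre (qconj (Lk k m) * Gam (Lk k) m) =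
      B (Lk k) (prev k) + c * qre (qconj (Lk k 0%N) * x k).
    rewrite (eq_bigr (fun m : 'I_N => qre (qconj (Lk k m) *
       (if k is k'.+1 then KS (Lk k') m else 0)) + qre (qconj (Lk k m) * (ce m * x k)))).
      rewrite big_split /=; congr (_ + _).
        case: k {E} => [|k]; last by rewrite KS_B.
        rewrite big1 => [|m _]; last by rewrite mulr0.
        rewrite /B !big1 ?mulr0 ?subr0 // => l _; rewrite ?mulr0 //.
        rewrite big1 // => j _; rewrite (_ : adjA (prev 0%N) l j = 0) ?mulr0 //.
        by rewrite /adjA big1 // => m _; rewrite mulr0.
      case: (N) (sLk k : forall m, (N <= m)%N -> Lk k m = 0) => [s|n _]; first by rewrite big_ord0 s // qconj0 mul0r qre0 mulr0.
      rewrite big_ord_recl big1 ?addr0 /= => [|i _]; last by rewrite mul0r mulr0.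
      by rewrite -[(c *: 1) * _]scalerAl mul1r -scalerAr.
    by move=> m _; rewrite rec // mulrDr qreD.
  have h := B_cauchy (sLk k) (sprev k).
  have h2 : 2 * (c * qre (qconj (Lk k 0%N) * x k)) <= c ^+ 2 * `|Lk k 0%N| ^+ 2 + `|x k| ^+ 2.
    exact: qre_conjM_le.
  rewrite E in E2; lra.
have sum_energy : B (prev M) (prev M) + \sum_(k < M) \sum_(j < J) `|adjA (Lk k) 0%N j| ^+ 2 <=
    \sum_(k < M) `|x k| ^+ 2.
  elim: (M) => [|m IH]; first by rewrite !big_ord0 addr0 B0.
  rewrite !big_ord_recr /=; have := energy m; move: IH; rewrite /=; lra.
apply: le_trans sum_energy; rewrite ler_wpDl ?B_ge0 //.
rewrite le_eqVlt; apply/orP; left; apply/eqP; apply: eq_bigr => k _; apply: eq_bigr => j _.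
by rewrite (adjA_sum _ (fun l => Lam (k - l)%N)).
Qed.

End Leech.

Arguments qre {R} q : simpl nomatch.
Arguments qim1 {R} q : simpl nomatch.
Arguments qim2 {R} q : simpl nomatch.
Arguments qim3 {R} q : simpl nomatch.

(** * From quaternionic symbols to complex ones *)

Section QuaternionComplex.
Variable R : realType.
Local Notation H := (quaternion R).
Local Notation C := R[i].
Implicit Types (x y : H) (z : C).

(* x = qc1 x + j (qc2 x) identifies H with C^2, right multiplication by
   C = R + Ri becoming the scalar action. *)
Definition qc1 x : C := qre x +i* qim1 x.
Definition qc2 x : C := qim2 x +i* (- qim3 x).
Definition qemb z : H := Quat (complex.Re z) (complex.Im z) 0 0.

Lemma complex_eqP z w : complex.Re z = complex.Re w -> complex.Im z = complex.Im w -> z = w.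
Proof. by case: z w => a b [c d] /= -> ->. Qed.

Lemma qc1D x y : qc1 (x + y) = qc1 x + qc1 y. Proof. by []. Qed.
Lemma qc2D x y : qc2 (x + y) = qc2 x + qc2 y.
Proof. by apply: complex_eqP => //; exact: opprD. Qed.
Lemma qc10 : qc1 0 = 0. Proof. by []. Qed.
Lemma qc20 : qc2 0 = 0. Proof. by apply: complex_eqP => //=; ring. Qed.
Lemma qc1_sum (I : Type) (r : seq I) (P : pred I) (F : I -> H) :
  qc1 (\sum_(i <- r | P i) F i) = \sum_(i <- r | P i) qc1 (F i).
Proof. exact: (big_morph qc1 qc1D erefl). Qed.
Lemma qc2_sum (I : Type) (r : seq I) (P : pred I) (F : I -> H) :
  qc2 (\sum_(i <- r | P i) F i) = \sum_(i <- r | P i) qc2 (F i).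
Proof.
by apply: (big_morph qc2 qc2D); apply: complex_eqP => //; exact: oppr0.
Qed.

Lemma qc1_conjM x y : qc1 (qconj x * y) = (qc1 x)^* * qc1 y + (qc2 x)^* * qc2 y.
Proof.
by case: x y => ? ? ? ? [? ? ? ?]; apply: complex_eqP => /=; ring.
Qed.

Lemma qc2_conjM x y : qc2 (qconj x * y) = qc1 x * qc2 y - qc2 x * qc1 y.
Proof.
by case: x y => ? ? ? ? [? ? ? ?]; apply: complex_eqP => /=; ring.
Qed.

Lemma qc1_emb x z : qc1 (x * qemb z) = qc1 x * z.
Proof.
by case: x z => ? ? ? ? [? ?]; apply: complex_eqP => /=; ring.
Qed.

Lemma qc2_emb x z : qc2 (x * qemb z) = qc2 x * z.
Proof.
by case: x z => ? ? ? ? [? ?]; apply: complex_eqP => /=; ring.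
Qed.

Lemma qembM z w : qemb (z * w) = qemb z * qemb w.
Proof.
by case: z w => ? ? [? ?]; apply: quat_eqP => /=; ring.
Qed.

Lemma qemb1 : qemb 1 = 1. Proof. by []. Qed.

Lemma qemb_conj z : qemb z^* = qconj (qemb z).
Proof.
by case: z => ? ?; apply: quat_eqP => /=; ring.
Qed.

Lemma qnorm_cmod x : `|x| ^+ 2 = cmod (qc1 x) ^+ 2 + cmod (qc2 x) ^+ 2.
Proof. by rewrite sqr_qnorm /quat_sqnorm !sqr_cmod /=; ring. Qed.

Lemma qnorm_emb z : `|qemb z| = cmod z.
Proof.
apply: (@pexpIrn _ 2); rewrite ?nnegrE ?cmod_ge0 // sqr_qnorm /quat_sqnorm sqr_cmod.
by case: z => ? ? /=; ring.
Qed.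

(* Z^m v^* = v^* q^m with q conjugate to Z turns a value of the matrix symbol
   at Z into a value of the slice regular function at q. *)
Lemma conj_eval (v : H) (z : C) : v != 0 ->
  exists q : H, `|q| = cmod z /\ forall (n : nat) (a : nat -> H),
   \sum_(m < n) qconj (a m) * v * qemb (z ^+ m)^* = qconj (qconj v * \sum_(m < n) q ^+ m * a m).
Proof.
move=> v0; have nv : `|v| != 0 by rewrite normr_eq0.
exists ((`|v| ^+ 2)^-1 *: (v * qemb z * qconj v)); split.
  rewrite normrZ !qnormM qnorm_conj qnorm_emb ger0_norm ?invr_ge0 ?exprn_ge0 //.
  by field.
set q := _ *: _.
have vq : qconj v * q = qemb z * qconj v.
  rewrite /q -scalerAr !mulrA qconjM_self -!scalerAl mul1r scalerA mulVf ?scale1r //.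
  by rewrite expf_neq0.
have vqm m : qconj v * q ^+ m = qemb (z ^+ m) * qconj v.
  elim: m => [|m IH]; first by rewrite mulr1 qemb1 mul1r.
  by rewrite exprSr mulrA IH -mulrA vq mulrA -qembM -exprSr.
move=> n a; rewrite mulr_sumr qconj_sum; apply: eq_bigr => m _.
by rewrite mulrA vqm !qconjM qconjK -qemb_conj mulrA.
Qed.

Arguments qre {R} q : simpl never.
Arguments qim1 {R} q : simpl never.
Arguments qim2 {R} q : simpl never.
Arguments qim3 {R} q : simpl never.

Lemma split_shift_sum (n m : nat) (g : nat -> C) : (forall i, (n <= i)%N -> g i = 0) ->
  \sum_(i < n) g i = \sum_(i < m) g i + \sum_(i < n) g (m + i)%N.
Proof.
move=> g0.
have <- : \sum_(i < m + n) g i = \sum_(i < m) g i + \sum_(i < n) g (m + i)%N.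
  by rewrite big_split_ord.
rewrite addnC big_split_ord /= [X in _ = _ + X]big1 ?addr0 // => i _.
by rewrite g0 // leq_addr.
Qed.

(** On the circle conj(z)^m is z^(-m). The terms with i >= m form the analytic part w; those with i
    < m are conjugates of positive powers and form psi, which has no constant term. *)
Lemma laurent_split (M n : nat) (T : nat -> nat -> C) (z : C) : cmod z = 1 ->
  (forall m i, (n <= i)%N -> T m i = 0) ->
  \sum_(m < M) (\sum_(i < n) T m i * z ^+ i) * (z ^+ m)^* =
  ev (fun l => \sum_(m < M) T m (m + l)%N) n z +
  (\sum_(m < M) \sum_(i < m) (T m i)^* * z ^+ (m - i))^*.
Proof.
move=> z1 T0.
have zz k : z ^+ k * (z ^+ k)^* = 1.
  by rewrite mulJ_sqr_cmod cmodX z1 expr1n expr1n.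
have -> : ev (fun l => \sum_(m < M) T m (m + l)%N) n z =
    \sum_(m < M) \sum_(l < n) T m (m + l)%N * z ^+ l.
  by rewrite exchange_big /=; apply: eq_bigr => l _; rewrite mulr_suml.
rewrite conjc_sum -big_split /=; apply: eq_bigr => m _.
rewrite mulr_suml (@split_shift_sum n m (fun i => T m i * z ^+ i * (z ^+ m)^*)); last first.
  by move=> i ni; rewrite T0 // !mul0r.
rewrite addrC; congr (_ + _); last first.
  by apply: eq_bigr => l _; rewrite exprD -!mulrA [z ^+ m * _]mulrC -!mulrA [_^* * _]mulrC zz mulr1.
rewrite conjc_sum; apply: eq_bigr => i _; rewrite conjcM conjcK.
have -> : z ^+ m = z ^+ i * z ^+ (m - i) by rewrite -exprD subnKC // ltnW.
by rewrite !conjcM -!mulrA; congr (_ * _); rewrite mulrA zz mul1r.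
Qed.

(** A quaternionic column becomes two complex ones, told apart by the boolean index. The room [D]
    lets the f_j have degrees beyond the support of la; those do not reach the adjoint. *)
Lemma quat_corona_H2 (J n D : nat) (a : nat -> nat -> H) (del : R) (la : nat -> H) :
  0 < del -> del < 1 ->
  (forall q : H, `|q| <= 1 ->
     del ^+ 2 <= \sum_(j < J) `|\sum_(m < n + D) q ^+ m * a j m| ^+ 2 <= 1) ->
  (forall m, (n <= m)%N -> la m = 0) ->
  forall X, X = expR 1 * ln (del ^- 4) ->
  \sum_(m < n) `|la m| ^+ 2 <= 4 * (X / del ^+ 2 + del ^- 2) * (X / del ^+ 4 + 1) *
    \sum_(l < n) \sum_(j < J) `|\sum_(m < n) qconj (a j m) * la (m + l)%N| ^+ 2.
Proof.
move=> del0 del1 Hb sla X XE.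
have [al alE] : exists al, forall j m, al j m = qc1 (a j m) by eexists.
have [be beE] : exists be, forall j m, be j m = qc2 (a j m) by eexists.
have [k1 k1E] : exists k1, forall m, k1 m = qc1 (la m) by eexists.
have [k2 k2E] : exists k2, forall m, k2 m = qc2 (la m) by eexists.
pose p1 (i : 'I_J * bool) z := if i.2 then ev (fun m => - (be i.1 m)^*) (n + D) z
   else ev (al i.1) (n + D) z.
pose p2 (i : 'I_J * bool) z := if i.2 then ev (fun m => (al i.1 m)^*) (n + D) z
   else ev (be i.1) (n + D) z.
pose T (i : 'I_J * bool) m m' : C := if i.2 then qc2 (qconj (a i.1 m) * la m')
   else qc1 (qconj (a i.1 m) * la m').
pose w i l := \sum_(m < n + D) T i m (m + l)%N.
pose psi i z := \sum_(m < n + D) \sum_(m' < m) (T i m m')^* * z ^+ (m - m').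
have TE i m m' : T i m m' = if i.2 then al i.1 m * k2 m' - be i.1 m * k1 m'
   else (al i.1 m)^* * k1 m' + (be i.1 m)^* * k2 m'.
  by rewrite /T qc1_conjM qc2_conjM alE beE k1E k2E.
have symb i z (v1 v2 : C) : (p1 i z)^* * v1 + (p2 i z)^* * v2 =
   \sum_(m < n + D) (if i.2 then al i.1 m * v2 - be i.1 m * v1
     else (al i.1 m)^* * v1 + (be i.1 m)^* * v2) * (z ^+ m)^*.
  rewrite /p1 /p2 /ev; case: i.2; rewrite !conjc_sum !mulr_suml -big_split /=;
    apply: eq_bigr => m _; rewrite !(conjcM, conjcN, conjcK); ring.
have T0 i m m' : (n <= m')%N -> T i m m' = 0.
  by move=> h; rewrite TE k1E k2E sla // !(qc10, qc20) !mulr0 subr0 addr0; case: i.2.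
have E1 i : entire (p1 i) by rewrite /p1; case: i.2; exact: entire_ev.
have E2 i : entire (p2 i) by rewrite /p2; case: i.2; exact: entire_ev.
have Epsi i : entire (psi i).
  apply: entire_sum => m; apply: entire_sum => m'.
  by apply: entireM (entire_const _) _; exact: entireX (@entire_id R).
have psi0 i : psi i 0 = 0.
  rewrite /psi big1 // => m _; rewrite big1 // => m' _.
  by rewrite expr0n subn_eq0 leqNgt ltn_ord mulr0.
have Hbd z i : cmod z = 1 -> (p1 i z)^* * ev k1 n z + (p2 i z)^* * ev k2 n z =
     ev (w i) n z + (psi i z)^*.
  move=> z1; rewrite symb -(laurent_split (n + D) z1 (T0 i)).
  apply: eq_bigr => m _; congr (_ * _).
  under [RHS]eq_bigr => m' _ do rewrite TE.
  case: (i.2); rewrite /ev !mulr_sumr.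
    by rewrite -sumrB; apply: eq_bigr => m' _; rewrite [RHS]mulrBl !mulrA.
  by rewrite -big_split; apply: eq_bigr => m' _; rewrite [RHS]mulrDl !mulrA.
have pair_sum (F : 'I_J * bool -> R) : \sum_i F i = \sum_(j < J) (F (j, false) + F (j, true)).
  rewrite (eq_bigr (fun p => F (p.1, p.2))); last by move=> [].
  rewrite -(pair_bigA _ (fun j b => F (j, b))) /=.
  by apply: eq_bigr => j _; rewrite big_bool addrC.
have Hq z : cmod z <= 1 -> forall v1 v2 : C,
    del ^+ 2 * (cmod v1 ^+ 2 + cmod v2 ^+ 2) <=
      \sum_i cmod ((p1 i z)^* * v1 + (p2 i z)^* * v2) ^+ 2 <=
    cmod v1 ^+ 2 + cmod v2 ^+ 2.
  move=> z1 v1 v2; pose v := Quat (complex.Re v1) (complex.Im v1) (complex.Re v2) (- complex.Im v2).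
  have v1E : v1 = qc1 v by rewrite /v /qc1 /=; case: (v1).
  have v2E : v2 = qc2 v by rewrite /v /qc2 /=; case: (v2) => ? ? /=; rewrite ?opprK.
  have key : \sum_i cmod ((p1 i z)^* * v1 + (p2 i z)^* * v2) ^+ 2 =
      \sum_(j < J) `|\sum_(m < n + D) qconj (a j m) * v * qemb (z ^+ m)^*| ^+ 2.
    rewrite pair_sum; apply: eq_bigr => j _; rewrite qnorm_cmod qc1_sum qc2_sum !symb /=.
    congr (cmod _ ^+ 2 + cmod _ ^+ 2); apply: eq_bigr => m _.
      by rewrite qc1_emb qc1_conjM -v1E -v2E alE beE.
    by rewrite qc2_emb qc2_conjM -v1E -v2E alE beE.
  rewrite key v1E v2E -qnorm_cmod.
  have [->|v0] := eqVneq v 0.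
    rewrite normr0 expr0n /= mulr0 big1 ?lexx // => j _.
    by rewrite big1 ?normr0 ?expr0n // => m _; rewrite mulr0 mul0r.
  (* One q serves all j, so the form at v is |v|^2 times the sum of the |f_j(q)|^2, with |q| =
     |z|. *)
  have [q [qn qE]] := conj_eval z v0.
  under eq_bigr => j _ do rewrite qE qnorm_conj qnormM exprMn qnorm_conj.
  rewrite -mulr_sumr; have q1 : `|q| <= 1 by rewrite qn.
  have /andP[h1 h2] := Hb q q1.
  have nv : 0 <= `|v| ^+ 2 by rewrite exprn_ge0.
  by rewrite mulrC ler_wpM2l //= ler_piMr.
have := corona_H2 del0 del1 E1 E2 Epsi Hq psi0 Hbd XE.
have -> : \sum_(i < n) (cmod (k1 i) ^+ 2 + cmod (k2 i) ^+ 2) = \sum_(m < n) `|la m| ^+ 2.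
  by apply: eq_bigr => i _; rewrite qnorm_cmod k1E k2E.
congr (_ <= _ * _); rewrite pair_sum exchange_big /=; apply: eq_bigr => j _.
rewrite -big_split /=; apply: eq_bigr => l _; rewrite qnorm_cmod /w /T /=.
rewrite -qc1_sum -qc2_sum.
have -> : \sum_(m < n + D) qconj (a j m) * la (m + l)%N = \sum_(m < n) qconj (a j m) * la (m + l)%N.
  rewrite big_split_ord /= [X in _ + X]big1 ?addr0 // => m _.
  by rewrite sla ?mulr0 // -addnA leq_addr.
by [].
Qed.

End QuaternionComplex.

(** * Cauchy's theorem on slices *)

Section Primitives.
Variable R : realType.
Implicit Types (f g F G : R -> R) (a b x : R).

Definition primitive_on a b f F := {within `[a, b], continuous F} /\
  forall x, a < x < b -> is_derive x 1 F (f x).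

(** The only appeal to measure theory: elsewhere an integral is a difference of two values of a
    primitive. *)
Lemma primitive_exists a b f : a < b -> {within `[a, b], continuous f} ->
  exists F, primitive_on a b f F.
Proof.
move=> ab cf; pose mu := (@lebesgue_measure R).
have intf : mu.-integrable `[a, b] (EFin \o f).
  by apply: continuous_compact_integrable => //; exact: segment_compact.
exists (fun x => parameterized_integral mu a x f); split.
  by apply: parameterized_integral_continuous => //; exact: ltW.
move=> x /andP[ax xb].
have [cf' _ _] := (continuous_within_itvP f ab).1 cf.
have xab : x \in `]a, b[ by rewrite in_itv /= ax xb.
have [dF FE] := continuous_FTC1_closed xb intf ax (cf' x xab).
by split; [exact: dF|rewrite -derive1E; exact: FE].
Qed.

Lemma primitive_mvt a b f F x y : primitive_on a b f F -> a <= x -> x <= y -> y <= b ->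
  exists2 c, x <= c <= y & F y - F x = f c * (y - x).
Proof.
move=> [cF dF] ax xy yb.
have sub : `[x, y] `<=` `[a, b].
  move=> z /=; rewrite !in_itv /= => /andP[xz zy].
  by rewrite (le_trans ax xz) (le_trans zy yb).
have cF' : {within `[x, y], continuous F} by exact: continuous_subspaceW cF.
have [z|c] := @MVT_segment R F f x y xy _ cF'.
  rewrite in_itv /= => /andP[xz zy]; apply: dF.
  by rewrite (le_lt_trans ax) // (lt_le_trans zy).
by rewrite in_itv /= => cxy E; exists c.
Qed.

Lemma primitive_lin a b f g F G (r : R) : primitive_on a b f F -> primitive_on a b g G ->
  primitive_on a b (fun x => r * f x + g x) (fun x => r * F x + G x).
Proof.
move=> [cF dF] [cG dG]; split.
  move=> x; apply: cvgD; last exact: cG.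
  by apply: cvgM; [exact: cvg_cst|exact: cF].
move=> x xab; have := dF x xab => D1; have := dG x xab => D2.
exact: (is_deriveD (is_deriveZ r D1) D2).
Qed.

Lemma primitive_eq a b f F G : a <= b -> primitive_on a b f F -> primitive_on a b f G ->
  F b - F a = G b - G a.
Proof.
move=> ab PF PG; have := primitive_lin (-1) PF PG => PD.
have [c _] := primitive_mvt PD (lexx a) ab (lexx b); lra.
Qed.

End Primitives.

Lemma natr_lt_exp2 (R : realType) (n : nat) : n%:R < 2 ^+ n :> R.
Proof.
elim: n => [|n IH]; first by rewrite expr0.
rewrite exprS -natr1; have : 1 <= 2 ^+ n :> R by rewrite exprn_ege1 // ler1n.
lra.
Qed.

Lemma dist_itv_le (R : realType) (x0 x1 x y : R) :
  x0 <= x -> x <= x1 -> x0 <= y -> y <= x1 -> `|x - y| <= x1 - x0.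
Proof. by move=> *; rewrite ler_norml; apply/andP; split; lra. Qed.

(** * Goursat's lemma on a rectangle *)

Section Goursat.
Variable R : realType.
Variables (P Q U V : R -> R -> R) (a b c d : R).

Definition small_at (g : R -> R -> R) (x y A B : R) := forall eps : R, 0 < eps ->
  exists2 del : R, 0 < del & forall x' y', a <= x' <= b -> c <= y' <= d ->
    `|x' - x| <= del -> `|y' - y| <= del ->
    `|g x' y' - g x y - A * (x' - x) - B * (y' - y)| <= eps * (`|x' - x| + `|y' - y|).

Hypothesis ab : a < b.
Hypothesis cd : c < d.
Hypothesis HU : forall y, c <= y <= d -> primitive_on a b (fun x => P x y) (fun x => U x y).
Hypothesis HV : forall x, a <= x <= b -> primitive_on c d (Q x) (V x).
Hypothesis HPQ : forall x y, a <= x <= b -> c <= y <= d ->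
  exists A P1 Q2, small_at P x y P1 A /\ small_at Q x y A Q2.

(** The circulation of P dx + Q dy around the rectangle, in terms of the primitives. *)
Let W x0 x1 y0 y1 : R := (V x1 y1 - V x1 y0 - V x0 y1 + V x0 y0) -
  (U x1 y1 - U x1 y0 - U x0 y1 + U x0 y0).

(** By the mean value theorem, [W] is a difference of Q in x times k, minus a difference of P in y
    times h. Both differences have the same slope A, so A h k cancels and only the errors remain. *)
Lemma goursat_local x y : a <= x <= b -> c <= y <= d -> forall eps : R, 0 < eps ->
  exists2 del : R, 0 < del & forall x0 x1 y0 y1,
    a <= x0 -> x0 <= x -> x <= x1 -> x1 <= b -> c <= y0 -> y0 <= y -> y <= y1 -> y1 <= d ->
    x1 - x0 <= del -> y1 - y0 <= del ->
    `|W x0 x1 y0 y1| <= eps * (x1 - x0 + (y1 - y0)) ^+ 2.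
Proof.
move=> xab ycd eps eps0; have [A [P1 [Q2 [sP sQ]]]] := HPQ xab ycd.
have e2 : 0 < eps / 2 by rewrite divr_gt0.
have [d1 d10 H1] := sP _ e2; have [d2 d20 H2] := sQ _ e2.
exists (Num.min d1 d2); first by rewrite lt_min d10.
move=> x0 x1 y0 y1 ax0 x0x xx1 x1b cy0 y0y yy1 y1d.
rewrite !le_min => /andP[hx1 hx2] /andP[hy1 hy2].
have x01 : x0 <= x1 by apply: le_trans xx1.
have y01 : y0 <= y1 by apply: le_trans yy1.
have x0ab : a <= x0 <= b by rewrite ax0 (le_trans x01).
have x1ab : a <= x1 <= b by rewrite x1b (le_trans ax0).
have y0cd : c <= y0 <= d by rewrite cy0 (le_trans y01).
have y1cd : c <= y1 <= d by rewrite y1d (le_trans cy0).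
set h := x1 - x0; set k := y1 - y0.
have h0 : 0 <= h by rewrite subr_ge0. have k0 : 0 <= k by rewrite subr_ge0.
have PV := primitive_lin (-1) (HV x0ab) (HV x1ab).
have PU := primitive_lin (-1) (HU y0cd) (HU y1cd).
have [eta /andP[e0 e1] EV] := primitive_mvt PV cy0 y01 y1d.
have [xi /andP[xi0 xi1] EU] := primitive_mvt PU ax0 x01 x1b.
have BV : `|-1 * Q x0 eta + Q x1 eta - A * h| <= eps * (h + k).
  have etacd : c <= eta <= d by rewrite (le_trans cy0) // (le_trans e1).
  have ey : `|eta - y| <= k by apply: dist_itv_le.
  have r0 : `|x0 - x| <= h by apply: dist_itv_le.
  have r1 : `|x1 - x| <= h by apply: dist_itv_le.
  have := H2 x0 eta x0ab etacd (le_trans r0 hx2) (le_trans ey hy2).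
  have := H2 x1 eta x1ab etacd (le_trans r1 hx2) (le_trans ey hy2).
  set t1 := _ - Q2 * _; set t0 := _ - Q2 * _ => b1 b0.
  have -> : -1 * Q x0 eta + Q x1 eta - A * h = t1 - t0 by rewrite /t1 /t0 /h; ring.
  apply: le_trans (ler_normB _ _) _.
  have : eps / 2 * (`|x1 - x| + `|eta - y|) <= eps / 2 * (h + k).
    by rewrite ler_wpM2l ?lerD // ltW.
  have : eps / 2 * (`|x0 - x| + `|eta - y|) <= eps / 2 * (h + k).
    by rewrite ler_wpM2l ?lerD // ltW.
  by clear -b0 b1; lra.
have BU : `|-1 * P xi y0 + P xi y1 - A * k| <= eps * (h + k).
  have xiab : a <= xi <= b by rewrite (le_trans ax0) // (le_trans xi1).
  have ey : `|xi - x| <= h by apply: dist_itv_le.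
  have r0 : `|y0 - y| <= k by apply: dist_itv_le.
  have r1 : `|y1 - y| <= k by apply: dist_itv_le.
  have := H1 xi y0 xiab y0cd (le_trans ey hx1) (le_trans r0 hy1).
  have := H1 xi y1 xiab y1cd (le_trans ey hx1) (le_trans r1 hy1).
  set t1 := _ - A * _; set t0 := _ - A * _ => b1 b0.
  have -> : -1 * P xi y0 + P xi y1 - A * k = t1 - t0 by rewrite /t1 /t0 /k; ring.
  apply: le_trans (ler_normB _ _) _.
  have : eps / 2 * (`|xi - x| + `|y1 - y|) <= eps / 2 * (h + k).
    by rewrite ler_wpM2l ?lerD // ltW.
  have : eps / 2 * (`|xi - x| + `|y0 - y|) <= eps / 2 * (h + k).
    by rewrite ler_wpM2l ?lerD // ltW.
  by clear -b0 b1; lra.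
have -> : W x0 x1 y0 y1 = (-1 * Q x0 eta + Q x1 eta - A * h) * k -
    (-1 * P xi y0 + P xi y1 - A * k) * h.
  by rewrite /W; move: EV EU; rewrite -/h -/k; lra.
apply: le_trans (ler_normB _ _) _; rewrite !normrM (ger0_norm h0) (ger0_norm k0).
have h1 := ler_wpM2r k0 BV; have h2 := ler_wpM2r h0 BU.
by apply: le_trans (lerD h1 h2) _; rewrite le_eqVlt; apply/orP; left; apply/eqP; ring.
Qed.

(* [P dx + Q dy] is closed, so [W], which is additive under subdivision, is
   small of second order at every point; bisection, without continuity of the
   derivatives. *)
Lemma goursat : W a b c d = 0.
Proof.
apply/eqP; apply/negPn/negP => W0.
pose eta := `|W a b c d|; have eta0 : 0 < eta by rewrite normr_gt0.
pose h := b - a; pose k := d - c.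
have h0 : 0 < h by rewrite subr_gt0. have k0 : 0 < k by rewrite subr_gt0.
pose hn n : R := h / 2 ^+ n; pose kn n : R := k / 2 ^+ n.
have hn0 n : 0 <= hn n by rewrite divr_ge0 ?exprn_ge0 // ltW.
have kn0 n : 0 <= kn n by rewrite divr_ge0 ?exprn_ge0 // ltW.
have hnS n : hn n = hn n.+1 + hn n.+1.
  by rewrite /hn exprS; field; rewrite expf_neq0.
have knS n : kn n = kn n.+1 + kn n.+1.
  by rewrite /kn exprS; field; rewrite expf_neq0.
pose good n (p : R * R) := [/\ a <= p.1, p.1 + hn n <= b, c <= p.2, p.2 + kn n <= d &
  eta / 4 ^+ n <= `|W p.1 (p.1 + hn n) p.2 (p.2 + kn n)|].
have step : forall np : nat * (R * R), exists p' : R * R, good np.1 np.2 ->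
   [/\ good np.1.+1 p', np.2.1 <= p'.1 <= np.2.1 + hn np.1.+1 &
       np.2.2 <= p'.2 <= np.2.2 + kn np.1.+1].
  move=> [n [x y]] /=.
  have [G|NG] := pselect (good n (x, y)); last by exists (0, 0).
  case: G => /= ax xb cy yd GW.
  have hS := hnS n; have kS := knS n; have p1 := hn0 n.+1; have p2 := kn0 n.+1.
  set h' := hn n.+1 in hS p1 *; set k' := kn n.+1 in kS p2 *.
  rewrite hS kS in xb yd GW.
  apply: contrapT => N.
  have N' x' y' : x <= x' <= x + h' -> y <= y' <= y + k' ->
      x' + h' <= b -> y' + k' <= d -> `|W x' (x' + h') y' (y' + k')| < eta / 4 ^+ n.+1.
    move=> hx hy hb hd; rewrite ltNge; apply/negP => le; apply: N; exists (x', y') => _.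
    move/andP: (hx) => [hx1 _]; move/andP: (hy) => [hy1 _].
    by split => //; split => //=; [apply: le_trans hx1|apply: le_trans hy1].
  have E4 : eta / 4 ^+ n = 4 * (eta / 4 ^+ n.+1).
    by rewrite exprS; field; rewrite expf_neq0.
  have A1 : `|W x (x + h') y (y + k')| < eta / 4 ^+ n.+1.
    by apply: N'; rewrite ?lexx ?lerDl ?p1 ?p2 //; lra.
  have A2 : `|W (x + h') (x + h' + h') y (y + k')| < eta / 4 ^+ n.+1.
    by apply: N'; rewrite ?lexx ?lerDl ?p1 ?p2 //; lra.
  have A3 : `|W x (x + h') (y + k') (y + k' + k')| < eta / 4 ^+ n.+1.
    by apply: N'; rewrite ?lexx ?lerDl ?p1 ?p2 //; lra.
  have A4 : `|W (x + h') (x + h' + h') (y + k') (y + k' + k')| < eta / 4 ^+ n.+1.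
    by apply: N'; rewrite ?lexx ?lerDl ?p1 ?p2 //; lra.
  have E : W x (x + (h' + h')) y (y + (k' + k')) =
     W x (x + h') y (y + k') + W (x + h') (x + h' + h') y (y + k') +
     W x (x + h') (y + k') (y + k' + k') + W (x + h') (x + h' + h') (y + k') (y + k' + k').
    by rewrite /W !addrA; ring.
  have := ler_normD (W x (x + h') y (y + k') + W (x + h') (x + h' + h') y (y + k') +
     W x (x + h') (y + k') (y + k' + k')) (W (x + h') (x + h' + h') (y + k') (y + k' + k')).
  have := ler_normD (W x (x + h') y (y + k') + W (x + h') (x + h' + h') y (y + k'))
     (W x (x + h') (y + k') (y + k' + k')).
  have := ler_normD (W x (x + h') y (y + k')) (W (x + h') (x + h' + h') y (y + k')).
  move: GW; rewrite E E4; lra.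
have [nxt Hnxt] := choice step.
pose s := fix s n : R * R := if n is n'.+1 then nxt (n', s n') else (a, c).
have sgood n : good n (s n).
  elim: n => [|n IH]; last by have [] := Hnxt (n, s n) IH.
  rewrite /good /hn /kn !expr0 !divr1 /=.
  by rewrite /h /k !(addrC _ (_ - _)) !subrK; split.
have sx n m : (n <= m)%N -> (s n).1 <= (s m).1 /\ (s m).1 + hn m <= (s n).1 + hn n.
  move=> /subnKC <-; elim: (m - n)%N => [|i [IH1 IH2]]; first by rewrite addn0.
  have [_ /andP[l1 l2] _] := Hnxt ((n + i)%N, s (n + i)%N) (sgood _).
  rewrite addnS /=; move: l1 l2 IH1 IH2; rewrite /= (hnS (n + i)%N); split; lra.
have sy n m : (n <= m)%N -> (s n).2 <= (s m).2 /\ (s m).2 + kn m <= (s n).2 + kn n.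
  move=> /subnKC <-; elim: (m - n)%N => [|i [IH1 IH2]]; first by rewrite addn0.
  have [_ _ /andP[l1 l2]] := Hnxt ((n + i)%N, s (n + i)%N) (sgood _).
  rewrite addnS /=; move: l1 l2 IH1 IH2; rewrite /= (knS (n + i)%N); split; lra.
have limpt (u : nat -> R) (l : nat -> R) : (forall n, 0 <= l n) ->
    (forall n m, (n <= m)%N -> u n <= u m /\ u m + l m <= u n + l n) ->
    exists x, forall n, u n <= x <= u n + l n.
  move=> l0 mono; exists (sup (range u)) => n.
  have ub m : ubound (range u) (u m + l m).
    move=> _ [i _ <-]; have [im|/ltnW mi] := leqP i m.
      by have [h1 _] := mono _ _ im; rewrite (le_trans h1) // lerDl.
    by have [_ h2] := mono _ _ mi; rewrite (le_trans _ h2) // lerDl.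
  apply/andP; split.
    by apply: ub_le_sup; [exists (u 0%N + l 0%N)|exists n].
  by apply: ge_sup; [exists (u n); exists n|].
have [x Hx] := limpt (fun n => (s n).1) hn hn0 sx.
have [y Hy] := limpt (fun n => (s n).2) kn kn0 sy.
have xab : a <= x <= b.
  have /andP[l1 l2] := Hx 0%N; have [g1 g2 _ _ _] := sgood 0%N.
  by rewrite (le_trans g1 l1) (le_trans l2 g2).
have ycd : c <= y <= d.
  have /andP[l1 l2] := Hy 0%N; have [_ _ g1 g2 _] := sgood 0%N.
  by rewrite (le_trans g1 l1) (le_trans l2 g2).
(* With this choice the local bound on the n-th rectangle is half of eta / 4^n, against [good]. *)
pose eps := eta / (2 * (h + k) ^+ 2).
have hk : 0 < (h + k) ^+ 2 by rewrite exprn_gt0 // addr_gt0.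
have eps0 : 0 < eps by rewrite divr_gt0 // mulr_gt0.
have [del del0 Hdel] := goursat_local xab ycd eps0.
have [n nlarge] : exists n : nat, (h + k) / del < 2 ^+ n.
  exists (Num.bound ((h + k) / del)).
  apply: lt_trans (archi_boundP _) (natr_lt_exp2 _ _).
  by rewrite divr_ge0 ?ltW // addr_gt0.
have [g1 g2 g3 g4 g5] := sgood n.
have /andP[x1 x2] := Hx n; have /andP[y1 y2] := Hy n.
have small (z : R) : 0 <= z -> z <= h + k -> z / 2 ^+ n <= del.
  move=> z0 zk; rewrite ler_pdivrMr ?exprn_gt0 // (le_trans zk) //.
  by rewrite mulrC -ler_pdivrMr // ltW.
have sh : hn n <= del by apply: small; rewrite ?lerDl ltW.
have sk : kn n <= del by apply: small; rewrite ?lerDr ltW.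
have := Hdel (s n).1 ((s n).1 + hn n) (s n).2 ((s n).2 + kn n) g1 x1 x2 g2 g3 y1 y2 g4.
rewrite [X in X - _]addrC [X in X - (s n).2]addrC !addrK => /(_ sh sk) le.
have := le_trans g5 le.
have -> : eps * (hn n + kn n) ^+ 2 = eta / 4 ^+ n / 2.
  rewrite /eps /hn /kn -mulrDl.
  have -> : 4 ^+ n = (2 ^+ n) ^+ 2 :> R by rewrite -exprM mulnC exprM; congr (_ ^+ n); ring.
  by field; rewrite !(expf_neq0, gt_eqF) // addr_gt0.
have : 0 < eta / 4 ^+ n by rewrite divr_gt0 // exprn_gt0.
lra.
Qed.

End Goursat.

Arguments qre {R} q : simpl nomatch.
Arguments qim1 {R} q : simpl nomatch.
Arguments qim2 {R} q : simpl nomatch.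
Arguments qim3 {R} q : simpl nomatch.

(** * Complex differentiability on a slice *)

Section SliceEmbedding.
Variable R : realType.
Local Notation H := (quaternion R).
Local Notation C := R[i].
Variable I : H.
Hypothesis II : imag_units R I.
Implicit Types (z w t : C) (F : C -> H).

Lemma imag_unit_qre : qre I = 0.
Proof.
case: I II => a b c d; rewrite /imag_units /= => E.
have /= e0 := congr1 (@qre R) E; have /= e1 := congr1 (@qim1 R) E.
have /= e2 := congr1 (@qim2 R) E; have /= e3 := congr1 (@qim3 R) E.
(* Multiply the real part of I^2 + 1 by a^2; the imaginary parts give ab = ac = ad = 0. *)
have a2 : a * a * (a * a) + a * a = 0.
  have -> : a * a * (a * a) + a * a =
     a * a * (a * a - b * b - c * c - d * d + 1) + (a * b) ^+ 2 + (a * c) ^+ 2 + (a * d) ^+ 2 by ring.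
  have -> : a * b = 0 by lra. have -> : a * c = 0 by lra. have -> : a * d = 0 by lra.
  by rewrite e0 addNr mulr0 !expr0n /= !addr0.
have a20 : a ^+ 2 = 0.
  have := sqr_ge0 a; have := sqr_ge0 (a * a); rewrite !expr2; lra.
by move/eqP: a20; rewrite sqrf_eq0 => /eqP.
Qed.

Lemma imag_unit_norm : `|I| = 1.
Proof.
apply: (@pexpIrn _ 2); rewrite ?nnegrE // expr1n sqr_qnorm.
have := imag_unit_qre; have := II; case: (I) => a b c d; rewrite /imag_units /= => E a0.
have /= e0 := congr1 (@qre R) E; rewrite /quat_sqnorm /= a0.
by move: e0; rewrite a0 !expr2; lra.
Qed.

Definition em z : H := slice_point I (complex.Re z) (complex.Im z).

Lemma emD z w : em (z + w) = em z + em w.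
Proof. by case: z w => a b [c d]; rewrite /em /slice_point /= !scalerDl addrACA. Qed.

Lemma emN z : em (- z) = - em z.
Proof. by case: z => a b; rewrite /em /slice_point /= !scaleNr opprD. Qed.

Lemma emB z w : em (z - w) = em z - em w.
Proof. by rewrite emD emN. Qed.

Lemma emM z w : em (z * w) = em z * em w.
Proof.
case: z w => a b [c d]; rewrite /em /slice_point /=.
rewrite mulrDl !mulrDr -!scalerAl -!scalerAr !mul1r !mulr1 !scalerA.
rewrite (_ : I * I = - 1) ?scalerN; last exact: II.
by rewrite !scalerDl scaleNr addrACA [X in _ + X]addrC.
Qed.

Lemma em0 : em 0 = 0. Proof. by rewrite /em /slice_point /= !scale0r addr0. Qed.
Lemma em1 : em 1 = 1. Proof. by rewrite /em /slice_point /= scale1r scale0r addr0. Qed.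
Lemma em_real (x : R) : em x%:C = x%:A.
Proof. by rewrite /em /slice_point /= scale0r addr0. Qed.
Lemma em_i : em 'i = I.
Proof. by rewrite /em /slice_point /= scale1r scale0r add0r. Qed.

Lemma emX z n : em (z ^+ n) = em z ^+ n.
Proof. by elim: n => [|n IH]; rewrite ?expr0 ?em1 // !exprS emM IH. Qed.

Lemma em_sum (J : Type) (s : seq J) (P : pred J) (G : J -> C) :
  em (\sum_(j <- s | P j) G j) = \sum_(j <- s | P j) em (G j).
Proof. exact: (big_morph em emD em0). Qed.

Lemma em_norm z : `|em z| = cmod z.
Proof.
apply: (@pexpIrn _ 2); rewrite ?nnegrE ?cmod_ge0 // sqr_qnorm sqr_cmod.
have := imag_unit_qre; have : quat_sqnorm I = 1 by rewrite -sqr_qnorm imag_unit_norm expr1n.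
rewrite /em /slice_point /quat_sqnorm; case: (I) z => a b c d [x y] /= E a0.
by move: E; rewrite a0 !expr2 => E; transitivity (x * x + y * y * (0 * 0 + b * b + c * c + d * d));
  [ring|rewrite E mulr1].
Qed.

Lemma em_commute z w : em z * em w = em w * em z.
Proof. by rewrite -!emM mulrC. Qed.

(** The increment acts from the left of the derivative: H is a left complex vector space through
    [em], and F is holomorphic with values in it. *)
Definition hder F z (D : H) := forall eps : R, 0 < eps -> exists2 del : R, 0 < del &
  forall t, cmod t <= del -> `|F (z + t) - F z - em t * D| <= eps * cmod t.

Lemma diff_expand (f : H -> H) (q : H) : differentiable f q -> forall eps : R, 0 < eps ->
  exists2 del : R, 0 < del & forall h : H, `|h| <= del ->
    `|f (q + h) - f q - 'd f q h| <= eps * `|h|.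
Proof.
move=> df eps eps0.
have /eqaddoP /(_ eps eps0) := diff_locally df.
move=> /nbhs_normP [r /= r0 Hr]; exists (r / 2); first by rewrite divr_gt0.
move=> h hr; have := Hr h; rewrite /ball_ /= sub0r normrN => H1.
have hr' : `|h| < r by apply: le_lt_trans hr _; rewrite ltr_pdivrMr // mulr2n mulrDr mulr1 ltrDl.
have := H1 hr'; rewrite !fctE /= [h + q]addrC.
by rewrite (_ : forall a b c : H, a - (b + c) = a - b - c) // => a b c; rewrite opprD addrA.
Qed.

(** The slice equation says df(I) = I df(1), so the real differential is left multiplication of
    df(1) by the increment. *)
Lemma slice_hder (f : H -> H) z : slice_regular f -> cmod z < 1 ->
  exists D, hder (fun z => f (em z)) z D.
Proof.
move=> [df cr] z1; pose q := em z.
have qb : qball R q by rewrite /qball /= em_norm.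
exists ('d f q 1) => eps eps0.
have [r r0 Hr] := diff_expand (df q qb) eps0; exists r => // t tr.
rewrite emD; have := Hr (em t); rewrite em_norm => /(_ tr).
suff -> : em t * 'd f q 1 = 'd f q (em t) by [].
have E1 : derive1 (fun x : R => f (slice_point I x (complex.Im z))) (complex.Re z) = 'd f q 1.
  rewrite -deriveE; last exact: df.
  rewrite /derive1 /derive; suff -> : (fun h : R => h^-1 *:
      (f (slice_point I (h + complex.Re z) (complex.Im z)) -
       f (slice_point I (complex.Re z) (complex.Im z)))) =
      (fun h => h^-1 *: ((f \o shift q) (h *: (1 : H)) - f q)) by [].
  apply/funext => h /=.
  by congr (_ *: (f _ - f _)); rewrite /slice_point scalerDl addrA.
have E2 : derive1 (fun y : R => f (slice_point I (complex.Re z) y)) (complex.Im z) = 'd f q I.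
  rewrite -deriveE; last exact: df.
  rewrite /derive1 /derive; suff -> : (fun h : R => h^-1 *:
      (f (slice_point I (complex.Re z) (h + complex.Im z)) -
       f (slice_point I (complex.Re z) (complex.Im z)))) =
      (fun h => h^-1 *: ((f \o shift q) (h *: I) - f q)) by [].
  apply/funext => h /=.
  by congr (_ *: (f _ - f _)); rewrite /slice_point scalerDl addrCA.
have := cr I II (complex.Re z) (complex.Im z) qb; rewrite E1 E2.
move/(congr1 (fun x => I * (2 *: x))); rewrite scalerA mulfV // scale1r scaler0 mulr0.
rewrite mulrDr mulrA (_ : I * I = -1); last exact: II.
rewrite mulN1r => /eqP; rewrite subr_eq0 => /eqP E.
rewrite {2}/em /slice_point linearD !linearZ /= -E.
by rewrite /em /slice_point mulrDl -!scalerAl mul1r.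
Qed.

End SliceEmbedding.

Ltac quat_ring := apply: quat_eqP => /=; ring.

(** * Differentiability of quaternionic functions of two real variables *)

Section TwoVariable.
Variable R : realType.
Local Notation H := (quaternion R).
Local Notation C := R[i].
Implicit Types (g h : R -> R -> H).

Definition hsmall g (x y : R) (A B : H) := forall eps : R, 0 < eps ->
  exists2 del : R, 0 < del & forall s t, `|s| <= del -> `|t| <= del ->
    `|g (x + s) (y + t) - g x y - (s *: A + t *: B)| <= eps * (`|s| + `|t|).

Lemma hsmall_lip g x y A B : hsmall g x y A B -> exists K : R, 0 <= K /\
  exists2 del : R, 0 < del & forall s t, `|s| <= del -> `|t| <= del ->
    `|g (x + s) (y + t) - g x y| <= K * (`|s| + `|t|).
Proof.
move=> /(_ 1 ltr01) [del del0 Hd]; exists (1 + (`|A| + `|B|)); split.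
  by rewrite !addr_ge0.
exists del => // s t hs ht; have h1 := Hd s t hs ht.
have -> : g (x + s) (y + t) - g x y =
   (g (x + s) (y + t) - g x y - (s *: A + t *: B)) + (s *: A + t *: B) by rewrite subrK.
apply: le_trans (ler_normD _ _) _; rewrite mulrDl; apply: lerD => //.
apply: le_trans (ler_normD _ _) _; rewrite !normrZ.
have := mulr_ge0 (normr_ge0 s) (normr_ge0 B); have := mulr_ge0 (normr_ge0 t) (normr_ge0 A).
lra.
Qed.

Lemma hsmall_const (c : H) x y : hsmall (fun _ _ => c) x y 0 0.
Proof.
move=> eps eps0; exists 1 => // s t _ _.
by rewrite !scaler0 addr0 !subrr normr0 mulr_ge0 ?addr_ge0 // ltW.
Qed.

Lemma hsmall_affine (a b : R) x y : hsmall (fun x _ => (a + b * x)%:A) x y b%:A 0.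
Proof.
move=> eps eps0; exists 1 => // s t _ _.
rewrite scaler0 addr0 scalerA -!scalerBl.
have -> : a + b * (x + s) - (a + b * x) - s * b = 0 by ring.
by rewrite scale0r normr0 mulr_ge0 ?addr_ge0 // ltW.
Qed.

Lemma hsmallD g h x y A B A' B' : hsmall g x y A B -> hsmall h x y A' B' ->
  hsmall (fun x y => g x y + h x y) x y (A + A') (B + B').
Proof.
move=> Hg Hh eps eps0; have e2 : 0 < eps / 2 by rewrite divr_gt0.
have [d d0 H1] := Hg _ e2; have [d' d'0 H2] := Hh _ e2.
exists (Num.min d d'); first by rewrite lt_min d0.
move=> s t; rewrite !le_min => /andP[s1 s2] /andP[t1 t2].
have b1 := H1 s t s1 t1; have b2 := H2 s t s2 t2.
have -> : g (x + s) (y + t) + h (x + s) (y + t) - (g x y + h x y) - (s *: (A + A') + t *: (B + B')) =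
  (g (x + s) (y + t) - g x y - (s *: A + t *: B)) +
  (h (x + s) (y + t) - h x y - (s *: A' + t *: B')).
  by move: (g _ _) (h _ _) (g x y) (h x y) => *; quat_ring.
apply: le_trans (ler_normD _ _) _; have := lerD b1 b2; lra.
Qed.

Lemma hsmallM g h x y A B A' B' : hsmall g x y A B -> hsmall h x y A' B' ->
  hsmall (fun x y => g x y * h x y) x y (A * h x y + g x y * A') (B * h x y + g x y * B').
Proof.
move=> Hg Hh eps eps0.
have [K [K0 [d1 d10 L1]]] := hsmall_lip Hg; have [K' [K'0 [d2 d20 L2]]] := hsmall_lip Hh.
pose G := `|g x y|; pose M := `|h x y|.
have G00 : 0 <= G by exact: normr_ge0. have M00 : 0 <= M by exact: normr_ge0.
have G1 : 0 < 3 * (G + 1) by rewrite mulr_gt0 // ltr_wpDl.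
have M1 : 0 < 3 * (M + 1) by rewrite mulr_gt0 // ltr_wpDl.
have [d3 d30 H3] := Hg (eps / (3 * (M + 1))) (divr_gt0 eps0 M1).
have [d4 d40 H4] := Hh (eps / (3 * (G + 1))) (divr_gt0 eps0 G1).
pose d5 := eps / (6 * (K * K' + 1)).
have KK : 0 < 6 * (K * K' + 1) by rewrite mulr_gt0 // ltr_wpDl // mulr_ge0.
have d50 : 0 < d5 by rewrite divr_gt0.
exists (Num.min (Num.min d1 d2) (Num.min (Num.min d3 d4) d5)).
  by rewrite !lt_min d10 d20 d30 d40.
move=> s t; rewrite !le_min => /andP[/andP[s1 s2] /andP[/andP[s3 s4] s5]].
move=> /andP[/andP[t1 t2] /andP[/andP[t3 t4] t5]].
set u := `|s| + `|t|; have u0 : 0 <= u by rewrite addr_ge0.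
set g' := g (x + s) (y + t); set h' := h (x + s) (y + t).
have -> : g' * h' - g x y * h x y - (s *: (A * h x y + g x y * A') + t *: (B * h x y + g x y * B')) =
   (g' - g x y) * (h' - h x y) + (g' - g x y - (s *: A + t *: B)) * h x y +
   g x y * (h' - h x y - (s *: A' + t *: B')).
  by move: g' h' (g x y) (h x y) => *; quat_ring.
have b1 : `|(g' - g x y) * (h' - h x y)| <= eps / 3 * u.
  rewrite qnormM; have l1 := L1 s t s1 t1; have l2 := L2 s t s2 t2.
  apply: le_trans (ler_pM _ _ l1 l2) _; rewrite ?normr_ge0 //.
  have u5 : u <= 2 * d5 by rewrite mulrDl !mul1r lerD.
  rewrite -/u mulrACA [K * K' * _]mulrA ler_wpM2r //.
  apply: (@le_trans _ _ (K * K' * (2 * d5))); first by rewrite ler_wpM2l // mulr_ge0.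
  have -> : K * K' * (2 * d5) = eps / 3 * (K * K' / (K * K' + 1)).
    by rewrite /d5; field; rewrite gt_eqF // ltr_wpDl // mulr_ge0.
  rewrite ger_pMr ?divr_gt0 // ler_pdivrMr ?mul1r ?lerDl // ltr_wpDl // mulr_ge0 //.
have b2 : `|(g' - g x y - (s *: A + t *: B)) * h x y| <= eps / 3 * u.
  rewrite qnormM; have := ler_wpM2r (normr_ge0 (h x y)) (H3 s t s3 t3); move/le_trans; apply.
  have -> : eps / (3 * (M + 1)) * (`|s| + `|t|) * `|h x y| = eps / 3 * u * (M / (M + 1)).
    by rewrite -/u -/M; field; rewrite gt_eqF // ltr_wpDl // normr_ge0.
  rewrite ler_piMr ?mulr_ge0 ?(ltW eps0) ?invr_ge0 //.
  by rewrite ler_pdivrMr ?mul1r ?lerDl // ltr_wpDl // normr_ge0.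
have b3 : `|g x y * (h' - h x y - (s *: A' + t *: B'))| <= eps / 3 * u.
  rewrite qnormM; have := ler_wpM2l (normr_ge0 (g x y)) (H4 s t s4 t4); move/le_trans; apply.
  have -> : `|g x y| * (eps / (3 * (G + 1)) * (`|s| + `|t|)) = eps / 3 * u * (G / (G + 1)).
    by rewrite -/u -/G; field; rewrite gt_eqF // ltr_wpDl // normr_ge0.
  rewrite ler_piMr ?mulr_ge0 ?(ltW eps0) ?invr_ge0 //.
  by rewrite ler_pdivrMr ?mul1r ?lerDl // ltr_wpDl // normr_ge0.
apply: le_trans (ler_normD _ _) _; have := ler_normD ((g' - g x y) * (h' - h x y))
   ((g' - g x y - (s *: A + t *: B)) * h x y).
by move: b1 b2 b3; clear; lra.
Qed.

Lemma hsmall_small_at g x y A B v a b c d : hsmall g x y A B ->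
  small_at a b c d (fun x y => qre (qconj v * g x y)) x y
    (qre (qconj v * A)) (qre (qconj v * B)).
Proof.
move=> Hg eps eps0.
have v1 : 0 < `|v| + 1 by rewrite ltr_wpDl.
have [del del0 Hd] := Hg (eps / (`|v| + 1)) (divr_gt0 eps0 v1).
exists del => // x' y' _ _ hx hy.
have := Hd (x' - x) (y' - y) hx hy; rewrite !(addrC _ (_ - _)) !subrK => h.
have -> : qre (qconj v * g x' y') - qre (qconj v * g x y) - qre (qconj v * A) * (x' - x) -
   qre (qconj v * B) * (y' - y) =
   qre (qconj v * (g x' y' - g x y - ((x' - x) *: A + (y' - y) *: B))).
  by move: (g _ _) (g x y) => * /=; ring.
apply: le_trans (qre_le_norm _) _; rewrite qnormM qnorm_conj.
apply: le_trans (ler_wpM2l (normr_ge0 v) h) _.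
have -> : `|v| * (eps / (`|v| + 1) * (`|x' - x| + `|y' - y|)) =
   eps * (`|x' - x| + `|y' - y|) * (`|v| / (`|v| + 1)) by field; rewrite gt_eqF.
rewrite ler_piMr ?mulr_ge0 ?addr_ge0 ?(ltW eps0) //.
by rewrite ler_pdivrMr ?mul1r ?lerDl.
Qed.

Lemma hsmall_continuous g x y A B v : hsmall g x y A B ->
  {for x, continuous (fun x => qre (qconj v * g x y))} /\
  {for y, continuous (fun y => qre (qconj v * g x y))}.
Proof.
move=> /hsmall_lip [K [K0 [del del0 L]]].
have cont (w : R -> R) z (M : R) : 0 <= M ->
    (forall s, `|s| <= del -> `|w (z + s) - w z| <= M * `|s|) -> {for z, continuous w}.
  move=> M0 Hw; apply/cvgrPdist_le => eps eps0; near=> z'.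
  have E : z' = z + (z' - z) by rewrite addrC subrK.
  have zd : `|z' - z| <= Num.min del (eps / (M + 1)).
    rewrite distrC; near: z'; have h : (fun z' : R => z') @ nbhs z --> z by exact: cvg_id.
    move/cvgrPdist_le : h; apply.
    by rewrite lt_min del0 divr_gt0 // ltr_wpDl.
  rewrite distrC {1}E; move: zd; rewrite le_min => /andP[zd1 zd2].
  apply: le_trans (Hw _ zd1) _.
  apply: (@le_trans _ _ (M * (eps / (M + 1)))); first by rewrite ler_wpM2l.
  have -> : M * (eps / (M + 1)) = eps * (M / (M + 1)) by field; rewrite gt_eqF // ltr_wpDl.
  by rewrite ger_pMr // ler_pdivrMr ?mul1r ?lerDl // ltr_wpDl.
have bound (p q : H) (M : R) : `|p - q| <= M ->
    `|qre (qconj v * p) - qre (qconj v * q)| <= `|v| * M.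
  move=> pq; have -> : qre (qconj v * p) - qre (qconj v * q) = qre (qconj v * (p - q)).
    by rewrite /=; ring.
  apply: le_trans (qre_le_norm _) _; rewrite qnormM qnorm_conj ler_wpM2l //.
split; apply: (@cont _ _ (`|v| * K)); rewrite ?mulr_ge0 // => s sd; rewrite -mulrA; apply: bound.
  by have := L s 0 sd; rewrite normr0 addr0 => /(_ (ltW del0)); rewrite addr0.
by have := L 0 s; rewrite normr0 add0r => /(_ (ltW del0) sd); rewrite addr0.
Unshelve. all: by end_near.
Qed.

End TwoVariable.

Section SliceComposition.
Variable R : realType.
Local Notation H := (quaternion R).
Local Notation C := R[i].
Variable I : H.
Hypothesis II : imag_units R I.
Implicit Types (z w t : C) (F : C -> H).

Lemma hsmall_comp F (u : R -> R -> C) x y (a b : C) D :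
  hsmall (fun x y => em I (u x y)) x y (em I a) (em I b) -> hder I F (u x y) D ->
  hsmall (fun x y => F (u x y)) x y (em I a * D) (em I b * D).
Proof.
move=> Hu HF eps eps0.
have [K [K0 [d1 d10 L]]] := hsmall_lip Hu.
have K1 : 0 < 2 * (K + 1) by rewrite mulr_gt0 // ltr_wpDl.
have D1 : 0 < 2 * (`|D| + 1) by rewrite mulr_gt0 // ltr_wpDl.
have [d2 d20 H2] := HF (eps / (2 * (K + 1))) (divr_gt0 eps0 K1).
have [d3 d30 H3] := Hu (eps / (2 * (`|D| + 1))) (divr_gt0 eps0 D1).
pose d4 := d2 / (2 * (K + 1)).
have d40 : 0 < d4 by rewrite divr_gt0.
exists (Num.min d1 (Num.min d3 d4)); first by rewrite !lt_min d10 d30.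
move=> s t; rewrite !le_min => /andP[s1 /andP[s3 s4]] /andP[t1 /andP[t3 t4]].
set U := `|s| + `|t|; have U0 : 0 <= U by rewrite addr_ge0.
pose tau := u (x + s) (y + t) - u x y.
have tauE : u (x + s) (y + t) = u x y + tau by rewrite /tau addrCA subrr addr0.
have ctau : cmod tau <= K * U by rewrite -(em_norm II) emB; exact: L.
have tau2 : cmod tau <= d2.
  apply: le_trans ctau _; have : U <= 2 * d4 by rewrite mulrDl !mul1r lerD.
  move/(ler_wpM2l K0)/le_trans; apply.
  have -> : K * (2 * d4) = d2 * (K / (K + 1)) by rewrite /d4; field; rewrite gt_eqF // ltr_wpDl.
  by rewrite ger_pMr // ler_pdivrMr ?mul1r ?lerDl // ltr_wpDl.
have b1 := H2 tau tau2; have b2 := H3 s t s3 t3; rewrite -tauE in b1.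
have emtau : em I tau = em I (u (x + s) (y + t)) - em I (u x y) by rewrite emB.
have -> : F (u (x + s) (y + t)) - F (u x y) - (s *: (em I a * D) + t *: (em I b * D)) =
   (F (u (x + s) (y + t)) - F (u x y) - em I tau * D) +
   (em I (u (x + s) (y + t)) - em I (u x y) - (s *: em I a + t *: em I b)) * D.
  rewrite emtau; move: (F _) (F (u x y)) (em I (u (x + s) _)) (em I (u x y)) (em I a) (em I b) => *.
  by quat_ring.
apply: le_trans (ler_normD _ _) _.
have c1 : eps / (2 * (K + 1)) * cmod tau <= eps / 2 * U.
  apply: le_trans (ler_wpM2l _ ctau) _; first by rewrite divr_ge0 // ltW.
  have -> : eps / (2 * (K + 1)) * (K * U) = eps / 2 * U * (K / (K + 1)).
    by field; rewrite gt_eqF // ltr_wpDl.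
  by rewrite ler_piMr ?mulr_ge0 ?invr_ge0 ?(ltW eps0) // ler_pdivrMr ?mul1r ?lerDl // ltr_wpDl.
have c2 : `|(em I (u (x + s) (y + t)) - em I (u x y) - (s *: em I a + t *: em I b)) * D| <= eps / 2 * U.
  rewrite qnormM; apply: le_trans (ler_wpM2r (normr_ge0 D) b2) _.
  have -> : eps / (2 * (`|D| + 1)) * (`|s| + `|t|) * `|D| = eps / 2 * U * (`|D| / (`|D| + 1)).
    by rewrite -/U; field; rewrite gt_eqF // ltr_wpDl.
  by rewrite ler_piMr ?mulr_ge0 ?invr_ge0 ?(ltW eps0) // ler_pdivrMr ?mul1r ?lerDl // ltr_wpDl.
have := lerD (le_trans b1 c1) c2; move/le_trans; apply.
by rewrite -mulrDl -mulrDr; rewrite ler_wpM2r //; lra.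
Qed.

Definition circ (th : R) : C := cos th +i* sin th.

Lemma hsmall_circ x y : hsmall (fun _ th => em I (circ th)) x y 0 (em I ('i * circ y)).
Proof.
move=> eps eps0; have e2 : 0 < eps / 2 by rewrite divr_gt0.
have [d1 d10 H1] := is_derive_expand (is_derive_cos y) e2.
have [d2 d20 H2] := is_derive_expand (is_derive_sin y) e2.
exists (Num.min d1 d2); first by rewrite lt_min d10.
move=> s t _; rewrite le_min => /andP[t1 t2].
have b1 := H1 t t1; have b2 := H2 t t2.
rewrite scaler0 add0r -[t]/(complex.Re (t +i* 0)).
set c1 := cos (y + t) - cos y - - sin y * t in b1.
set c2 := sin (y + t) - sin y - cos y * t in b2.
have -> : em I (circ (y + t)) - em I (circ y) - t *: em I ('i * circ y) = c1%:A + c2 *: I.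
  rewrite /em /slice_point /circ /c1 /c2 /=.
  by move: (cos _) (sin _) (cos y) (sin y) => *; quat_ring.
apply: le_trans (ler_normD _ _) _; rewrite !normrZ qnorm1 (imag_unit_norm II) !mulr1.
have := mulr_ge0 (ltW eps0) (normr_ge0 s); move: b1 b2; rewrite mulrDr; lra.
Qed.

End SliceComposition.

(** * Integrals over the circle and Cauchy's theorem *)

Section CircleIntegral.
Variable R : realType.
Implicit Types (g h G : R -> R).

Definition circ_prim g G := primitive_on 0 (2 * pi) g G.
(** Does not depend on the primitive, by [cintE]. Without a primitive the default gives 0, so values
    are always used together with [cintegrable]. *)
Definition cint g : R :=
  let G := xget (fun=> 0) [set G | circ_prim g G] in G (2 * pi) - G 0.
Definition cintegrable g := exists G, circ_prim g G.

Let pi2 : 0 < 2 * pi :> R. Proof. by rewrite mulr_gt0 // pi_gt0. Qed.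

Lemma cintE g G : circ_prim g G -> cint g = G (2 * pi) - G 0.
Proof.
move=> PG; rewrite /cint; set G' := xget _ _.
have PG' : circ_prim g G' by rewrite /G'; exact: (@xgetPex _ (fun=> 0) [set G | circ_prim g G] (ex_intro _ G PG)).
exact: (primitive_eq (ltW pi2) PG' PG).
Qed.

Lemma cintegrable_cont g : {within `[0, 2 * pi], continuous g} -> cintegrable g.
Proof. by move=> cg; have [G PG] := primitive_exists pi2 cg; exists G. Qed.

Lemma cint_lin (r : R) g h : cintegrable g -> cintegrable h ->
  cintegrable (fun x => r * g x + h x) /\
  cint (fun x => r * g x + h x) = r * cint g + cint h.
Proof.
move=> [G PG] [K PK]; have P := primitive_lin r PG PK; split; first by exists (fun x => r * G x + K x).
by rewrite (cintE P) (cintE PG) (cintE PK); ring.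
Qed.

Lemma cint_bound g (M : R) : cintegrable g -> (forall x, `|g x| <= M) ->
  `|cint g| <= M * (2 * pi).
Proof.
move=> [G PG] Hg; rewrite (cintE PG).
have [c _ ->] := primitive_mvt PG (lexx 0) (ltW pi2) (lexx (2 * pi)).
by rewrite subr0 normrM (ger0_norm (ltW pi2)) ler_wpM2r // ltW.
Qed.

Lemma cint0 : cintegrable (fun=> 0) /\ cint (fun=> 0) = 0.
Proof.
have P : circ_prim (fun=> 0) (fun=> 0).
  by split => [x|x _]; [exact: cvg_cst|exact: is_derive_cst].
by split; [exists (fun=> 0)|rewrite (cintE P) subrr].
Qed.

Lemma cint_sum (n : nat) (g : nat -> R -> R) : (forall i, cintegrable (g i)) ->
  cintegrable (fun x => \sum_(i < n) g i x) /\
  cint (fun x => \sum_(i < n) g i x) = \sum_(i < n) cint (g i).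
Proof.
move=> Hg; elim: n => [|n [IH1 IH2]].
  have [h1 h2] := cint0; rewrite big_ord0.
  by have -> : (fun x => \sum_(i < 0) g i x) = (fun=> 0) by apply/funext => x; rewrite big_ord0.
have -> : (fun x => \sum_(i < n.+1) g i x) = (fun x => 1 * (\sum_(i < n) g i x) + g n x).
  by apply/funext => x; rewrite big_ord_recr mul1r.
have [h1 h2] := cint_lin 1 IH1 (Hg n); split => //.
by rewrite h2 IH2 mul1r big_ord_recr.
Qed.

End CircleIntegral.

Section Cauchy.
Variable R : realType.
Local Notation H := (quaternion R).
Local Notation C := R[i].
Variable I : H.
Hypothesis II : imag_units R I.
Variable F : C -> H.
Hypothesis hF : forall z, cmod z < 1 -> exists D, hder I F z D.
Local Notation em := (em I).

Lemma hsmall_eq (g g' : R -> R -> H) x y A B A' B' : (forall x y, g x y = g' x y) ->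
  A = A' -> B = B' -> hsmall g x y A B -> hsmall g' x y A' B'.
Proof. by move=> E <- <- Hg; have -> : g' = g by apply/funext => s; apply/funext => t. Qed.

Lemma hder_quot w z D : z != w -> hder I F z D ->
  exists D', hder I (fun z => em (z - w)^-1 * (F z - F w)) z D'.
Proof.
move=> zw HF; set k := z - w; have k0 : k != 0 by rewrite subr_eq0.
have ck : 0 < cmod k by rewrite lt_neqAle cmod_ge0 andbT eq_sym; apply: contraNneq k0 => /cmod_eq0 ->.
exists (em k^-1 * D - em (k^-1 ^+ 2) * (F z - F w)) => eps eps0.
pose ik := (cmod k)^-1; have ik0 : 0 < ik by rewrite invr_gt0.
pose M := 2 * ik ^+ 2 * `|D| + 2 * ik ^+ 3 * `|F z - F w|.
have M0 : 0 <= M by rewrite addr_ge0 // !mulr_ge0 // ?exprn_ge0 // ltW.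
have e1 : 0 < eps / (4 * ik) by rewrite divr_gt0 // mulr_gt0.
have [d1 d10 H1] := HF _ e1.
pose d2 := eps / (2 * (M + 1)).
have M1 : 0 < 2 * (M + 1) by rewrite mulr_gt0 // ltr_wpDl.
have d20 : 0 < d2 by rewrite divr_gt0.
exists (Num.min (cmod k / 2) (Num.min d1 d2)); first by rewrite !lt_min divr_gt0 // d10.
move=> t; rewrite !le_min => /andP[t0 /andP[t1 t2]].
have kt : cmod k / 2 <= cmod (k + t).
  have : cmod k <= cmod (k + t) + cmod t by rewrite -(cmodN t); apply: le_trans (cmodD _ _); rewrite addrK.
  lra.
have kt0 : k + t != 0 by apply/eqP => h; move: kt; rewrite h cmod0 leNgt divr_gt0.
have ikt : cmod (k + t)^-1 <= 2 * ik.
  rewrite cmodV; have -> : 2 * ik = (cmod k / 2)^-1 by rewrite /ik; field; rewrite gt_eqF.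
  by rewrite lef_pV2 // posrE ?divr_gt0 // (lt_le_trans _ kt) // divr_gt0.
have -> : z + t - w = k + t by rewrite /k addrAC.
have E1 : (k + t)^-1 = k^-1 - t * k^-1 * (k + t)^-1 by field; rewrite k0 kt0.
have E2 : (k + t)^-1 = k^-1 - t * k^-1 ^+ 2 + t ^+ 2 * k^-1 ^+ 2 * (k + t)^-1.
  by field; rewrite k0 kt0.
have -> : em (k + t)^-1 * (F (z + t) - F w) - em k^-1 * (F z - F w) -
    em t * (em k^-1 * D - em (k^-1 ^+ 2) * (F z - F w)) =
   em (k + t)^-1 * (F (z + t) - F z - em t * D) - em (t ^+ 2 * k^-1 * (k + t)^-1) * D +
   em (t ^+ 2 * k^-1 ^+ 2 * (k + t)^-1) * (F z - F w).
  have -> : em (t ^+ 2 * k^-1 * (k + t)^-1) = em t * em k^-1 - em (k + t)^-1 * em t.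
    rewrite -!(emM II) -emB; congr em; rewrite {2}E1; ring.
  have -> : em (t ^+ 2 * k^-1 ^+ 2 * (k + t)^-1) = em (k + t)^-1 - em k^-1 + em t * em (k^-1 ^+ 2).
    rewrite -!(emM II) -emB -emD; congr em; rewrite {2}E2; ring.
  move: (em (k + t)^-1) (em k^-1) (em t) (em (k^-1 ^+ 2)) (F (z + t)) (F z) (F w) => a b c d e f g.
  quat_ring.
have b1 : `|em (k + t)^-1 * (F (z + t) - F z - em t * D)| <= eps / 2 * cmod t.
  rewrite qnormM (em_norm II); apply: le_trans (ler_pM _ _ ikt (H1 t t1)) _; rewrite ?cmod_ge0 //.
  by rewrite le_eqVlt; apply/orP; left; apply/eqP; field; rewrite gt_eqF.
have ct0 := cmod_ge0 t.
have b2 : `|em (t ^+ 2 * k^-1 * (k + t)^-1) * D| <= cmod t * (cmod t * (2 * ik ^+ 2 * `|D|)).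
  rewrite qnormM (em_norm II) 2!cmodM cmodX [cmod k^-1]cmodV -/ik expr2.
  have -> : cmod t * (cmod t * (2 * ik ^+ 2 * `|D|)) = cmod t * cmod t * ik * (2 * ik) * `|D| by ring.
  by rewrite ler_wpM2r // ler_wpM2l // !mulr_ge0 // ltW.
have b3 : `|em (t ^+ 2 * k^-1 ^+ 2 * (k + t)^-1) * (F z - F w)| <=
    cmod t * (cmod t * (2 * ik ^+ 3 * `|F z - F w|)).
  rewrite qnormM (em_norm II) 2!cmodM !cmodX [cmod k^-1]cmodV -/ik.
  have -> : cmod t * (cmod t * (2 * ik ^+ 3 * `|F z - F w|)) =
     cmod t ^+ 2 * ik ^+ 2 * (2 * ik) * `|F z - F w| by ring.
  by rewrite ler_wpM2r // ler_wpM2l // !mulr_ge0 // ?exprn_ge0 // ltW.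
have b4 : cmod t * M <= eps / 2.
  apply: le_trans (ler_wpM2r M0 t2) _.
  have -> : d2 * M = eps / 2 * (M / (M + 1)) by rewrite /d2; field; rewrite gt_eqF // ltr_wpDl.
  by rewrite ler_piMr ?divr_ge0 ?(ltW eps0) // ler_pdivrMr ?mul1r ?lerDl // ltr_wpDl.
apply: le_trans (ler_normD _ _) _; have := ler_normB (em (k + t)^-1 * (F (z + t) - F z - em t * D))
  (em (t ^+ 2 * k^-1 * (k + t)^-1) * D).
have := ler_wpM2l ct0 b4; rewrite /M mulrDr; move: b1 b2 b3; clear; lra.
Qed.

Lemma cmod_circ th : cmod (circ th : C) = 1.
Proof. by rewrite cmodE /= cos2Dsin2 sqrtr1. Qed.

(* The circle of radius [r] is deformed into a small circle of radius [rho]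
   about [w] through [l * w + (r + (rho - r) * l) * circ th], which avoids [w]. *)
Lemma circle_cauchy (w : C) (r : R) (v : H) : cmod w < r -> r < 1 ->
  cintegrable (fun th => qre (qconj v * (em ((r%:C * circ th) / (r%:C * circ th - w)) *
     (F (r%:C * circ th) - F w)))) /\
  cint (fun th => qre (qconj v * (em ((r%:C * circ th) / (r%:C * circ th - w)) *
     (F (r%:C * circ th) - F w)))) = 0.
Proof.
move=> wr r1.
have r0 : 0 < r by rewrite (le_lt_trans (cmod_ge0 w)).
have pi20 : 0 < 2 * pi :> R by rewrite mulr_gt0 // pi_gt0.
(* dz = i z dth on the circle brings a factor I in front of the integrand; replacing v by [v0]
   cancels it. *)
pose v0 := qconj (- (qconj v * I)).
have v0I : qconj v0 * I = qconj v.
  by rewrite /v0 qconjK mulNr -mulrA (_ : I * I = -1) ?mulrN1 ?opprK //; exact: II.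
pose Gz z := em (z - w)^-1 * (F z - F w).
pose zf (rho l th : R) : C := l%:C * w + (r + (rho - r) * l)%:C * circ th.
pose zl (rho l th : R) : C := w + (rho - r)%:C * circ th.
pose zt (rho l th : R) : C := (r + (rho - r) * l)%:C * ('i * circ th).
pose Q rho l th : R := qre (qconj v0 * (em (zt rho l th) * Gz (zf rho l th))).
have Q0E th rho : Q rho 0 th = qre (qconj v * (em ((r%:C * circ th) / (r%:C * circ th - w)) *
     (F (r%:C * circ th) - F w))).
  rewrite /Q /zt /zf /Gz mulr0 addr0 rmorph0 mul0r add0r -v0I; congr qre.
  rewrite -[RHS]mulrA; congr (_ * _); rewrite [LHS]mulrA [RHS]mulrA; congr (_ * _).
  transitivity (em 'i * em (r%:C * circ th / (r%:C * circ th - w))); last by rewrite em_i.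
  by rewrite -!(emM II) complexiE; congr em; rewrite mulrCA !mulrA.
(* Goursat on [0, 1] x [0, 2 pi] for the pull-back of Gz dz along [zf]; P and Q are its components
   in l and th. *)
have main (rho : R) : 0 < rho -> rho <= r - cmod w ->
    cintegrable (Q rho 0) /\ cintegrable (Q rho 1) /\ cint (Q rho 0) = cint (Q rho 1).
  move=> rho0 rhor.
  have Hzf l th : hsmall (fun l th => em (zf rho l th)) l th (em (zl rho l th)) (em (zt rho l th)).
    have h1 := hsmallM (hsmall_affine 0 1 l th) (hsmall_const (em w) l th).
    have h2 := hsmallM (hsmall_affine r (rho - r) l th) (hsmall_circ II l th).
    have := hsmallD h1 h2; apply: hsmall_eq => [x y||].
    - by rewrite /zf emD !(emM II) !em_real add0r mul1r.
    - by rewrite /zl emD (emM II) em_real !(mulr0, addr0) scale1r mul1r.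
    - by rewrite /zt (emM II) em_real !(mul0r, mulr0, add0r).
  have Hzl l th : hsmall (fun l th => em (zl rho l th)) l th 0 (em ((rho - r)%:C * ('i * circ th))).
    have h2 := hsmallM (hsmall_const (rho - r)%:A l th) (hsmall_circ II l th).
    have := hsmallD (hsmall_const (em w) l th) h2; apply: hsmall_eq => [x y||].
    - by rewrite /zl emD (emM II) em_real.
    - by rewrite mul0r mulr0 !addr0.
    - by rewrite mul0r !add0r -(em_real I) -(emM II).
  have Hzt l th : hsmall (fun l th => em (zt rho l th)) l th
      (em ((rho - r)%:C * ('i * circ th))) (em (- (r + (rho - r) * l)%:C * circ th)).
    have h1 := hsmallM (hsmall_const (em 'i) l th) (hsmall_circ II l th).
    have := hsmallM (hsmall_affine r (rho - r) l th) h1; apply: hsmall_eq => [x y||].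
    - by rewrite /zt (emM II) em_real (emM II).
    - by rewrite (emM II) em_real (emM II) mul0r mulr0 addr0 mulr0 addr0.
    - rewrite !mul0r !add0r -!(emM II) -(em_real I) -(emM II); congr em.
      by rewrite -complexiE ['i%C * _]mulrA -expr2 sqr_i mulN1r mulNr mulrN.
  have zf_in l th : 0 <= l <= 1 -> cmod (zf rho l th) < 1 /\ zf rho l th != w.
    move=> /andP[l0 l1].
    have Rl : 0 <= r + (rho - r) * l.
      have -> : r + (rho - r) * l = r * (1 - l) + rho * l by ring.
      by rewrite addr_ge0 // mulr_ge0 ?subr_ge0 // ltW.
    split.
      apply: le_lt_trans (cmodD _ _) _; rewrite !cmodM !cmod_real cmod_circ mulr1 !ger0_norm //.
      apply: le_lt_trans r1; have : l * rho <= l * (r - cmod w) by rewrite ler_wpM2l.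
      lra.
    rewrite -subr_eq0; apply/eqP => h.
    have : (1 - l)%:C * w = (r + (rho - r) * l)%:C * circ th.
      rewrite -[RHS]subr0 -h /zf (realcD 1) (realcN l) rmorph1; ring.
    move/(congr1 (@cmod R)); rewrite !cmodM !cmod_real cmod_circ mulr1 !ger0_norm ?subr_ge0 // => E.
    have p1 : (1 - l) * cmod w <= (1 - l) * r by rewrite ler_wpM2l ?subr_ge0 // ltW.
    have [l1'|l1'] := eqVneq l 1.
      by move: E; rewrite l1' subrr mul0r => E; move: rho0; lra.
    have p2 : (1 - l) * cmod w < (1 - l) * r by rewrite ltr_pM2l // subr_gt0 lt_neqAle l1'.
    have : 0 <= l * rho by rewrite mulr_ge0 // ltW.
    lra.
  have HG l th : 0 <= l <= 1 -> exists D, hsmall (fun l th => Gz (zf rho l th)) l th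
      (em (zl rho l th) * D) (em (zt rho l th) * D).
    move=> /(zf_in l th) [h1 h2]; have [D HD] := hF h1.
    have [D' HD'] := hder_quot h2 HD; exists D'.
    exact: (hsmall_comp II (Hzf l th) HD').
  pose P l th : R := qre (qconj v0 * (em (zl rho l th) * Gz (zf rho l th))).
  have HPQ l th : 0 <= l <= 1 -> exists A P1 Q2,
     [/\ small_at 0 1 0 (2 * pi) P l th P1 A, small_at 0 1 0 (2 * pi) (Q rho) l th A Q2,
      {for l, continuous (fun l => P l th)} & {for th, continuous (Q rho l)}].
    move=> l01; have [D HD] := HG l th l01.
    have hP := hsmallM (Hzl l th) HD; have hQ := hsmallM (Hzt l th) HD.
    do 3 eexists; split.
    - exact: (hsmall_small_at v0 0 1 0 (2 * pi) hP).
    - have := hsmall_small_at v0 0 1 0 (2 * pi) hQ.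
      congr small_at; congr (qre (qconj v0 * (_ + _))).
      by rewrite !mulrA; congr (_ * _); exact: em_commute.
    - exact: (hsmall_continuous v0 hP).1.
    - exact: (hsmall_continuous v0 hQ).2.
  have CQ l : 0 <= l <= 1 -> cintegrable (Q rho l).
    move=> l01; apply: cintegrable_cont; apply: continuous_in_subspaceT => th _.
    by have [A [P1 [Q2 []]]] := HPQ l th l01.
  have l0 : 0 <= (0 : R) <= 1 by rewrite lexx ler01.
  have l1 : 0 <= (1 : R) <= 1 by rewrite lexx ler01.
  split; first exact: CQ; split; first exact: CQ.
  have exU th : exists U, primitive_on 0 1 (fun l => P l th) U.
    apply: primitive_exists; first exact: ltr01.
    apply: continuous_in_subspaceT => l; rewrite inE /= in_itv /= => l01.
    by have [A [P1 [Q2 []]]] := HPQ l th l01.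
  pose Uf (g : R -> R) := xget (fun=> 0) [set G | primitive_on 0 1 g G].
  pose U l th := Uf (fun l => P l th) l.
  have HU th : primitive_on 0 1 (fun l => P l th) (fun l => U l th).
    rewrite /U /Uf; exact: (@xgetPex _ (fun=> 0) [set G | primitive_on 0 1 (fun l => P l th) G] (exU th)).
  pose V l := xget (fun=> 0) [set G | circ_prim (Q rho l) G].
  have HV l : 0 <= l <= 1 -> circ_prim (Q rho l) (V l).
    move=> /CQ h; rewrite /V; exact: (@xgetPex _ (fun=> 0) [set G | circ_prim (Q rho l) G] h).
  have := @goursat R P (Q rho) U V 0 1 0 (2 * pi) ltr01 pi20 (fun y _ => HU y) HV.
  move=> /(_ _) G0.
  have {}G0 := G0 (fun l th l01 _ => let: ex_intro A (ex_intro P1 (ex_intro Q2 (And4 a b _ _))) := HPQ l th l01 in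
     ex_intro _ A (ex_intro _ P1 (ex_intro _ Q2 (conj a b)))).
  (* By periodicity the sides th = 0 and th = 2 pi cancel, leaving the circles l = 0 and l = 1. *)
  have UE : forall l, U l 0 = U l (2 * pi).
    move=> l; rewrite /U; congr (Uf _ l); apply/funext => l'.
    rewrite /P /zl /zf (_ : circ (2 * pi) = circ 0 :> C) //.
    by rewrite /circ cos0 sin0 -[2 * pi]add0r mulr2n mulrDl mul1r addrA !(cosDpi, sinDpi) cos0 sin0 !opprK.
  rewrite (cintE (HV _ l0)) (cintE (HV _ l1)).
  move: G0; rewrite !UE; lra.
have rw : 0 < r - cmod w by rewrite subr_gt0.
have w1 : cmod w < 1 by apply: lt_trans r1.
have [D HD] := hF w1.
have [del del0 Hdel] := HD 1 ltr01.
have [CI _] := main _ rw (lexx _).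
have Q0fun rho : Q rho 0 = fun th => qre (qconj v * (em ((r%:C * circ th) / (r%:C * circ th - w)) *
     (F (r%:C * circ th) - F w))) by apply/funext => th; exact: Q0E.
rewrite Q0fun in CI; split => //.
set c := cint _.
pose K := `|v0| * (`|D| + 1) * (2 * pi).
have K0 : 0 <= K by rewrite mulr_ge0 ?(ltW pi20) // mulr_ge0 // addr_ge0.
(* On the circle of radius rho the difference quotient is bounded by |D| + 1 and dz contributes rho,
   so the integral tends to 0. *)
have small (rho : R) : 0 < rho -> rho <= r - cmod w -> rho <= del -> `|c| <= rho * K.
  move=> rho0 rhow rhod; have [_ [C1]] := main rho rho0 rhow; rewrite Q0fun -/c => ->.
  have -> : rho * K = (`|v0| * (rho * (`|D| + 1))) * (2 * pi) by rewrite /K; ring.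
  apply: cint_bound => // th; rewrite /Q; apply: le_trans (qre_le_norm _) _.
  rewrite !qnormM qnorm_conj ler_wpM2l // !(em_norm II) /zt /zf /Gz.
  have -> : r + (rho - r) * 1 = rho by ring.
  rewrite rmorph1 mul1r ?qnormM ?(em_norm II) [w + _ - w]addrAC subrr add0r.
  have crho : cmod (rho%:C * circ th) = rho by rewrite cmodM cmod_real cmod_circ mulr1 gtr0_norm.
  rewrite !cmodM cmodV crho cmod_circ cmod_real gtr0_norm // mulr1.
  rewrite (_ : cmod 'i = 1); last by rewrite cmodE /= expr0n expr1n add0r sqrtr1.
  rewrite mulr1 mulrA divff ?gt_eqF // mul1r.
  have := Hdel (rho%:C * circ th); rewrite crho => /(_ rhod) h.
  have -> : F (w + rho%:C * circ th) - F w = (F (w + rho%:C * circ th) - F w - em (rho%:C * circ th) * D)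
     + em (rho%:C * circ th) * D by rewrite subrK.
  apply: le_trans (ler_normD _ _) _; rewrite qnormM (em_norm II) crho; lra.
apply/eqP; rewrite -normr_eq0 eq_le normr_ge0 andbT leNgt; apply/negP => c0.
pose rho := Num.min (Num.min (r - cmod w) del) (`|c| / (2 * (K + 1))).
have K1 : 0 < 2 * (K + 1) by rewrite mulr_gt0 // ltr_wpDl.
have rho0 : 0 < rho by rewrite !lt_min rw del0 divr_gt0.
have := small rho rho0; rewrite /rho !ge_min !lexx /= orbT => /(_ isT isT).
apply/negP; rewrite -ltNge -/rho.
apply: (@le_lt_trans _ _ (`|c| / (2 * (K + 1)) * K)).
  by rewrite ler_wpM2r // /rho ge_min lexx orbT.
have -> : `|c| / (2 * (K + 1)) * K = `|c| / 2 * (K / (K + 1)) by field; rewrite gt_eqF // ltr_wpDl.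
apply: (@le_lt_trans _ _ (`|c| / 2)); last by lra.
by rewrite ler_piMr ?divr_ge0 // ler_pdivrMr ?mul1r ?lerDl // ltr_wpDl.
Qed.

End Cauchy.

Section QuaternionCircleIntegral.
Variable R : realType.
Local Notation H := (quaternion R).
Implicit Types (g h : R -> H) (x y c : H).

(** Weak form of a quaternionic integral: real integrals against all v. Constant factors on either
    side of g are moved onto v. *)
Definition is_hint g x := forall v : H, cintegrable (fun th => qre (qconj v * g th)) /\
  cint (fun th => qre (qconj v * g th)) = qre (qconj v * x).

Lemma is_hint_ext g h x y : g =1 h -> x = y -> is_hint g x -> is_hint h y.
Proof. by move=> /funext -> ->. Qed.

Lemma is_hintD g h x y : is_hint g x -> is_hint h y -> is_hint (fun th => g th + h th) (x + y).
Proof.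
move=> Hg Hh v; have [g1 g2] := Hg v; have [h1 h2] := Hh v.
have [k1 k2] := cint_lin 1 g1 h1.
have E : (fun th => qre (qconj v * (g th + h th))) =
  (fun th => 1 * qre (qconj v * g th) + qre (qconj v * h th)).
  by apply/funext => th; rewrite mul1r mulrDr.
by rewrite E; split => //; rewrite k2 g2 h2 mul1r [in RHS]mulrDr.
Qed.

Lemma is_hintMl c g x : is_hint g x -> is_hint (fun th => c * g th) (c * x).
Proof.
move=> Hg v; have [g1 g2] := Hg (qconj c * v).
have E y : qre (qconj v * (c * y)) = qre (qconj (qconj c * v) * y).
  by rewrite qconjM qconjK mulrA.
by rewrite E -g2; split; [move: g1; congr cintegrable|congr cint]; apply/funext => th; rewrite E.
Qed.

Lemma is_hintMr c g x : is_hint g x -> is_hint (fun th => g th * c) (x * c).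
Proof.
move=> Hg v; have [g1 g2] := Hg (v * qconj c).
have E y : qre (qconj v * (y * c)) = qre (qconj (v * qconj c) * y).
  by rewrite qconjM qconjK mulrA qre_comm mulrA.
by rewrite E -g2; split; [move: g1; congr cintegrable|congr cint]; apply/funext => th; rewrite E.
Qed.

Lemma is_hint0 : is_hint (fun=> 0) 0.
Proof. by move=> v; rewrite mulr0 qre0; exact: cint0. Qed.

Lemma is_hintN g x : is_hint g x -> is_hint (fun th => - g th) (- x).
Proof.
move=> /(is_hintMl (-1)); apply: is_hint_ext; last by rewrite mulN1r.
by move=> th; rewrite mulN1r.
Qed.

Lemma is_hint_sum n (g : nat -> R -> H) (x : nat -> H) : (forall i, is_hint (g i) (x i)) ->
  is_hint (fun th => \sum_(i < n) g i th) (\sum_(i < n) x i).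
Proof.
move=> Hg; elim: n => [|n IH].
  by apply: is_hint_ext is_hint0 => [th|]; rewrite big_ord0.
by apply: is_hint_ext (is_hintD IH (Hg n)) => [th|]; rewrite big_ord_recr.
Qed.

(** Test against v = x and divide by |x|. *)
Lemma is_hint_bound g x (M : R) : 0 <= M -> is_hint g x -> (forall th, `|g th| <= M) ->
  `|x| <= 2 * pi * M.
Proof.
move=> M0 /(_ x) [g1 g2] HM.
have [->|x0] := eqVneq x 0.
  by rewrite normr0 mulr_ge0 // mulr_ge0 // pi_ge0.
have x1 : 0 < `|x| by rewrite normr_gt0.
have : `|x| ^+ 2 <= `|x| * M * (2 * pi).
  rewrite -qre_conjM_self -g2; apply: le_trans (ler_norm _) _; apply: cint_bound => // th.
  by apply: le_trans (qre_le_norm _) _; rewrite qnormM qnorm_conj ler_wpM2l.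
by rewrite expr2 -mulrA ler_pM2l // mulrC.
Qed.

Lemma is_hint_exists g : (forall v, cintegrable (fun th => qre (qconj v * g th))) ->
  exists x, is_hint g x.
Proof.
move=> Hg; have E v x : qre (qconj v * x) =
  qre v * qre x + (qim1 v * qim1 x + (qim2 v * qim2 x + (qim3 v * qim3 x + 0))).
  by rewrite qre_conjM; ring.
have i0 : cintegrable (fun th => qre (g th)).
  move: (Hg 1); congr cintegrable; apply/funext => th; rewrite E /=; ring.
have i1 : cintegrable (fun th => qim1 (g th)).
  move: (Hg (Quat 0 1 0 0)); congr cintegrable; apply/funext => th; rewrite E /=; ring.
have i2 : cintegrable (fun th => qim2 (g th)).
  move: (Hg (Quat 0 0 1 0)); congr cintegrable; apply/funext => th; rewrite E /=; ring.
have i3 : cintegrable (fun th => qim3 (g th)).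
  move: (Hg (Quat 0 0 0 1)); congr cintegrable; apply/funext => th; rewrite E /=; ring.
exists (Quat (cint (fun th => qre (g th))) (cint (fun th => qim1 (g th)))
   (cint (fun th => qim2 (g th))) (cint (fun th => qim3 (g th)))) => v.
have [z1 z2] := cint0 R.
have [a1 a2] := cint_lin (qim3 v) i3 z1.
have [b1 b2] := cint_lin (qim2 v) i2 a1.
have [c1 c2] := cint_lin (qim1 v) i1 b1.
have [d1 d2] := cint_lin (qre v) i0 c1.
have F : (fun th => qre (qconj v * g th)) = (fun th => qre v * qre (g th) +
  (qim1 v * qim1 (g th) + (qim2 v * qim2 (g th) + (qim3 v * qim3 (g th) + 0)))).
  by apply/funext => th; rewrite E.
by rewrite E F; split; [exact: d1|rewrite d2 c2 b2 a2 z2].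
Qed.

End QuaternionCircleIntegral.

Section CircleMoments.
Variable R : realType.
Local Notation H := (quaternion R).
Local Notation C := R[i].

Lemma circD (s t : R) : circ (s + t) = circ s * circ t :> C.
Proof. by rewrite /circ cosD sinD; apply/eqP; rewrite eq_complex /= eqxx addrC eqxx. Qed.

Lemma circ0 : circ 0 = 1 :> C.
Proof. by rewrite /circ cos0 sin0. Qed.

Lemma circ_neq0 (t : R) : circ t != 0 :> C.
Proof. by apply/eqP => /(congr1 (@cmod R)); rewrite cmod_circ cmod0 => /eqP; rewrite oner_eq0. Qed.

Lemma circN (t : R) : circ (- t) = (circ t)^-1 :> C.
Proof. by apply: (mulIf (circ_neq0 t)); rewrite -circD addNr circ0 mulVf ?circ_neq0. Qed.

Lemma circM (m : nat) (t : R) : circ (m%:R * t) = circ t ^+ m :> C.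
Proof. by elim: m => [|m IH]; rewrite ?mul0r ?circ0 // -natr1 mulrDl mul1r circD IH exprSr. Qed.

Lemma circ_2pi : circ (2 * pi) = 1 :> C.
Proof.
rewrite -circ0 /circ cos0 sin0 -[2 * pi]add0r mulr2n mulrDl mul1r addrA !(cosDpi, sinDpi).
by rewrite cos0 sin0 !opprK.
Qed.

Variable I : H.
Hypothesis II : imag_units R I.

Lemma is_hint_const (c : H) : is_hint (fun=> c) ((2 * pi)%:A * c).
Proof.
move=> v; have P1 : circ_prim (fun=> 1 : R) id.
  by split => [x|x _]; [apply: continuous_subspaceT => y; exact: cvg_id|exact: is_derive_id].
have P0 : circ_prim (fun=> 0 : R) (fun=> 0).
  by split => [x|x _]; [exact: cvg_cst|exact: is_derive_cst].
have /= := primitive_lin (qre (qconj v * c)) P1 P0.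
rewrite mulr1 addr0 => P; split; first by eexists; exact: P.
by rewrite (cintE P) mulr0 !addr0 subr0 /=; ring.
Qed.

Lemma is_hint_moment (m : nat) :
  is_hint (fun th => em I (circ (- th) ^+ m)) (if m is 0 then (2 * pi)%:A else 0 : H).
Proof.
case: m => [|m].
  by apply: is_hint_ext (is_hint_const 1) => [th|]; rewrite ?expr0 ?em1 ?mulr1.
move=> v; set n : R := m.+1%:R.
have n0 : n != 0 by rewrite pnatr_eq0.
pose a := qre (qconj v); pose b := qre (qconj v * I).
have Pc : circ_prim (fun th => cos (n * th)) (fun th => n^-1 * sin (n * th)).
  have D (x : R) : is_derive x 1 (fun th => n^-1 * sin (n * th)) (cos (n * x)).
    have D1 : is_derive x 1 (fun th : R => n * th) n.
      by apply: is_derive_eq; rewrite /GRing.scale /= mulr1.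
    have D2 := is_derive1_comp (is_derive_sin (n * x)) D1.
    by apply: is_derive_eq; rewrite /GRing.scale /= mulrCA mulVf ?mulr1.
  split => [|x _]; last exact: D.
  by apply: continuous_subspaceT => x; apply: differentiable_continuous; apply/derivable1_diffP; case: (D x).
have Ps : circ_prim (fun th => sin (n * th)) (fun th => - n^-1 * cos (n * th)).
  have D (x : R) : is_derive x 1 (fun th => - n^-1 * cos (n * th)) (sin (n * x)).
    have D1 : is_derive x 1 (fun th : R => n * th) n.
      by apply: is_derive_eq; rewrite /GRing.scale /= mulr1.
    have D2 := is_derive1_comp (is_derive_cos (n * x)) D1.
    by apply: is_derive_eq; rewrite /GRing.scale /=; field.
  split => [|x _]; last exact: D.
  by apply: continuous_subspaceT => x; apply: differentiable_continuous; apply/derivable1_diffP; case: (D x).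
have P0 : circ_prim (fun=> 0 : R) (fun=> 0).
  by split => [x|x _]; [exact: cvg_cst|exact: is_derive_cst].
have P := primitive_lin a Pc (primitive_lin (- b) Ps P0).
have E : (fun th => qre (qconj v * em I (circ (- th) ^+ m.+1))) =
    (fun th => a * cos (n * th) + (- b * sin (n * th) + 0)).
  have em_cart x y : qre (qconj v * em I (x +i* y)) = a * x + b * y.
    have -> : em I (x +i* y) = x%:A + y *: I by [].
    by rewrite mulrDr -!scalerAr mulr1 qreD !qreZ (mulrC a) (mulrC b).
  apply/funext => th; rewrite -circM mulrN /circ cosN sinN em_cart; ring.
rewrite E; split; first by eexists; exact: P.
have := circM m.+1 (2 * pi); rewrite circ_2pi expr1n -/n => -[c1 s1].
by rewrite (cintE P) c1 s1 !mulr0 cos0 sin0 qre0; ring.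
Qed.

End CircleMoments.

(** * Taylor expansion on a slice *)

Section SliceTaylor.
Variable R : realType.
Local Notation H := (quaternion R).
Local Notation C := R[i].
Variable I : H.
Hypothesis II : imag_units R I.
Local Notation em := (em I).

Lemma hsmall_hint (g : R -> H) :
  (forall th, exists A B, hsmall (fun _ th => g th) 0 th A B) -> exists x, is_hint g x.
Proof.
move=> Hg; apply: is_hint_exists => v; apply: cintegrable_cont; apply: continuous_subspaceT => th.
by have [A [B /(@hsmall_continuous R _ _ _ _ _ v) [_]]] := Hg th.
Qed.

Lemma hsmall_circN th : exists A B, hsmall (fun _ th => em (circ (- th))) 0 th A B.
Proof.
exists 0, (- em ('i * circ (- th))) => eps eps0.
have [del del0 Hd] := hsmall_circ II 0 (- th) eps0; exists del => // s t hs ht.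
have := Hd s (- t) hs; rewrite normrN => /(_ ht).
by rewrite (opprD th t) scaleNr scalerN.
Qed.

Lemma hsmall_circNX m th : exists A B, hsmall (fun _ th => em (circ (- th) ^+ m)) 0 th A B.
Proof.
elim: m => [|m [A [B IH]]]; first exists 0, 0.
  by apply: hsmall_eq (hsmall_const 1 0 th) => // x y; rewrite expr0 em1.
have [A' [B' h]] := hsmall_circN th; do 2 eexists.
by apply: hsmall_eq (hsmallM h IH) => // x y; rewrite exprS (emM II).
Qed.

Variable F : C -> H.
Hypothesis hF : forall z, cmod z < 1 -> exists D, hder I F z D.

Lemma slice_coef_exists (r : R) m : 0 < r -> r < 1 ->
  exists a : H, is_hint (fun th => em (circ (- th) ^+ m) * F (r%:C * circ th)) ((2 * pi * r ^+ m) *: a).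
Proof.
move=> r0 r1.
have [x Hx] : exists x, is_hint (fun th => em (circ (- th) ^+ m) * F (r%:C * circ th)) x.
  apply: hsmall_hint => th; have [A [B h1]] := hsmall_circNX m th.
  have zr : cmod (r%:C * circ th) < 1 by rewrite cmodM cmod_real cmod_circ mulr1 gtr0_norm.
  have h2 : hsmall (fun _ th => em (r%:C * circ th)) 0 th (em 0) (em (r%:C * ('i * circ th))).
    apply: hsmall_eq (hsmallM (hsmall_const (em r%:C) 0 th) (hsmall_circ II 0 th)).
    - by move=> _ y; rewrite (emM II).
    - by rewrite mul0r mulr0 addr0 em0.
    - by rewrite mul0r add0r (emM II).
  have [D HD] := hF zr; do 2 eexists.
  exact: hsmallM h1 (hsmall_comp II h2 HD).
exists ((2 * pi * r ^+ m)^-1 *: x); rewrite scalerA divff ?scale1r //.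
by rewrite !mulf_neq0 ?expf_neq0 // gt_eqF // pi_gt0.
Qed.

(** Cauchy's theorem gives integral 0 for z / (z - w) times F z - F w. Subtracting the first M terms
    of the geometric series of z / (z - w) yields F w minus the Taylor sum, and leaves the kernel (w
    / z)^M z / (z - w). *)
Lemma slice_taylor (r B : R) (a : nat -> H) (w : C) (M : nat) : cmod w < r -> r < 1 ->
  (forall z, cmod z < 1 -> `|F z| <= B) ->
  (forall m, is_hint (fun th => em (circ (- th) ^+ m) * F (r%:C * circ th)) ((2 * pi * r ^+ m) *: a m)) ->
  `|F w - \sum_(m < M) em w ^+ m * a m| <= (2 * B * r / (r - cmod w)) * (cmod w / r) ^+ M.
Proof.
move=> wr r1 FB Ha.
have r0 : 0 < r by rewrite (le_lt_trans (cmod_ge0 w)).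
have w1 : cmod w < 1 by apply: lt_trans r1.
have B0 : 0 <= B by apply: le_trans (FB w w1).
have rw : 0 < r - cmod w by rewrite subr_gt0.
(* With no term at all the moment m = 0, which produces F w, is missing; the bound then follows from
   |F| <= B. *)
case: M => [|M].
  rewrite big_ord0 subr0 expr0 mulr1; apply: le_trans (FB w w1) _.
  rewrite ler_pdivlMr //; have := mulr_ge0 B0 (cmod_ge0 w); have := mulr_ge0 B0 (ltW r0); lra.
pose z th : C := r%:C * circ th; pose q : C := w / r%:C.
have r0C : r%:C != 0 :> C by apply/eqP => -[] /eqP; rewrite gt_eqF.
have cz th : cmod (z th) = r by rewrite /z cmodM cmod_real cmod_circ mulr1 gtr0_norm.
have z0 th : z th != 0 by rewrite mulf_neq0 ?circ_neq0.
have zw th : z th - w != 0.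
  by rewrite subr_eq0; apply/eqP => h; move: wr; rewrite -h cz ltxx.
have qz th : q * circ (- th) = w / z th by rewrite circN /q /z invfM mulrA.
have HT : is_hint (fun th => em (z th / (z th - w)) * (F (z th) - F w)) 0.
  move=> v; rewrite mulr0 qre0; exact: (circle_cauchy II hF v wr r1).
have HS m : is_hint (fun th => em (q ^+ m) * (em (circ (- th) ^+ m) * F (z th)) -
    em (q ^+ m) * (em (circ (- th) ^+ m) * F w))
   ((2 * pi) *: (em w ^+ m * a m) - (if m is 0 then (2 * pi) *: F w else 0)).
  have h1 := is_hintMl (em (q ^+ m)) (Ha m).
  have h2 := is_hintMl (em (q ^+ m)) (is_hintMr (F w) (is_hint_moment I m)).
  apply: is_hint_ext (is_hintD h1 (is_hintN h2)) => //; congr (_ - _).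
    have -> : em w ^+ m = r ^+ m *: em (q ^+ m).
      rewrite -(emX II); have -> : w = r%:C * q by rewrite /q mulrCA divff ?mulr1.
      rewrite exprMn -rmorphXn (emM II) (em_real I) -scalerAl mul1r.
      by congr (_ *: _); congr em; congr (_ ^+ _); rewrite /q mulrCA divff ?mulr1.
    by rewrite -(scalerAl (r ^+ m)) scalerA -scalerAr.
  by case: m {h1 h2} => [|m]; rewrite ?mul0r ?mulr0 // expr0 em1 mul1r -scalerAl mul1r.
have HR := is_hintD HT (is_hintN (is_hint_sum M.+1 HS)).
have bound th : `|em (z th / (z th - w)) * (F (z th) - F w) -
   \sum_(m < M.+1) (em (q ^+ m) * (em (circ (- th) ^+ m) * F (z th)) -
    em (q ^+ m) * (em (circ (- th) ^+ m) * F w))| <=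
   (2 * B * r / (r - cmod w)) * (cmod w / r) ^+ M.+1.
  have -> : em (z th / (z th - w)) * (F (z th) - F w) -
   \sum_(m < M.+1) (em (q ^+ m) * (em (circ (- th) ^+ m) * F (z th)) -
    em (q ^+ m) * (em (circ (- th) ^+ m) * F w)) =
    em ((w / z th) ^+ M.+1 * (z th / (z th - w))) * (F (z th) - F w).
    rewrite (eq_bigr (fun m : 'I_M.+1 => em ((w / z th) ^+ m) * (F (z th) - F w))); last first.
      by move=> m _; rewrite -!mulrBr mulrA -(emM II) -exprMn qz.
    rewrite -mulr_suml -em_sum -mulrBl -emB; congr (em _ * _).
    have geo : (1 - w / z th) * (\sum_(m < M.+1) (w / z th) ^+ m) = 1 - (w / z th) ^+ M.+1.
      by rewrite -[1 - _ / _]opprB mulNr -subrX1 opprB.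
    have E1 : 1 - w / z th != 0.
      by rewrite (_ : 1 - w / z th = (z th - w) / z th) ?mulf_neq0 ?invr_neq0 // mulrBl divff.
    have iv : (1 - w / z th) * (z th / (z th - w)) = 1.
      by field; rewrite z0 zw.
    by apply: (mulfI E1); rewrite mulrBr geo [RHS]mulrCA iv; ring.
  have -> : `|em ((w / z th) ^+ M.+1 * (z th / (z th - w))) * (F (z th) - F w)| =
      (cmod w / r) ^+ M.+1 * (r / cmod (z th - w)) * `|F (z th) - F w|.
    by rewrite qnormM (em_norm II) (cmodM (_ ^+ _)) cmodX 2!cmodM 2!cmodV cz.
  have h1 : r - cmod w <= cmod (z th - w).
    have := cmodD (z th - w) w; rewrite subrK cz; lra.
  have h2 : `|F (z th) - F w| <= 2 * B.
    by apply: le_trans (ler_normB _ _) _; rewrite mulr2n mulrDl mul1r lerD // FB // cz.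
  have -> : 2 * B * r / (r - cmod w) * (cmod w / r) ^+ M.+1 =
    (cmod w / r) ^+ M.+1 * (r / (r - cmod w)) * (2 * B) by ring.
  have p0 : 0 <= (cmod w / r) ^+ M.+1 by rewrite exprn_ge0 // divr_ge0 ?cmod_ge0 // ltW.
  apply: ler_pM => //.
    by rewrite !mulr_ge0 ?invr_ge0 ?cmod_ge0 // ltW.
  by rewrite ler_wpM2l // ler_wpM2l ?(ltW r0) // lef_pV2 ?posrE // (lt_le_trans rw).
have K0 : 0 <= (2 * B * r / (r - cmod w)) * (cmod w / r) ^+ M.+1 by apply: le_trans (bound 0).
have := is_hint_bound K0 HR bound.
rewrite sub0r normrN.
have -> : \sum_(m < M.+1) ((2 * pi) *: (em w ^+ m * a m) - (if (m : nat) is 0 then (2 * pi) *: F w else 0 : H)) =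
    (2 * pi) *: (\sum_(m < M.+1) em w ^+ m * a m - F w).
  rewrite sumrB -scaler_sumr scalerBr; congr (_ - _).
  by rewrite big_ord_recl [X in _ + X]big1 ?addr0.
rewrite normrZ.
have pi20 : 0 < 2 * pi :> R by rewrite mulr_gt0 // pi_gt0.
by rewrite gtr0_norm // ler_pM2l // distrC.
Qed.

End SliceTaylor.

(** * Quaternionic power series *)

Section QuaternionLimits.
Variable R : realType.
Local Notation H := (quaternion R).

Lemma qnorm_le_coord (x : H) : `|x| <= `|qre x| + `|qim1 x| + `|qim2 x| + `|qim3 x|.
Proof.
set s := _ + _; have s0 : 0 <= s by rewrite /s !addr_ge0.
rewrite -(@ler_pXn2r _ 2) ?nnegrE // sqr_qnorm /quat_sqnorm /s.
rewrite -(real_normK (num_real (qre x))) -(real_normK (num_real (qim1 x))).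
rewrite -(real_normK (num_real (qim2 x))) -(real_normK (num_real (qim3 x))).
move: (normr_ge0 (qre x)) (normr_ge0 (qim1 x)) (normr_ge0 (qim2 x)) (normr_ge0 (qim3 x)).
move: `|qre x| `|qim1 x| `|qim2 x| `|qim3 x| => a b c d a0 b0 c0 d0; rewrite -subr_ge0.
have -> : (a + b + c + d) ^+ 2 - (a ^+ 2 + b ^+ 2 + c ^+ 2 + d ^+ 2) =
  2 * (a * b + a * c + a * d + b * c + b * d + c * d) by ring.
by rewrite mulr_ge0 // !addr_ge0 // mulr_ge0.
Qed.

Lemma qcoord_le_norm (x : H) : [/\ `|qre x| <= `|x|, `|qim1 x| <= `|x|, `|qim2 x| <= `|x| &
  `|qim3 x| <= `|x|].
Proof.
have := sqr_ge0 (qre x); have := sqr_ge0 (qim1 x); have := sqr_ge0 (qim2 x); have := sqr_ge0 (qim3 x).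
split; rewrite -(@ler_pXn2r _ 2) ?nnegrE // sqr_qnorm real_normK ?num_real // /quat_sqnorm; lra.
Qed.

Lemma quat_cvg (T : Type) (G : set_system T) (FG : Filter G) (u : T -> H) (x : H) :
  (qre (u t) @[t --> G] --> qre x) -> (qim1 (u t) @[t --> G] --> qim1 x) ->
  (qim2 (u t) @[t --> G] --> qim2 x) -> (qim3 (u t) @[t --> G] --> qim3 x) ->
  u t @[t --> G] --> x.
Proof.
move=> /cvgrPdist_le h0 /cvgrPdist_le h1 /cvgrPdist_le h2 /cvgrPdist_le h3.
apply/cvgrPdist_le => eps eps0; have e4 : 0 < eps / 4 by rewrite divr_gt0.
near=> t; apply: le_trans (qnorm_le_coord _) _.
have a0 : `|qre x - qre (u t)| <= eps / 4 by near: t; exact: h0.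
have a1 : `|qim1 x - qim1 (u t)| <= eps / 4 by near: t; exact: h1.
have a2 : `|qim2 x - qim2 (u t)| <= eps / 4 by near: t; exact: h2.
have a3 : `|qim3 x - qim3 (u t)| <= eps / 4 by near: t; exact: h3.
rewrite /=; lra.
Unshelve. all: by end_near. Qed.

Lemma geo_tail (K s : R) (M N : nat) (u : nat -> H) : 0 <= K -> 0 <= s -> s < 1 -> (M <= N)%N ->
  (forall m, `|u m| <= K * s ^+ m) ->
  `|\sum_(m < N) u m - \sum_(m < M) u m| <= K / (1 - s) * s ^+ M.
Proof.
move=> K0 s0 s1 MN Hu.
have -> : \sum_(m < N) u m - \sum_(m < M) u m = \sum_(M <= m < N) u m.
  by rewrite -!(big_mkord xpredT) (big_cat_nat (leq0n M) MN) /= addrAC subrr add0r.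
have s1' : 0 < 1 - s by rewrite subr_gt0.
apply: le_trans (qnorm_sum _ _ _) _.
suff : \sum_(M <= m < N) `|u m| <= K / (1 - s) * (s ^+ M - s ^+ N).
  move=> h; apply: (le_trans h); rewrite ler_wpM2l ?divr_ge0 // ?(ltW s1') // gerBl exprn_ge0 //.
elim: N MN => [|N IH].
  by rewrite leqn0 => /eqP ->; rewrite big_nil subrr mulr0.
rewrite leq_eqVlt => /orP[/eqP <-|]; first by rewrite big_geq // subrr mulr0.
rewrite ltnS => MN; rewrite big_nat_recr //=; apply: le_trans (lerD (IH MN) (Hu N)) _.
by rewrite le_eqVlt; apply/orP; left; apply/eqP; rewrite exprS; field; rewrite gt_eqF.
Qed.

Lemma geo_small (K s eps : R) : 0 <= s -> s < 1 -> 0 < eps -> \forall m \near \oo, K * s ^+ m <= eps.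
Proof.
move=> s0 s1 eps0.
have : (fun m => K * s ^+ m) @ \oo --> K * 0.
  by apply: cvgM; [exact: cvg_cst|apply: cvg_expr; rewrite ger0_norm].
rewrite mulr0 => /cvgrPdist_le /(_ _ eps0); apply: filterS => m.
by rewrite sub0r normrN; apply: le_trans; exact: ler_norm.
Qed.

Lemma geo_cvg (K s : R) (u : nat -> H) : 0 <= K -> 0 <= s -> s < 1 ->
  (forall m, `|u m| <= K * s ^+ m) -> exists y : H, series u @ \oo --> y.
Proof.
move=> K0 s0 s1 Hu.
have coord (p : H -> R) : (forall x y, p (x + y) = p x + p y) -> p 0 = 0 ->
    (forall x, `|p x| <= `|x|) -> cvgn (fun n => p (series u n)).
  move=> pD p0 ple.
  have -> : (fun n => p (series u n)) = series (p \o u).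
    by apply/funext => n; rewrite /series /= (big_morph p pD p0).
  apply: normed_cvg; apply: (@series_le_cvg _ _ (fun m => K * s ^+ m)) => [n|n|n|] //=.
  - by rewrite mulr_ge0 // exprn_ge0.
  - by apply: le_trans (ple _) _.
  - by apply: is_cvg_geometric_series; rewrite ger0_norm.
have c0 : cvgn (fun n => qre (series u n)) by apply: coord => // x; case: (qcoord_le_norm x).
have c1 : cvgn (fun n => qim1 (series u n)) by apply: coord => // x; case: (qcoord_le_norm x).
have c2 : cvgn (fun n => qim2 (series u n)) by apply: coord => // x; case: (qcoord_le_norm x).
have c3 : cvgn (fun n => qim3 (series u n)) by apply: coord => // x; case: (qcoord_le_norm x).
exists (Quat (limn (fun n => qre (series u n))) (limn (fun n => qim1 (series u n)))
  (limn (fun n => qim2 (series u n))) (limn (fun n => qim3 (series u n)))).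
exact: quat_cvg.
Qed.

Lemma lim_norm_le (G : set_system nat) {FG : ProperFilter G} (u : nat -> H) (x y : H) (M : R) :
  u @ G --> x -> (\forall n \near G, `|u n - y| <= M) -> `|x - y| <= M.
Proof.
move=> ux h; have cn : (fun n => `|u n - y| : R) @ G --> (`|x - y| : R).
  by apply: cvg_norm; apply: cvgB ux _; exact: cvg_cst.
have cM : (fun _ : nat => M) @ G --> M by exact: cvg_cst.
exact: (ler_cvg_to cn cM h).
Qed.

Lemma geo_lim (K s : R) (u : nat -> H) (y : H) M : 0 <= K -> 0 <= s -> s < 1 ->
  (forall m, `|u m| <= K * s ^+ m) -> series u @ \oo --> y ->
  `|y - \sum_(m < M) u m| <= K / (1 - s) * s ^+ M.
Proof.
move=> K0 s0 s1 Hu uy; apply: (lim_norm_le uy).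
exists M => // n /= Mn; rewrite /series /= big_mkord; exact: geo_tail.
Qed.

(** Positive reals lie in every slice, so this expansion compares coefficients obtained on different
    slices and radii. *)
Definition taylor_at0 (F : R -> H) (a : nat -> H) := forall M, exists K r, 0 < r /\
  forall x, 0 < x -> x <= r -> `|F x - \sum_(m < M) x ^+ m *: a m| <= K * x ^+ M.

Lemma taylor_at0_unique F a b : taylor_at0 F a -> taylor_at0 F b -> a = b.
Proof.
move=> Ha Hb; apply/funext => M; elim/ltn_ind: M => M IH.
have [K1 [r1 [r10 h1]]] := Ha M.+1; have [K2 [r2 [r20 h2]]] := Hb M.+1.
have bound x : 0 < x -> x <= r1 -> x <= r2 -> `|a M - b M| <= (K1 + K2) * x.
  move=> x0 xr1 xr2; have := h1 x x0 xr1; have := h2 x x0 xr2.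
  have -> : \sum_(m < M.+1) x ^+ m *: a m = \sum_(m < M) x ^+ m *: b m + x ^+ M *: a M.
    by rewrite big_ord_recr /=; congr (_ + _); apply: eq_bigr => m _; rewrite (IH m (ltn_ord m)).
  rewrite big_ord_recr /=.
  set S := \sum_(m < M) _ => e2 e1.
  have := ler_normB (F x - (S + x ^+ M *: b M)) (F x - (S + x ^+ M *: a M)).
  have -> : F x - (S + x ^+ M *: b M) - (F x - (S + x ^+ M *: a M)) = x ^+ M *: (a M - b M).
    by rewrite opprB addrC subrKA opprD addrACA subrr add0r scalerBr.
  have xM : 0 < x ^+ M by rewrite exprn_gt0.
  rewrite normrZ gtr0_norm // => e3.
  have := le_trans e3 (lerD e2 e1); rewrite exprS => e4.
  rewrite -(ler_pM2l xM); apply: (le_trans e4); rewrite le_eqVlt; apply/orP; left; apply/eqP; ring.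
apply/eqP; rewrite -subr_eq0 -normr_eq0 eq_le normr_ge0 andbT leNgt; apply/negP => d0.
set d := `|_| in bound d0.
pose K := `|K1 + K2| + 1; have K0 : 0 < K by rewrite ltr_wpDl.
pose x := Num.min (Num.min r1 r2) (d / (2 * K)).
have x0 : 0 < x by rewrite !lt_min r10 r20 divr_gt0 // mulr_gt0.
have := bound x x0; rewrite {1 2}/x !ge_min !lexx !orbT /= => /(_ isT isT).
apply/negP; rewrite -ltNge; apply: (@le_lt_trans _ _ (K * x)).
  by rewrite ler_wpM2r ?(ltW x0) // (le_trans (ler_norm _)) // lerDl.
apply: (@le_lt_trans _ _ (K * (d / (2 * K)))).
  by rewrite ler_wpM2l ?(ltW K0) // /x ge_min lexx orbT.
have -> : K * (d / (2 * K)) = d / 2 by field; rewrite gt_eqF.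
lra.
Qed.

(** Convergence at 1/2 gives |a_m| <= K 2^m; for x <= 1/4 the tail is then geometric with ratio at
    most 1/2. *)
Lemma has_qcoef_taylor (f : H -> H) a : has_qcoef f a -> taylor_at0 (fun x => f x%:A) a.
Proof.
move=> Ha M.
have qX (x : R) m : (x%:A : H) ^+ m = (x ^+ m)%:A by rewrite exprZn expr1n.
have half : qball R (2^-1)%:A by rewrite /qball /= normrZ qnorm1 mulr1 gtr0_norm ?invf_lt1 ?ltr1n.
have [K [K0 HK]] : exists K, 0 <= K /\ forall m, `|a m| <= K * 2 ^+ m.
  have /cvgP/cvg_series_cvg_0 c0 := Ha _ half.
  have [K HK] := cvg_seq_bounded (cvgP _ c0).
  pose K' := `|K| + 1; have K0 : 0 <= K' by rewrite addr_ge0.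
  exists K'; split => // m; have := HK.2 K'; rewrite (le_lt_trans (ler_norm K)) ?ltrDl // => /(_ isT m I).
  rewrite /= qnormM qX normrZ qnorm1 mulr1 ger0_norm ?exprn_ge0 // exprVn.
  by rewrite ler_pdivrMl ?exprn_gt0 // mulrC.
exists (K * 2 * 2 ^+ M), (4^-1); split => [|x x0 x1]; first by rewrite invr_gt0.
have xb : qball R x%:A.
  by rewrite /qball /= normrZ qnorm1 mulr1 gtr0_norm // (le_lt_trans x1) // invf_lt1 ?ltr1n.
have x20 : 0 <= 2 * x by rewrite mulr_ge0 // ltW.
have x2 : 2 * x <= 2^-1 by move: x1; lra.
have x21 : 2 * x < 1 by move: x2; lra.
have := @geo_lim K (2 * x) (fun m => (x%:A) ^+ m * a m) (f x%:A) M K0 x20 x21.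
have -> : \sum_(m < M) x%:A ^+ m * a m = \sum_(m < M) x ^+ m *: a m.
  by apply: eq_bigr => m _; rewrite qX -scalerAl mul1r.
move=> /(_ _ (Ha _ xb)) h; apply: le_trans (h _) _.
  move=> m; rewrite qnormM qX normrZ qnorm1 mulr1 ger0_norm ?exprn_ge0 ?(ltW x0) //.
  by rewrite exprMn mulrA mulrC ler_wpM2r // exprn_ge0 // ltW.
rewrite exprMn [leRHS](_ : _ = K * 2 * (2 ^+ M * x ^+ M)); last by ring.
rewrite ler_wpM2r ?mulr_ge0 ?exprn_ge0 // ?(ltW x0) // ler_wpM2l //.
rewrite -[leRHS]invrK lef_pV2 ?posrE ?invr_gt0 //; lra.
Qed.

Lemma has_qcoef_unique (f : H -> H) a b : has_qcoef f a -> has_qcoef f b -> a = b.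
Proof. by move=> /has_qcoef_taylor ha /has_qcoef_taylor hb; apply: taylor_at0_unique ha hb. Qed.

Lemma qcoefE (f : H -> H) a : has_qcoef f a -> qcoef f = a.
Proof.
move=> ha; apply: (has_qcoef_unique _ ha).
exact: (@xgetPex _ (fun=> 0) [set a | has_qcoef f a] (ex_intro _ a ha)).
Qed.

End QuaternionLimits.

(** * Power series coefficients of bounded slice regular functions *)

Section HardyCoefficients.
Variable R : realType.
Local Notation H := (quaternion R).
Local Notation C := R[i].
Implicit Types (f : H -> H) (I q : H) (a : nat -> H).

Lemma slice_exists q : exists I z, imag_units R I /\ em I z = q.
Proof.
case: q => a b c d; set n := Num.sqrt (b ^+ 2 + c ^+ 2 + d ^+ 2).
have s0 : 0 <= b ^+ 2 + c ^+ 2 + d ^+ 2 by rewrite !addr_ge0 // sqr_ge0.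
have n2 : n ^+ 2 = b ^+ 2 + c ^+ 2 + d ^+ 2 by rewrite sqr_sqrtr.
have [n0|n0] := eqVneq n 0.
  have : b ^+ 2 + c ^+ 2 + d ^+ 2 = 0 by rewrite -n2 n0 expr0n.
  move/eqP; rewrite !paddr_eq0 ?addr_ge0 ?sqr_ge0 // !sqrf_eq0.
  move=> /andP[/andP[/eqP -> /eqP ->] /eqP ->].
  exists (Quat 0 1 0 0), (a +i* 0); split; last first.
    by rewrite /em /slice_point; apply: quat_eqP => /=; ring.
  by rewrite /imag_units /=; apply: quat_eqP => /=; ring.
exists (Quat 0 (b / n) (c / n) (d / n)), (a +i* n); split; last first.
  by rewrite /em /slice_point; apply: quat_eqP => /=; field.
rewrite /imag_units /=; apply: quat_eqP => /=; try ring.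
have nn : (b ^+ 2 + c ^+ 2 + d ^+ 2) / n ^+ 2 = 1 by rewrite -n2 divff // expf_neq0.
by rewrite -nn; field.
Qed.

Definition slice_coefs f I (r : R) a := forall m,
  is_hint (fun th => em I (circ (- th) ^+ m) * f (em I (r%:C * circ th))) ((2 * pi * r ^+ m) *: a m).

Lemma slice_coefs_exist f I r : imag_units R I -> slice_regular f -> 0 < r -> r < 1 ->
  exists a, slice_coefs f I r a.
Proof.
move=> II sf r0 r1.
have h m := @slice_coef_exists R I II (fun z => f (em I z)) (fun z => slice_hder II sf) r m r0 r1.
by have [a Ha] := choice h; exists a => m; exact: Ha.
Qed.

Lemma slice_coefs_taylor f I r a : imag_units R I -> Hinfty f -> 0 < r -> r < 1 ->
  slice_coefs f I r a -> taylor_at0 (fun x => f x%:A) a.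
Proof.
move=> II [sf [B HB]] r0 r1 Ha M.
have FB z : cmod z < 1 -> `|f (em I z)| <= B by move=> z1; apply: HB; rewrite /qball /= em_norm.
have B0 : 0 <= B by apply: le_trans (FB 0 _); rewrite ?cmod0 ?ltr01.
exists (4 * B / r ^+ M), (r / 2); split; first by rewrite divr_gt0.
move=> x x0 xr.
have cx : cmod x%:C = x by rewrite cmod_real gtr0_norm.
have xr' : cmod x%:C < r by rewrite cx; move: xr r0; lra.
have := slice_taylor II (fun z => slice_hder II sf) M xr' r1 FB Ha.
rewrite cx em_real.
have -> : \sum_(m < M) (x%:A : H) ^+ m * a m = \sum_(m < M) x ^+ m *: a m.
  by apply: eq_bigr => m _; rewrite exprZn expr1n -scalerAl mul1r.
have -> : 4 * B / r ^+ M * x ^+ M = 4 * B * (x / r) ^+ M by rewrite expr_div_n mulrA mulrAC.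
have rx : 0 < r - x by move: xr r0; lra.
move/le_trans; apply; rewrite ler_wpM2r ?exprn_ge0 ?divr_ge0 ?(ltW r0) ?(ltW x0) // ler_pdivrMr //.
have : B * r <= B * (2 * (r - x)) by rewrite ler_wpM2l //; move: xr; lra.
lra.
Qed.

(** The integral coefficients on any slice and radius are Taylor coefficients along the positive
    reals, hence all equal; [slice_taylor] then sums the series on every slice. *)
Lemma hinfty_coefs f : Hinfty f -> exists a, has_qcoef f a /\
  forall I r, imag_units R I -> 0 < r -> r < 1 -> slice_coefs f I r a.
Proof.
move=> Hf; have [sf [B HB]] := Hf.
have I0 : imag_units R (Quat 0 1 0 0) by rewrite /imag_units /=; apply: quat_eqP => /=; ring.
have h0 : 0 < 2^-1 :> R by rewrite invr_gt0.
have h1 : 2^-1 < 1 :> R by rewrite invf_lt1 ?ltr1n.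
have [a Ha] := slice_coefs_exist I0 sf h0 h1; exists a.
have all I r : imag_units R I -> 0 < r -> r < 1 -> slice_coefs f I r a.
  move=> II r0 r1; have [b Hb] := slice_coefs_exist II sf r0 r1.
  suff -> : a = b by [].
  apply: taylor_at0_unique (slice_coefs_taylor I0 Hf h0 h1 Ha) (slice_coefs_taylor II Hf r0 r1 Hb).
split=> // q qb; have [I [z [II qE]]] := slice_exists q.
have z1 : cmod z < 1 by rewrite -(em_norm II) qE.
have FB z' : cmod z' < 1 -> `|f (em I z')| <= B by move=> ?; apply: HB; rewrite /qball /= em_norm.
pose r := (cmod z + 1) / 2.
have zr : cmod z < r by rewrite /r; move: z1; lra.
have r1 : r < 1 by rewrite /r; move: z1; lra.
have r0 : 0 < r by rewrite (le_lt_trans (cmod_ge0 z)).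
apply/cvgrPdist_le => eps eps0.
have s0 : 0 <= cmod z / r by rewrite divr_ge0 ?cmod_ge0 // ltW.
have s1 : cmod z / r < 1 by rewrite ltr_pdivrMr // mul1r.
have := geo_small (2 * B * r / (r - cmod z)) s0 s1 eps0; apply: filterS => M.
apply: le_trans; rewrite /qpseries /series /= big_mkord -qE.
exact: (slice_taylor II (fun z => slice_hder II sf) M zr r1 FB (all I r II r0 r1)).
Qed.

Lemma hinfty_qcoef f : Hinfty f -> has_qcoef f (qcoef f).
Proof. by move=> /hinfty_coefs [a [ha _]]; rewrite (qcoefE ha). Qed.

(* Pair the integral formula for the coefficients with the coefficients themselves. *)
Lemma sum_sqr_coef_le1 (f : nat -> H -> H) (J m : nat) : (forall j, Hinfty (f j)) ->
  (forall q, qball R q -> \sum_(j < J) `|f j q| ^+ 2 <= 1) ->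
  \sum_(j < J) `|qcoef (f j) m| ^+ 2 <= 1.
Proof.
move=> Hf Hq; set S := \sum_(j < J) _.
have S0 : 0 <= S by rewrite sumr_ge0 // => j _; rewrite exprn_ge0.
have I0 : imag_units R (Quat 0 1 0 0) by rewrite /imag_units /=; apply: quat_eqP => /=; ring.
have pi20 : 0 < 2 * pi :> R by rewrite mulr_gt0 // pi_gt0.
have key r : 0 < r -> r < 1 -> r ^+ m * S <= Num.sqrt S.
  move=> r0 r1; pose I := Quat (0 : R) 1 0 0.
  pose g j th := em I (circ (- th) ^+ m) * f j (em I (r%:C * circ th)).
  have Hg j : is_hint (g j) ((2 * pi * r ^+ m) *: qcoef (f j) m).
    have [a [ha hI]] := hinfty_coefs (Hf j); rewrite (qcoefE ha); exact: hI.
  pose v j := qcoef (f j) m.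
  have [c1 c2] := @cint_sum R J (fun j th => qre (qconj (v j) * g j th)) (fun j => (Hg j (v j)).1).
  have E : cint (fun th => \sum_(j < J) qre (qconj (v j) * g j th)) = 2 * pi * (r ^+ m * S).
    rewrite c2 mulrA /S mulr_sumr; apply: eq_bigr => j _.
    by rewrite (Hg j (v j)).2 -scalerAr qreZ qre_conjM_self.
  rewrite -(ler_pM2l pi20) -E mulrC; apply: le_trans (ler_norm _) _; apply: cint_bound => // th.
  apply: le_trans (ler_norm_sum _ _ _) _.
  have gf j : `|g j th| = `|f j (em I (r%:C * circ th))|.
    by rewrite /g qnormM em_norm // cmodX cmod_circ expr1n mul1r.
  have qb : qball R (em I (r%:C * circ th)).
    by rewrite /qball /= em_norm // cmodM cmod_real cmod_circ mulr1 gtr0_norm.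
  have := Hq _ qb; under eq_bigr => j _ do rewrite -gf.
  set T := \sum_(j < J) _ => T1.
  have T0 : 0 <= T by rewrite sumr_ge0 // => j _; rewrite exprn_ge0.
  have [S00|S00] := eqVneq S 0.
    rewrite S00 sqrtr0 big1 // => j _.
    suff -> : v j = 0 by rewrite qconj0 mul0r qre0 normr0.
    apply/eqP; rewrite -normr_eq0 -sqrf_eq0 eq_le exprn_ge0 // andbT -S00 /S (bigD1 j) //= lerDl.
    by rewrite sumr_ge0 // => i _; rewrite exprn_ge0.
  have Sp : 0 < S by rewrite lt_neqAle eq_sym S00.
  have s0 : 0 < Num.sqrt S by rewrite sqrtr_gt0.
  have s2 : Num.sqrt S ^+ 2 = S by rewrite sqr_sqrtr.
  rewrite -(ler_pM2l s0) -expr2 s2.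
  have : 2 * (Num.sqrt S * \sum_(j < J) `|qre (qconj (v j) * g j th)|) <= S + S * T.
    rewrite !mulr_sumr {3}/S -big_split; apply: ler_sum => j _.
    have h : `|qre (qconj (v j) * g j th)| <= `|v j| * `|g j th|.
      by apply: le_trans (qre_le_norm _) _; rewrite qnormM qnorm_conj.
    change (2 * (Num.sqrt S * `|qre (qconj (v j) * g j th)|) <= `|v j| ^+ 2 + S * `|g j th| ^+ 2).
    move: h (ltW s0) s2; move: `|qre _| `|v j| `|g j th| (Num.sqrt S) => t x y s h s0' <-.
    have := ler_wpM2l s0' h; have := sqr_ge0 (x - s * y); rewrite sqrrB exprMn; lra.
  have : S * T <= S by rewrite ler_piMr.
  lra.
(* Squaring r^m S <= sqrt S bounds r^(2m) S by 1; below, r tends to 1 along 1 - 1 / (k + 2). *)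
have S1 r : 0 < r -> r < 1 -> (r ^+ m) ^+ 2 * S <= 1.
  move=> r0 r1; have rm0 : 0 <= r ^+ m by rewrite exprn_ge0 // ltW.
  have := key r r0 r1; rewrite -(ler_pXn2r (n := 2)) ?nnegrE ?mulr_ge0 ?sqrtr_ge0 //.
  rewrite sqr_sqrtr // exprMn => h.
  have [->|S00] := eqVneq S 0; first by rewrite mulr0.
  have Sp : 0 < S by rewrite lt_neqAle eq_sym S00.
  by rewrite -(ler_pM2r Sp) mul1r -mulrA -expr2.
have cr : (fun k : nat => ((1 - k.+2%:R^-1 : R) ^+ m) ^+ 2 * S) @ \oo --> ((1 - 0 : R) ^+ m) ^+ 2 * S.
  have c0 : (fun k : nat => (k.+2%:R^-1 : R)) @ \oo --> (0 : R).
    by have := @cvg_harmonic R; rewrite -cvg_shiftS.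
  have c1 : (fun k : nat => (1 - k.+2%:R^-1 : R)) @ \oo --> (1 - 0 : R).
    by apply: cvgB c0; exact: cvg_cst.
  have cX n (u : nat -> R) (l : R) : u @ \oo --> l -> (fun k => u k ^+ n) @ \oo --> l ^+ n.
    move=> hu; elim: n => [|n IH].
      by under eq_fun do rewrite expr0; rewrite expr0; exact: cvg_cst.
    by under eq_fun do rewrite exprS; rewrite exprS; apply: cvgM hu IH.
  by apply: cvgM; [exact: (cX _ _ _ (cX _ _ _ c1))|exact: cvg_cst].
move: cr; rewrite subr0 !expr1n mul1r => cr.
have cc : (fun _ : nat => 1 : R) @ \oo --> (1 : R) by exact: cvg_cst.
apply: (ler_cvg_to cr cc); apply: nearW => k; apply: S1.
  by rewrite subr_gt0 invf_lt1 // ltr1n.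
by rewrite ltrBlDr ltrDl invr_gt0.
Qed.

End HardyCoefficients.

(** * Power series with bounded coefficients are slice regular *)

Section PowerSeriesRegular.
Variable R : realType.
Local Notation H := (quaternion R).
Implicit Types (q h : H) (b : nat -> H).

(** (m + 1) t^m is at most 1 + t + ... + t^m. *)
Lemma natr_geo (t : R) (m : nat) : 0 < t -> t < 1 -> (1 - t) * (m.+1%:R * t ^+ m) <= 1.
Proof.
move=> t0 t1; suff : (1 - t) * (m.+1%:R * t ^+ m) <= 1 - t ^+ m.+1.
  by move/le_trans; apply; rewrite gerBl exprn_ge0 // ltW.
elim: m => [|m IH]; first by rewrite expr0 expr1 !mulr1.
have tm : t ^+ m.+1 <= 1 by rewrite exprn_ile1 // ltW.
rewrite -natr1; have := ler_wpM2l (ltW t0) IH; have := ler_wpM2l (ltW t0) tm.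
have := ler_wpM2r (_ : 0 <= 1 - t) tm; rewrite subr_ge0 (ltW t1) => /(_ isT).
rewrite [t ^+ m.+2]exprS [in t * _]exprS ![_ ^+ m.+1]exprS.
move: (t ^+ m) (m.+1%:R : R) => p n; lra.
Qed.

(** The mean t of s, 1, 1 satisfies s <= t^3; two factors t^m absorb the two factors m + 1 and the
    third stays. *)
Lemma sqr_natr_geo (s : R) : 0 <= s -> s < 1 -> exists t K, [/\ 0 < t, t < 1, 0 <= K &
  forall m : nat, m.+1%:R ^+ 2 * s ^+ m <= K * t ^+ m].
Proof.
move=> s0 s1; pose t := (s + 2) / 3.
have t0 : 0 < t by rewrite /t; move: s0; lra.
have t1 : t < 1 by rewrite /t; move: s1; lra.
have st : s <= t ^+ 3.
  rewrite /t -subr_ge0; have -> : ((s + 2) / 3) ^+ 3 - s = (s - 1) ^+ 2 * (s + 8) / 27 by field.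
  by rewrite divr_ge0 // mulr_ge0 ?sqr_ge0 // addr_ge0.
have u0 : 0 < 1 - t by rewrite subr_gt0.
exists t, ((1 - t) ^- 2); split => // [|m]; first by rewrite invr_ge0 exprn_ge0 // ltW.
have h1 : s ^+ m <= t ^+ m * (t ^+ m) ^+ 2.
  by rewrite -exprS -exprM mulnC exprM lerXn2r ?nnegrE ?exprn_ge0 // ltW.
rewrite -ler_pdivrMl ?invr_gt0 ?exprn_gt0 // invrK.
apply: (@le_trans _ _ ((1 - t) ^+ 2 * (m.+1%:R ^+ 2 * (t ^+ m * (t ^+ m) ^+ 2)))).
  by rewrite !ler_wpM2l // ?exprn_ge0 // ltW.
have -> : (1 - t) ^+ 2 * (m.+1%:R ^+ 2 * (t ^+ m * (t ^+ m) ^+ 2)) =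
  ((1 - t) * (m.+1%:R * t ^+ m)) ^+ 2 * t ^+ m by ring.
rewrite ler_piMl ?exprn_ge0 ?(ltW t0) // exprn_ile1 ?natr_geo //.
by rewrite !mulr_ge0 ?exprn_ge0 // ltW.
Qed.

(* The derivative of [q ^+ m] in the direction [h]: [\sum_k q ^+ k * h * q ^+ (m - 1 - k)]. *)
Fixpoint dqX m q h : H := if m is m'.+1 then h * q ^+ m' + q * dqX m' q h else 0.

Lemma dqXD m q (r : R) h k : dqX m q (r *: h + k) = r *: dqX m q h + dqX m q k.
Proof.
elim: m => [|m IH] /=; first by rewrite scaler0 addr0.
by rewrite IH mulrDl [q * _]mulrDr -scalerAl -scalerAr scalerDr addrACA.
Qed.

Lemma dqX_comm m q h : h * q = q * h -> dqX m q h = h * dqX m q 1.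
Proof.
move=> hq; elim: m => [|m IH] /=; first by rewrite mulr0.
by rewrite IH mul1r [RHS]mulrDr [in RHS]mulrA hq mulrA.
Qed.

(** The factor s on the left replaces an exponent m - 1 on the right; likewise s in [qX_bound] and
    s^2 in [dqX_rem]. *)
Lemma dqX_bound m q h (s : R) : `|q| <= s -> `|dqX m q h| * s <= m%:R * s ^+ m * `|h|.
Proof.
move=> qs; have s0 : 0 <= s by apply: le_trans qs.
elim: m => [|m IH] /=; first by rewrite normr0 !mul0r.
have h1 : `|h * q ^+ m + q * dqX m q h| <= `|h| * s ^+ m + s * `|dqX m q h|.
  apply: le_trans (ler_normD _ _) _; rewrite !qnormM qnormX lerD //.
    by rewrite ler_wpM2l // lerXn2r ?nnegrE.
  by rewrite ler_wpM2r.
have := ler_wpM2r s0 h1; have := ler_wpM2l s0 IH; rewrite -natr1 exprS.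
move: `|h * _ + _| `|dqX _ _ _| `|h| (s ^+ m) (m%:R : R) => X Y hh p n; lra.
Qed.

Lemma qX_bound m q h (s : R) : `|q| <= s -> `|q + h| <= s ->
  `|(q + h) ^+ m - q ^+ m| * s <= m%:R * s ^+ m * `|h|.
Proof.
move=> qs qhs; have s0 : 0 <= s by apply: le_trans qs.
elim: m => [|m IH] /=; first by rewrite !expr0 subrr normr0 !mul0r.
have -> : (q + h) ^+ m.+1 - q ^+ m.+1 = (q + h) * ((q + h) ^+ m - q ^+ m) + h * q ^+ m.
  by rewrite !exprS [(q + h) * (_ - _)]mulrBr [(q + h) * q ^+ m]mulrDl opprD addrA subrK.
have h1 : `|(q + h) * ((q + h) ^+ m - q ^+ m) + h * q ^+ m| <=
    s * `|(q + h) ^+ m - q ^+ m| + `|h| * s ^+ m.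
  apply: le_trans (ler_normD _ _) _; rewrite !qnormM qnormX lerD //.
    by rewrite ler_wpM2r.
  by rewrite ler_wpM2l // lerXn2r ?nnegrE.
have := ler_wpM2r s0 h1; have := ler_wpM2l s0 IH; rewrite -natr1 exprS.
move: `|(q + h) * ((q + h) ^+ m - q ^+ m) + h * q ^+ m| `|(q + h) ^+ m - q ^+ m| => X Y.
move: `|h| (s ^+ m) (m%:R : R) => hh p n; lra.
Qed.

Lemma dqX_rem m q h (s : R) : `|q| <= s -> `|q + h| <= s ->
  `|(q + h) ^+ m - q ^+ m - dqX m q h| * s ^+ 2 <= m%:R ^+ 2 * s ^+ m * `|h| ^+ 2.
Proof.
move=> qs qhs; have s0 : 0 <= s by apply: le_trans qs.
elim: m => [|m IH]; first by rewrite !expr0 subrr sub0r normrN /= normr0 expr0n /= !mul0r.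
have -> : (q + h) ^+ m.+1 - q ^+ m.+1 - dqX m.+1 q h =
    q * ((q + h) ^+ m - q ^+ m - dqX m q h) + h * ((q + h) ^+ m - q ^+ m).
  rewrite /= !exprS; move: ((q + h) ^+ m) (q ^+ m) (dqX m q h) => X Y Z.
  quat_ring.
have h1 : `|q * ((q + h) ^+ m - q ^+ m - dqX m q h) + h * ((q + h) ^+ m - q ^+ m)| <=
    s * `|(q + h) ^+ m - q ^+ m - dqX m q h| + `|h| * `|(q + h) ^+ m - q ^+ m|.
  by apply: le_trans (ler_normD _ _) _; rewrite !qnormM lerD // ler_wpM2r.
have s20 : 0 <= s ^+ 2 by rewrite exprn_ge0.
have := ler_wpM2r s20 h1; have := ler_wpM2l s0 IH.
have hs0 : 0 <= `|h| * s by rewrite mulr_ge0.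
have := ler_wpM2l hs0 (qX_bound m qs qhs).
have m0 : 0 <= (m%:R + 1) * (s * s ^+ m * `|h| ^+ 2).
  by rewrite mulr_ge0 ?addr_ge0 // !mulr_ge0 ?exprn_ge0.
move: m0; rewrite -natr1 [s ^+ m.+1]exprS.
move: `|q * ((q + h) ^+ m - q ^+ m - dqX m q h) + h * ((q + h) ^+ m - q ^+ m)|.
move: `|(q + h) ^+ m - q ^+ m - dqX m q h| `|(q + h) ^+ m - q ^+ m| `|h| (s ^+ m) (m%:R : R).
clear => Y Z hh p n X; lra.
Qed.

(** Termwise differentiation in all real directions. A direction h commuting with q can be pulled
    out on the left, and I commutes with x + y I, which gives the slice equation. *)
Lemma pseries_regular b (K : R) : (forall m, `|b m| <= K) ->
  exists g, slice_regular g /\ has_qcoef g b.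
Proof.
move=> Hb; have K0 : 0 <= K by apply: le_trans (Hb 0%N).
pose g q := limn (qpseries b q); exists g.
have gq : has_qcoef g b.
  move=> q q1; have bnd m : `|q ^+ m * b m| <= K * `|q| ^+ m.
    by rewrite qnormM qnormX mulrC ler_wpM2r // exprn_ge0.
  have [y hy] := geo_cvg K0 (normr_ge0 q) q1 bnd.
  by rewrite /g (cvg_lim (@norm_hausdorff _ _) hy).
clearbody g; split=> //.
have der q : qball R q -> differentiable g q /\ forall h, h * q = q * h -> 'd g q h = h * 'd g q 1.
  move=> q1; have {q1} q1 : `|q| < 1 by [].
  pose s := (`|q| + 1) / 2.
  have qs : `|q| < s by rewrite /s; move: q1; lra.
  have s1 : s < 1 by rewrite /s; move: q1; lra.
  have s0 : 0 < s by rewrite (le_lt_trans _ qs).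
  have [t [Kt [t0 t1 Kt0 Ht]]] := sqr_natr_geo (ltW s0) s1.
  have nat_le m : m%:R * s ^+ m <= Kt * t ^+ m /\ m%:R ^+ 2 * s ^+ m <= Kt * t ^+ m.
    have h := Ht m; have sm : 0 <= s ^+ m by rewrite exprn_ge0 // ltW.
    have n0 : 0 <= m%:R :> R by rewrite ler0n.
    split; apply: le_trans h; rewrite ler_wpM2r // -natr1; move: n0; move: (m%:R : R) => n; nra.
  have dbound h m : `|dqX m q h * b m| <= (K * Kt / s * `|h|) * t ^+ m.
    have e1 := dqX_bound m h (ltW qs).
    have e2 := ler_wpM2r (normr_ge0 h) (nat_le m).1.
    have e3 : `|dqX m q h| <= Kt * t ^+ m * `|h| / s by rewrite ler_pdivlMr // (le_trans e1).
    rewrite qnormM; apply: le_trans (ler_pM (normr_ge0 _) (normr_ge0 _) e3 (Hb m)) _.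
    by rewrite le_eqVlt; apply/orP; left; apply/eqP; ring.
  have C0 h : 0 <= K * Kt / s * `|h| by rewrite !mulr_ge0 ?invr_ge0 // ltW.
  have exD h : exists y : H, series (fun m => dqX m q h * b m) @ \oo --> y.
    exact: (geo_cvg (C0 h) (ltW t0) t1 (dbound h)).
  have [D HD] := choice exD.
  have Dlin : linear D.
    move=> r h k; apply: (cvg_unique _ (HD (r *: h + k))) => //.
    have -> : series (fun m => dqX m q (r *: h + k) * b m) =
        (fun n => r *: series (fun m => dqX m q h * b m) n + series (fun m => dqX m q k * b m) n).
      apply/funext => n; rewrite /series /= scaler_sumr -big_split /=; apply: eq_bigr => m _.
      by rewrite dqXD mulrDl scalerAl.
    by apply: cvgD (HD k); apply: cvgZr; exact: HD.
  have t1' : 0 < 1 - t by rewrite subr_gt0.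
  have Dbound h : `|D h| <= K * Kt / s / (1 - t) * `|h|.
    have := geo_lim 0 (C0 h) (ltW t0) t1 (dbound h) (HD h).
    by rewrite big_ord0 subr0 expr0 mulr1 mulrAC.
  pose DL := GRing.isLinear.Build R H H *:%R D Dlin.
  pose df : {linear H -> H} := HB.pack D DL.
  have dfc (x : H) : (fun y : H => D y) @ nbhs x --> (D x : H).
    apply/(@cvgrPdist_le _ _ _ _ (nbhs_filter x)) => eps eps0.
    pose c := K * Kt / s / (1 - t) + 1.
    have c0 : 0 < c by rewrite ltr_wpDl // !mulr_ge0 ?invr_ge0 // ltW.
    have ec : 0 < eps / c by rewrite divr_gt0.
    have hid : (fun z : H => z) @ nbhs x --> x by exact: cvg_id.
    move/cvgrPdist_le : hid => /(_ _ ec); apply: filterS => y hy.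
    rewrite -[D x - D y]/(df x - df y) -linearB; apply: le_trans (Dbound _) _.
    apply: (@le_trans _ _ (c * `|x - y|)); first by rewrite ler_wpM2r // /c lerDl.
    by rewrite mulrC -ler_pdivlMr.
  (* For |h| <= s - |q| the remainders [dqX_rem] sum to a constant times |h|^2. *)
  have dfo : g \o shift q = cst (g q) + df +o_ (0 : H) id.
    apply/eqaddoP => eps eps0.
    pose c := K * Kt / s ^+ 2 / (1 - t) + 1.
    have c0 : 0 < c by rewrite ltr_wpDl // !mulr_ge0 ?invr_ge0 ?exprn_ge0 // ltW.
    have ec : 0 < eps / c by rewrite divr_gt0.
    have sq : 0 < s - `|q| by rewrite subr_gt0.
    have em : 0 < Num.min (eps / c) (s - `|q|) by rewrite lt_min ec.
    have hid : (fun z : H => z) @ nbhs (0 : H) --> (0 : H) by exact: cvg_id.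
    move/cvgrPdist_le : hid => /(_ _ em); apply: filterS => h.
    rewrite sub0r normrN le_min => /andP[h1 h2].
    have qhs : `|q + h| <= s by apply: le_trans (ler_normD _ _) _; move: h2; lra.
    have qh1 : qball R (h + q) by rewrite /qball /= addrC (le_lt_trans qhs).
    have hs : series (fun m => ((h + q) ^+ m - q ^+ m - dqX m q h) * b m) @ \oo --> g (h + q) - g q - D h.
      have -> : series (fun m => ((h + q) ^+ m - q ^+ m - dqX m q h) * b m) =
        (fun n => qpseries b (h + q) n - qpseries b q n - series (fun m => dqX m q h * b m) n).
        apply/funext => n; rewrite /qpseries /series /= -!sumrB; apply: eq_bigr => m _.
        by rewrite !mulrBl.
      by apply: cvgB (HD h); apply: cvgB; exact: gq.
    have rb m : `|((h + q) ^+ m - q ^+ m - dqX m q h) * b m| <= (K * Kt / s ^+ 2 * `|h| ^+ 2) * t ^+ m.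
      have e1 := dqX_rem m (ltW qs) qhs; rewrite [q + h]addrC in e1.
      have e2 := ler_wpM2r (exprn_ge0 2 (normr_ge0 h)) (nat_le m).2.
      have e3 : `|(h + q) ^+ m - q ^+ m - dqX m q h| <= Kt * t ^+ m * `|h| ^+ 2 / s ^+ 2.
        by rewrite ler_pdivlMr ?exprn_gt0 // (le_trans e1).
      rewrite qnormM; apply: le_trans (ler_pM (normr_ge0 _) (normr_ge0 _) e3 (Hb m)) _.
      by rewrite le_eqVlt; apply/orP; left; apply/eqP; ring.
    have C20 : 0 <= K * Kt / s ^+ 2 * `|h| ^+ 2.
      by rewrite !mulr_ge0 ?invr_ge0 ?exprn_ge0 // ltW.
    have := geo_lim 0 C20 (ltW t0) t1 rb hs; rewrite big_ord0 subr0 expr0 mulr1 => rem.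
    rewrite !fctE /=.
    have -> : g (h + q) - (g q + D h) = g (h + q) - g q - D h by rewrite opprD addrA.
    apply: (le_trans rem).
    have -> : K * Kt / s ^+ 2 * `|h| ^+ 2 / (1 - t) = (c - 1) * `|h| * `|h|.
      by rewrite /c addrK expr2; ring.
    rewrite ler_wpM2r //; apply: (@le_trans _ _ (c * `|h|)).
      by rewrite ler_wpM2r // gerBl.
    by rewrite mulrC -ler_pdivlMr.
  have dE := @diff_unique _ _ _ _ df q dfc dfo.
  split.
    by apply/diff_locallyP; rewrite dE.
  move=> h hq; rewrite dE /=; apply: (cvg_unique _ (HD h)) => //.
  have -> : series (fun m => dqX m q h * b m) = (fun n => h * series (fun m => dqX m q 1 * b m) n).
    apply/funext => n; rewrite /series /= mulr_sumr; apply: eq_bigr => m _.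
    by rewrite (dqX_comm m hq) mulrA.
  apply/cvgrPdist_le => eps eps0.
  have eh : 0 < eps / (`|h| + 1) by rewrite divr_gt0 // ltr_wpDl.
  have /cvgrPdist_le /(_ _ eh) := HD 1; apply: filterS => n hn.
  rewrite -mulrBr qnormM; apply: le_trans (ler_wpM2l (normr_ge0 h) hn) _.
  rewrite mulrCA ler_piMr ?(ltW eps0) // ler_pdivrMr ?mul1r ?lerDl // ltr_wpDl.
split=> [q qb|I II x y qb]; first by have [] := der q qb.
set q := slice_point I x y in qb; have [dq dc] := der q qb.
have E1 : derive1 (fun t : R => g (slice_point I t y)) x = 'd g q 1.
  rewrite -deriveE; last exact: dq.
  rewrite /derive1 /derive; suff -> : (fun h : R => h^-1 *:
      (g (slice_point I (h + x) y) - g (slice_point I x y))) =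
      (fun h : R => h^-1 *: ((g \o shift q) (h *: (1 : H)) - g q)) by [].
  apply/funext => h /=.
  by congr (_ *: (g _ - g _)); rewrite /q /slice_point scalerDl addrA.
have E2 : derive1 (fun t : R => g (slice_point I x t)) y = 'd g q I.
  rewrite -deriveE; last exact: dq.
  rewrite /derive1 /derive; suff -> : (fun h : R => h^-1 *:
      (g (slice_point I x (h + y)) - g (slice_point I x y))) =
      (fun h : R => h^-1 *: ((g \o shift q) (h *: I) - g q)) by [].
  apply/funext => h /=.
  by congr (_ *: (g _ - g _)); rewrite /q /slice_point scalerDl addrCA.
rewrite E1 E2 (dc I); last first.
  by rewrite /q /slice_point; quat_ring.
by rewrite mulrA (_ : I * I = -1) ?mulN1r ?subrr ?scaler0 //; exact: II.
Qed.

End PowerSeriesRegular.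

(** * Reduction to polynomials *)

Section L2Blocks.
Variable R : realType.
Local Notation H := (quaternion R).

Lemma weighted_CS (T : Type) (s : seq T) (w x : T -> R) : (forall i, 0 <= w i) ->
  (\sum_(i <- s) w i * x i) ^+ 2 <= (\sum_(i <- s) w i) * (\sum_(i <- s) w i * x i ^+ 2).
Proof.
move=> w0; elim: s => [|i s IH]; first by rewrite !big_nil expr0n /= mul0r.
rewrite !big_cons; move: IH (w0 i).
have : 0 <= \sum_(j <- s) w j by apply: sumr_ge0.
have : 0 <= \sum_(j <- s) w j * x j ^+ 2 by apply: sumr_ge0 => j _; rewrite mulr_ge0 ?sqr_ge0.
move: (\sum_(j <- s) w j * x j) (\sum_(j <- s) w j) (\sum_(j <- s) w j * x j ^+ 2) (w i) (x i).
move=> A B D v y D0 B0 h v0.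
have key : 2 * A * y <= B * y ^+ 2 + D.
  have r0 : 0 <= B * y ^+ 2 + D by rewrite addr_ge0 // mulr_ge0 // sqr_ge0.
  have [l0|l0] := ltP (2 * A * y) 0; first by rewrite (le_trans (ltW l0)).
  rewrite -(ler_pXn2r (n := 2)) ?nnegrE // -subr_ge0.
  have -> : (B * y ^+ 2 + D) ^+ 2 - (2 * A * y) ^+ 2 =
    (B * y ^+ 2 - D) ^+ 2 + 4 * y ^+ 2 * (B * D - A ^+ 2) by ring.
  apply: addr_ge0; first exact: sqr_ge0.
  by apply: mulr_ge0; [rewrite mulr_ge0 // sqr_ge0|rewrite subr_ge0].
have := ler_wpM2l v0 key; rewrite -subr_ge0 => k2; rewrite -subr_ge0.
have -> : (v + B) * (v * y ^+ 2 + D) - (v * y + A) ^+ 2 =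
   (v * (B * y ^+ 2 + D) - v * (2 * A * y)) + (B * D - A ^+ 2) by ring.
by apply: addr_ge0 => //; rewrite subr_ge0.
Qed.

Lemma geo_block_le (r : R) M M' : 0 <= r -> r < 1 -> \sum_(M <= m < M') r ^+ m <= r ^+ M / (1 - r).
Proof.
move=> r0 r1; have r1' : 0 < 1 - r by rewrite subr_gt0.
have [MM|MM] := leqP M' M.
  by rewrite big_geq // divr_ge0 ?exprn_ge0 // ltW.
suff -> : \sum_(M <= m < M') r ^+ m = (r ^+ M - r ^+ M') / (1 - r).
  by rewrite ler_wpM2r ?invr_ge0 ?(ltW r1') // gerBl exprn_ge0.
elim: M' MM => // M' IH; rewrite ltnS leq_eqVlt => /orP[/eqP <-|MM].
  by rewrite big_nat1 exprS; field; rewrite gt_eqF.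
by rewrite big_nat_recr ?(ltnW MM) //= IH // exprS; field; rewrite gt_eqF.
Qed.

(** Cauchy-Schwarz with weights r^m, so that only the sums of |a_j m|^2 over j at fixed degree
    enter. *)
Lemma l2_block (a : nat -> nat -> H) (J0 J M M' : nat) (r : R) (q : H) : `|q| <= r ->
  \sum_(J0 <= j < J) `|\sum_(M <= m < M') q ^+ m * a j m| ^+ 2 <=
  (\sum_(M <= m < M') r ^+ m) *
  (\sum_(M <= m < M') r ^+ m * \sum_(J0 <= j < J) `|a j m| ^+ 2).
Proof.
move=> qr; have r0 : 0 <= r by apply: le_trans qr.
have -> : \sum_(M <= m < M') r ^+ m * (\sum_(J0 <= j < J) `|a j m| ^+ 2) =
    \sum_(J0 <= j < J) \sum_(M <= m < M') r ^+ m * `|a j m| ^+ 2.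
  by rewrite exchange_big /=; apply: eq_bigr => m _; rewrite mulr_sumr.
rewrite mulr_sumr; apply: ler_sum => j _.
apply: le_trans (weighted_CS _ _ _); last by move=> m; rewrite exprn_ge0.
rewrite lerXn2r ?nnegrE ?sumr_ge0 // => [m _|]; first by rewrite mulr_ge0 ?exprn_ge0.
apply: le_trans (qnorm_sum _ _ _) _; apply: ler_sum => m _.
by rewrite qnormM qnormX ler_wpM2r // lerXn2r ?nnegrE.
Qed.

Lemma l2_lim (G : set_system nat) {FG : ProperFilter G} (u : nat -> nat -> H) (x : nat -> H) (J0 J : nat) (K : R) :
  (forall j, u j @ G --> x j) ->
  (\forall n \near G, \sum_(J0 <= j < J) `|u j n| ^+ 2 <= K) ->
  \sum_(J0 <= j < J) `|x j| ^+ 2 <= K.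
Proof.
move=> ux h.
have c : (fun n => \sum_(J0 <= j < J) `|u j n| ^+ 2 : R) @ G --> (\sum_(J0 <= j < J) `|x j| ^+ 2 : R).
  elim: (index_iota J0 J) => [|j s IH].
    by under eq_fun do rewrite big_nil; rewrite big_nil; exact: cvg_cst.
  under eq_fun do rewrite big_cons; rewrite big_cons; apply: cvgD IH.
  have cn : (fun n => `|u j n| : R) @ G --> (`|x j| : R) by apply: cvg_norm; exact: ux.
  by under eq_fun do rewrite expr2; rewrite expr2; exact: cvgM.
have cK : (fun _ : nat => K) @ G --> K by exact: cvg_cst.
exact: (ler_cvg_to c cK h).
Qed.

Lemma bounded_sum_tail (x : nat -> R) (B eps : R) : (forall j, 0 <= x j) ->
  (forall J, \sum_(j < J) x j <= B) -> 0 < eps ->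
  exists J0, forall J, \sum_(J0 <= j < J) x j <= eps.
Proof.
move=> x0 xB eps0.
have E J : series x J = \sum_(j < J) x j by rewrite /series /= big_mkord.
have nd : {homo (series x) : n m / (n <= m)%N >-> n <= m}.
  move=> n m nm; rewrite /series /= (big_cat_nat (leq0n n) nm) /= lerDl.
  by apply: sumr_ge0.
have cx : cvgn (series x).
  apply: nondecreasing_is_cvgn => //; exists B => _ [J _ <-]; rewrite E; exact: xB.
have /cvgrPdist_le /(_ _ eps0) [J0 _ HJ] := cx.
exists J0 => J; have [JJ|JJ] := leqP J J0; first by rewrite big_geq // ltW.
have := HJ J0 (leqnn _); rewrite /= => h.
have : series x J <= limn (series x) by apply: nondecreasing_cvgn_le.
rewrite {1}/series /= (big_cat_nat (leq0n J0) (ltnW JJ)) /= -[\sum_(0 <= i < J0) _]/(series x J0).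
by move: h; rewrite ler_norml => /andP[_]; lra.
Qed.

End L2Blocks.

(** * Truncation in the index and in the degree *)

Section Truncation.
Variable R : realType.
Local Notation H := (quaternion R).
Variables (f : nat -> H -> H) (a : nat -> nat -> H) (delta : R).
Hypothesis Ha : forall j, has_qcoef (f j) (a j).
Hypothesis HS : forall J m, \sum_(j < J) `|a j m| ^+ 2 <= 1.
Hypothesis HU : forall J q, qball R q -> \sum_(j < J) `|f j q| ^+ 2 <= 1.
Hypothesis HL : forall q c, qball R q -> c < delta ^+ 2 ->
  exists J, c <= \sum_(j < J) `|f j q| ^+ 2.

Lemma coef_block_le1 J0 J m : \sum_(J0 <= j < J) `|a j m| ^+ 2 <= 1.
Proof.
have [JJ|JJ] := leqP J J0; first by rewrite big_geq.
have := HS J m; rewrite -(big_mkord xpredT (fun j => `|a j m| ^+ 2)) (big_cat_nat (leq0n J0) (ltnW JJ)) /=.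
apply: le_trans; rewrite lerDr; apply: sumr_ge0 => j _; exact: exprn_ge0.
Qed.

Lemma tail_degree (r : R) (M J : nat) (q : H) : r < 1 -> `|q| <= r ->
  \sum_(j < J) `|f j q - \sum_(m < M) q ^+ m * a j m| ^+ 2 <= (r ^+ M / (1 - r)) ^+ 2.
Proof.
move=> r1 qr; have r0 : 0 <= r by apply: le_trans qr.
have qb : qball R q by exact: le_lt_trans qr r1.
rewrite -(big_mkord xpredT (fun j => `|f j q - \sum_(m < M) q ^+ m * a j m| ^+ 2)).
apply: (@l2_lim R \oo _ (fun j n => qpseries (a j) q n - \sum_(m < M) q ^+ m * a j m)).
  by move=> j; apply: cvgB; [exact: Ha|exact: cvg_cst].
exists M => // M' /= MM.
have E j : qpseries (a j) q M' - \sum_(m < M) q ^+ m * a j m = \sum_(M <= m < M') q ^+ m * a j m.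
  by rewrite /qpseries /series /= (big_cat_nat (leq0n M) MM) /= big_mkord addrAC subrr add0r.
under eq_bigr do rewrite E.
apply: le_trans (l2_block _ _ _ _ _ qr) _; rewrite expr2.
have s0 : 0 <= \sum_(M <= m < M') r ^+ m by apply: sumr_ge0 => m _; exact: exprn_ge0.
apply: ler_pM => //; first by apply: sumr_ge0 => m _; rewrite mulr_ge0 ?exprn_ge0 // sumr_ge0.
  exact: geo_block_le.
apply: le_trans (geo_block_le M M' r0 r1); apply: ler_sum => m _.
by rewrite ler_piMr ?exprn_ge0 // coef_block_le1.
Qed.

(** Each degree has a convergent sum over j; finitely many degrees share one index. *)
Lemma coef_tail_uniform (M : nat) (eps : R) : 0 < eps ->
  exists J0, forall m J, (m < M)%N -> \sum_(J0 <= j < J) `|a j m| ^+ 2 <= eps.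
Proof.
move=> eps0; elim: M => [|M [J1 H1]]; first by exists 0%N.
have [J2 H2] := @bounded_sum_tail R (fun j => `|a j M| ^+ 2) 1 eps
   (fun j => exprn_ge0 2 (normr_ge0 _)) (fun J => HS J M) eps0.
exists (maxn J1 J2) => m J; rewrite ltnS leq_eqVlt.
have mono J3 (x : nat -> R) : (forall j, 0 <= x j) -> (J3 <= maxn J1 J2)%N ->
    \sum_(maxn J1 J2 <= j < J) x j <= \sum_(J3 <= j < J) x j.
  move=> x0 J3m; have [JJ|JJ] := leqP J (maxn J1 J2).
    by rewrite big_geq //; exact: sumr_ge0.
  by rewrite [leRHS](big_cat_nat J3m (ltnW JJ)) /= lerDr; exact: sumr_ge0.
move=> /orP[/eqP ->|mM].
  by apply: le_trans (H2 J); apply: mono => [j|]; rewrite ?exprn_ge0 ?leq_maxr.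
by apply: le_trans (H1 m J mM); apply: mono => [j|]; rewrite ?exprn_ge0 ?leq_maxl.
Qed.

(** Uniformity in q comes from coefficients: degrees below M have small tails in j by
    [coef_tail_uniform], degrees above M carry the small factor r^M. *)
Lemma tail_index (r eta : R) : 0 <= r -> r < 1 -> 0 < eta ->
  exists J0, forall J (q : H), `|q| <= r -> \sum_(J0 <= j < J) `|f j q| ^+ 2 <= eta.
Proof.
move=> r0 r1 eta0; have r1' : 0 < 1 - r by rewrite subr_gt0.
have e1 : 0 < eta / 2 by rewrite divr_gt0.
have [M _ HM] := geo_small ((1 - r) ^- 2) r0 r1 e1.
have {HM} := HM M (leqnn M) => /= HM.
pose eps := (1 - r) ^+ 2 * (eta / 2).
have eps0 : 0 < eps by rewrite mulr_gt0 ?exprn_gt0.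
have [J0 HJ0] := coef_tail_uniform M eps0; exists J0 => J q qr.
have qb : qball R q by exact: le_lt_trans qr r1.
apply: (@l2_lim R \oo _ (fun j n => qpseries (a j) q n)) => [j|]; first exact: Ha.
apply: nearW => n.
apply: le_trans (l2_block _ _ _ _ _ qr) _.
have s0 : 0 <= \sum_(0 <= m < n) r ^+ m by apply: sumr_ge0 => m _; exact: exprn_ge0.
have ir0 : 0 <= (1 - r)^-1 by rewrite invr_ge0 ltW.
apply: (@le_trans _ _ ((1 - r)^-1 * ((1 - r)^-1 * eps + r ^+ M / (1 - r)))); last first.
  have -> : (1 - r)^-1 * ((1 - r)^-1 * eps + r ^+ M / (1 - r)) = eta / 2 + (1 - r) ^- 2 * r ^+ M.
    by rewrite /eps; field; rewrite gt_eqF.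
  by move: HM; lra.
apply: ler_pM => //.
- by apply: sumr_ge0 => m _; rewrite mulr_ge0 ?exprn_ge0 // sumr_ge0.
- by have := geo_block_le 0 n r0 r1; rewrite expr0 mul1r.
have bnd m : r ^+ m * (\sum_(J0 <= j < J) `|a j m| ^+ 2) <=
    r ^+ m * eps + (if (M <= m)%N then r ^+ m else 0).
  have [Mm|mM] := leqP M m.
    apply: le_trans (_ : r ^+ m <= _); first by rewrite ler_piMr ?exprn_ge0 // coef_block_le1.
    by rewrite lerDr mulr_ge0 ?exprn_ge0 // ltW.
  by rewrite addr0 ler_wpM2l ?exprn_ge0 // HJ0.
apply: le_trans (ler_sum _ (fun m _ => bnd m)) _.
rewrite big_split /= -mulr_suml; apply: lerD.
  by rewrite ler_wpM2r ?(ltW eps0) //; have := geo_block_le 0 n r0 r1; rewrite expr0 mul1r.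
rewrite -big_mkcond /=; have [nM|Mn] := leqP n M.
  rewrite big_nat_cond big1 ?divr_ge0 ?exprn_ge0 ?(ltW r1') // => m /andP[/andP[_ mn] Mm].
  by move: (leq_trans mn nM); rewrite ltnNge Mm.
rewrite (big_cat_nat (leq0n M) (ltnW Mn)) /= [X in X + _]big_nat_cond big1 ?add0r; last first.
  by move=> m /andP[/andP[_ mM] Mm]; move: mM; rewrite ltnNge Mm.
rewrite big_mkcond; apply: le_trans (geo_block_le M n r0 r1); apply: ler_sum => m _.
by case: ifP => _ //; exact: exprn_ge0.
Qed.

Lemma sqr_norm_split (x y : H) (eta : R) : 0 < eta ->
  `|x| ^+ 2 <= (1 + eta) * `|y| ^+ 2 + (1 + eta^-1) * `|x - y| ^+ 2.
Proof.
move=> eta0; have h : `|x| <= `|y| + `|x - y| by rewrite -{1}(subrK y x) addrC ler_normD.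
apply: (@le_trans _ _ ((`|y| + `|x - y|) ^+ 2)); first by rewrite lerXn2r ?nnegrE // addr_ge0.
move: `|y| `|x - y| => u v; rewrite -subr_ge0.
have -> : (1 + eta) * u ^+ 2 + (1 + eta^-1) * v ^+ 2 - (u + v) ^+ 2 = (eta * u - v) ^+ 2 / eta.
  by field; rewrite gt_eqF.
by rewrite divr_ge0 ?sqr_ge0 // ltW.
Qed.

(** [tail_index] discards the functions beyond J and [tail_degree] the degrees beyond M;
    [sqr_norm_split] trades each error for a factor 1 + eta. *)
Lemma truncation (r eta : R) (N : nat) : 0 <= r -> r < 1 -> 0 < eta -> eta <= 1 ->
  exists J M, (N <= M)%N /\ forall q : H, `|q| <= r ->
    delta ^+ 2 - 3 * eta <= (1 + eta) * \sum_(j < J) `|\sum_(m < M) q ^+ m * a j m| ^+ 2 /\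
    \sum_(j < J) `|\sum_(m < M) q ^+ m * a j m| ^+ 2 <= 1 + 2 * eta.
Proof.
move=> r0 r1 eta0 eta1.
have [J0 HJ0] := tail_index r0 r1 eta0.
have e2 : 0 < eta / 2 by rewrite divr_gt0.
have [M0 _ HM0] := geo_small ((1 - r)^-1) r0 r1 e2.
pose M := maxn N M0; have := HM0 M (leq_maxr _ _) => /=; rewrite mulrC => HM.
exists J0, M; split=> [|q qr]; first exact: leq_maxl.
have qb : qball R q by exact: le_lt_trans qr r1.
have T := tail_degree M J0 r1 qr.
have T2 : (1 + eta^-1) * \sum_(j < J0) `|f j q - \sum_(m < M) q ^+ m * a j m| ^+ 2 <= eta.
  apply: (@le_trans _ _ ((1 + eta^-1) * (eta / 2) ^+ 2)).
    rewrite ler_wpM2l ?addr_ge0 ?invr_ge0 ?(ltW eta0) //; apply: (le_trans T).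
    by rewrite lerXn2r ?nnegrE ?(ltW e2) // divr_ge0 ?exprn_ge0 // subr_ge0 ltW.
  have -> : (1 + eta^-1) * (eta / 2) ^+ 2 = eta * ((eta + 1) / 4) by field; rewrite gt_eqF.
  rewrite ler_piMr ?(ltW eta0) //; lra.
split; last first.
  apply: (@le_trans _ _ (\sum_(j < J0) ((1 + eta) * `|f j q| ^+ 2 +
      (1 + eta^-1) * `|f j q - \sum_(m < M) q ^+ m * a j m| ^+ 2))).
    by apply: ler_sum => j _; rewrite (distrC (f j q)); exact: sqr_norm_split.
  rewrite big_split /= -!mulr_sumr.
  have := ler_wpM2l (_ : 0 <= 1 + eta) (HU J0 qb); rewrite addr_ge0 ?(ltW eta0) // => /(_ isT).
  by move: T2; lra.
have dl : delta ^+ 2 - eta < delta ^+ 2 by rewrite ltrBlDr ltrDl.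
have [J1 HJ1] := HL qb dl.
have low : delta ^+ 2 - 2 * eta <= \sum_(j < J0) `|f j q| ^+ 2.
  have := HJ0 J1 q qr; have [JJ|JJ] := leqP J1 J0.
    have : \sum_(j < J1) `|f j q| ^+ 2 <= \sum_(j < J0) `|f j q| ^+ 2.
      rewrite -!(big_mkord xpredT (fun j => `|f j q| ^+ 2)) [leRHS](big_cat_nat (leq0n J1) JJ) /= lerDl.
      by apply: sumr_ge0 => j _; exact: exprn_ge0.
    by move: HJ1 eta0; lra.
  move: HJ1; rewrite -!(big_mkord xpredT (fun j => `|f j q| ^+ 2)) (big_cat_nat (leq0n J0) (ltnW JJ)) /=.
  lra.
have : \sum_(j < J0) `|f j q| ^+ 2 <= (1 + eta) * \sum_(j < J0) `|\sum_(m < M) q ^+ m * a j m| ^+ 2 + eta.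
  apply: (@le_trans _ _ (\sum_(j < J0) ((1 + eta) * `|\sum_(m < M) q ^+ m * a j m| ^+ 2 +
      (1 + eta^-1) * `|f j q - \sum_(m < M) q ^+ m * a j m| ^+ 2))).
    by apply: ler_sum => j _; exact: sqr_norm_split.
  by rewrite big_split /= -!mulr_sumr lerD2l.
by move: low; lra.
Qed.

End Truncation.

(** * Numerical comparison of the constants *)

Section CoronaConstants.
Variable R : realType.
Implicit Types d : R.

Lemma expR1_ge : 244 / 100 <= expR 1 :> R.
Proof.
have -> : expR 1 = expR (4^-1) ^+ 4 :> R by rewrite -expRM_natl mulfV.
apply: (@le_trans _ _ ((1 + 4^-1) ^+ 4)); first by rewrite !exprS expr0; lra.
by rewrite lerXn2r ?nnegrE ?expR_ge0 ?expR_ge1Dx // addr_ge0 // invr_ge0.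
Qed.

Lemma expRN2_le : expR (- 2) <= 168 / 1000 :> R.
Proof.
have e1 := expR1_ge; have e0 := expR_gt0 (1 : R).
have e2 : expR 2 = expR 1 * expR 1 :> R by rewrite -expRD.
have : expR 2 * expR (- 2) = 1 :> R by rewrite -expRD subrr expR0.
have := expR_ge0 (- 2 : R); rewrite e2; move: e1 e0; move: (expR 1) (expR (- 2)) => e y.
clear => e1 e0 y0 h; nra.
Qed.

(** The terms sqrt(1 + e^2) >= e and sqrt(2) e >= 1.4 e suffice; the excess of 2.4 over 2.38 is the
    slack. *)
Lemma kappa_ge : 24 / 10 * expR 1 <= kappa R.
Proof.
rewrite /kappa /euler_e; set e := expR 1.
have e0 : 0 <= e by exact: expR_ge0.
have h1 : e <= Num.sqrt (1 + e ^+ 2).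
  by rewrite -[leLHS](ger0_norm e0) -sqrtr_sqr ler_wsqrtr // lerDr.
have h2 : 14 / 10 <= Num.sqrt 2 :> R.
  have h : 0 <= 14 / 10 :> R by rewrite divr_ge0.
  by rewrite -[leLHS](ger0_norm h) -sqrtr_sqr ler_wsqrtr // expr2; lra.
have := ler_wpM2r e0 h2; have := sqrtr_ge0 e; lra.
Qed.

Lemma lnV4_ge2 d : 0 < d -> d <= expR (- 2^-1) -> 2 <= ln (d ^- 4).
Proof.
move=> d0 dle; have -> : (2 : R) = ln (expR 2) by rewrite expRK.
rewrite ler_ln ?posrE ?expR_gt0 ?invr_gt0 ?exprn_gt0 //.
rewrite -[leLHS]invrK lef_pV2 ?posrE ?invr_gt0 ?expR_gt0 ?exprn_gt0 // -expRN.
have -> : expR (- 2) = expR (- 2^-1) ^+ 4 :> R by rewrite -expRM_natl; congr expR; field.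
by rewrite lerXn2r ?nnegrE ?expR_ge0 // ltW.
Qed.

(** The leading term is (2 X / d^3)^2. The factors 102/100 and 99/100 and the added lower terms
    raise 2 to less than 2.38, since X >= 2 e when d <= e^(-1/2). *)
Lemma corona_H2_constant d X X' : 0 < d -> d <= expR (- 2^-1) ->
  X = expR 1 * ln (d ^- 4) -> X' = expR 1 * ln ((99 / 100 * d) ^- 4) ->
  102 / 100 * (4 * (X' / (99 / 100 * d) ^+ 2 + (99 / 100 * d) ^- 2) *
     (X' / (99 / 100 * d) ^+ 4 + 1)) <= (238 / 100 * X / d ^+ 3) ^+ 2.
Proof.
move=> d0 dle XE XE'.
have e1 := expR1_ge; have L2 := lnV4_ge2 d0 dle.
have e0 : 0 < expR 1 :> R by rewrite expR_gt0.
have Xe : 2 * expR 1 <= X by rewrite XE mulrC ler_wpM2l // ltW.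
have lnt : ln ((99 / 100 * d) ^- 4) <= ln (d ^- 4) + 411 / 10000.
  have -> : (99 / 100 * d) ^- 4 = (1 + ((99 / 100) ^- 4 - 1)) * d ^- 4.
    by rewrite addrC subrK exprMn invfM.
  rewrite lnM ?posrE ?invr_gt0 ?exprn_gt0 // ?[1 + _]addrC ?subrK ?invr_gt0 ?exprn_gt0 //.
  rewrite addrC lerD2l -[X in ln X](subrK 1) [X in ln X]addrC.
  have q : (99 / 100) ^- 4 - 1 <= 411 / 10000 :> R.
    have : 1 <= 10411 / 10000 * (99 / 100) ^+ 4 :> R by rewrite !exprS expr0; lra.
    have : 0 < (99 / 100) ^+ 4 :> R by rewrite exprn_gt0 //; lra.
    move: ((99 / 100) ^+ 4) => y y0 h; have : y^-1 <= 10411 / 10000 by rewrite -div1r ler_pdivrMr.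
    by clear; lra.
  apply: le_trans q; apply: le_ln1Dx.
  by rewrite ltrBrDr addNr invr_gt0 exprn_gt0.
have X'X : X' <= 10206 / 10000 * X.
  by have := ler_wpM2l (ltW e0) lnt; rewrite XE' mulrDr -XE; move: Xe e0; clear; lra.
have t0 : 0 < 99 / 100 * d by move: d0; clear; lra.
have t1 : 99 / 100 * d <= 1.
  have : expR (- 2^-1) <= 1 :> R by rewrite -expR0 ler_expR oppr_le0 invr_ge0.
  by move: dle d0; clear; lra.
have X'0 : 0 <= X'.
  rewrite XE'; move: (99 / 100 * d) t0 t1 => t t0 t1.
  by rewrite mulr_ge0 ?(ltW e0) // ln_ge0 // -[leLHS]invr1 lef_pV2 ?posrE ?exprn_gt0 // exprn_ile1 // ltW.
pose p := (99 / 100 * d) ^+ 4; have p0 : 0 <= p by exact: exprn_ge0 (ltW t0).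
have pX : p <= 345 / 10000 * X.
  apply: (@le_trans _ _ (168 / 1000)); last by move: Xe e1; clear; lra.
  apply: le_trans expRN2_le.
  have -> : expR (- 2) = expR (- 2^-1) ^+ 4 :> R by rewrite -expRM_natl; congr expR; field.
  have d99 : 99 / 100 * d <= expR (- 2^-1) by apply: le_trans dle; move: d0; clear; lra.
  have d990 : 0 <= 99 / 100 * d by move: d0; clear; lra.
  by rewrite /p; move: (99 / 100 * d) d99 d990 => t ? ?; rewrite lerXn2r ?nnegrE ?expR_ge0.
have X0 : 0 <= X by move: Xe e1; clear; lra.
have dn : d != 0 by rewrite gt_eqF.
have split_d (t c : R) : t != 0 -> c * (4 * (X' / (t * d) ^+ 2 + (t * d) ^- 2) *
     (X' / (t * d) ^+ 4 + 1)) = c * 4 * t ^- 6 * ((X' + 1) * (X' + (t * d) ^+ 4)) * d ^- 6.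
  by move=> tn; field; rewrite dn tn.
rewrite split_d -/p; last by rewrite gt_eqF //; clear; lra.
have -> : (238 / 100 * X / d ^+ 3) ^+ 2 = ((238 / 100) ^+ 2 * X ^+ 2) * d ^- 6.
  by move: (238 / 100) => c; field; rewrite dn.
rewrite ler_wpM2r ?invr_ge0 ?exprn_ge0 ?(ltW d0) //.
have h1 : (X' + 1) * (X' + p) <= (12256 / 10000 * X) * (10551 / 10000 * X).
  have a1 : X' + 1 <= 12256 / 10000 * X by move: X'X Xe e1; clear; lra.
  have a2 : X' + p <= 10551 / 10000 * X by move: X'X pX; clear; lra.
  exact: (ler_pM (addr_ge0 X'0 ler01) (addr_ge0 X'0 p0) a1 a2).
have t6 : (99 / 100) ^- 6 <= 10623 / 10000 :> R.
  have : 1 <= 10623 / 10000 * (99 / 100) ^+ 6 :> R by rewrite !exprS expr0; clear; lra.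
  have : 0 < (99 / 100) ^+ 6 :> R by rewrite exprn_gt0 //; clear; lra.
  by move: ((99 / 100) ^+ 6) => y y0 h; rewrite -div1r ler_pdivrMr.
have c0 : 0 <= 102 / 100 * 4 :> R by clear; lra.
have h0 : 0 <= (X' + 1) * (X' + p) by rewrite mulr_ge0 ?addr_ge0.
apply: le_trans (ler_wpM2r h0 (ler_wpM2l c0 t6)) _.
have c1 : 0 <= 102 / 100 * 4 * (10623 / 10000) :> R by clear; lra.
apply: le_trans (ler_wpM2l c1 h1) _.
rewrite expr2 [X ^+ 2]expr2; have := mulr_ge0 X0 X0; clear; lra.
Qed.

Lemma bernoulli (eps : R) n : 0 <= eps -> eps <= 1 -> 1 - n%:R * eps <= (1 - eps) ^+ n.
Proof.
move=> e0 e1; elim: n => [|n IH]; first by rewrite mul0r subr0 expr0.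
rewrite exprS -natr1; have e1' : 0 <= 1 - eps by rewrite subr_ge0.
apply: le_trans (ler_wpM2l e1' IH); rewrite -subr_ge0.
have -> : (1 - eps) * (1 - n%:R * eps) - (1 - (n%:R + 1) * eps) = n%:R * eps ^+ 2 by ring.
by rewrite mulr_ge0 ?ler0n ?sqr_ge0.
Qed.

End CoronaConstants.

(** * The lower bound for the given functions *)

Section CoronaLower.
Variable R : realType.
Local Notation H := (quaternion R).
Variables (f : nat -> H -> H) (a : nat -> nat -> H) (delta : R).
Hypothesis Ha : forall j, has_qcoef (f j) (a j).
Hypothesis HS : forall J m, \sum_(j < J) `|a j m| ^+ 2 <= 1.
Hypothesis HU : forall J q, qball R q -> \sum_(j < J) `|f j q| ^+ 2 <= 1.
Hypothesis HL : forall q c, qball R q -> c < delta ^+ 2 ->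
  exists J, c <= \sum_(j < J) `|f j q| ^+ 2.

(** The dilation radius r is chosen after N, so that undoing it on degrees below N costs almost
    nothing. J depends on N, the constant does not. *)
Lemma corona_lower (d : R) (N : nat) : 0 < d -> d <= delta -> delta < 1 -> d <= expR (- 2^-1) ->
  exists J, forall mu : nat -> H, (forall m, (N <= m)%N -> mu m = 0) ->
  \sum_(m < N) `|mu m| ^+ 2 <= (238 / 100 * (expR 1 * ln (d ^- 4)) / d ^+ 3) ^+ 2 *
    \sum_(l < N) \sum_(j < J) `|\sum_(m < N) qconj (a j m) * mu (m + l)%N| ^+ 2.
Proof.
move=> d0 dd delta1 dle; have delta0 : 0 < delta by apply: lt_le_trans dd.
pose n2 : R := (2 * N)%:R; have n20 : 0 <= n2 by rewrite ler0n.
(* By Bernoulli's inequality r^(2N) is at least 99/100. *)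
pose eps : R := (100 * (n2 + 1))^-1.
have n2p : 0 < 100 * (n2 + 1) by rewrite mulr_gt0 // ltr_wpDl.
have eps0 : 0 < eps by rewrite invr_gt0.
have eps1 : eps < 1 by rewrite invf_lt1 // ; move: n20; lra.
have ne : n2 * eps <= 100^-1.
  have -> : n2 * eps = 100^-1 * (n2 / (n2 + 1)) by rewrite /eps; field; rewrite gt_eqF // ltr_wpDl.
  by rewrite ler_piMr ?invr_ge0 // ler_pdivrMr ?mul1r ?lerDl // ltr_wpDl.
pose r := 1 - eps; have r0 : 0 < r by rewrite subr_gt0.
have r1 : r < 1 by rewrite /r; move: eps0; lra.
have rN : 99 / 100 <= r ^+ (2 * N).
  apply: le_trans (bernoulli (2 * N) (ltW eps0) (ltW eps1)); rewrite -/n2; move: ne; lra.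
have [k kE] : exists k : R, k = 1000 by eexists.
have k0 : 0 < k by rewrite kE ltr0n.
pose eta := delta ^+ 2 / k.
have del2 : delta ^+ 2 = k * eta by rewrite /eta mulrCA divff ?mulr1 // gt_eqF.
have eta0 : 0 < eta by exact: divr_gt0 (exprn_gt0 2 delta0) k0.
have eta1 : eta <= 1 / 1000.
  have : delta ^+ 2 <= 1 by rewrite exprn_ile1 // ltW.
  by rewrite del2 kE; clear -Ha HS HU HL; lra.
have eta1' : eta <= 1 by move: eta1; clear -Ha HS HU HL; lra.
clearbody eta.
have [J [M [NM HM]]] := truncation Ha HS HU HL N (ltW r0) r1 eta0 eta1'.
exists J => mu smu.
have e2 : 0 < 1 + 2 * eta by rewrite addr_gt0 // mulr_gt0.
pose s := (Num.sqrt (1 + 2 * eta))^-1.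
have s0 : 0 <= s by rewrite invr_ge0 sqrtr_ge0.
have s2 : s ^+ 2 = (1 + 2 * eta)^-1 by rewrite /s exprVn sqr_sqrtr // ltW.
have s21 : s ^+ 2 <= 1 by rewrite s2 invf_le1 // lerDl mulr_ge0 // ltW.
have d'0 : 0 < 99 / 100 * d by move: d0; clear -Ha HS HU HL; lra.
have d'1 : 99 / 100 * d < 1 by move: dd delta1 d0; clear -Ha HS HU HL; lra.
(* Dilating by r brings the bounds to the closed unit ball; [s] restores the upper bound 1. *)
pose b j m := (s * r ^+ m) *: a j m.
have Hb (q : H) : `|q| <= 1 -> (99 / 100 * d) ^+ 2 <=
    \sum_(j < J) `|\sum_(m < N + (M - N)) q ^+ m * b j m| ^+ 2 <= 1.
  move=> q1; rewrite subnKC //.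
  have rq : `|r *: q| <= r by rewrite normrZ gtr0_norm // ler_piMr // ltW.
  have [lo up] := HM (r *: q) rq.
  have -> : \sum_(j < J) `|\sum_(m < M) q ^+ m * b j m| ^+ 2 =
      s ^+ 2 * \sum_(j < J) `|\sum_(m < M) (r *: q) ^+ m * a j m| ^+ 2.
    rewrite mulr_sumr; apply: eq_bigr => j _.
    have -> : \sum_(m < M) q ^+ m * b j m = s *: \sum_(m < M) (r *: q) ^+ m * a j m.
      rewrite scaler_sumr; apply: eq_bigr => m _.
      by rewrite /b -scalerAr exprZn -scalerAl scalerA.
    by rewrite normrZ exprMn ger0_norm.
  move: lo up; rewrite s2; move: (\sum_(j < J) _) => S lo up.
  rewrite ler_pdivlMl // ler_pdivrMl // mulr1 up andbT.
  have dd2 : d ^+ 2 <= delta ^+ 2 by rewrite lerXn2r ?nnegrE // ltW.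
  have S0 : 997 * eta <= (1 + eta) * S by move: lo; rewrite del2 kE; clear -Ha HS HU HL; lra.
  have eta12 : (1 + 2 * eta) * (1 + eta) <= 1004 / 1000.
    have : eta * eta <= eta * (1 / 1000) by rewrite ler_wpM2l // ltW.
    by move: eta1; clear -Ha HS HU HL; lra.
  have e1 : 0 < 1 + eta by rewrite addr_gt0.
  rewrite -(ler_pM2l e1); apply: le_trans S0.
  have [c cE] : exists c : R, c = (99 / 100) ^+ 2 by eexists.
  have c0 : 0 <= c by rewrite cE sqr_ge0.
  have w0 : 0 <= c * delta ^+ 2 := mulr_ge0 c0 (sqr_ge0 _).
  apply: (@le_trans _ _ (((1 + 2 * eta) * (1 + eta)) * (c * delta ^+ 2))).
    rewrite exprMn -cE mulrCA mulrA.
    have w1 : 0 <= (1 + 2 * eta) * (1 + eta) by rewrite mulr_ge0 // ltW.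
    exact: (ler_wpM2l w1 (ler_wpM2l c0 dd2)).
  apply: le_trans (ler_wpM2r w0 eta12) _; rewrite del2 kE cE; move: eta0; clear -Ha HS HU HL; lra.
(* Undoes the dilation by [r]. *)
pose la m := r ^- m *: mu m.
have sla m : (N <= m)%N -> la m = 0 by move=> h; rewrite /la smu // scaler0.
have := quat_corona_H2 d'0 d'1 Hb sla (erefl _).
set Phi := 4 * _ * _ => key.
have rV i : 1 <= r ^- i.
  by rewrite -[leLHS]invr1 lef_pV2 ?posrE ?exprn_gt0 // exprn_ile1 // ltW.
have l1 : \sum_(m < N) `|mu m| ^+ 2 <= \sum_(m < N) `|la m| ^+ 2.
  apply: ler_sum => m _; rewrite /la normrZ ger0_norm ?(le_trans ler01 (rV _)) //.
  by rewrite exprMn ler_peMl ?exprn_ge0 // exprn_ege1.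
have l2 : \sum_(l < N) \sum_(j < J) `|\sum_(m < N) qconj (b j m) * la (m + l)%N| ^+ 2 <=
    102 / 100 * \sum_(l < N) \sum_(j < J) `|\sum_(m < N) qconj (a j m) * mu (m + l)%N| ^+ 2.
  rewrite mulr_sumr; apply: ler_sum => l _; rewrite mulr_sumr; apply: ler_sum => j _.
  have -> : \sum_(m < N) qconj (b j m) * la (m + l)%N =
     (s * r ^- l) *: \sum_(m < N) qconj (a j m) * mu (m + l)%N.
    rewrite scaler_sumr; apply: eq_bigr => m _.
    rewrite /b /la qconjZ -scalerAl -scalerAr scalerA; congr (_ *: _).
    by rewrite exprD; field; rewrite !expf_neq0 // gt_eqF.
  rewrite normrZ exprMn ler_wpM2r ?exprn_ge0 // real_normK ?num_real // exprMn.
  apply: (@le_trans _ _ (1 * (r ^- N) ^+ 2)).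
    apply: ler_pM; rewrite ?sqr_ge0 // lerXn2r ?nnegrE ?(le_trans ler01 (rV _)) //.
    by rewrite lef_pV2 ?posrE ?exprn_gt0 // ler_wiXn2l ?(ltW r0) ?(ltW r1) // ltnW.
  rewrite mul1r -exprVn -exprM mulnC exprVn -[leRHS]invrK lef_pV2 ?posrE ?invr_gt0 ?exprn_gt0 //.
  apply: le_trans rN; have : 102 / 100 * (99 / 100) >= 1 :> R by clear -Ha HS HU HL; lra.
  have : 0 < 102 / 100 :> R by clear -Ha HS HU HL; lra.
  by move: (102 / 100) (99 / 100) => x y x0 xy; rewrite -div1r ler_pdivrMr // mulrC.
have Phi0 : 0 <= Phi.
  rewrite /Phi; move: (99 / 100 * d) d'0 d'1 => t t0 t1.
  have ln0 : 0 <= ln (t ^- 4).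
    by rewrite ln_ge0 // -[leLHS]invr1 lef_pV2 ?posrE ?exprn_gt0 // exprn_ile1 // ltW.
  have x0 : 0 <= expR 1 * ln (t ^- 4) by rewrite mulr_ge0 // expR_ge0.
  by rewrite !mulr_ge0 ?addr_ge0 ?divr_ge0 ?invr_ge0 ?exprn_ge0 // ltW.
have T0 : 0 <= \sum_(l < N) \sum_(j < J) `|\sum_(m < N) qconj (a j m) * mu (m + l)%N| ^+ 2.
  by apply: sumr_ge0 => l _; apply: sumr_ge0 => j _; exact: exprn_ge0.
apply: le_trans l1 _; apply: le_trans key _; apply: le_trans (ler_wpM2l Phi0 l2) _.
rewrite mulrCA mulrA; apply: ler_wpM2r => //.
exact: (corona_H2_constant d0 dle erefl erefl).
Qed.

End CoronaLower.

(** * The limit in the number of coefficients *)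

Section UltraLimits.
Variable R : realType.
Local Notation H := (quaternion R).
Variables (G : set_system nat).
Hypothesis UG : UltraFilter G.
Let FG : ProperFilter G. Proof. exact: ultra_proper. Qed.

(** A cluster point of an ultrafilter is a limit. All coefficients thus converge along the same
    filter, without diagonal extraction. *)
Lemma ultra_cvg_real (u : nat -> R) (C : R) : (forall n, `|u n| <= C) -> exists x : R, u @ G --> x.
Proof.
move=> uC; have F : ProperFilter (u @ G) by exact: fmap_proper_filter.
have FA : (u @ G) `[- C, C]%classic.
  by apply: nearW => n; rewrite /= in_itv /= -ler_norml.
have [p [_ cp]] := @segment_compact R (- C) C (u @ G) F FA.
exists p => N Np; case: (in_ultra_setVsetC (u @^-1` N) UG) => // nN.
have [x [nx Nx]] := cp (~` N) N nN Np; by [].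
Qed.

Lemma ultra_cvg (u : nat -> H) (C : R) : (forall n, `|u n| <= C) -> exists x : H, u @ G --> x.
Proof.
move=> uC.
have [x0 h0] : exists x : R, (fun n => qre (u n)) @ G --> x.
  by apply: (@ultra_cvg_real _ C) => n; case: (qcoord_le_norm (u n)) => h *; exact: le_trans h (uC n).
have [x1 h1] : exists x : R, (fun n => qim1 (u n)) @ G --> x.
  by apply: (@ultra_cvg_real _ C) => n; case: (qcoord_le_norm (u n)) => ? h *; exact: le_trans h (uC n).
have [x2 h2] : exists x : R, (fun n => qim2 (u n)) @ G --> x.
  by apply: (@ultra_cvg_real _ C) => n; case: (qcoord_le_norm (u n)) => ? ? h *; exact: le_trans h (uC n).
have [x3 h3] : exists x : R, (fun n => qim3 (u n)) @ G --> x.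
  by apply: (@ultra_cvg_real _ C) => n; case: (qcoord_le_norm (u n)) => ? ? ? h; exact: le_trans h (uC n).
by exists (Quat x0 x1 x2 x3); exact: quat_cvg.
Qed.

End UltraLimits.

Section QuaternionFilters.
Variable R : realType.
Local Notation H := (quaternion R).
Context (G : set_system nat) {FG : ProperFilter G}.

Lemma cvg_qmul_bound (u v : nat -> H) (x y : H) (K : R) : u @ G --> x ->
  (forall n, `|v n - y| <= K * `|u n - x|) -> v @ G --> y.
Proof.
move=> ux h; have K1 : 0 < `|K| + 1 by rewrite ltr_wpDl.
apply/cvgrPdist_le => eps eps0.
have e1 : 0 < eps / (`|K| + 1) by rewrite divr_gt0.
have /cvgrPdist_le /(_ _ e1) := ux; apply: filterS => n hn; rewrite distrC.
apply: le_trans (h n) _; apply: (@le_trans _ _ ((`|K| + 1) * `|u n - x|)).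
  by rewrite ler_wpM2r // (le_trans (ler_norm K)) // lerDl.
by rewrite mulrC -ler_pdivlMr // distrC.
Qed.

Lemma cvg_qmull (u : nat -> H) (x c : H) : u @ G --> x -> (fun n => c * u n) @ G --> c * x.
Proof. by move=> ux; apply: (cvg_qmul_bound (K := `|c|) ux) => n; rewrite -mulrBr qnormM. Qed.

Lemma cvg_qmulr (u : nat -> H) (x c : H) : u @ G --> x -> (fun n => u n * c) @ G --> x * c.
Proof. by move=> ux; apply: (cvg_qmul_bound (K := `|c|) ux) => n; rewrite -mulrBl qnormM mulrC. Qed.

Lemma cvg_qsum (T : Type) (s : seq T) (u : T -> nat -> H) (x : T -> H) :
  (forall i, u i @ G --> x i) -> (fun n => \sum_(i <- s) u i n) @ G --> \sum_(i <- s) x i.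
Proof.
move=> ux; elim: s => [|i s IH].
  by under eq_fun do rewrite big_nil; rewrite big_nil; exact: cvg_cst.
by under eq_fun do rewrite big_cons; rewrite big_cons; apply: cvgD IH; exact: ux.
Qed.

Lemma cvg_rsum (T : Type) (s : seq T) (u : T -> nat -> R) (x : T -> R) :
  (forall i, u i @ G --> x i) -> (fun n => \sum_(i <- s) u i n) @ G --> \sum_(i <- s) x i.
Proof.
move=> ux; elim: s => [|i s IH].
  by under eq_fun do rewrite big_nil; rewrite big_nil; exact: cvg_cst.
by under eq_fun do rewrite big_cons; rewrite big_cons; apply: cvgD IH; exact: ux.
Qed.

Lemma cvg_sqnorm (u : nat -> H) (x : H) : u @ G --> x -> (fun n => `|u n| ^+ 2 : R) @ G --> (`|x| ^+ 2 : R).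
Proof.
move=> ux; have cn : (fun n => `|u n| : R) @ G --> (`|x| : R) by exact: cvg_norm.
by under eq_fun do rewrite expr2; rewrite expr2; exact: cvgM.
Qed.

End QuaternionFilters.

(** * Passage to the limit in the factorization *)

Section LeechLimit.
Variable R : realType.
Local Notation H := (quaternion R).

Lemma qsum_mul_le (a b : nat -> H) (J J' : nat) (t alp bet : R) : 0 < t ->
  \sum_(J <= j < J') `|a j| ^+ 2 <= alp -> \sum_(J <= j < J') `|b j| ^+ 2 <= bet ->
  `|\sum_(J <= j < J') a j * b j| <= (t * alp + bet / t) / 2.
Proof.
move=> t0 ha hb.
have h : `|\sum_(J <= j < J') a j * b j| <=
    \sum_(J <= j < J') (t / 2 * `|a j| ^+ 2 + (2 * t)^-1 * `|b j| ^+ 2).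
  apply: le_trans (qnorm_sum _ _ _) _; apply: ler_sum => j _; rewrite qnormM.
  move: `|a j| `|b j| => x y; rewrite -subr_ge0.
  have -> : t / 2 * x ^+ 2 + (2 * t)^-1 * y ^+ 2 - x * y = (t * x - y) ^+ 2 / (2 * t).
    by field; rewrite gt_eqF.
  by rewrite divr_ge0 ?sqr_ge0 // mulr_ge0 // ltW.
apply: (le_trans h); rewrite big_split /= -!mulr_sumr.
have -> : (t * alp + bet / t) / 2 = t / 2 * alp + (2 * t)^-1 * bet by field; rewrite gt_eqF.
by rewrite lerD // ler_wpM2l // ?invr_ge0 ?divr_ge0 ?mulr_ge0 // ltW.
Qed.

(** The norm bound of the column Toeplitz operator on its finite sections; each instance involves
    finitely many coefficients and so passes to limits. *)
Definition energy_bound (b : nat -> nat -> H) (C : R) := forall J M (x : nat -> H),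
  \sum_(k < M) \sum_(j < J) `|\sum_(l < k.+1) b j (k - l)%N * x l| ^+ 2 <=
  C ^+ 2 * \sum_(k < M) `|x k| ^+ 2.

Lemma energy_coef b C J k : energy_bound b C -> \sum_(j < J) `|b j k| ^+ 2 <= C ^+ 2.
Proof.
pose x0 (l : nat) : H := if l is 0%N then 1 else 0.
move=> /(_ J k.+1 x0) E.
have -> : C ^+ 2 = C ^+ 2 * \sum_(i < k.+1) `|x0 i| ^+ 2.
  by rewrite big_ord_recl big1 ?qnorm1 ?expr1n ?addr0 ?mulr1 // => i _; rewrite normr0 expr0n.
apply: le_trans E; rewrite big_ord_recr /= -[leLHS]add0r; apply: lerD.
  by apply: sumr_ge0 => i _; apply: sumr_ge0 => j _; exact: exprn_ge0.
apply: ler_sum => j _; rewrite big_ord_recl big1 ?addr0 ?subn0 ?mulr1 // => i _.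
by rewrite mulr0.
Qed.

Variables (a : nat -> nat -> H) (C0 C1 : R).
Hypothesis C10 : 0 < C1.
Hypothesis C01 : C1 < C0.
Hypothesis HS : forall J m, \sum_(j < J) `|a j m| ^+ 2 <= 1.
Hypothesis Hlow : forall N, exists J, forall mu : nat -> H, (forall m, (N <= m)%N -> mu m = 0) ->
  \sum_(m < N) `|mu m| ^+ 2 <= C1 ^+ 2 *
    \sum_(l < N) \sum_(j < J) `|\sum_(m < N) qconj (a j m) * mu (m + l)%N| ^+ 2.

Let C00 : 0 < C0. Proof. exact: lt_trans C01. Qed.

(** Coefficients of the constant 1; unrelated to the number [delta0]. *)
Definition delta0m (m : nat) : H := if m is 0%N then 1 else 0.

(** [leech_finite] with c = 1 / C0 < c1 = 1 / C1, rescaled by C0. The equations hold below degree N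
    only, the energy bound in all degrees. *)
Lemma leech_stage N : exists b : nat -> nat -> H, energy_bound b C0 /\
  exists J, (forall j m, (J <= j)%N -> b j m = 0) /\
  forall m, (m < N)%N -> \sum_(l < m.+1) \sum_(j < J) a j (m - l)%N * b j l = delta0m m.
Proof.
have [J HJ] := Hlow N.
have c0 : 0 < C0^-1 by rewrite invr_gt0.
have cc : C0^-1 < C1^-1 by rewrite ltf_pV2.
have Hl : forall la : nat -> H, (forall m, (N <= m)%N -> la m = 0) ->
    (C1^-1) ^+ 2 * \sum_(m < N) `|la m| ^+ 2 <= \sum_(l < N) \sum_(j < J) `|adjA N a la l j| ^+ 2.
  move=> la sla; rewrite exprVn ler_pdivrMl ?exprn_gt0 //; exact: HJ.
have [b [b1 b2]] := leech_finite c0 cc Hl.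
pose b' j m : H := if (j < J)%N then C0 *: b j m else 0.
exists b'; split.
  move=> J' M x.
  have tr k : \sum_(j < J') `|\sum_(l < k.+1) b' j (k - l)%N * x l| ^+ 2 <=
      C0 ^+ 2 * \sum_(j < J) `|\sum_(l < k.+1) b j (k - l)%N * x l| ^+ 2.
    pose F j : R := `|\sum_(l < k.+1) b' j (k - l)%N * x l| ^+ 2.
    have F0 j : 0 <= F j by exact: exprn_ge0.
    have FJ j : (J <= j)%N -> F j = 0.
      by move=> Jj; rewrite /F /b' ltnNge Jj big1 ?normr0 ?expr0n // => l _; rewrite mul0r.
    have -> : C0 ^+ 2 * \sum_(j < J) `|\sum_(l < k.+1) b j (k - l)%N * x l| ^+ 2 = \sum_(j < J) F j.
      rewrite mulr_sumr; apply: eq_bigr => j _; rewrite /F /b' ltn_ord.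
      have -> : \sum_(l < k.+1) C0 *: b j (k - l)%N * x l = C0 *: \sum_(l < k.+1) b j (k - l)%N * x l.
        by rewrite scaler_sumr; apply: eq_bigr => l _; rewrite scalerAl.
      by rewrite normrZ exprMn (ger0_norm (ltW C00)).
    rewrite -!(big_mkord xpredT F); have [JJ|JJ] := leqP J' J.
      by rewrite [leRHS](big_cat_nat (leq0n J') JJ) /= lerDl sumr_ge0.
    rewrite (big_cat_nat (leq0n J) (ltnW JJ)) /= [X in _ + X]big_nat_cond [X in _ + X]big1 ?addr0 //.
    by move=> j /andP[/andP[Jj _] _]; exact: FJ.
  apply: (@le_trans _ _ (\sum_(k < M) C0 ^+ 2 * \sum_(j < J) `|\sum_(l < k.+1) b j (k - l)%N * x l| ^+ 2)).
    by apply: ler_sum => k _; exact: tr.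
  by rewrite -mulr_sumr ler_wpM2l ?exprn_ge0 ?(ltW C00).
exists J; split=> [j m Jj|m mN]; first by rewrite /b' ltnNge Jj.
have -> : \sum_(l < m.+1) \sum_(j < J) a j (m - l)%N * b' j l =
    C0 *: \sum_(l < m.+1) \sum_(j < J) a j (m - l)%N * b j l.
  rewrite scaler_sumr; apply: eq_bigr => l _; rewrite scaler_sumr; apply: eq_bigr => j _.
  by rewrite /b' ltn_ord scalerAr.
rewrite b1 //; case: m {mN} => [|m]; last by rewrite scaler0.
by rewrite scalerA divff ?scale1r // gt_eqF.
Qed.

(** The tail in j pairs a small tail of a with b of norm at most C0. [J0] is found before b, so it
    serves all stages and their limit. *)
Lemma stage_partial (m : nat) (eps : R) : 0 < eps -> exists J0, forall J, (J0 <= J)%N ->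
  forall b J', energy_bound b C0 -> (forall j m, (J' <= j)%N -> b j m = 0) ->
  \sum_(l < m.+1) \sum_(j < J') a j (m - l)%N * b j l = delta0m m ->
  `|\sum_(l < m.+1) \sum_(j < J) a j (m - l)%N * b j l - delta0m m| <= eps.
Proof.
move=> eps0; pose e := eps / m.+1%:R.
have m0 : 0 < m.+1%:R :> R by rewrite ltr0n.
have e0 : 0 < e by rewrite divr_gt0.
(* With this t, alp = e^2 / C0^2 and bet = C0^2, the bound of [qsum_mul_le] is exactly e. *)
have t0 : 0 < C0 ^+ 2 / e by rewrite divr_gt0 // exprn_gt0.
have al0 : 0 < e ^+ 2 / C0 ^+ 2 by rewrite divr_gt0 // exprn_gt0.
have [J0 HJ0] := coef_tail_uniform HS m.+1 al0.
exists J0 => J JJ b J' Eb b0 bs.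
rewrite -bs -sumrB; apply: le_trans (qnorm_sum _ _ _) _.
have -> : eps = \sum_(l < m.+1) e.
  by rewrite sumr_const card_ord -mulr_natr /e divfK // gt_eqF.
apply: ler_sum => l _.
rewrite -!(big_mkord xpredT (fun j => a j (m - l)%N * b j l)).
have [J'J|JJ'] := leqP J' J.
  rewrite [X in X - _](big_cat_nat (leq0n J') J'J) /= addrAC subrr add0r.
  rewrite big_nat_cond big1 ?normr0 ?(ltW e0) // => j /andP[/andP[h _] _].
  by rewrite b0 // mulr0.
rewrite [X in _ - X](big_cat_nat (leq0n J) (ltnW JJ')) /= opprD addrA subrr sub0r normrN.
have ha : \sum_(J <= j < J') `|a j (m - l)%N| ^+ 2 <= e ^+ 2 / C0 ^+ 2.
  apply: le_trans (HJ0 (m - l)%N J' _); last by rewrite ltnS leq_subr.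
  rewrite [leRHS](big_cat_nat JJ (ltnW JJ')) /= lerDr sumr_ge0 // => j _; exact: exprn_ge0.
have hb : \sum_(J <= j < J') `|b j l| ^+ 2 <= C0 ^+ 2.
  apply: le_trans (energy_coef J' l Eb); rewrite -(big_mkord xpredT (fun j => `|b j l| ^+ 2)).
  rewrite [leRHS](big_cat_nat (leq0n J) (ltnW JJ')) /= lerDr sumr_ge0 // => j _; exact: exprn_ge0.
apply: le_trans (qsum_mul_le t0 ha hb) _.
rewrite le_eqVlt; apply/orP; left; apply/eqP; field.
by rewrite (gt_eqF C00) (gt_eqF e0).
Qed.

Lemma leech_limit : exists b : nat -> nat -> H, energy_bound b C0 /\
  forall m eps, 0 < eps -> exists J0, forall J, (J0 <= J)%N ->
    `|\sum_(l < m.+1) \sum_(j < J) a j (m - l)%N * b j l - delta0m m| <= eps.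
Proof.
have [b Hb] := choice leech_stage.
have [G [UG ooG]] := ultraFilterLemma (@eventually_filter).
have FG : ProperFilter G by exact: ultra_proper.
have bC N j m : `|b N j m| <= C0.
  rewrite -(@ler_pXn2r _ 2) ?nnegrE ?(ltW C00) //.
  apply: le_trans (energy_coef j.+1 m (Hb N).1); rewrite big_ord_recr /= lerDr.
  by apply: sumr_ge0 => i _; exact: exprn_ge0.
have ex (p : nat * nat) : exists x : H, (fun N => b N p.1 p.2) @ G --> x.
  exact: (ultra_cvg UG (fun N => bC N p.1 p.2)).
have [bet Hbet] := choice ex.
exists (fun j m => bet (j, m)); split.
  move=> J M x.
  have cE : (fun N => \sum_(k < M) \sum_(j < J) `|\sum_(l < k.+1) b N j (k - l)%N * x l| ^+ 2 : R) @ G -->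
      \sum_(k < M) \sum_(j < J) `|\sum_(l < k.+1) bet (j : nat, (k - l)%N) * x l| ^+ 2.
    apply: cvg_rsum => k; apply: cvg_rsum => j; apply: cvg_sqnorm; apply: cvg_qsum => l.
    by apply: cvg_qmulr; exact: (Hbet ((j : nat), (k - l)%N)).
  have cC : (fun _ : nat => C0 ^+ 2 * \sum_(k < M) `|x k| ^+ 2) @ G --> C0 ^+ 2 * \sum_(k < M) `|x k| ^+ 2.
    exact: cvg_cst.
  by apply: (ler_cvg_to cE cC); apply: nearW => N; exact: (Hb N).1.
move=> m eps eps0; have [J0 HJ0] := stage_partial m eps0.
exists J0 => J JJ.
apply: (@lim_norm_le R G FG (fun N => \sum_(l < m.+1) \sum_(j < J) a j (m - l)%N * b N j l)).
  apply: cvg_qsum => l; apply: cvg_qsum => j; apply: cvg_qmull.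
  exact: (Hbet ((j : nat), (l : nat))).
apply: ooG; exists m.+1 => // N /= mN.
have [Eb [J' [b0 bs]]] := Hb N; apply: (HJ0 J JJ (b N) J' Eb b0); exact: bs.
Qed.

End LeechLimit.

(** * Pointwise bounds for the solutions *)

Section SolutionBound.
Variable R : realType.
Local Notation H := (quaternion R).
Variables (b : nat -> nat -> H) (C : R).
Hypothesis C0 : 0 < C.
Hypothesis Eb : energy_bound b C.

Lemma energy_coef_le j m : `|b j m| <= C.
Proof.
rewrite -(@ler_pXn2r _ 2) ?nnegrE ?(ltW C0) //.
apply: le_trans (energy_coef j.+1 m Eb); rewrite big_ord_recr /= lerDr.
by apply: sumr_ge0 => i _; exact: exprn_ge0.
Qed.

Lemma right_eval_cvg (w : H) j : `|w| < 1 ->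
  exists Z : H, (fun M => \sum_(m < M) b j m * w ^+ m) @ \oo --> Z.
Proof.
move=> w1; have bnd m : `|b j m * w ^+ m| <= C * `|w| ^+ m.
  by rewrite qnormM qnormX ler_wpM2r ?exprn_ge0 ?energy_coef_le.
have [Z hZ] := geo_cvg (ltW C0) (normr_ge0 w) w1 bnd.
by exists Z; move: hZ; rewrite /series /=; under eq_fun do rewrite big_mkord.
Qed.

(** At powers of w in decreasing order each convolution factors as a partial sum of b_m w^m times a
    power of w. Powers stand on the right here; [slice_split] returns to the values q^m b_m. *)
Lemma energy_eval (w : H) J M : \sum_(k < M)
   (\sum_(j < J) `|\sum_(m < k.+1) b j m * w ^+ m| ^+ 2) * (`|w| ^+ 2) ^+ (M.-1 - k) <=
  C ^+ 2 * \sum_(k < M) (`|w| ^+ 2) ^+ (M.-1 - k).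
Proof.
have := Eb J M (fun l => w ^+ (M.-1 - l)).
have -> : \sum_(k < M) `|w ^+ (M.-1 - k)| ^+ 2 = \sum_(k < M) (`|w| ^+ 2) ^+ (M.-1 - k).
  by apply: eq_bigr => k _; rewrite qnormX -!exprM mulnC.
congr (_ <= _); apply: eq_bigr => k _; rewrite mulr_suml; apply: eq_bigr => j _.
have -> : \sum_(l < k.+1) b j (k - l)%N * w ^+ (M.-1 - l) =
    (\sum_(m < k.+1) b j m * w ^+ m) * w ^+ (M.-1 - k).
  rewrite mulr_suml (reindex_inj rev_ord_inj) /=; apply: eq_bigr => l _.
  have kM : (k <= M.-1)%N by rewrite -ltnS (ltn_predK (ltn_ord k)).
  have := ltn_ord l; rewrite ltnS => lk.
  rewrite subSS subKn // -mulrA -exprD; congr (_ * _ ^+ _).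
  by rewrite subnBA // addnC addnBA.
by rewrite qnormM qnormX exprMn -!exprM mulnC.
Qed.

(* The energy inequality at [x l = w ^+ (M - 1 - l)] bounds averages of the
   squared partial sums whose weights concentrate near the index [M]. *)
Lemma right_eval_bound (w : H) J (eps : R) : `|w| < 1 -> 0 < eps ->
  \forall M \near \oo, \sum_(j < J) `|\sum_(m < M) b j m * w ^+ m| ^+ 2 <= C ^+ 2 + eps.
Proof.
move=> w1 eps0.
have [Z HZ] := choice (fun j => right_eval_cvg j w1).
pose A M : R := \sum_(j < J) `|\sum_(m < M) b j m * w ^+ m| ^+ 2.
have cA : A @ \oo --> \sum_(j < J) `|Z j| ^+ 2.
  by apply: cvg_rsum => j; apply: cvg_sqnorm; exact: HZ.
set S := \sum_(j < J) `|Z j| ^+ 2 in cA.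
suff SC : S <= C ^+ 2.
  move/cvgrPdist_le : cA => /(_ _ eps0); apply: filterS => M; rewrite ler_norml => /andP[h _].
  by move: h SC; rewrite -/(A M); lra.
rewrite leNgt; apply/negP => CS; pose eta := (S - C ^+ 2) / 2.
have eta0 : 0 < eta by rewrite divr_gt0 // subr_gt0.
move/cvgrPdist_le : cA => /(_ _ eta0) [K _ HK].
have AK k : (K <= k)%N -> C ^+ 2 + eta <= A k.
  by move=> Kk; have := HK k Kk; rewrite ler_norml /eta => /andP[_]; lra.
pose rho := `|w| ^+ 2; have rho0 : 0 <= rho by exact: exprn_ge0.
have rho1 : rho < 1 by rewrite /rho exprn_ilt1.
have Cn : 0 <= C ^+ 2 by rewrite exprn_ge0 // ltW.
have e2 : 0 < eta / 2 by rewrite divr_gt0.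
have [M1 _ HM1] := geo_small (C ^+ 2 * K%:R) rho0 rho1 e2.
pose M := (K + M1).+1.
have := energy_eval w J M; rewrite -/rho mulr_sumr -subr_ge0 -sumrB => E.
(* Indices below K contribute at most C^2 K rho^M1, later ones are nonpositive, and the last one, of
   weight 1, contributes at most -eta. *)
have lower : \sum_(k < M) (C ^+ 2 * rho ^+ (M.-1 - k) - A k.+1 * rho ^+ (M.-1 - k)) <=
    C ^+ 2 * K%:R * rho ^+ M1 - eta.
  rewrite -(big_mkord xpredT (fun k => C ^+ 2 * rho ^+ (M.-1 - k) - A k.+1 * rho ^+ (M.-1 - k))).
  have KM : (K <= K + M1)%N by exact: leq_addr.
  rewrite /M big_nat_recr //= (big_cat_nat (leq0n K) KM) /=.
  have h1 : \sum_(0 <= k < K) (C ^+ 2 * rho ^+ (K + M1 - k) - A k.+1 * rho ^+ (K + M1 - k)) <=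
      C ^+ 2 * K%:R * rho ^+ M1.
    have -> : C ^+ 2 * K%:R * rho ^+ M1 = \sum_(0 <= k < K) C ^+ 2 * rho ^+ M1.
      by rewrite sumr_const_nat subn0 -[RHS]mulr_natr mulrAC.
    apply: ler_sum_nat => k /andP[_ kK].
    have A0 : 0 <= A k.+1 by apply: sumr_ge0 => j _; exact: exprn_ge0.
    apply: (@le_trans _ _ (C ^+ 2 * rho ^+ (K + M1 - k))).
      by rewrite gerBl mulr_ge0 ?exprn_ge0.
    by rewrite ler_wpM2l // ler_wiXn2l ?(ltW rho1) // -addnBAC ?leq_addl // ltnW.
  have h2 : \sum_(K <= k < K + M1) (C ^+ 2 * rho ^+ (K + M1 - k) - A k.+1 * rho ^+ (K + M1 - k)) <= 0.
    rewrite big_nat_cond; apply: sumr_le0 => k /andP[/andP[Kk _] _].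
    rewrite -mulrBl mulr_le0_ge0 ?exprn_ge0 // subr_le0.
    by apply: le_trans (AK k.+1 (leqW Kk)); rewrite lerDl ltW.
  have h3 : C ^+ 2 * rho ^+ (K + M1 - (K + M1)) - A (K + M1).+1 * rho ^+ (K + M1 - (K + M1)) <= - eta.
    rewrite subnn expr0 !mulr1; have := AK (K + M1).+1 (leqW KM); lra.
  by move: h1 h2 h3; lra.
have := HM1 M1 (leqnn _) => /= h.
move: (le_trans E lower) h eta0; lra.
Qed.

(* The part commuting with [I] and the part anticommuting with [I] are orthogonal. *)
Lemma slice_split (I : H) (z : R[i]) (x : nat -> H) (M : nat) : imag_units R I ->
  `|\sum_(m < M) em I z ^+ m * x m| ^+ 2 <=
  `|\sum_(m < M) x m * em I z ^+ m| ^+ 2 + `|\sum_(m < M) x m * em I z^* ^+ m| ^+ 2.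
Proof.
move=> II; set Z := \sum_(m < M) x m * em I z ^+ m; set Z' := \sum_(m < M) x m * em I z^* ^+ m.
have I2 : I * I = -1 by exact: II.
(* Coefficients commuting with I let z^m pass to the right unchanged, anticommuting ones turn it
   into conj(z)^m: u is the commuting part of Z, v the anticommuting part of Z'. *)
pose u := 2^-1 *: (Z - I * Z * I); pose v := 2^-1 *: (Z' + I * Z' * I).
have E : \sum_(m < M) em I z ^+ m * x m = u + v.
  rewrite /u /v -scalerDr /Z /Z' !mulr_sumr !mulr_suml -sumrB -big_split -big_split /= scaler_sumr.
  apply: eq_bigr => m _; rewrite -!(emX II) -rmorphXn /=.
  move: (z ^+ m) (x m) => [p s] y; rewrite /em /slice_point /=.
  have -> : p%:A + s *: I = (p *: 1 + s *: I) :> H by [].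
  have e1 (t : R) : y * (p%:A + t *: I) = p *: y + t *: (y * I).
    by rewrite mulrDr -!scalerAr mulr1.
  have e2 (t : R) : I * (y * (p%:A + t *: I)) * I = p *: (I * y * I) - t *: (I * y).
    rewrite e1 [I * _]mulrDr mulrDl -!scalerAr -!scalerAl; congr (_ + _).
    by rewrite -!mulrA I2 mulrN1 mulrN scalerN.
  rewrite !e2 !e1 mulrDl -!scalerAl mul1r !scaleNr.
  move: (y * I) (I * y * I) (I * y) => A B D.
  by apply: quat_eqP => /=; field.
rewrite E.
have Iu : u * I = I * u.
  rewrite /u -scalerAl -scalerAr; congr (_ *: _); rewrite mulrBl mulrBr.
  by rewrite -[I * Z * I * I]mulrA I2 mulrN1 opprK !mulrA I2 mulN1r mulNr opprK addrC.
have Iv : v * I = - (I * v).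
  rewrite /v -scalerAl -scalerAr -scalerN; congr (_ *: _); rewrite mulrDl mulrDr.
  by rewrite -[I * Z' * I * I]mulrA I2 mulrN1 !mulrA I2 mulN1r mulNr opprD opprK addrC.
have cI : qconj I * I = 1.
  by rewrite qconjM_self (imag_unit_norm II) expr1n scale1r.
have orth : qre (qconj u * v) = 0.
  have e : qconj I * (qconj u * v) * I = - (qconj u * v).
    by rewrite -!mulrA Iv !mulrN !mulrA -qconjM Iu qconjM -[_ * qconj I * I]mulrA cI mulr1.
  have h : qre (qconj I * (qconj u * v) * I) = qre (qconj u * v).
    by rewrite qre_comm mulrA qMconj_self (imag_unit_norm II) expr1n scale1r mul1r.
  move: h; rewrite e qreN.
  by clear; lra.
have nZ : `|u| <= `|Z|.
  rewrite /u normrZ ger0_norm ?invr_ge0 // -ler_pdivlMl ?invr_gt0 // invrK.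
  apply: le_trans (ler_normB _ _) _; rewrite !qnormM (imag_unit_norm II); lra.
have nZ' : `|v| <= `|Z'|.
  rewrite /v normrZ ger0_norm ?invr_ge0 // -ler_pdivlMl ?invr_gt0 // invrK.
  apply: le_trans (ler_normD _ _) _; rewrite !qnormM (imag_unit_norm II); lra.
have -> : `|u + v| ^+ 2 = `|u| ^+ 2 + `|v| ^+ 2.
  rewrite -!qre_conjM_self qconjD mulrDl !mulrDr.
  have -> : qre (qconj u * u + qconj u * v + (qconj v * u + qconj v * v)) =
    qre (qconj u * u) + qre (qconj u * v) + (qre (qconj v * u) + qre (qconj v * v)) by [].
  by rewrite [qre (qconj v * u)]qre_conjM_comm orth addr0 add0r.
by rewrite lerD // lerXn2r ?nnegrE.
Qed.

(** The two right evaluations, at z and at conj z, each contribute C^2 through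
    [right_eval_bound]. *)
Lemma solution_exists : exists g : nat -> H -> H,
  [/\ forall j, Hinfty (g j), forall j, has_qcoef (g j) (b j) &
  forall J q, qball R q -> \sum_(j < J) `|g j q| ^+ 2 <= 2 * C ^+ 2].
Proof.
have [g Hg] := choice (fun j => pseries_regular (energy_coef_le j)).
have bound J q : qball R q -> \sum_(j < J) `|g j q| ^+ 2 <= 2 * C ^+ 2.
  move=> qb; have [I [z [II qE]]] := slice_exists q.
  have w1 : `|em I z| < 1 by rewrite qE.
  have w2 : `|em I z^*| < 1 by rewrite (em_norm II) cmodJ -(em_norm II).
  apply/ler_addgt0Pr => eps eps0; have e2 : 0 < eps / 2 by rewrite divr_gt0.
  rewrite -(big_mkord xpredT (fun j => `|g j q| ^+ 2)).
  apply: (@l2_lim R \oo _ (fun j n => qpseries (b j) q n)) => [j|]; first exact: (Hg j).2.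
  have := right_eval_bound J w1 e2; have := right_eval_bound J w2 e2.
  apply: filterS2 => M h2 h1; rewrite big_mkord.
  apply: (@le_trans _ _ (\sum_(j < J) (`|\sum_(m < M) b j m * em I z ^+ m| ^+ 2 +
     `|\sum_(m < M) b j m * em I z^* ^+ m| ^+ 2))).
    by apply: ler_sum => j _; rewrite /qpseries /series /= big_mkord -qE; exact: slice_split.
  by rewrite big_split /=; move: h1 h2; lra.
exists g; split=> // [j|j]; last exact: (Hg j).2.
split; first exact: (Hg j).1.
exists (Num.sqrt (2 * C ^+ 2)) => q qb.
have h : `|g j q| ^+ 2 <= 2 * C ^+ 2.
  apply: le_trans (bound j.+1 q qb); rewrite big_ord_recr /= lerDr.
  by apply: sumr_ge0 => i _; exact: exprn_ge0.
by rewrite -[leLHS]ger0_norm // -sqrtr_sqr ler_wsqrtr.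
Qed.

End SolutionBound.

(** * Convergence of the star products *)

Section StarSums.
Variable R : realType.
Local Notation H := (quaternion R).
Variables (f g : nat -> H -> H) (a b : nat -> nat -> H) (L : set nat) (C : R).
Hypothesis Ha : forall j, L j -> has_qcoef (f j) (a j).
Hypothesis a0 : forall j m, ~ L j -> a j m = 0.
Hypothesis Hb : forall j, has_qcoef (g j) (b j).
Hypothesis HS : forall J m, \sum_(j < J) `|a j m| ^+ 2 <= 1.
Hypothesis HB : forall J m, \sum_(j < J) `|b j m| ^+ 2 <= C ^+ 2.
Hypothesis Hlim : forall m eps, 0 < eps -> exists J0, forall J, (J0 <= J)%N ->
  `|\sum_(l < m.+1) \sum_(j < J) a j (m - l)%N * b j l - delta0m R m| <= eps.

Let c j m := \sum_(k < m.+1) a j k * b j (m - k)%N.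
Let K := (1 + C ^+ 2) / 2.
Let s j q : H := if j \in L then star (f j) (g j) q else 0.

(** Each product is at most half the sum of squares, and the sums of squares over j are bounded at
    every degree. Independence of J gives absolute convergence. *)
Lemma conv_coef_l1 J m : \sum_(j < J) `|c j m| <= m.+1%:R * K.
Proof.
apply: (@le_trans _ _ (\sum_(j < J) \sum_(k < m.+1) `|a j k| * `|b j (m - k)%N|)).
  apply: ler_sum => j _; apply: le_trans (qnorm_sum _ _ _) _.
  by apply: ler_sum => k _; rewrite qnormM.
rewrite exchange_big /= (_ : m.+1%:R * K = \sum_(k < m.+1) K); last first.
  by rewrite sumr_const card_ord -[RHS]mulr_natl.
apply: ler_sum => k _.
apply: (@le_trans _ _ (\sum_(j < J) 2^-1 * (`|a j k| ^+ 2 + `|b j (m - k)%N| ^+ 2))).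
  apply: ler_sum => j _; have := sqr_ge0 (`|a j k| - `|b j (m - k)%N|); rewrite sqrrB.
  by move: `|a j k| `|b j (m - k)%N| => x y; lra.
rewrite -mulr_sumr big_split /= /K mulrC ler_wpM2r ?invr_ge0 //; apply: lerD; [exact: HS|exact: HB].
Qed.

Lemma conv_const_ge0 : 0 <= K.
Proof. by rewrite /K divr_ge0 // addr_ge0 // sqr_ge0. Qed.

Lemma geo_majorant (r : R) : 0 <= r -> r < 1 -> exists t B, [/\ 0 < t, t < 1, 0 <= B &
  forall m : nat, m.+1%:R * r ^+ m <= B * t ^+ m].
Proof.
move=> r0 r1; have [t [B [t0 t1 B0 h]]] := sqr_natr_geo r0 r1.
exists t, B; split=> // m; apply: le_trans (h m); rewrite ler_wpM2r ?exprn_ge0 //.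
by rewrite expr2 ler_peMr // ler1n.
Qed.

Lemma conv_coef_le j m : `|c j m| <= m.+1%:R * K.
Proof.
apply: le_trans (conv_coef_l1 j.+1 m); rewrite big_ord_recr /= lerDr.
by apply: sumr_ge0 => i _.
Qed.

Lemma star_lim j q : qball R q -> qpseries (c j) q @ \oo --> s j q.
Proof.
move=> qb; rewrite /s; case: ifPn => jL.
  have {}jL : L j by exact: set_mem.
  have -> : star (f j) (g j) q = limn (qpseries (c j) q).
    by rewrite /star (qcoefE (@Ha j jL)) (qcoefE (@Hb j)).
  have [t [B [t0 t1 B0 hB]]] := geo_majorant (normr_ge0 q) qb.
  have bnd m : `|q ^+ m * c j m| <= (K * B) * t ^+ m.
    rewrite qnormM qnormX mulrC; apply: le_trans (ler_wpM2r _ (conv_coef_le j m)) _.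
      by rewrite exprn_ge0.
    rewrite [leLHS](_ : _ = K * (m.+1%:R * `|q| ^+ m)); last by ring.
    by rewrite -[leRHS]mulrA ler_wpM2l ?conv_const_ge0.
  have [y hy] := geo_cvg (mulr_ge0 conv_const_ge0 B0) (ltW t0) t1 bnd.
  by rewrite (cvg_lim (@norm_hausdorff _ _) hy).
have {}jL : ~ L j by move=> h; move: jL; rewrite mem_set.
have -> : qpseries (c j) q = fun=> 0.
  apply/funext => n; rewrite /qpseries /series /= big1 // => m _.
  by rewrite /c big1 ?mulr0 // => k _; rewrite a0 // mul0r.
exact: cvg_cst.
Qed.

Lemma partial_sumsE q N : partial_sums L (fun j => star (f j) (g j) q) N = \sum_(0 <= j < N) s j q.
Proof. by rewrite /partial_sums big_mkcond. Qed.

Lemma partial_sums_normE q N :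
  partial_sums L (fun j => `|star (f j) (g j) q|) N = \sum_(0 <= j < N) `|s j q|.
Proof.
rewrite /partial_sums big_mkcond; apply: eq_bigr => j _; rewrite /s.
by case: ifP; rewrite ?normr0.
Qed.

(** The coefficients of the error are small below degree M for large N, by [Hlim]; above M they are
    dominated by a geometric tail not depending on N. *)
Lemma partial_sums_uniform (r eps : R) : 0 <= r -> r < 1 -> 0 < eps ->
  exists N0, forall N, (N0 <= N)%N -> forall q, `|q| <= r ->
  `|1 - partial_sums L (fun j => star (f j) (g j) q) N| <= eps.
Proof.
move=> r0 r1 eps0.
have [t [B [t0 t1 B0 hB]]] := geo_majorant r0 r1.
have e2 : 0 < eps / 2 by rewrite divr_gt0.
have [M _ HM] := geo_small ((K + 1) * B / (1 - t)) (ltW t0) t1 e2.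
have {}HM := HM M (leqnn _).
pose e N m := \sum_(j < N) c j m - delta0m R m.
have [eta etaE] : exists eta, eta = eps / (2 * M.+1%:R) by eexists.
have e3 : 0 < eta by rewrite etaE divr_gt0 // mulr_gt0 // ltr0n.
have [N0 HN0] : exists N0, forall m N, (m < M)%N -> (N0 <= N)%N -> `|e N m| <= eta.
  elim: (M) => [|M' [N1 H1]]; first by exists 0%N.
  have [N2 H2] := Hlim M' e3; exists (maxn N1 N2) => m N; rewrite ltnS leq_eqVlt.
  move=> /orP[/eqP ->|mM]; rewrite geq_max => /andP[h1 h2]; last exact: H1.
  move: (H2 N h2); congr (`| _ - _ | <= _); rewrite exchange_big /=; apply: eq_bigr => j _.
  (* The star product indexes its convolution by the factor of f, [Hlim] by that of g; the reversal
     identifies them. *)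
  rewrite /c (reindex_inj rev_ord_inj) /=; apply: eq_bigr => l _.
  by rewrite subSS subKn // -ltnS.
exists N0 => N NN q qr.
have qb : qball R q by exact: le_lt_trans qr r1.
have ebnd m : `|q ^+ m * e N m| <= ((K + 1) * B) * t ^+ m.
  have h1 : `|e N m| <= m.+1%:R * (K + 1).
    rewrite /e; apply: le_trans (ler_normB _ _) _; rewrite mulrDr mulr1; apply: lerD.
      by apply: le_trans (qnorm_sum _ _ _) _; exact: conv_coef_l1.
    by case: m => [|m] /=; rewrite ?qnorm1 ?normr0 ?ler0n.
  rewrite qnormM qnormX.
  apply: (@le_trans _ _ (r ^+ m * (m.+1%:R * (K + 1)))).
    by apply: ler_pM; rewrite ?exprn_ge0 // lerXn2r ?nnegrE.
  rewrite [leLHS](_ : _ = (K + 1) * (m.+1%:R * r ^+ m)); last by ring.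
  by rewrite -mulrA ler_wpM2l // addr_ge0 // conv_const_ge0.
have lim : series (fun m => q ^+ m * e N m) @ \oo --> \sum_(0 <= j < N) s j q - 1.
  have E n : (0 < n)%N -> series (fun m => q ^+ m * e N m) n = \sum_(0 <= j < N) qpseries (c j) q n - 1.
    move=> n0; rewrite /series /= (eq_bigr (fun m => q ^+ m * (\sum_(j < N) c j m) - q ^+ m * delta0m R m)).
      rewrite sumrB; congr (_ - _).
        rewrite [RHS]exchange_big /=; apply: eq_bigr => m _.
        by rewrite mulr_sumr (big_mkord xpredT (fun j => q ^+ m * c j m)).
      case: n n0 => // n _; rewrite big_nat_recl //= mulr1 big1 ?addr0 // => m _.
      by rewrite mulr0.
    by move=> m _; rewrite /e mulrBr.
  have l1 : (fun n => \sum_(0 <= j < N) qpseries (c j) q n - 1) @ \oo --> \sum_(0 <= j < N) s j q - 1.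
    by apply: cvgB; [apply: cvg_qsum => j; exact: star_lim|exact: cvg_cst].
  apply/cvgrPdist_le => x x0; move/cvgrPdist_le : l1 => /(_ _ x0) h.
  near=> n; rewrite E; last by near: n; exists 1%N.
  by near: n.
have KB0 : 0 <= (K + 1) * B by rewrite mulr_ge0 // addr_ge0 // conv_const_ge0.
have := geo_lim M KB0 (ltW t0) t1 ebnd lim.
rewrite partial_sumsE; set P := \sum_(0 <= j < N) _ => h1.
have h2 : `|\sum_(m < M) q ^+ m * e N m| <= eps / 2.
  apply: le_trans (qnorm_sum _ _ _) _.
  apply: (@le_trans _ _ (\sum_(m < M) eta)).
    apply: ler_sum => m _; rewrite qnormM qnormX; apply: le_trans (HN0 m N (ltn_ord m) NN).
    by rewrite ler_piMl // exprn_ile1 // ltW // (le_lt_trans qr).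
  rewrite sumr_const card_ord -[leLHS]mulr_natr etaE.
  have M1 : 0 < M.+1%:R :> R by rewrite ltr0n.
  have -> : eps / (2 * M.+1%:R) * M%:R = eps / 2 * (M%:R / M.+1%:R) by field; rewrite gt_eqF.
  by rewrite ler_piMr ?(ltW e2) // ler_pdivrMr // mul1r ler_nat.
have -> : 1 - P = - (P - 1 - \sum_(m < M) q ^+ m * e N m) - \sum_(m < M) q ^+ m * e N m.
  by rewrite opprB addrAC subrr add0r opprB.
apply: le_trans (ler_normB _ _) _; rewrite normrN.
by move: h1 h2 HM => /=; lra.
Unshelve. all: by end_near. Qed.

Lemma partial_sums_cvg q : qball R q ->
  partial_sums L (fun j => star (f j) (g j) q) @ \oo --> (1 : H).
Proof.
move=> qb; apply/cvgrPdist_le => eps eps0.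
have [N0 HN] := partial_sums_uniform (normr_ge0 q) qb eps0.
by exists N0 => // N /= NN; exact: HN.
Qed.

Lemma partial_sums_abs q : qball R q ->
  cvgn (partial_sums L (fun j => `|star (f j) (g j) q|)).
Proof.
move=> qb; have -> : partial_sums L (fun j => `|star (f j) (g j) q|) = series (fun j => `|s j q|).
  by apply/funext => N; rewrite partial_sums_normE.
have [t [B [t0 t1 B0 hB]]] := geo_majorant (normr_ge0 q) qb.
apply: nondecreasing_is_cvgn.
  move=> n m nm; rewrite /series /= (big_cat_nat (leq0n n) nm) /= lerDl.
  by apply: sumr_ge0.
exists (K * B / (1 - t)) => _ [N _ <-].
have c1 : (fun M => \sum_(0 <= j < N) `|qpseries (c j) q M| : R) @ \oo --> (series (fun j => `|s j q|) N : R).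
  by apply: cvg_rsum => j; apply: cvg_norm; exact: star_lim.
have c2 : (fun _ : nat => K * B / (1 - t)) @ \oo --> K * B / (1 - t) by exact: cvg_cst.
apply: (ler_cvg_to c1 c2); apply: nearW => M; rewrite big_mkord.
apply: (@le_trans _ _ (\sum_(j < N) \sum_(0 <= m < M) `|q| ^+ m * `|c j m|)).
  apply: ler_sum => j _; rewrite /qpseries /series /=; apply: le_trans (qnorm_sum _ _ _) _.
  by apply: ler_sum => m _; rewrite qnormM qnormX.
rewrite exchange_big /=.
apply: (@le_trans _ _ (\sum_(0 <= m < M) K * (B * t ^+ m))).
  apply: ler_sum => m _; rewrite -mulr_sumr.
  apply: (@le_trans _ _ (`|q| ^+ m * (m.+1%:R * K))).
    by rewrite ler_wpM2l ?exprn_ge0 // conv_coef_l1.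
  rewrite [leLHS](_ : _ = K * (m.+1%:R * `|q| ^+ m)); last by ring.
  by rewrite ler_wpM2l ?conv_const_ge0.
rewrite -!mulr_sumr mulrA ler_wpM2l ?(mulr_ge0 conv_const_ge0 B0) //.
by have := geo_block_le 0 M (ltW t0) t1; rewrite expr0 mul1r.
Qed.

Lemma compact_qball_radius (A : set H) : compact A -> A `<=` qball R ->
  exists r : R, [/\ 0 <= r, r < 1 & forall q, A q -> `|q| <= r].
Proof.
move=> cA AB; have [A0|/set0P A0] := eqVneq A set0.
  by exists 0; split=> // q; rewrite A0.
have cn : {within A, continuous (fun q : H => `|q| : R)}.
  by apply: continuous_subspaceT => q; exact: norm_continuous.
have [q0 q0A Hq0] := compact_EVT_max A0 cA cn.
exists `|q0|; split => // [|q Aq]; first by apply: AB; exact: set_mem.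
by apply: Hq0; rewrite mem_set.
Qed.

Lemma partial_sums_unif_cvg (A : set H) : compact A -> A `<=` qball R ->
  {uniform A, (fun N q => partial_sums L (fun j => star (f j) (g j) q) N) @ \oo --> (fun=> 1 : H)}.
Proof.
move=> cA AB; have [r [r0 r1 Ar]] := compact_qball_radius cA AB.
move=> P /uniform_nbhs [E [entE EP]].
move: entE; rewrite -entourage_from_ballE => -[e /= e0 eE].
have e2 : 0 < e / 2 by rewrite divr_gt0.
have [N0 HN0] := partial_sums_uniform r0 r1 e2.
exists N0 => // N /= NN; apply: EP => q Aq; apply: eE.
rewrite /= -ball_normE /=; apply: le_lt_trans (HN0 N NN q (Ar q Aq)) _.
by rewrite ltr_pdivrMr // ltr_pMr // ltr1n.
Qed.

End StarSums.

(** * Extended sums and partial sums *)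

Section EsumPartial.
Variable R : realType.
Variables (L : set nat) (u : nat -> R).
Hypothesis u0 : forall j, 0 <= u j.

Lemma esum_nneseries : (\esum_(j in L) (u j)%:E = \sum_(0 <= j <oo | j \in L) (u j)%:E)%E.
Proof.
rewrite nneseries_esum; last by move=> j _; rewrite lee_fin.
by congr esum; apply/seteqP; split=> j /=; rewrite ?in_setE.
Qed.

Lemma esum_le_partial (M : R) : (\esum_(j in L) (u j)%:E <= M%:E)%E ->
  forall J, \sum_(0 <= j < J | j \in L) u j <= M.
Proof.
rewrite esum_nneseries => h J; rewrite -lee_fin; apply: le_trans h.
rewrite -sumEFin; apply: nneseries_lim_ge => j _ _; by rewrite lee_fin.
Qed.

Lemma esum_le (M : R) : (forall J, \sum_(0 <= j < J | j \in L) u j <= M) ->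
  (\esum_(j in L) (u j)%:E <= M%:E)%E.
Proof.
move=> h; rewrite esum_nneseries; apply: lime_le.
  by apply: is_cvg_nneseries => j _ _; rewrite lee_fin.
by apply: nearW => J; rewrite sumEFin lee_fin.
Qed.

(** An infinite sum need not be attained by partial sums, hence a strictly smaller c. *)
Lemma esum_ge_partial (c c' : R) : (c'%:E <= \esum_(j in L) (u j)%:E)%E -> c < c' ->
  exists J, c <= \sum_(0 <= j < J | j \in L) u j.
Proof.
move=> h cc; apply: contrapT => nJ.
have : (\esum_(j in L) (u j)%:E <= c%:E)%E.
  apply: esum_le => J; rewrite leNgt; apply/negP => hJ; apply: nJ; exists J; exact: ltW.
by move/(le_trans h); rewrite lee_fin leNgt cc.
Qed.

End EsumPartial.

Section FinalConstants.
Variable R : realType.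
Implicit Types delta : R.

Lemma kappa_ge0 : 0 <= kappa R.
Proof. by rewrite /kappa !addr_ge0 ?mulr_ge0 ?sqrtr_ge0 ?expR_ge0. Qed.

Lemma delta0_gt0 delta : 0 < delta -> 0 < delta0 delta.
Proof. by move=> d0; rewrite /delta0 lt_min d0 expR_gt0. Qed.

Lemma delta0_le delta : delta0 delta <= delta /\ delta0 delta <= expR (- 2^-1).
Proof. by rewrite /delta0 !ge_min !lexx orbT. Qed.

(** 2.38 e < 2.4 e <= kappa. The strict inequality is the gap that makes the operator of the Leech
    recursion definite. *)
Lemma C0_gap delta : 0 < delta ->
  0 < 238 / 100 * (expR 1 * ln (delta0 delta ^- 4)) / delta0 delta ^+ 3 < C0 delta.
Proof.
move=> dp; have d0 := delta0_gt0 dp; have [_ dle] := delta0_le delta.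
have L2 := lnV4_ge2 d0 dle; move: d0 L2; rewrite /C0 div1r.
set d := delta0 delta; set l := ln _ => d0 L2.
have e0 : 0 < expR 1 :> R by exact: expR_gt0.
have k := kappa_ge R; have l0 : 0 < l by apply: lt_le_trans L2.
have i0 : 0 < d ^- 3 by rewrite invr_gt0 exprn_gt0.
have t0 : 0 < expR 1 * l / d ^+ 3 by rewrite !mulr_gt0.
have t1 : 238 / 100 * (expR 1 * l) / d ^+ 3 = 238 / 100 * (expR 1 * l / d ^+ 3).
  by rewrite [RHS]mulrA.
rewrite t1; apply/andP; split.
  by apply: mulr_gt0; [clear; lra|exact: t0].
have : 24 / 10 * (expR 1 * l / d ^+ 3) <= kappa R / d ^+ 3 * l.
  have := ler_wpM2r (ltW (mulr_gt0 l0 i0)) k.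
  have -> : 24 / 10 * expR 1 * (l * d ^- 3) = 24 / 10 * (expR 1 * l / d ^+ 3).
    by move: (24 / 10) (d ^- 3) => x y; ring.
  by have -> : kappa R * (l * d ^- 3) = kappa R / d ^+ 3 * l by rewrite [LHS]mulrA mulrAC.
have : 0 < 1 / d by rewrite divr_gt0.
move: t0; move: (expR 1 * l / d ^+ 3) (kappa R / d ^+ 3 * l) (1 / d) => x y z; clear; lra.
Qed.

(** For delta <= e^(-1/2) the logarithm of delta^-4 is at most 4 ln(e / delta); for larger delta the
    constant [C0] is frozen at c, while delta^-3 ln(e / delta) >= 1. *)
Lemma Ccorona_le : exists K : R, forall delta, 0 < delta < 1 ->
  Ccorona delta <= K * delta ^- 3 * ln (expR 1 / delta).
Proof.
pose s : R := expR (- 2^-1); have s0 : 0 < s by exact: expR_gt0.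
pose c := kappa R / s ^+ 3 * ln (1 / s ^+ 4) + 1 / s.
have k0 := kappa_ge0; have q0 : 0 <= Num.sqrt 2 :> R by exact: sqrtr_ge0.
have c0 : 0 <= c.
  have := lnV4_ge2 s0 (lexx _); rewrite /c div1r => h.
  apply: addr_ge0; last by rewrite divr_ge0 // ltW.
  apply: mulr_ge0; last exact: le_trans h.
  by apply: divr_ge0 => //; rewrite exprn_ge0 // ltW.
exists (Num.sqrt 2 * (4 * kappa R + 1 + c)) => delta /andP[d0 d1].
have i1 : 1 <= delta^-1 by rewrite invf_ge1 // ltW.
have i3 : delta^-1 <= delta ^- 3.
  by rewrite -exprVn !exprS expr0 mulr1 ler_peMr ?invr_ge0 ?(ltW d0) // -[leLHS]mulr1 ler_pM ?ler01.
have i31 : 1 <= delta ^- 3 by exact: le_trans i3.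
have lE : ln (expR 1 / delta) = 1 + ln (delta^-1) by rewrite lnM ?posrE ?expR_gt0 ?invr_gt0 // expRK.
have ln0 : 0 <= ln (delta^-1) by rewrite ln_ge0.
have le1 : 1 <= ln (expR 1 / delta) by rewrite lE lerDl.
rewrite /Ccorona -!mulrA; apply: ler_wpM2l => //; rewrite /C0.
have D0 : 0 <= delta ^- 3 by exact: le_trans i31.
set l := ln (expR 1 / delta) in lE le1 *.
have D1 : delta ^- 3 <= delta ^- 3 * l by rewrite ler_peMr.
have [dle|dgt] := leP delta s.
  have -> : delta0 delta = delta by rewrite /delta0; apply/min_idPl.
  have l4 : ln (1 / delta ^+ 4) <= 4 * l.
    rewrite div1r -exprVn lnXn ?invr_gt0 // -[leLHS]mulr_natl ler_wpM2l // lE lerDr //.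
  have h1 : kappa R / delta ^+ 3 * ln (1 / delta ^+ 4) <= 4 * kappa R * (delta ^- 3 * l).
    have := ler_wpM2l (mulr_ge0 k0 D0) l4.
    by have -> : kappa R / delta ^+ 3 * (4 * l) = 4 * kappa R * (delta ^- 3 * l) by move: (delta ^- 3) => z; ring.
  have h2 : 1 / delta <= delta ^- 3 * l by rewrite div1r (le_trans i3).
  have h3 : 0 <= c * (delta ^- 3 * l) by rewrite mulr_ge0 // (le_trans D0).
  move: h1 h2 h3; move: (kappa R / _ * ln _) (1 / delta) (delta ^- 3 * l) => x y z.
  by clear; lra.
have -> : delta0 delta = s by rewrite /delta0; apply/min_idPr; exact: ltW.
rewrite -/c; apply: (@le_trans _ _ (c * (delta ^- 3 * l))).
  by rewrite ler_peMr // (le_trans i31).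
by rewrite ler_wpM2r ?(le_trans D0) // lerDr addr_ge0 // mulr_ge0.
Qed.

End FinalConstants.

(** * Assembly of the corona theorem *)

Lemma Hinfty0 (R : realType) : Hinfty (fun=> 0 : quaternion R).
Proof.
split; last by exists 0 => q _; rewrite normr0.
split=> [q _|I _ x y _]; first exact: differentiable_cst.
by rewrite !derive1_cst mulr0 addr0 scaler0.
Qed.

Lemma has_qcoef0 (R : realType) : has_qcoef (fun=> 0 : quaternion R) (fun=> 0).
Proof.
move=> q _; have -> : qpseries (fun=> 0) q = fun=> 0.
  by apply/funext => n; rewrite /qpseries /series /= big1 // => m _; rewrite mulr0.
exact: cvg_cst.
Qed.

Theorem theorem1p1 (R : realType) :
  exists K : R,
  forall (L : set nat) (delta : R) (f : nat -> quaternion R -> quaternion R),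
    index_set L ->
    0 < delta < 1 ->
    (forall j, L j -> Hinfty (f j)) ->
    (forall q, qball R q ->
      ((delta ^+ 2)%:E <= \esum_(j in L) (`|f j q| ^+ 2)%:E <= 1)%E) ->
  exists g : nat -> quaternion R -> quaternion R,
    [/\ forall j, L j -> Hinfty (g j),
        forall q, qball R q ->
          partial_sums L (fun j => star (f j) (g j) q) @ \oo --> (1 : quaternion R),
        L = setT ->
          (forall q, qball R q ->
            cvgn (partial_sums L (fun j => `|star (f j) (g j) q|))) /\
          (forall A : set (quaternion R), compact A -> A `<=` qball R ->
            {uniform A,
              (fun N q => partial_sums L (fun j => star (f j) (g j) q) N) @ \oo
                --> (fun=> 1 : quaternion R)}),
        (ereal_sup [set sqrte (\esum_(j in L) (`|g j q| ^+ 2)%:E) | q in qball R]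
          <= (Ccorona delta)%:E)%E &
        (ereal_sup [set Hinfty_norm (g j) | j in L] <= (Ccorona delta)%:E)%E /\
        Ccorona delta <= K * delta ^- 3 * ln (expR 1 / delta)].
Proof.
have [K HK] := Ccorona_le R; exists K => L delta f _ d01 Hf Hsum.
have /andP[d0 d1] := d01.
(* Extension by zero outside L treats finite and infinite index sets alike. *)
pose f' j : quaternion R -> quaternion R := if j \in L then f j else fun=> 0.
pose a j : nat -> quaternion R := if j \in L then qcoef (f j) else fun=> 0.
have Hf' j : Hinfty (f' j).
  by rewrite /f'; case: ifPn => [/set_mem /Hf //|_]; exact: Hinfty0.
have Ha' j : has_qcoef (f' j) (a j).
  rewrite /f' /a; case: ifPn => [/set_mem Lj|_]; last exact: has_qcoef0.
  exact: hinfty_qcoef (Hf j Lj).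
have sumE J q : \sum_(j < J) `|f' j q| ^+ 2 = \sum_(0 <= j < J | j \in L) `|f j q| ^+ 2.
  rewrite -(big_mkord xpredT (fun j => `|f' j q| ^+ 2)) [RHS]big_mkcond; apply: eq_bigr => j _.
  by rewrite /f'; case: ifP => _; rewrite ?normr0 ?expr0n.
have sq0 (h : nat -> quaternion R -> quaternion R) q j : 0 <= `|h j q| ^+ 2 by exact: exprn_ge0.
have HU J q : qball R q -> \sum_(j < J) `|f' j q| ^+ 2 <= 1.
  move=> /Hsum /andP[_ h]; rewrite sumE; exact: (esum_le_partial (sq0 f q) h).
have HL q c : qball R q -> c < delta ^+ 2 -> exists J, c <= \sum_(j < J) `|f' j q| ^+ 2.
  move=> /Hsum /andP[h _] /(esum_ge_partial (sq0 f q) h) [J hJ]; exists J; by rewrite sumE.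
have aE j : a j = qcoef (f' j) by rewrite (qcoefE (@Ha' j)).
have HS J m : \sum_(j < J) `|a j m| ^+ 2 <= 1.
  under eq_bigr => j _ do rewrite aE.
  by apply: sum_sqr_coef_le1 => // q; exact: HU.
have dp := delta0_gt0 d0; have [dle dle'] := delta0_le delta.
have /andP[C10 C1C0] := C0_gap d0.
have low N := corona_lower Ha' HS HU HL N dp dle d1 dle'.
have [b [Eb Hlim]] := leech_limit C10 C1C0 HS low.
have C0p : 0 < C0 delta by exact: lt_trans C1C0.
have [g [Hg Hb Hgb]] := solution_exists C0p Eb.
have Ha j : L j -> has_qcoef (f j) (a j).
  by move=> Lj; have := @Ha' j; rewrite /f' mem_set.
have a0 j m : ~ L j -> a j m = 0.
  by move=> nL; rewrite /a; case: ifPn => // /set_mem.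
have HB J m : \sum_(j < J) `|b j m| ^+ 2 <= C0 delta ^+ 2 by exact: energy_coef.
have sqrtC : Num.sqrt (2 * C0 delta ^+ 2) = Ccorona delta.
  by rewrite sqrtrM // sqrtr_sqr ger0_norm // ltW.
exists g; split=> [j _|q qb|_||]; first exact: Hg.
- exact: (partial_sums_cvg Ha a0 Hb HS HB Hlim qb).
- split=> [q qb|A cA AB]; first exact: (partial_sums_abs Ha a0 Hb HS HB qb).
  exact: (partial_sums_unif_cvg Ha a0 Hb HS HB Hlim cA AB).
- apply: ge_ereal_sup => _ [q qb <-].
  have h : (\esum_(j in L) (`|g j q| ^+ 2)%:E <= (2 * C0 delta ^+ 2)%:E)%E.
    apply: (esum_le (sq0 g q)) => J; apply: le_trans (Hgb J q qb).
    rewrite big_mkcond -(big_mkord xpredT (fun j => `|g j q| ^+ 2)); apply: ler_sum => j _.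
    by case: ifP.
  have -> : (Ccorona delta)%:E = sqrte (2 * C0 delta ^+ 2)%:E by rewrite /= sqrtC.
  by rewrite lee_sqrt // lee_fin mulr_ge0 // sqr_ge0.
split; last exact: HK.
apply: ge_ereal_sup => _ [j _ <-]; apply: ge_ereal_sup => _ [q qb <-]; rewrite lee_fin -sqrtC.
rewrite -[leLHS]ger0_norm // -sqrtr_sqr ler_wsqrtr //.
(* A single |g_j(q)|^2 is at most the sum of squares up to j. *)
apply: le_trans (Hgb j.+1 q qb); rewrite big_ord_recr /= lerDr.
by apply: sumr_ge0 => i _; exact: exprn_ge0.
Qed.
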